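(* Let $M_1$ ($n_1\times n_1$) and $M_2$ ($n_2\times n_2$) be symmetric positive semidefinite integer matrices and $M_1\oplus M_2$ the block-diagonal matrix. The direct product $(f,g)\mapsto (f\otimes g)(\tau,\mathfrak z_1,\mathfrak z_2):=f(\tau,\mathfrak z_1)g(\tau,\mathfrak z_2)$ ($\mathfrak z_i\in\mathbb{C}^{n_i}$) induces isomorphisms of $\mathbb{C}[E_4,E_6]$-modules $$J^!_{*,M_1}\otimes J^!_{*,M_2}\xrightarrow{\ \sim\ }J^!_{*,M_1\oplus M_2},\qquad J^w_{*,M_1}\otimes J^w_{*,M_2}\xrightarrow{\ \sim\ }J^w_{*,M_1\oplus M_2}.$$ In particular $P^w_{M_1\oplus M_2}=P^w_{M_1}\cdot P^w_{M_2}$.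
   Context: Notation: $\mathbb{H}$ is the upper half-plane, $q=e^{2\pi i\tau}$. For a symmetric positive semidefinite $n\times n$ integer matrix $M$ (diagonal may be odd, $M$ may be singular) let $Q(\mathfrak z)=\tfrac12\mathfrak z^TM\mathfrak z$. A weakly holomorphic Jacobi form of weight $k\in\mathbb{Z}$ and index $M$ is a holomorphic $f:\mathbb{H}\times\mathbb{C}^n\to\mathbb{C}$ with (i) $f\big(\frac{a\tau+b}{c\tau+d},\frac{\mathfrak z}{c\tau+d}\big)=(c\tau+d)^k\exp\big(\frac{2\pi i c\,Q(\mathfrak z)}{c\tau+d}\big)f(\tau,\mathfrak z)$ for all $\begin{pmatrix}a&b\\c&d\end{pmatrix}\in\mathrm{SL}_2(\mathbb{Z})$; (ii) $f(\tau,\mathfrak z+\lambda\tau+\mu)=(-1)^{2Q(\lambda)+2Q(\mu)}\exp\big(-2\pi i\tau Q(\lambda)-2\pi i\lambda^TM\mathfrak z\big)f(\tau,\mathfrak z)$ for all $\lambda,\mu\in\mathbb{Z}^n$; (iii) its Fourier expansion $\sum_m c(m,\mathfrak z)q^m$ in $\tau$ contains only finitely many negative powers of $q$. It is a weak Jacobi form if only nonnegative powers occur. $J^!_{k,M}$, $J^w_{k,M}$ are the spaces, $J^!_{*,M}=\bigoplus_kJ^!_{k,M}$, $J^w_{*,M}=\bigoplus_kJ^w_{k,M}$, modules over $\mathbb{C}[E_4,E_6]$ (normalized Eisenstein series); tensor products are over $\mathbb{C}[E_4,E_6]$. $J^w_{*,M}$ is a free finitely generated $\mathbb{C}[E_4,E_6]$-module,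 and $P^w_M$ denotes the Laurent polynomial with $\sum_{k\in\mathbb{Z}}\dim J^w_{k,M}\,t^k=P^w_M(t)/((1-t^4)(1-t^6))$. *)

(* Defs.v *)
From HB Require Import structures.
From mathcomp Require Import all_boot all_order all_algebra.
From mathcomp Require Import generic_quotient complex ring zify.
From mathcomp Require Import all_classical all_reals all_analysis.

Set Implicit Arguments.
Unset Strict Implicit.
Unset Printing Implicit Defensive.

Import Order.TTheory GRing.Theory Num.Theory.
Import numFieldNormedType.Exports.
Local Open Scope classical_set_scope.
Local Open Scope ring_scope.
Local Open Scope quotient_scope.
Local Open Scope complex_scope.

Section TensorProduct.
Variables (A : comPzRingType) (U V : lmodType A).

(* A list [:: (u1, v1); ...; (ur, vr)] stands for the formal sum
   u1 (x) v1 + ... + ur (x) vr. *)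
Inductive tens_rel : seq (U * V) -> seq (U * V) -> Prop :=
| tens_refl s : tens_rel s s
| tens_sym s t : tens_rel s t -> tens_rel t s
| tens_trans s t r : tens_rel s t -> tens_rel t r -> tens_rel s r
| tens_cat s s' t t' :
    tens_rel s s' -> tens_rel t t' -> tens_rel (s ++ t) (s' ++ t')
| tens_comm s t : tens_rel (s ++ t) (t ++ s)
| tens_zero v : tens_rel [:: (0, v)] [::]
| tens_addl u u' v : tens_rel [:: (u + u', v)] [:: (u, v); (u', v)]
| tens_addr u v v' : tens_rel [:: (u, v + v')] [:: (u, v); (u, v')]
| tens_scale a u v : tens_rel [:: (a *: u, v)] [:: (u, a *: v)].

Definition tens_relb (s t : seq (U * V)) : bool := `[< tens_rel s t >].

Lemma tens_relb_refl : reflexive tens_relb.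
Proof. by move=> s; apply/asboolP; exact: tens_refl. Qed.

Lemma tens_relb_sym : symmetric tens_relb.
Proof. by move=> s t; apply/asboolP/asboolP; exact: tens_sym. Qed.

Lemma tens_relb_trans : transitive tens_relb.
Proof.
by move=> t s r /asboolP st /asboolP tr; apply/asboolP; exact: tens_trans tr.
Qed.

Canonical tens_equiv :=
  EquivRel tens_relb tens_relb_refl tens_relb_sym tens_relb_trans.

Definition tensor := {eq_quot tens_equiv}.

HB.instance Definition _ := Choice.on tensor.
HB.instance Definition _ := EqQuotient.on tensor.

Lemma tensP (s t : seq (U * V)) : \pi_tensor s = \pi_tensor t <-> tens_rel s t.
Proof.
split; first by move=> /eqquotP /asboolP.
by move=> st; apply/eqquotP/asboolP.
Qed.

Lemma tens_repr (s : seq (U * V)) : tens_rel (repr (\pi_tensor s)) s.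
Proof. by apply/tensP; rewrite reprK. Qed.

Definition tens (u : U) (v : V) : tensor := \pi_tensor [:: (u, v)].

Definition tadd (x y : tensor) : tensor := \pi_tensor (repr x ++ repr y).
Definition tscale (a : A) (x : tensor) : tensor :=
  \pi_tensor [seq (a *: p.1, p.2) | p <- repr x].

Lemma tens_rel_scale a s t : tens_rel s t ->
  tens_rel [seq (a *: p.1, p.2) | p <- s] [seq (a *: p.1, p.2) | p <- t].
Proof.
elim=> {s t} [s|s t _|s t r _ + _|s s' t t' _ + _|s t|v|u u' v|u v v'|b u v] /=.
- exact: tens_refl.
- exact: tens_sym.
- exact: tens_trans.
- by rewrite !map_cat; exact: tens_cat.
- by rewrite !map_cat; exact: tens_comm.
- by rewrite scaler0; exact: tens_zero.
- by rewrite scalerDr; exact: tens_addl.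
- exact: tens_addr.
- by rewrite scalerA mulrC -scalerA; exact: tens_scale.
Qed.

Lemma taddE s t : tadd (\pi_tensor s) (\pi_tensor t) = \pi_tensor (s ++ t).
Proof. by apply/tensP/tens_cat; exact: tens_repr. Qed.

Lemma tscaleE a s :
  tscale a (\pi_tensor s) = \pi_tensor [seq (a *: p.1, p.2) | p <- s].
Proof. by apply/tensP/tens_rel_scale; exact: tens_repr. Qed.

Fact taddA : associative tadd.
Proof.
move=> x y z; rewrite -[x]reprK -[y]reprK -[z]reprK.
by rewrite (taddE (repr y) (repr z)) (taddE (repr x) (repr y)) !taddE catA.
Qed.

Fact taddC : commutative tadd.
Proof.
by move=> x y; rewrite -[x]reprK -[y]reprK !taddE; apply/tensP/tens_comm.
Qed.

Fact tadd0 : left_id (\pi_tensor [::]) tadd.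
Proof. by move=> x; rewrite -[x]reprK taddE. Qed.

Lemma tscaleDl x : {morph tscale^~ x : a b / a + b >-> tadd a b}.
Proof.
move=> a b; rewrite -[x]reprK; move: (repr x) => s; rewrite !tscaleE taddE; apply/tensP.
elim: s => [|[u v] s IHs] /=; first exact: tens_refl.
rewrite scalerDl.
apply: tens_trans (tens_cat (tens_addl (a *: u) (b *: u) v) IHs) _.
apply: (tens_cat (tens_refl [:: (a *: u, v)])) => /=.
rewrite -(cat1s (b *: u, v) (_ ++ _)) -(cat1s (b *: u, v) (map _ _)) !catA.
by apply: tens_cat; [exact: tens_comm | exact: tens_refl].
Qed.

Lemma tscale0 x : tscale 0 x = \pi_tensor [::].
Proof.
rewrite -[x]reprK; move: (repr x) => s; rewrite tscaleE; apply/tensP.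
elim: s => [|[u v] s IHs] /=; first exact: tens_refl.
by rewrite scale0r -cat1s; exact: (tens_cat (tens_zero _) IHs).
Qed.

Lemma tscale1 : left_id 1 tscale.
Proof.
move=> x; rewrite -[x]reprK; move: (repr x) => s; rewrite tscaleE; congr (\pi_ _).
by rewrite -[RHS]map_id; apply: eq_map => -[u v] /=; rewrite scale1r.
Qed.

Fact taddN : left_inverse (\pi_tensor [::]) (tscale (-1)) tadd.
Proof. by move=> x; rewrite -{2}[x]tscale1 -tscaleDl addNr tscale0. Qed.

HB.instance Definition _ :=
  GRing.isZmodule.Build tensor taddA taddC tadd0 taddN.

Fact tscaleA a b x : tscale a (tscale b x) = tscale (a * b) x.
Proof.
rewrite -[x]reprK; move: (repr x) => s; rewrite (tscaleE b) (tscaleE a) (tscaleE (a * b)) -map_comp; congr (\pi_ _).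
by apply: eq_map => -[u v] /=; rewrite scalerA.
Qed.

Fact tscaleDr : right_distributive tscale +%R.
Proof.
move=> a x y; rewrite -[x]reprK -[y]reprK.
have -> : \pi_tensor (repr x) + \pi_tensor (repr y) = \pi_tensor (repr x ++ repr y).
  exact: taddE.
rewrite (tscaleE a (repr x)) (tscaleE a (repr y)) (tscaleE a (_ ++ _)) map_cat.
by rewrite -taddE.
Qed.

HB.instance Definition _ :=
  GRing.Zmodule_isLmodule.Build A tensor tscaleA tscale1 tscaleDr tscaleDl.

Lemma tens_linearl v : linear (tens^~ v).
Proof.
move=> a u u'; have -> : a *: tens u v = tens (a *: u) v by exact: tscaleE.
have -> : tens (a *: u) v + tens u' v = \pi_tensor [:: (a *: u, v); (u', v)].
  exact: taddE.
exact/tensP/tens_addl.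
Qed.

Lemma tens_linearr u : linear (tens u).
Proof.
move=> a v v'; have -> : a *: tens u v = tens (a *: u) v by exact: tscaleE.
have -> : tens (a *: u) v + tens u v' = \pi_tensor [:: (a *: u, v); (u, v')].
  exact: taddE.
apply/tensP; apply: tens_trans (tens_addr _ _ _) _.
exact: (tens_cat (tens_sym (tens_scale a u v)) (tens_refl [:: (u, v')])).
Qed.

Lemma tensor_seqE (s : seq (U * V)) :
  \pi_tensor s = \sum_(p <- s) tens p.1 p.2.
Proof.
elim: s => [|[u v] s IHs]; first by rewrite big_nil.
by rewrite big_cons -IHs; apply/esym; exact: (taddE [:: (u, v)]).
Qed.

Lemma tensor_universal (W : lmodType A) (b : U -> V -> W) :
  (forall v, linear (b^~ v)) -> (forall u, linear (b u)) ->
  exists2 phi : {linear tensor -> W},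
    (forall u v, phi (tens u v) = b u v) &
    forall psi : {linear tensor -> W},
      (forall u v, psi (tens u v) = b u v) -> psi =1 phi.
Proof.
move=> bl br.
have b0l v : b 0 v = 0.
  by have := bl v (-1) 0 0; rewrite scaler0 add0r scaleN1r addNr.
have bZl a u v : b (a *: u) v = a *: b u v.
  by have := bl v a u 0; rewrite !addr0 b0l addr0.
have b0r u : b u 0 = 0.
  by have := br u (-1) 0 0; rewrite scaler0 add0r scaleN1r addNr.
have bZr a u v : b u (a *: v) = a *: b u v.
  by have := br u a v 0; rewrite !addr0 b0r addr0.
have bDl u u' v : b (u + u') v = b u v + b u' v.
  by have := bl v 1 u u'; rewrite !scale1r.
have bDr u v v' : b u (v + v') = b u v + b u v'.
  by have := br u 1 v v'; rewrite !scale1r.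
pose S s := \sum_(p <- s) b p.1 p.2.
have SE s t : tens_rel s t -> S s = S t.
  rewrite /S; elim=> {s t}.
  - by [].
  - by [].
  - by move=> s t r _ -> _ ->.
  - by move=> s s' t t' _ IHs _ IHt; rewrite !big_cat /= IHs IHt.
  - by move=> s t; rewrite !big_cat /= addrC.
  - by move=> v; rewrite big_seq1 big_nil.
  - by move=> u u' v; rewrite !big_cons !big_nil /= !addr0.
  - by move=> u v v'; rewrite !big_cons !big_nil /= !addr0.
  - by move=> a u v; rewrite !big_seq1 /= bZl bZr.
pose f (x : tensor) := S (repr x).
have fE s : f (\pi_tensor s) = S s by exact/SE/tens_repr.
have f_lin : linear f.
  move=> a x y; rewrite -{1}[x]reprK -{1}[y]reprK.
  have -> : a *: \pi_tensor (repr x) + \pi_tensor (repr y) =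
      \pi_tensor ([seq (a *: p.1, p.2) | p <- repr x] ++ repr y).
    by rewrite -taddE -tscaleE.
  rewrite fE /S big_cat big_map /= scaler_sumr; congr (_ + _).
  by apply: eq_bigr => p _; rewrite bZl.
pose L := GRing.isLinear.Build A tensor W *:%R f f_lin.
pose phi : {linear tensor -> W} := HB.pack f L.
have phiE u v : phi (tens u v) = b u v by rewrite /= fE /S big_seq1.
exists phi => // psi psiE x; rewrite -[x]reprK tensor_seqE !linear_sum.
by apply: eq_bigr => p _; rewrite phiE psiE.
Qed.

End TensorProduct.

Definition uhp (R : realType) := {tau : R[i] | 0 < complex.Im tau}.

Section UpperHalfPlane.
Variable R : realType.
Local Notation C := R[i].
Local Notation H := (uhp R).

Definition cexp (z : C) : C :=
  (expR (complex.Re z))%:C * (cos (complex.Im z) +i* sin (complex.Im z)).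

Definition twopii : C := 0 +i* (2 * pi).

Definition qpar (tau : H) : C := cexp (twopii * val tau).

Definition jfactor (c d : int) (tau : H) : C := c%:~R * val tau + d%:~R.

Lemma im_mobius (a b c d : int) (tau : H) : a * d - b * c = 1 ->
  0 < complex.Im ((a%:~R * val tau + b%:~R) / jfactor c d tau).
Proof.
have intrE (m : int) : m%:~R = (m%:~R : R)%:C :> C by rewrite rmorph_int.
case: tau => -[x y] /= y_gt0 abcd; rewrite /jfactor /= !intrE /=.
move: (congr1 (fun m : int => m%:~R : R) abcd).
rewrite rmorphB !rmorphM /=; move: abcd => _.
move: (a%:~R : R) (b%:~R : R) (c%:~R : R) (d%:~R : R) => {}a {}b {}c {}d abcd.
have N_gt0 : 0 < (c * x + d) ^+ 2 + (c * y) ^+ 2.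
  rewrite lt_neqAle addr_ge0 ?sqr_ge0 // andbT eq_sym paddr_eq0 ?sqr_ge0 //.
  rewrite !sqrf_eq0 mulf_eq0 (gt_eqF y_gt0) orbF.
  apply/negP => /andP[/[swap]/eqP c0]; rewrite c0 mul0r add0r => /eqP d0.
  by move: abcd; rewrite c0 d0 !mulr0 subrr => /esym/eqP; rewrite oner_eq0.
simpc; set N := _ ^+ 2 + _ in N_gt0 *.
rewrite [X in 0 < X](_ : _ = (a * d - b * c) * y * N^-1); last first.
  by rewrite {1 2}/GRing.inv /= -/(N^-1); ring.
by rewrite abcd mul1r divr_gt0.
Qed.

Definition mobius (a b c d : int) (abcd : a * d - b * c = 1) (tau : H) : H :=
  exist (fun t : C => is_true (0 < complex.Im t)) _ (im_mobius tau abcd).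

Definition divisor_sigma (l m : nat) : nat :=
  (\sum_(d <- divisors m) d ^ l)%N.

(* [eisenstein c l] is the q-series 1 + c * \sum_(m >= 1) sigma_l(m) q^m. *)
Definition eisenstein (c : C) (l : nat) (tau : H) : C :=
  1 + c * limn (series
    (fun m => (divisor_sigma l m.+1)%:R * qpar tau ^+ m.+1 : C^o)).

Definition E4 : H -> C := eisenstein 240 3.
Definition E6 : H -> C := eisenstein (- 504) 5.

Definition is_E4E6 : {pred (H -> C)} := fun a =>
  `[< exists p : {poly {poly C}}, a = fun tau => p.[(E6 tau)%:P].[E4 tau] >].

Lemma is_E4E6_subring : GRing.subring_closed is_E4E6.
Proof.
split.
- apply/asboolP; exists 1; apply/funext => tau.
  by rewrite !hornerE.
- move=> _ _ /asboolP[p ->] /asboolP[r ->]; apply/asboolP; exists (p - r).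
  by apply/funext => tau; rewrite !hornerE.
- move=> _ _ /asboolP[p ->] /asboolP[r ->]; apply/asboolP; exists (p * r).
  by apply/funext => tau; rewrite !hornerE.
Qed.

Record mring := Mring { mring_val :> H -> C; _ : mring_val \in is_E4E6 }.

HB.instance Definition _ := [isSub for mring_val].
HB.instance Definition _ := [Choice of mring by <:].
HB.instance Definition _ :=
  GRing.SubChoice_isSubComPzRing.Build (H -> C) is_E4E6 mring is_E4E6_subring.

(* A name for the functions H x C^n -> C, so that they can carry the module
   structure over [mring]. *)
Definition jfun (n : nat) : Type := H * 'cV[C]_n -> C.

Section Functions.
Variable n : nat.

HB.instance Definition _ := GRing.Zmodule.copy (jfun n) (H * 'cV[C]_n -> C).

Definition jscale (a : mring) (f : jfun n) : jfun n := fun x => a x.1 * f x.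

Fact jscaleA a b f : jscale a (jscale b f) = jscale (a * b) f.
Proof. by apply/funext => x; rewrite /jscale mulrA. Qed.

Fact jscale1 : left_id 1 jscale.
Proof. by move=> f; apply/funext => x; rewrite /jscale mul1r. Qed.

Fact jscaleDr : right_distributive jscale +%R.
Proof. by move=> a f g; apply/funext => x; rewrite /jscale mulrDr. Qed.

Fact jscaleDl f : {morph jscale^~ f : a b / a + b}.
Proof. by move=> a b; apply/funext => x; rewrite /jscale mulrDl. Qed.

HB.instance Definition _ := GRing.Zmodule_isLmodule.Build mring (jfun n)
  jscaleA jscale1 jscaleDr jscaleDl.

End Functions.

End UpperHalfPlane.

Record submodule (A : pzRingType) (W : lmodType A) (S : {pred W})
    (S_closed : GRing.submod_closed S) := Submodule {
  submodule_val : W;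
  submodule_valP : submodule_val \in S
}.

Section Submodule.
Variables (A : pzRingType) (W : lmodType A) (S : {pred W}).
Variable S_closed : GRing.submod_closed S.

HB.instance Definition _ := [isSub for @submodule_val A W S S_closed].
HB.instance Definition _ := [Choice of submodule S_closed by <:].
HB.instance Definition _ := GRing.SubChoice_isSubLmodule.Build A W S
  (submodule S_closed) (GRing.submod_closed_semi S_closed).

End Submodule.

Section JacobiForms.
Variables (R : realType) (n : nat).
Local Notation C := R[i].
Local Notation H := (uhp R).

Definition psd (M : 'M[int]_n) : Prop :=
  forall x : 'cV[R]_n, 0 <= (x^T *m map_mx intr M *m x) 0 0.

(* [quad M z] is Q(z), and [quad2 M l] is the integer 2Q(l). *)
Definition quad (M : 'M[int]_n) (z : 'cV[C]_n) : C :=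
  2^-1 * (z^T *m map_mx intr M *m z) 0 0.
Definition quad2 (M : 'M[int]_n) (l : 'cV[int]_n) : int :=
  (l^T *m M *m l) 0 0.

Implicit Types (M : 'M[int]_n) (f : jfun R n).

(* Complex Frechet differentiability on H x C^n; the values of the extension
   outside of this open set are irrelevant. *)
Definition jext f (p : C^o * 'cV[C]_n) : C^o :=
  if insub p.1 is Some tau then f (tau, p.2) else 0.

Definition holomorphic f : Prop :=
  forall p : (C^o * 'cV[C]_n)%type : normedModType C,
    0 < complex.Im (p.1 : C) -> differentiable (jext f) p.

Definition modular_law (k : int) M f : Prop :=
  forall (a b c d : int) (abcd : a * d - b * c = 1) (tau : H) (z : 'cV[C]_n),
    f (mobius abcd tau, (jfactor c d tau)^-1 *: z) =
    jfactor c d tau ^ k *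
      cexp (twopii R * c%:~R * quad M z / jfactor c d tau) * f (tau, z).

Definition elliptic_law M f : Prop :=
  forall (l m : 'cV[int]_n) (tau : H) (z : 'cV[C]_n),
    let l' : 'cV[C]_n := map_mx intr l in
    let m' : 'cV[C]_n := map_mx intr m in
    f (tau, z + val tau *: l' + m') =
    (-1) ^ (quad2 M l + quad2 M m) *
      cexp (- (twopii R * val tau * quad M l')
            - twopii R * (l'^T *m map_mx intr M *m z) 0 0) * f (tau, z).

(* The two-sided series splits into the powers q^m and q^(- m - 1), m >= 0. *)
Definition fourier_expansion f (c : int -> 'cV[C]_n -> C) : Prop :=
  forall (tau : H) (z : 'cV[C]_n), exists s t : C^o,
    [/\ series (fun m : nat => c m%:Z z * qpar tau ^ m%:Z : C^o) @ \oo --> s,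
        series (fun m : nat => c (Negz m) z * qpar tau ^ Negz m : C^o) @ \oo --> t
      & f (tau, z) = s + t].

Definition weakly_holomorphic_jacobi (k : int) M : set (jfun R n) :=
  [set f | [/\ holomorphic f, modular_law k M f, elliptic_law M f
    & exists2 c, fourier_expansion f c &
        finite_set [set m : int | m < 0 /\ c m <> (fun=> 0)]]].

Definition weak_jacobi (k : int) M : set (jfun R n) :=
  [set f | [/\ holomorphic f, modular_law k M f, elliptic_law M f
    & exists2 c, fourier_expansion f c &
        forall m : int, m < 0 -> c m = (fun=> 0)]].

(* The sum of the spaces J k inside the space of all functions.  It is direct
   for the spaces of Jacobi forms: see [modular_law_direct]. *)
Definition graded_sum (J : int -> set (jfun R n)) : {pred jfun R n} := fun f =>
  `[< exists (s : seq int) (F : int -> jfun R n),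
        [/\ uniq s, forall k, J k (F k) & f = \sum_(k <- s) F k] >].

Definition Jwh M : {pred jfun R n} :=
  graded_sum (fun k => weakly_holomorphic_jacobi k M).
Definition Jw M : {pred jfun R n} := graded_sum (fun k => weak_jacobi k M).

Lemma cexp_neq0 (z : C) : cexp z != 0.
Proof.
rewrite mulf_neq0 //.
  by rewrite eq_complex /= negb_and gt_eqF // expR_gt0.
apply/negP; rewrite eq_complex /= => /andP[/eqP c0 /eqP s0].
have := cos2Dsin2 (complex.Im z); rewrite c0 s0 expr0n addr0 => /esym/eqP.
by rewrite oner_eq0.
Qed.

Lemma modular_law_direct M (s : seq int) (F : int -> jfun R n) :
  uniq s -> (forall k, modular_law k M (F k)) -> \sum_(k <- s) F k = 0 ->
  forall k, k \in s -> F k = 0.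
Proof.
move=> s_uniq FM F0 k0 k0s; apply/funext => -[tau z].
pose N : nat := (\sum_(k <- s) absz k)%N.
have sN k : k \in s -> (absz (k + N%:Z))%:Z = k + N%:Z.
  move=> ks; have kN : (absz k <= N)%N.
    by rewrite /N (big_rem k) //= leq_addr.
  by apply: gez0_abs; lia.
pose p : {poly C} := \sum_(k <- s) (F k (tau, z))%:P * 'X^(absz (k + N%:Z)).
suff p0 : p = 0.
  have := congr1 (fun r : {poly C} => r`_(absz (k0 + N%:Z))) p0.
  rewrite coef0 /p coef_sum (bigD1_seq k0) //= coefCM coefXn eqxx mulr1.
  rewrite big_seq_cond big1 ?addr0 // => k /andP[ks kk0].
  rewrite coefCM coefXn; case: eqP; rewrite ?mulr0 // => E.
  have : k0 + N%:Z = k + N%:Z by rewrite -(sN k0 k0s) -(sN k ks) E.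
  by move/addIr => k0k; rewrite k0k eqxx in kk0.
have j_neq0 (d : int) : jfactor 1 d tau != 0.
  rewrite /jfactor mul1r; case: (tau) => -[x y] /= y_gt0.
  apply/eqP => /(congr1 (@complex.Im R)).
  have -> : d%:~R = (d%:~R : R)%:C :> C by rewrite rmorph_int.
  by rewrite /= addr0 => y0; rewrite y0 ltxx in y_gt0.
have p_root (d : int) : root p (jfactor 1 d tau).
  have abcd : 0 * d - (-1) * 1 = 1 :> int by rewrite mul0r sub0r mulN1r opprK.
  have := congr1
    (fun G : jfun R n => G (mobius abcd tau, (jfactor 1 d tau)^-1 *: z)) F0.
  have -> : (\sum_(k <- s) F k)
      (mobius abcd tau, (jfactor 1 d tau)^-1 *: z) =
      \sum_(k <- s) F k (mobius abcd tau, (jfactor 1 d tau)^-1 *: z).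
    elim: (s) => [|k r IHr]; first by rewrite !big_nil.
    by rewrite !big_cons -IHr.
  under eq_bigr => k _ do rewrite FM mulrAC mulrC.
  rewrite -big_distrr /= => /eqP.
  rewrite mulf_eq0 (negbTE (cexp_neq0 _)) /= => /eqP S0.
  suff pE : p.[jfactor 1 d tau] = jfactor 1 d tau ^ N%:Z *
      \sum_(k <- s) jfactor 1 d tau ^ k * F k (tau, z).
    by rewrite /root pE S0 mulr0.
  rewrite /p horner_sum mulr_sumr big_seq [RHS]big_seq.
  apply: eq_bigr => k ks.
  by rewrite hornerCM hornerXn exprnP (sN k ks) mulrA -expfzDr // addrC mulrC.
apply/eqP; apply/negPn/negP => p_neq0.
pose rs := [seq jfactor 1 i%:Z tau | i <- iota 0 (size p)].
have := max_poly_roots (rs := rs) p_neq0; rewrite size_map size_iota ltnn => H0; suff : false by []; apply: H0.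
  by apply/allP => _ /mapP[i _ ->].
rewrite map_inj_uniq ?iota_uniq // => i j; rewrite /jfactor => /addrI/eqP.
by rewrite eqr_int => /eqP [].
Qed.

Definition has_dim (V : set (jfun R n)) (d : nat) : Prop :=
  exists b : 'I_d -> jfun R n,
    (forall i, V (b i)) /\
    forall f, V f -> exists! c : 'rV[C]_d,
      forall x, f x = \sum_(i < d) c 0 i * b i x.

(* Laurent polynomials are finitely supported families of coefficients; the
   coefficients of P(t) / ((1 - t^4)(1 - t^6)) are those of the product of P(t)
   with the sum of the t^(4 a + 6 b), a, b >= 0. *)
Definition weak_numerator M (P : int -> int) : Prop :=
  finite_set [set k | P k != 0] /\
  forall k : int, exists2 d : nat, has_dim (weak_jacobi k M) d &
    d%:Z = \sum_(ab \in [set: nat * nat]) P (k - (4 * ab.1 + 6 * ab.2)%N%:Z).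

End JacobiForms.

Arguments Jwh R {n} M.
Arguments Jw R {n} M.

Definition laurent_mul (P1 P2 : int -> int) (k : int) : int :=
  \sum_(i \in [set: int]) P1 i * P2 (k - i).

Section DirectProduct.
Variables (R : realType) (n1 n2 : nat).

Definition direct_product (f : jfun R n1) (g : jfun R n2) : jfun R (n1 + n2) :=
  fun x => f (x.1, usubmx x.2) * g (x.1, dsubmx x.2).

(* The closure proofs are what makes J1, J2 and J modules over C[E4, E6]; for
   Jacobi forms they rest on the modularity of E4 and E6. *)
Definition direct_product_iso (J1 : {pred jfun R n1}) (J2 : {pred jfun R n2})
    (J : {pred jfun R (n1 + n2)}) : Prop :=
  exists (h1 : GRing.submod_closed J1) (h2 : GRing.submod_closed J2)
         (h : GRing.submod_closed J)
         (phi : {linear tensor (submodule h1) (submodule h2) -> submodule h}),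
    bijective phi /\
    forall (f : submodule h1) (g : submodule h2),
      val (phi (tens f g)) = direct_product (val f) (val g).

End DirectProduct.

(* Main.v *)
(** A weak Jacobi form is tested through its Taylor coefficients in z.  After
    multiplication by exp(- kappa Q t^2), with kappa the quasi-modular Eisenstein
    series of weight 2, these are modular forms.  For fixed tau the functions
    satisfying the elliptic transformation law are bounded by their values on a
    finite grid, so they form a finite dimensional space; this bounds the number
    of independent weak forms and, as modular forms of negative weight vanish,
    their weights from below.  Since (E4, E6) is a regular sequence on weak Jacobi
    forms (E4^3 - E6^2 has no zero on the upper half-plane), the module of weak
    forms is free on finitely many homogeneous f_i, and some determinant D of
    Taylor coefficients of the f_i does not vanish identically.  Given F of index
    M1 + M2, Cramer's rule writes D F as a sum of products f_i h_i with h_i of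
    index M2, and independence of the f_i modulo the zeros of D lets one divide.
    The weakly holomorphic case follows by multiplying with powers of Delta, and
    the Hilbert series by counting the basis E4^a E6^b (f_i * g_j). *)
From HB Require Import structures.
From mathcomp Require Import all_boot all_order all_algebra.
From mathcomp Require Import generic_quotient complex perm ring lra zify.
From mathcomp Require Import all_classical all_reals all_analysis.
Require Import Defs.

Set Implicit Arguments.
Unset Strict Implicit.
Unset Printing Implicit Defensive.

Import Order.TTheory GRing.Theory Num.Theory.
Import numFieldNormedType.Exports.
Local Open Scope classical_set_scope.
Local Open Scope ring_scope.
Local Open Scope complex_scope.

(** Cauchy's formula enters only as the Fourier expansion of a holomorphic 1-periodic function on a
    half-plane. Pulled back along t -> exp(2 pi i t), it also gives Taylor expansions, Cauchy
    estimates and removable singularities on discs. Holomorphy in several variables is reached by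
    restriction to complex lines. Free generators come from a maximality argument: a family
    independent modulo E4 and E6 is independent over all modular forms, so its length is bounded by
    the number of grid points; a longest family generates, by induction on the weight. The obstacle
    in the tensor product is that the determinant D has zeros in the upper half-plane, where a
    quotient by D must still be holomorphic. What makes the division possible is that every Taylor
    coefficient of the function to be divided is already D times a modular form: Taylor coefficients
    of F in the second variables are weak forms of index M1, hence combinations of the f_i with
    modular coefficients, and these coefficients are the Taylor coefficients of the quotients. *)

Local Notation Re := complex.Re.
Local Notation Im := complex.Im.
Local Notation dff f p := (differentiable f p).
Local Notation dprd := direct_product.

(** * Real-valued norms and differentiability in epsilon-delta form *)

Section RealNorm.
Variable R : realType.
Notation C := R[i].

(** Norms over [C] are elements of [C]; taking the real part moves all estimates to [R], where [lra]
    and [nra] apply. *)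
Definition rn (V : normedZmodType C) (v : V) : R := Re `|v|.

Section Generic.
Variable V : normedZmodType C.
Implicit Types u v : V.

Lemma rnE v : `|v| = (rn v)%:C.
Proof. by rewrite /rn RRe_real // normr_real. Qed.

Lemma rn_ge0 v : 0 <= rn v.
Proof. by rewrite -lecR -rnE normr_ge0. Qed.

Lemma rnD u v : rn (u + v) <= rn u + rn v.
Proof. by rewrite -lecR rmorphD /= -!rnE ler_normD. Qed.

Lemma rnN v : rn (- v) = rn v.
Proof. by rewrite /rn normrN. Qed.

Lemma rnC u v : rn (u - v) = rn (v - u).
Proof. by rewrite -rnN opprB. Qed.

Lemma rnB u v : rn (u - v) <= rn u + rn v.
Proof. by rewrite (le_trans (rnD _ _)) // rnN. Qed.

Lemma rnBl u v : rn u - rn v <= rn (u - v).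
Proof. by rewrite lerBlDr -{1}(subrK v u) rnD. Qed.

Lemma rnDl u v : rn u - rn v <= rn (u + v).
Proof. by rewrite -(rnN v) -{2}[v]opprK rnBl. Qed.

Lemma rn0 : rn (0 : V) = 0.
Proof. by rewrite /rn normr0. Qed.

Lemma rn_eq0 v : (rn v == 0) = (v == 0).
Proof. by rewrite -[v == 0]normr_eq0 rnE -(inj_eq (@complexI R)). Qed.

Lemma rn_gt0 v : (0 < rn v) = (v != 0).
Proof. by rewrite lt_def rn_eq0 rn_ge0 andbT. Qed.

Lemma rn_sum (I : Type) (r : seq I) (P : pred I) (F : I -> V) :
 rn (\sum_(i <- r | P i) F i) <= \sum_(i <- r | P i) rn (F i).
Proof.
elim/big_rec2: _ => [|i y x _ le]; first by rewrite rn0.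
by rewrite (le_trans (rnD _ _)) // lerD2l.
Qed.

End Generic.

Lemma rnZ (V : normedModType C) (a : C) (v : V) : rn (a *: v) = rn a * rn v.
Proof. by apply: (@complexI R); rewrite rmorphM /= -!rnE normrZ. Qed.

Implicit Types z w : C.

Lemma rnM z w : rn (z * w) = rn z * rn w.
Proof. by apply: (@complexI R); rewrite rmorphM /= -!rnE normrM. Qed.

Lemma rn1 : rn (1 : C) = 1.
Proof. by rewrite /rn normr1. Qed.

Lemma rnX z n : rn (z ^+ n) = rn z ^+ n.
Proof. by elim: n => [|n IH]; rewrite ?expr0 ?rn1 // !exprS rnM IH. Qed.

Lemma rnV z : rn z^-1 = (rn z)^-1.
Proof. by apply: (@complexI R); rewrite fmorphV /= -!rnE normfV. Qed.

Lemma rn_real (x : R) : rn (x%:C) = `|x|.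
Proof. by rewrite /rn normc_def /= expr0n addr0 sqrtr_sqr. Qed.

Lemma rn_nat n : rn (n%:R : C) = n%:R.
Proof. by rewrite -[n%:R]/(n%:R) -(rmorph_nat (real_complex R)) rn_real ger0_norm. Qed.

Lemma rn_sqr z : rn z ^+ 2 = Re z ^+ 2 + Im z ^+ 2.
Proof. by rewrite /rn normc_def /= sqr_sqrtr // addr_ge0 ?sqr_ge0. Qed.

Lemma Re_le_rn z : `|Re z| <= rn z.
Proof.
rewrite -(@ler_pXn2r _ 2) ?nnegrE ?rn_ge0 // real_normK ?num_real //.
by rewrite rn_sqr lerDl sqr_ge0.
Qed.

Lemma Im_le_rn z : `|Im z| <= rn z.
Proof.
rewrite -(@ler_pXn2r _ 2) ?nnegrE ?rn_ge0 // real_normK ?num_real //.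
by rewrite rn_sqr lerDr sqr_ge0.
Qed.

Lemma rn_i : rn ('i : C) = 1.
Proof. by rewrite /rn normc_def /= expr0n expr1n add0r sqrtr1. Qed.

Lemma rn_le_ReIm z : rn z <= `|Re z| + `|Im z|.
Proof.
by rewrite {1}[z]complexE (le_trans (rnD _ _)) // rnM rn_i mul1r !rn_real.
Qed.

Lemma cReD z w : Re (z + w) = Re z + Re w.
Proof. by case: z w => [? ?] [? ?]. Qed.
Lemma cImD z w : Im (z + w) = Im z + Im w.
Proof. by case: z w => [? ?] [? ?]. Qed.
Lemma cReB z w : Re (z - w) = Re z - Re w.
Proof. by case: z w => [? ?] [? ?]. Qed.
Lemma cImB z w : Im (z - w) = Im z - Im w.
Proof. by case: z w => [? ?] [? ?]. Qed.
Lemma cImN z : Im (- z) = - Im z.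
Proof. by case: z. Qed.
Lemma cReM z w : Re (z * w) = Re z * Re w - Im z * Im w.
Proof. by case: z w => [? ?] [? ?]. Qed.
Lemma cImM z w : Im (z * w) = Re z * Im w + Im z * Re w.
Proof. by case: z w => [? ?] [? ?]. Qed.

Lemma ex_posC (e : C) : 0 < e -> exists2 d : R, 0 < d & e = d%:C.
Proof.
move=> e0; exists (Re e); last by rewrite RRe_real // gtr0_real.
by move: e0; rewrite ltcE => /andP[_].
Qed.

Lemma posC (d : R) : 0 < d -> 0 < d%:C.
Proof. by move=> d0; rewrite ltcR. Qed.

Lemma nbhs_rnP (V : normedModType C) (p : V) (A : set V) :
 nbhs p A <-> exists2 d : R, 0 < d & forall v, rn (v - p) < d -> A v.
Proof.
split=> [/nbhs_normP[e /= e0 eA]|[d d0 dA]].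
 have [d d0 ed] := ex_posC e0; exists d => // v vp; apply: eA => /=. by rewrite /ball_ /= distrC rnE ed ltcR.
apply/nbhs_normP; exists d%:C => /=; first exact: posC.
by move=> v; rewrite /ball_ /= distrC rnE ltcR; exact: dA.
Qed.

Lemma continuous_rnP (V W : normedModType C) (f : V -> W) (p : V) :
 {for p, continuous f} <-> forall e : R, 0 < e ->
  exists2 d : R, 0 < d & forall v, rn (v - p) < d -> rn (f v - f p) < e.
Proof.
split=> [fc e e0|H A].
 apply/(nbhs_rnP p [set v | rn (f v - f p) < e]).
 by apply: (fc [set w | rn (w - f p) < e]); apply/nbhs_rnP; exists e.
move=> /nbhs_rnP[e e0 eA]; apply/nbhs_rnP.
by have [d d0 dH] := H e e0; exists d => // v /dH /eA.
Qed.

Lemma cvg_rnP (V : normedModType C) (u : nat -> V) (l : V) : (u @ \oo --> l) <-> forall e : R, 0 < e ->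
  exists N, forall n, (N <= n)%N -> rn (u n - l) < e.
Proof.
split=> [ul e e0|H A].
 have := ul [set w | rn (w - l) < e] _.
 case; first by apply/nbhs_rnP; exists e.
 by move=> N _ NH; exists N => n nN; apply: NH.
move=> /nbhs_rnP[e e0 eA]; have [N NH] := H e e0.
by exists N => // n /= nN; apply: eA; apply: NH.
Qed.

Section Differentiable.
Variables V W : normedModType C.
Implicit Types f g : V -> W.

(** First-order approximation without little-o filters. Limits of holomorphic functions are later
    shown differentiable by exhibiting such an [L]. *)
Definition approx f (p : V) (L : V -> W) := forall e : R, 0 < e ->
 exists2 d : R, 0 < d & forall h, rn h < d -> rn (f (p + h) - f p - L h) <= e * rn h.

Lemma bounded_continuous (L : {linear V -> W}) (K : R) : (forall v, rn (L v) <= K * rn v) -> continuous L.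
Proof.
move=> LK p; apply/continuous_rnP => e e0.
have K0 : 0 < `|K| + 1 by rewrite ltr_wpDl.
exists (e / (`|K| + 1)) => [|v vp]; first by rewrite divr_gt0.
rewrite -linearB (le_lt_trans (LK _)) //.
have: K * rn (v - p) <= (`|K| + 1) * rn (v - p).
 by rewrite ler_wpM2r ?rn_ge0 // (le_trans (ler_norm _)) // lerDl.
by move=> /le_lt_trans; apply; rewrite mulrC -ltr_pdivlMr.
Qed.

Lemma differentiable_approx f p : dff f p -> exists L : {linear V -> W}, continuous L /\ approx f p L.
Proof.
move=> df; exists ('d f p); split; first exact: diff_continuous.
have /diff_locally/eqaddoP H := df.
move=> e e0; have /nbhs_rnP[d d0 dH] := H _ (posC e0).
exists d => // h hd; have := dH h; rewrite subr0 => /(_ hd) /=.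
rewrite !fctE /= [h + p]addrC opprD addrA !rnE -rmorphM lecR; exact.
Qed.

Lemma approx_differentiable f p (L : {linear V -> W}) : continuous L -> approx f p L -> dff f p.
Proof.
move=> Lc fL.
have E : f \o shift p = cst (f p) + L +o_ (0 : V) id.
 apply/eqaddoP => _ /ex_posC[e e0 ->]; apply/nbhs_rnP.
 have [d d0 dH] := fL e e0; exists d => // h; rewrite subr0 => /dH.
 by rewrite !fctE /= [h + p]addrC opprD addrA !rnE -rmorphM lecR.
by apply/diff_locallyP; rewrite (diff_unique Lc E).
Qed.

Lemma differentiable_local f g p (d : R) : 0 < d -> (forall v, rn (v - p) < d -> f v = g v) ->
 dff f p -> dff g p.
Proof.
move=> d0 fg /differentiable_approx[L [Lc fL]].
apply: (approx_differentiable Lc) => e e0; have [d' d'0 dH] := fL e e0.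
exists (Num.min d d') => [|h]; first by rewrite lt_min d0.
rewrite lt_min => /andP[hd hd']; rewrite -!fg ?subrr ?rn0 //; first exact: dH.
by rewrite addrC addKr.
Qed.

End Differentiable.

Section DifferentiableC.
Variable V : normedModType C.
Implicit Types f g : V -> C^o.

Lemma dfD f g p : dff f p -> dff g p -> dff (fun v => f v + g v : C^o) p.
Proof. exact: differentiableD. Qed.
Lemma dfB f g p : dff f p -> dff g p -> dff (fun v => f v - g v : C^o) p.
Proof. exact: differentiableB. Qed.
Lemma dfN f p : dff f p -> dff (fun v => - f v : C^o) p.
Proof. exact: differentiableN. Qed.
Lemma dfM f g p : dff f p -> dff g p -> dff (fun v => f v * g v : C^o) p.
Proof. exact: differentiableM. Qed.
Lemma dfV f p : dff f p -> f p != 0 -> dff (fun v => (f v)^-1 : C^o) p.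
Proof. exact: differentiableV. Qed.
Lemma dfX f p n : dff f p -> dff (fun v => f v ^+ n : C^o) p.
Proof.
move=> df; elim: n => [|n IH].
 by under eq_fun do rewrite expr0; apply: differentiable_cst.
by under eq_fun do rewrite exprS; apply: dfM.
Qed.
Lemma df_sum (I : Type) (r : seq I) (P : pred I) (F : I -> V -> C^o) p : (forall i, P i -> dff (F i) p) ->
 dff (fun v => \sum_(i <- r | P i) F i v : C^o) p.
Proof.
move=> dF; elim: r => [|i r IH].
 by under eq_fun do rewrite big_nil; apply: differentiable_cst.
have [Pi|nPi] := boolP (P i). by under eq_fun do rewrite big_cons Pi; apply: dfD => //; apply: dF.
by under eq_fun do rewrite big_cons (negbTE nPi).
Qed.
Lemma df_comp (U W : normedModType C) (g : V -> W) (f : U -> V) p : dff f p -> dff g (f p) ->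
 dff (fun u => g (f u)) p.
Proof. by move=> df dg; apply: differentiable_comp. Qed.

Lemma df_compC f (g : C^o -> C^o) p : dff f p -> dff g (f p) -> dff (fun u => g (f u)) p.
Proof. by move=> df dg; apply: differentiable_comp. Qed.

End DifferentiableC.

Lemma dfid (V : normedModType C) (p : V) : dff (fun v : V => v) p.
Proof. by apply: (linear_differentiable (f := idfun)) => ?. Qed.
Lemma dfcst (V W : normedModType C) (c : W) (p : V) : dff (fun _ : V => c) p.
Proof. exact: differentiable_cst. Qed.
Lemma df_add (V W : normedModType C) (f g : V -> W) p : dff f p -> dff g p -> dff (fun v => f v + g v) p.
Proof. exact: differentiableD. Qed.
Lemma df_scale (V W : normedModType C) (f : V -> C^o) (u : W) p : dff f p -> dff (fun v => (f v : C) *: u) p.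
Proof. exact: differentiableZl. Qed.
Lemma df_pair (U V W : normedModType C) (f : U -> V) (g : U -> W) p : dff f p -> dff g p ->
 dff (fun v => (f v, g v) : V * W) p.
Proof. exact: differentiable_pair. Qed.
Lemma df_fst (U V W : normedModType C) (f : U -> V * W) p : dff f p -> dff (fun v => (f v).1) p.
Proof.
move=> df; apply: (differentiable_comp (g := fst)) => //.
by apply: (linear_differentiable (f := fst)) => x; apply: cvg_fst.
Qed.
Lemma df_snd (U V W : normedModType C) (f : U -> V * W) p : dff f p -> dff (fun v => (f v).2) p.
Proof.
move=> df; apply: (differentiable_comp (g := snd)) => //.
by apply: (linear_differentiable (f := snd)) => x; apply: cvg_snd.
Qed.
Lemma df_lin (V W : normedModType C) (L : V -> W) (K : R) p :
 linear L -> (forall v, rn (L v) <= K * rn v) -> dff L p.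
Proof.
move=> Llin LK; pose LL : {linear V -> W} := HB.pack L (GRing.isLinear.Build C V W *:%R L Llin).
by apply: (linear_differentiable (f := LL)); apply: (bounded_continuous (K := K)).
Qed.

Definition has_deriv (g : C -> C) (w a : C) := forall e : R, 0 < e ->
 exists2 d : R, 0 < d & forall h : C, rn h < d -> rn (g (w + h) - g w - a * h) <= e * rn h.

Lemma differentiable_deriv (g : C^o -> C^o) (w : C^o) : dff g w <-> exists a, has_deriv g w a.
Proof.
split=> [/differentiable_approx[L [_ gL]]|[a ga]].
 exists (L 1) => e e0; have [d d0 dH] := gL e e0; exists d => // h /dH.
 have LE : L h = L 1 * h. by rewrite mulrC -[h * L 1]/(h *: L 1) -linearZ /= [_ *: _]mulr1. by rewrite -LE.
pose L : C^o -> C^o := fun s => a * s.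
have Llin : linear L by move=> c x y; rewrite /L mulrDr; congr (_ + _); exact: mulrCA.
pose LL : {linear C^o -> C^o} := HB.pack L (GRing.isLinear.Build C C^o C^o *:%R L Llin).
have Lc : continuous LL. by apply: (@bounded_continuous _ _ LL (rn a)) => v; rewrite /= /L rnM.
exact: (approx_differentiable Lc).
Qed.

End RealNorm.

(** * The complex exponential: derivative, kernel and surjectivity *)

Section Cexp.
Variable R : realType.
Notation C := R[i].
Implicit Types z w : C.

Lemma is_derive_approx (f : R -> R) (x d : R) : is_derive x 1 f d ->
 forall e : R, 0 < e -> exists2 del : R, 0 < del & forall h : R, `|h| < del ->
  `|f (x + h) - f x - d * h| <= e * `|h|.
Proof.
move=> fd e e0.
have df : dff f x by apply/derivable1_diffP; apply: ex_derive.
have dE h : 'd f x h = d * h.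
 rewrite -[in LHS](mulr1 h) -[h * 1]/(h *: (1 : R^o)) linearZ /= -deriveE // derive_val.
 by rewrite mulrC.
have /diff_locally/eqaddoP/(_ e e0)/nbhs_ballP[del /= del0 dH] := df.
exists del => // h hd; have := dH h.
rewrite /ball /= sub0r normrN => /(_ hd).
by rewrite !fctE /= dE [h + x]addrC opprD addrA.
Qed.

Lemma cexpD z w : cexp (z + w) = cexp z * cexp w.
Proof.
case: z w => [a b] [c d]; rewrite /cexp /= expRD sinD cosD.
by apply/eqP; rewrite eq_complex /=; apply/andP; split; apply/eqP; ring.
Qed.

Lemma cexp0 : cexp (0 : C) = 1.
Proof. by rewrite /cexp /= expR0 cos0 sin0; apply/eqP; rewrite eq_complex /= !mul0r !mul1r subr0 addr0 !eqxx. Qed.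

Lemma cexpN z : cexp (- z) = (cexp z)^-1.
Proof.
apply: (mulfI (cexp_neq0 z)); rewrite -cexpD subrr cexp0 mulfV //.
exact: cexp_neq0.
Qed.

Lemma cexpMn z n : cexp (n%:R * z) = cexp z ^+ n.
Proof.
elim: n => [|n IH]; first by rewrite mul0r cexp0 expr0.
by rewrite -natr1 mulrDl mul1r cexpD IH exprSr.
Qed.

Lemma rn_cexp z : rn (cexp z) = expR (Re z).
Proof.
rewrite /cexp rnM rn_real ger0_norm ?expR_ge0 //.
suff -> : rn (cos (Im z) +i* sin (Im z)) = 1 by rewrite mulr1.
by apply/eqP; rewrite -sqrp_eq1 ?rn_ge0 // rn_sqr /= cos2Dsin2.
Qed.

Lemma cexp_deriv0 : has_deriv (@cexp R) 0 1.
Proof.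
move=> e e0.
(* The four error terms [A1], [A2], [A3] and [H3'] are at most e1 h, 2 e1 h, 4 e1 h and e1 h, which
   add up to 8 e1 h; [e1 <= 1] bounds the remaining factors. *)
have [e1 [e10 e11 e1e]] : exists e1 : R, [/\ 0 < e1, e1 <= 1 & e1 <= e / 8].
 exists (Num.min (e / 8) 1).
 by split; rewrite ?ge_min ?lexx ?orbT // lt_min divr_gt0 /=.
have [d1 d10 H1] := is_derive_approx (is_derive_expR (0 : R)) e10.
have [d2 d20 H2] := is_derive_approx (is_derive_cos (0 : R)) e10.
have [d3 d30 H3] := is_derive_approx (is_derive_sin (0 : R)) e10.
exists (Num.min (Num.min d1 d2) (Num.min d3 e1)).
 by rewrite !lt_min d10 d20 d30 e10.
case=> a b; rewrite lt_min => /andP[]; rewrite lt_min => /andP[h1 h2].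
rewrite lt_min => /andP[h3 h4].
have ha := Re_le_rn (a +i* b); have hb := Im_le_rn (a +i* b).
rewrite /= in ha hb; set h := rn _ in h1 h2 h3 h4 ha hb *.
have {}H1 := H1 a (le_lt_trans ha h1); have {}H2 := H2 b (le_lt_trans hb h2).
have {}H3 := H3 b (le_lt_trans hb h3).
rewrite !(add0r, expR0, cos0, sin0, mul1r, oppr0, mul0r, subr0, addr0) in H1 H2 H3.
rewrite add0r cexp0 mul1r (le_trans (rn_le_ReIm _)) //.
rewrite !cReB !cImB /cexp /= !mul0r !subr0 !addr0.
have h0 : 0 <= h by exact: rn_ge0.
have cb : `|cos b| <= 1 by rewrite ler_norml cos_geN1 cos_le1.
have sb : `|sin b| <= 2 * h.
 have -> : sin b = (sin b - b) + b by ring. by rewrite (le_trans (ler_normD _ _)) //; nra.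
have ea : `|expR a - 1| <= 2 * h.
 have -> : expR a - 1 = (expR a - 1 - a) + a by ring. by rewrite (le_trans (ler_normD _ _)) //; nra.
have A1 : `|(expR a - 1) * cos b - a * cos b| <= e1 * h.
 rewrite -mulrBl normrM.
 have := ler_pM (normr_ge0 _) (normr_ge0 _) H1 cb; nra.
have A2 : `|(1 + a) * (cos b - 1)| <= 2 * e1 * h.
 have a1 : `|1 + a| <= 2 by have := ler_normD 1 a; rewrite normr1; lra.
 have H2' : `|cos b - 1| <= e1 * h by rewrite (le_trans H2) // ler_pM2l. by rewrite normrM -mulrA ler_pM.
have A3 : `|(expR a - 1) * sin b| <= 4 * e1 * h.
 by rewrite normrM; have := ler_pM (normr_ge0 _) (normr_ge0 _) ea sb; nra.
have -> : expR a * cos b - 1 - a = ((expR a - 1) * cos b - a * cos b) + (1 + a) * (cos b - 1) by ring.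
have -> : expR a * sin b - b = (expR a - 1) * sin b + (sin b - b) by ring.
apply: le_trans (lerD (ler_normD _ _) (ler_normD _ _)) _.
have H3' : `|sin b - b| <= e1 * h by rewrite (le_trans H3) // ler_pM2l.
have : e1 * h <= e / 8 * h by rewrite ler_wpM2r.
lra.
Qed.

Lemma cexp_deriv z : has_deriv (@cexp R) z (cexp z).
Proof.
move=> e e0; pose k := expR (Re z).
have k0 : 0 < k by rewrite expR_gt0.
have [d d0 dH] := cexp_deriv0 (divr_gt0 e0 k0).
exists d => // h /dH; rewrite add0r cexp0 mul1r => H.
have -> : cexp (z + h) - cexp z - cexp z * h = cexp z * (cexp h - 1 - h). by rewrite cexpD; ring.
rewrite rnM rn_cexp -/k mulrC -ler_pdivlMr //.
by rewrite mulrAC.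
Qed.

Lemma df_cexp (V : normedModType C) (f : V -> C^o) p : dff f p -> dff (fun v => cexp (f v) : C^o) p.
Proof.
move=> df; apply: (df_comp (g := fun z : C^o => cexp z : C^o) df).
by apply/differentiable_deriv; exists (cexp (f p)); exact: cexp_deriv.
Qed.

Definition ee (z : C) : C := cexp (twopii R * z).

Lemma eeD z w : ee (z + w) = ee z * ee w.
Proof. by rewrite /ee mulrDr cexpD. Qed.
Lemma ee0 : ee 0 = 1.
Proof. by rewrite /ee mulr0 cexp0. Qed.
Lemma eeN z : ee (- z) = (ee z)^-1.
Proof. by rewrite /ee mulrN cexpN. Qed.
Lemma eeB z w : ee (z - w) = ee z / ee w.
Proof. by rewrite eeD eeN. Qed.
Lemma ee_neq0 z : ee z != 0.
Proof. exact: cexp_neq0. Qed.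
Lemma eeMn z n : ee (n%:R * z) = ee z ^+ n.
Proof. by rewrite /ee mulrCA cexpMn. Qed.
Lemma rn_ee z : rn (ee z) = expR (- (2 * pi * Im z)).
Proof. by rewrite rn_cexp /twopii cReM /= mul0r sub0r. Qed.
Lemma ee1 : ee 1 = 1.
Proof.
rewrite /ee mulr1 /cexp /twopii /= expR0 mul1r.
by rewrite mulr_natl -[pi *+ 2]add0r cosD2pi sinD2pi cos0 sin0.
Qed.
Lemma ee_int (n : int) : ee n%:~R = 1.
Proof.
have E (m : nat) : ee m%:R = 1 by rewrite -[m%:R]mulr1 eeMn ee1 expr1n.
by case: n => n; [exact: E|rewrite NegzE rmorphN eeN /= E invr1].
Qed.
Lemma df_ee (V : normedModType C) (f : V -> C^o) p : dff f p -> dff (fun v => ee (f v) : C^o) p.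
Proof. by move=> df; apply: df_cexp; apply: dfM => //; exact: dfcst. Qed.

Lemma ee_surj w : w != 0 -> exists t, w = ee t.
Proof.
move=> w0; have nw : 0 < rn w by rewrite rn_gt0.
pose u := w / (rn w)%:C.
have u1 : Re u ^+ 2 + Im u ^+ 2 = 1.
 by rewrite -rn_sqr /u rnM rnV rn_real gtr0_norm // divff ?gt_eqF // expr1n.
have [th cth sth] : exists2 th : R, cos th = Re u & sin th = Im u.
 have ru : -1 <= Re u <= 1.
  by rewrite -ler_norml -(@ler_pXn2r _ 2) ?nnegrE // real_normK ?num_real // expr1n; have := sqr_ge0 (Im u); lra.
 have [iu|iu] := leP 0 (Im u).
  exists (acos (Re u)); first exact: acosK.
  by rewrite sin_acos // -u1 addrC addKr sqrtr_sqr ger0_norm.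
 exists (- acos (Re u)); first by rewrite cosN acosK.
 by rewrite sinN sin_acos // -u1 addrC addKr sqrtr_sqr ltr0_norm // opprK.
exists ((twopii R)^-1 * (ln (rn w) +i* th)).
have t0 : twopii R != 0. by rewrite eq_complex /= negb_and mulf_neq0 ?orbT // gt_eqF // pi_gt0.
rewrite /ee mulVKf // /cexp /= lnK ?posrE // cth sth.
have -> : Re u +i* Im u = u by case: (u).
by rewrite /u mulrC divfK // gt_eqF // ltcR.
Qed.

End Cexp.

Ltac dfs := repeat lazymatch goal with |- @differentiable_def _ ?V _ ?F _ _ => lazymatch F with
 | fun v => v => exact: dfid
 | fun _ => ?c => exact: dfcst
 | fun v => (@?f v, @?g v) => first [apply: (@df_pair _ V _ _ f g)|apply: df_pair]
 | fun v => fst (@?f v) => apply: (@df_fst _ V _ _ f)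
 | fun v => snd (@?f v) => apply: (@df_snd _ V _ _ f)
 | fun v => @?f v *: ?u => apply: (@df_scale _ V _ f)
 | fun v => @?f v * @?g v => apply: (@dfM _ V f g)
 | fun v => @?f v + @?g v => first [apply: (@dfD _ V f g)|apply: (@df_add _ V _ f g)]
 (* unification in [df_pair] eta-reduces the components *)
 | fst => apply: (@df_fst _ V _ _ (fun v => v))
 | snd => apply: (@df_snd _ V _ _ (fun v => v))
 | +%R ?c => apply: (@dfD _ V (fun=> c) (fun v => v))
 | fun v => - @?f v => apply: (@dfN _ V f)
 | fun v => @?f v ^+ ?n => apply: (@dfX _ V f _ n)
 | fun v => (@?f v)^-1 => apply: (@dfV _ V f)
 | fun v => cexp (@?f v) => apply: (@df_cexp _ V f)
 | fun v => ee (@?f v) => apply: (@df_ee _ V f)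
 end end.

(** Composition with a fixed outer function: [dfs] treats the inner function, and differentiability
    of [g] at the image point is left as a goal. *)
Ltac dfc g := lazymatch goal with |- @differentiable_def _ ?V _ (fun v => g (@?f v)) _ _ =>
 first [apply: (@df_compC _ V f g)|apply: (@df_comp _ _ V _ g f)]; dfs end.

(** * Integrals of continuous complex functions over a segment *)

Section Integral.
Variable R : realType.
Notation C := R[i].
Notation mu := (@lebesgue_measure R).

(** Neighbourhoods are taken in the whole line, also at the end points, so the property passes to
    subsegments and follows from continuity in the plane. *)
Definition ccont (f : R -> C) (a b : R) := forall x : R, a <= x <= b ->
 forall e : R, 0 < e -> exists2 d : R, 0 < d & forall t, `|t - x| < d -> rn (f t - f x) < e.

Definition cint (f : R -> C) (a b : R) : C := (\int[mu]_(x in `[a, b]) Re (f x)) +i*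
 (\int[mu]_(x in `[a, b]) Im (f x)).

Lemma ccont_integrable (f : R -> C) (g : C -> R) a b :
 (forall z w, `|g z - g w| <= rn (z - w)) -> ccont f a b ->
 mu.-integrable `[a, b] (EFin \o (fun x => g (f x))).
Proof.
move=> gL fc; apply: continuous_compact_integrable; first exact: segment_compact.
apply: continuous_in_subspaceT => x; rewrite inE /= in_itv /= => xab.
apply/cvgrPdist_lt => e e0; have [d d0 dH] := fc x xab e e0.
apply/nbhs_ballP; exists d => //= t; rewrite /ball /= distrC => /dH H.
by rewrite (le_lt_trans (gL _ _)) // rnC.
Qed.

Lemma Re_lip (z w : C) : `|Re z - Re w| <= rn (z - w).
Proof. by rewrite -cReB Re_le_rn. Qed.
Lemma Im_lip (z w : C) : `|Im z - Im w| <= rn (z - w).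
Proof. by rewrite -cImB Im_le_rn. Qed.

Lemma ccontD f g a b : ccont f a b -> ccont g a b -> ccont (fun x => f x + g x) a b.
Proof.
move=> fc gc x xab e e0; have e2 : 0 < e / 2 by rewrite divr_gt0.
have [d d0 dH] := fc x xab _ e2; have [d' d'0 dH'] := gc x xab _ e2.
exists (Num.min d d') => [|t]; first by rewrite lt_min d0.
rewrite lt_min => /andP[/dH h /dH' h'].
by rewrite opprD addrACA (le_lt_trans (rnD _ _)) //; lra.
Qed.

Lemma ccont_cst c a b : ccont (fun=> c) a b.
Proof. by move=> x _ e e0; exists 1 => // t _; rewrite subrr rn0. Qed.

Lemma ccontM f g a b : ccont f a b -> ccont g a b -> ccont (fun x => f x * g x) a b.
Proof.
move=> fc gc x xab e e0; pose K := rn (f x) + rn (g x) + 1.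
have fx := rn_ge0 (f x); have gx := rn_ge0 (g x).
have K0 : 0 < K by rewrite /K; lra.
have e2 : 0 < Num.min 1 (e / (2 * K)) by rewrite lt_min ltr01 divr_gt0 // mulr_gt0.
have [d d0 dH] := fc x xab _ e2; have [d' d'0 dH'] := gc x xab _ e2.
exists (Num.min d d') => [|t]; first by rewrite lt_min d0.
rewrite lt_min => /andP[/dH + /dH']; rewrite !lt_min => /andP[h1 h2] /andP[h1' h2'].
have -> : f t * g t - f x * g x = (f t - f x) * (g t - g x) + (f t - f x) * g x + f x * (g t - g x) by ring.
rewrite ltr_pdivlMr ?mulr_gt0 // in h2; rewrite ltr_pdivlMr ?mulr_gt0 // in h2'.
apply: le_lt_trans (rnD _ _) _; rewrite rnM.
apply: le_lt_trans (lerD (rnD _ _) (lexx _)) _; rewrite !rnM.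
have := rn_ge0 (f t - f x); have := rn_ge0 (g t - g x).
move: (rn (f t - f x)) (rn (g t - g x)) h1 h1' h2 h2' => u v u1 v1 u2 v2 v0 u0.
rewrite /K in u2 v2; nra.
Qed.

Lemma ccontN f a b : ccont f a b -> ccont (fun x => - f x) a b.
Proof.
by move=> fc x xab e e0; have [d d0 dH] := fc x xab e e0; exists d => // t /dH; rewrite -opprD rnN.
Qed.

Lemma cintD f g a b : ccont f a b -> ccont g a b -> cint (fun x => f x + g x) a b = cint f a b + cint g a b.
Proof.
move=> fc gc; rewrite /cint.
under eq_Rintegral do rewrite cReD.
under [X in _ +i* X]eq_Rintegral do rewrite cImD.
by rewrite !RintegralD //; first [exact: (ccont_integrable Re_lip)|exact: (ccont_integrable Im_lip)].
Qed.

Lemma cintM (c : C) f a b : ccont f a b -> cint (fun x => c * f x) a b = c * cint f a b.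
Proof.
move=> fc; have iR := ccont_integrable Re_lip fc; have iI := ccont_integrable Im_lip fc.
rewrite /cint; case: c => u v.
under eq_Rintegral do rewrite cReM /=.
under [X in _ +i* X]eq_Rintegral do rewrite cImM /=.
have iZ (k : R) (h : R -> R) : mu.-integrable `[a, b] (EFin \o h) ->
  mu.-integrable `[a, b] (EFin \o (fun x => k * h x)).
 by move=> ih; apply: (integrableZl _ k ih).
rewrite RintegralB //; [|exact: iZ|exact: iZ].
rewrite RintegralD //; [|exact: iZ|exact: iZ].
by rewrite !RintegralZl.
Qed.

Lemma cintN f a b : ccont f a b -> cint (fun x => - f x) a b = - cint f a b.
Proof.
by move=> fc; rewrite -mulN1r -cintM //; congr (_ +i* _); apply: eq_Rintegral => x _; rewrite mulN1r.
Qed.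

Lemma cintB f g a b : ccont f a b -> ccont g a b -> cint (fun x => f x - g x) a b = cint f a b - cint g a b.
Proof. by move=> fc gc; rewrite cintD ?cintN //; exact: ccontN. Qed.

Lemma cint_sum (I : Type) (r : seq I) (F : I -> R -> C) a b : (forall i, ccont (F i) a b) ->
 ccont (fun x => \sum_(i <- r) F i x) a b /\
 cint (fun x => \sum_(i <- r) F i x) a b = \sum_(i <- r) cint (F i) a b.
Proof.
move=> Fc; elim: r => [|i r [IH1 IH2]].
 have -> : (fun x => \sum_(i <- [::]) F i x) = fun=> 0 by apply/funext => x; rewrite big_nil.
 split; first exact: ccont_cst.
 rewrite big_nil /cint /=.
 by rewrite !Rintegral_cst //= !mul0r.
have -> : (fun x => \sum_(j <- i :: r) F j x) = fun x => F i x + \sum_(j <- r) F j x.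
 by apply/funext => x; rewrite big_cons.
by split; [exact: ccontD|rewrite cintD // big_cons IH2].
Qed.

Lemma eq_cint f g a b : (forall x, a <= x <= b -> f x = g x) -> cint f a b = cint g a b.
Proof.
move=> fg; rewrite /cint; congr (_ +i* _); apply: eq_Rintegral => x;
by rewrite inE /= in_itv /= => /fg ->.
Qed.

Lemma fine_mu_itv (a b : R) : a <= b -> fine (mu `[a, b]) = b - a.
Proof. by move=> ab; rewrite lebesgue_measure_itv /= lte_fin; case: ltP => //= ba; lra. Qed.

Lemma cint_cst (c : C) a b : a <= b -> cint (fun=> c) a b = c * (b - a)%:C.
Proof.
move=> ab; rewrite /cint /= !Rintegral_cst //= !fine_mu_itv //.
by case: c => u v /=; apply/eqP; rewrite eq_complex /= !mulr0 subr0 add0r !eqxx.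
Qed.

Lemma cint_split f a b c : ccont f a b -> a <= c <= b -> cint f a b = cint f a c + cint f c b.
Proof.
move=> fc /andP[ac cb].
have key (g : C -> R) : (forall z w, `|g z - g w| <= rn (z - w)) -> \int[mu]_(x in `[a, b]) g (f x) =
  \int[mu]_(x in `[a, c]) g (f x) + \int[mu]_(x in `[c, b]) g (f x).
 move=> gL; have ii := ccont_integrable gL fc.
 have := @Rintegral_itvB R (fun x => g (f x)) (BLeft a) (BRight b) c ii.
 rewrite !bnd_simp => /(_ ac cb) H.
 have ii2 : mu.-integrable `]c, b] (EFin \o (fun x => g (f x))).
  apply: integrableS ii => //; apply: subset_itvr; rewrite bnd_simp; lra.
 by rewrite (Rintegral_itv_obnd_cbnd ii2) in H; rewrite -H addrC subrK.
rewrite /cint (key _ Re_lip) (key _ Im_lip).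
by apply/eqP; rewrite eq_complex /= !eqxx.
Qed.

(** The factor 2 comes from estimating real and imaginary part separately. Where a sharp bound
    matters, in [maxmod], it is removed by taking powers. *)
Lemma cint_le f a b (M : R) : a <= b -> ccont f a b ->
 (forall x, a <= x <= b -> rn (f x) <= M) -> rn (cint f a b) <= 2 * M * (b - a).
Proof.
move=> ab fc fM.
have key (g : C -> R) : (forall z w, `|g z - g w| <= rn (z - w)) ->
  (forall z, `|g z| <= rn z) -> `|\int[mu]_(x in `[a, b]) g (f x)| <= M * (b - a).
 move=> gL gM; have ii := ccont_integrable gL fc.
 apply: le_trans (le_normr_Rintegral _ ii) _ => //.
 rewrite -(fine_mu_itv ab) -Rintegral_cst //.
 apply: le_Rintegral => //.
 - exact: (@integrable_norm _ _ _ _ _ _ ii).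
 - exact: (ccont_integrable Re_lip (@ccont_cst M%:C a b)).
 - by move=> x; rewrite /= in_itv /= => xab; rewrite (le_trans (gM _)) // fM.
apply: le_trans (rn_le_ReIm _) _ => /=.
rewrite -mulrA mulr_natl mulr2n.
exact: lerD (key _ Re_lip (@Re_le_rn R)) (key _ Im_lip (@Im_le_rn R)).
Qed.

Lemma cint0 f a : cint f a a = 0.
Proof.
by rewrite /cint set_itv1 !Rintegral_set1.
Qed.

End Integral.

(** * Goursat's theorem on rectangles *)

Section Goursat.
Variable R : realType.
Notation C := R[i].

Definition contat (f : C -> C) (w : C) := forall e : R, 0 < e ->
 exists2 d : R, 0 < d & forall v, rn (v - w) < d -> rn (f v - f w) < e.

(** The counterclockwise contour integral of f along the boundary of the rectangle with sides [a, b]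
    and [c, d]. *)
Definition bnd (f : C -> C) (a b c d : R) : C :=
 cint (fun x => f (x +i* c)) a b - cint (fun x => f (x +i* d)) a b +
 'i * (cint (fun y => f (b +i* y)) c d - cint (fun y => f (a +i* y)) c d).

Definition recton (P : C -> Prop) (a b c d : R) := forall x y, a <= x <= b -> c <= y <= d -> P (x +i* y).

Lemma has_deriv_cont (f : C -> C) w a : has_deriv f w a -> contat f w.
Proof.
move=> fa e e0; have [d d0 dH] := fa 1 ltr01.
have K0 : 0 < rn a + 2 by have := rn_ge0 a; lra.
exists (Num.min d (e / (rn a + 2))) => [|v]; first by rewrite lt_min d0 divr_gt0.
rewrite lt_min => /andP[/dH]; rewrite mul1r [w + _]addrC subrK => H.
rewrite ltr_pdivlMr // => H2.
have -> : f v - f w = (f v - f w - a * (v - w)) + a * (v - w) by ring.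
apply: le_lt_trans (rnD _ _) _; rewrite rnM.
have := rn_ge0 (v - w); have := rn_ge0 a; nra.
Qed.

Lemma contat_h (f : C -> C) a b c d y : recton (contat f) a b c d -> c <= y <= d ->
 ccont (fun x => f (x +i* y)) a b.
Proof.
move=> fc yc x xab e e0; have [del d0 dH] := fc x y xab yc e e0.
exists del => // t tx; apply: dH.
have -> : (t +i* y) - (x +i* y) = (t - x)%:C by apply/eqP; rewrite eq_complex /= subrr !eqxx.
by rewrite rn_real.
Qed.

Lemma contat_v (f : C -> C) a b c d x : recton (contat f) a b c d -> a <= x <= b ->
 ccont (fun y => f (x +i* y)) c d.
Proof.
move=> fc xab y yc e e0; have [del d0 dH] := fc x y xab yc e e0.
exists del => // t ty; apply: dH.
have -> : (x +i* t) - (x +i* y) = 'i * (t - y)%:C.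
 by apply/eqP; rewrite eq_complex /= subrr !mul0r !mul1r !subr0 !add0r !eqxx.
by rewrite rnM rn_i mul1r rn_real.
Qed.

Lemma recton_sub P a b c d a' b' c' d' : recton P a b c d ->
 a <= a' -> b' <= b -> c <= c' -> d' <= d -> recton P a' b' c' d'.
Proof.
move=> H aa bb cc dd x y /andP[x1 x2] /andP[y1 y2]; apply: H; apply/andP; split; lra.
Qed.

Lemma bnd_splitv f a b c d m : recton (contat f) a b c d -> c <= d -> a <= m <= b ->
 bnd f a b c d = bnd f a m c d + bnd f m b c d.
Proof.
move=> fc cd mab; rewrite /bnd.
rewrite (@cint_split _ _ a b m) //; last by apply: (contat_h fc); lra.
rewrite (@cint_split _ (fun x => f (x +i* d)) a b m) //; last by apply: (contat_h fc); lra.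
ring.
Qed.

Lemma bnd_splith f a b c d m : recton (contat f) a b c d -> a <= b -> c <= m <= d ->
 bnd f a b c d = bnd f a b c m + bnd f a b m d.
Proof.
move=> fc ab mcd; rewrite /bnd.
rewrite (@cint_split _ _ c d m) //; last by apply: (contat_v fc); lra.
rewrite (@cint_split _ (fun y => f (a +i* y)) c d m) //; last by apply: (contat_v fc); lra.
ring.
Qed.

Lemma bnd_le f a b c d (M : R) : recton (contat f) a b c d -> a <= b -> c <= d ->
 recton (fun w => rn (f w) <= M) a b c d -> rn (bnd f a b c d) <= 4 * M * ((b - a) + (d - c)).
Proof.
move=> fc ab cd fM; rewrite /bnd.
have hh y : c <= y <= d -> rn (cint (fun x => f (x +i* y)) a b) <= 2 * M * (b - a).
 by move=> yc; apply: cint_le => // [|x xab]; [apply: (contat_h fc)|apply: fM].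
have hv x : a <= x <= b -> rn (cint (fun y => f (x +i* y)) c d) <= 2 * M * (d - c).
 by move=> xab; apply: cint_le => // [|y yc]; [apply: (contat_v fc)|apply: fM].
apply: le_trans (rnD _ _) _; rewrite rnM rn_i mul1r.
apply: le_trans (lerD (rnB _ _) (rnB _ _)) _.
have := hh c; have := hh d; have := hv a; have := hv b.
rewrite !lexx ab cd /=; move=> /(_ isT) ? /(_ isT) ? /(_ isT) ? /(_ isT) ?; lra.
Qed.

Lemma bndD f g a b c d : recton (contat f) a b c d -> recton (contat g) a b c d -> a <= b -> c <= d ->
 bnd (fun w => f w + g w) a b c d = bnd f a b c d + bnd g a b c d.
Proof.
move=> fc gc ab cd; rewrite /bnd !cintD; first ring.
all: first [apply: (contat_h fc)|apply: (contat_h gc)|apply: (contat_v fc)|apply: (contat_v gc)]; lra.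
Qed.

Lemma has_deriv_affine (A B w : C) : has_deriv (fun w => A + B * w) w B.
Proof.
move=> e e0; exists 1 => // h _.
rewrite (_ : _ - _ - _ = 0); last by ring.
by rewrite rn0 mulr_ge0 ?rn_ge0 // ltW.
Qed.

Lemma bnd_affine (A B : C) a b c d : a <= b -> c <= d -> bnd (fun w => A + B * w) a b c d = 0.
Proof.
move=> ab cd; pose f w : C := A + B * w.
have fc : recton (contat f) a b c d by move=> x y _ _; exact: has_deriv_cont (has_deriv_affine _ _ _).
rewrite -[LHS]/(bnd f a b c d) /bnd -!cintB; first last.
- by apply: (contat_h fc); rewrite cd lexx.
- by apply: (contat_h fc); rewrite cd lexx.
- by apply: (contat_v fc); rewrite ab lexx.
- by apply: (contat_v fc); rewrite ab lexx.
rewrite (@eq_cint _ _ (fun=> B * ('i * (c - d)%:C))); last first.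
 move=> x _; rewrite /f; suff -> : 'i * (c - d)%:C = (x +i* c) - (x +i* d) by ring.
 by apply/eqP; rewrite eq_complex /= subrr !mul0r !mul1r !subr0 !add0r !eqxx.
rewrite (@eq_cint _ _ (fun=> B * (b - a)%:C) c d); last first.
 move=> y _; rewrite /f; suff -> : (b - a)%:C = (b +i* y) - (a +i* y) by ring.
 by apply/eqP; rewrite eq_complex /= subrr !eqxx.
rewrite !cint_cst // !rmorphB /=; ring.
Qed.

Definition subrect (Q : R * R * R * R) (s t : bool) : R * R * R * R := let: (a, b, c, d) := Q in
 let m := (a + b) / 2 in let k := (c + d) / 2 in
 (if s then m else a, if s then b else m, if t then k else c, if t then d else k).
Definition bndQ f (Q : R * R * R * R) := let: (a, b, c, d) := Q in bnd f a b c d.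
Definition nextrect f (Q : R * R * R * R) : R * R * R * R :=
 let v s t := rn (bndQ f Q) <= 4 * rn (bndQ f (subrect Q s t)) in
 if v false false then subrect Q false false else if v false true then subrect Q false true else
 if v true false then subrect Q true false else subrect Q true true.

Lemma mid_bounds (a b : R) : a <= b -> (a <= (a + b) / 2) /\ ((a + b) / 2 <= b).
Proof. by move=> ab; split; lra. Qed.

Lemma four_sum_lt (x u1 u2 u3 u4 : R) : x <= u1 + u2 + (u3 + u4) ->
 4 * u1 < x -> 4 * u2 < x -> 4 * u3 < x -> x <= 4 * u4.
Proof. lra. Qed.

(** The integrals over the quarters add up to that over the rectangle, so if the first three are
    each below a fourth of its norm, the last one is not. *)
Lemma nextrectP f a b c d : recton (contat f) a b c d -> a <= b -> c <= d ->
 (exists s t, nextrect f (a, b, c, d) = subrect (a, b, c, d) s t) /\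
 rn (bndQ f (a, b, c, d)) <= 4 * rn (bndQ f (nextrect f (a, b, c, d))).
Proof.
move=> fc ab cd; rewrite /nextrect.
case: ifPn => h1; first by split => //; exists false, false.
case: ifPn => h2; first by split => //; exists false, true.
case: ifPn => h3; first by split => //; exists true, false.
split; first by exists true, true.
rewrite -!ltNge in h1 h2 h3; rewrite /= in h1 h2 h3 *.
have [am mb] := mid_bounds ab; have [cm md] := mid_bounds cd.
move: ((a + b) / 2) ((c + d) / 2) am mb cm md h1 h2 h3 => m k am mb cm md.
apply: four_sum_lt.
rewrite (bnd_splitv (m := m) fc) ?am // (@bnd_splith _ a m _ _ k) ?cm //; last first.
 by apply: recton_sub fc _ _ _ _.
rewrite (@bnd_splith _ m b _ _ k) ?cm //; last by apply: recton_sub fc _ _ _ _.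
by apply: le_trans (rnD _ _) _; apply: lerD; apply: rnD.
Qed.

Lemma sup_nested (u v : nat -> R) : (forall n, u n <= u n.+1) ->
 (forall n, v n.+1 <= v n) -> (forall n, u n <= v n) -> exists x, forall n, u n <= x <= v n.
Proof.
move=> uh vh uv.
have um n m : (n <= m)%N -> u n <= u m.
 by move=> /subnK <-; elim: (m - n)%N => // k IH; rewrite addSn (le_trans IH).
have vm n m : (n <= m)%N -> v m <= v n.
 by move=> /subnK <-; elim: (m - n)%N => // k IH; rewrite addSn (le_trans _ IH).
have uvm n m : u n <= v m.
 have [nm|mn] := leqP n m; first by rewrite (le_trans (um _ _ nm)).
 by rewrite (le_trans (uv n)) // vm // ltnW.
exists (sup (range u)) => n; apply/andP; split.
 apply: ub_le_sup; last by exists n.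
 by exists (v 0%N) => _ [m _ <-].
by apply: ge_sup; [exists (u 0%N); exists 0%N|move=> _ [m _ <-]].
Qed.

Lemma goursat f a b c d : a <= b -> c <= d ->
 recton (fun w => exists A, has_deriv f w A) a b c d -> bnd f a b c d = 0.
Proof.
move=> ab cd fd; apply/eqP; rewrite -rn_eq0; apply/eqP/le_anti; rewrite rn_ge0 andbT.
have fc : recton (contat f) a b c d. by move=> x y xab yc; have [A] := fd x y xab yc; exact: has_deriv_cont.
rewrite leNgt; apply/negP => eps0; set eps := rn _ in eps0.
pose Q n := iter n (nextrect f) (a, b, c, d).
pose qa n := (Q n).1.1.1; pose qb n := (Q n).1.1.2.
pose qc n := (Q n).1.2; pose qd n := (Q n).2.
have QE n : Q n = (qa n, qb n, qc n, qd n). by rewrite /qa /qb /qc /qd; case: (Q n) => [[[? ?] ?] ?].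
have inv n : [/\ a <= qa n, qa n <= qb n & qb n <= b] /\ [/\ c <= qc n, qc n <= qd n & qd n <= d].
 elim: n => [|n [[a1 a2 a3] [c1 c2 c3]]]; first by rewrite /qa /qb /qc /qd /= !lexx.
 have fcn : recton (contat f) (qa n) (qb n) (qc n) (qd n). by apply: recton_sub fc _ _ _ _.
 have [[s [t E]] _] := nextrectP fcn a2 c2.
 rewrite -QE in E; have {}E : Q n.+1 = subrect (Q n) s t by exact: E.
 rewrite /qa /qb /qc /qd E QE /=.
 have [am mb] := mid_bounds a2; have [cm md] := mid_bounds c2.
 have := (le_trans a1 am, le_trans mb a3, le_trans c1 cm, le_trans md c3).
 by case=> [[[h1 h2] h3] h4]; case: (s); case: (t).
have step n : exists s t, Q n.+1 = subrect (Q n) s t.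
 have [[a1 a2 a3] [c1 c2 c3]] := inv n.
 have fcn : recton (contat f) (qa n) (qb n) (qc n) (qd n). by apply: recton_sub fc _ _ _ _.
 have [[s [t E]] _] := nextrectP fcn a2 c2. by exists s, t; rewrite [X in subrect X]QE -E -QE.
have big n : eps <= 4 ^+ n * rn (bndQ f (Q n)).
 elim: n => [|n IH]; first by rewrite expr0 mul1r.
 have [[a1 a2 a3] [c1 c2 c3]] := inv n.
 have fcn : recton (contat f) (qa n) (qb n) (qc n) (qd n). by apply: recton_sub fc _ _ _ _.
 have [_] := nextrectP fcn a2 c2; rewrite -QE -[nextrect f _]/(Q n.+1) => H.
 by apply: le_trans IH _; rewrite exprSr -mulrA ler_pM2l // exprn_gt0.
have len n : qb n - qa n = (b - a) / 2 ^+ n /\ qd n - qc n = (d - c) / 2 ^+ n.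
 elim: n => [|n [IH1 IH2]]; first by rewrite expr0 !divr1.
 have [s [t E]] := step n; rewrite /qa /qb /qc /qd E QE /=.
 rewrite exprS invfM !mulrA ![_ / 2 / _]mulrAC -IH1 -IH2.
 have half1 (u v : R) : (u + v) / 2 - u = (v - u) / 2 by lra.
 have half2 (u v : R) : v - (u + v) / 2 = (v - u) / 2 by lra.
 by case: s E; case: t => E; rewrite ?half1 ?half2.
have [x xP] : exists x, forall n, qa n <= x <= qb n.
 apply: sup_nested => n; try by have [[]] := inv n.
  have [s [t E]] := step n; have [[_ a2 _] [_ c2 _]] := inv n.
  by rewrite /qa E [X in subrect X]QE /=; case: (s) => //; case: (mid_bounds a2).
 have [s [t E]] := step n; have [[_ a2 _] [_ c2 _]] := inv n.
 by rewrite /qb E [X in subrect X]QE /=; case: (s) => //; case: (mid_bounds a2).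
have [y yP] : exists y, forall n, qc n <= y <= qd n.
 apply: sup_nested => n; try by have [_ []] := inv n.
  have [s [t E]] := step n; have [[_ a2 _] [_ c2 _]] := inv n.
  by rewrite /qc E [X in subrect X]QE /=; case: (t) => //; case: (mid_bounds c2).
 have [s [t E]] := step n; have [[_ a2 _] [_ c2 _]] := inv n.
 by rewrite /qd E [X in subrect X]QE /=; case: (t) => //; case: (mid_bounds c2).
have [A fA] : exists A, has_deriv f (x +i* y) A by apply: fd; [exact: (xP 0%N)|exact: (yP 0%N)].
pose S := (b - a) + (d - c).
have S0 : 0 <= S by rewrite /S; lra.
(* S is half the perimeter. The n-th rectangle has an integral of norm at least eps / 4^n. Its
   affine part integrates to 0, and with derivative error K the rest is at most 4 K (S / 2^n)^2.
   Hence eps <= 4 K S^2, which this K contradicts. *)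
have K0 : 0 < eps / (4 * S * S + 1) by rewrite divr_gt0 // ltr_wpDl // !mulr_ge0.
have [del del0 delH] := fA _ K0; set K := eps / _ in K0 delH.
have [n nH] : exists n, S / 2 ^+ n < del.
 have [m mH] : exists m : nat, S / del < m%:R.
  by exists (Num.Def.archi_bound (S / del)); apply: archi_boundP; rewrite divr_ge0 // ltW.
 exists m; rewrite ltr_pdivrMr ?exprn_gt0 // -ltr_pdivrMl // mulrC (lt_trans mH) //.
 by rewrite -natrX ltr_nat ltn_expl.
have [[a1 a2 a3] [c1 c2 c3]] := inv n; have [l1 l2] := len n.
pose r (w : C) := f w - (f (x +i* y) - A * (x +i* y) + A * w).
have fE : f = fun w => (f (x +i* y) - A * (x +i* y) + A * w) + r w. by apply/funext => w; rewrite /r; ring.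
have fcn : recton (contat f) (qa n) (qb n) (qc n) (qd n) by apply: recton_sub fc _ _ _ _.
have gc a' b' c' d' : recton (contat (fun w => f (x +i* y) - A * (x +i* y) + A * w)) a' b' c' d'.
 by move=> ? ? _ _; apply: has_deriv_cont (has_deriv_affine _ _ _).
have rc : recton (contat r) (qa n) (qb n) (qc n) (qd n).
 move=> u v ua vc e e0; have e2 : 0 < e / 2 by rewrite divr_gt0.
 have [d1 d10 H1] := fcn u v ua vc _ e2; have [d2 d20 H2] := gc _ _ _ _ u v ua vc _ e2.
 exists (Num.min d1 d2) => [|t]; first by rewrite lt_min d10.
 rewrite lt_min => /andP[/H1 h1 /H2 h2].
 rewrite /r; set g1 := (_ + A * t) in h2 *; set g2 := (_ + A * (u +i* v)) in h2 *.
 have -> : f t - g1 - (f (u +i* v) - g2) = (f t - f (u +i* v)) - (g1 - g2) by ring.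
 by apply: le_lt_trans (rnB _ _) _; lra.
have bE : bndQ f (Q n) = bnd r (qa n) (qb n) (qc n) (qd n).
 rewrite QE /= {1}fE bndD // ?bnd_affine ?add0r //.
have rM : recton (fun w => rn (r w) <= K * (S / 2 ^+ n)) (qa n) (qb n) (qc n) (qd n).
 move=> u v ua vc.
 have h : rn ((u +i* v) - (x +i* y)) <= S / 2 ^+ n.
  apply: le_trans (rn_le_ReIm _) _ => /=.
  rewrite /S mulrDl -l1 -l2; have := xP n; have := yP n => H1 H2.
  by apply: lerD; rewrite ler_norml; lra.
 have := delH ((u +i* v) - (x +i* y)) (le_lt_trans h nH).
 rewrite [x +i* y + _]addrC subrK => /le_trans H.
 have -> : r (u +i* v) = f (u +i* v) - f (x +i* y) - A * ((u +i* v) - (x +i* y)). by rewrite /r; ring.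
 by apply: H; rewrite ler_pM2l.
have := big n; rewrite bE => H.
have := bnd_le rc a2 c2 rM; rewrite l1 l2 -mulrDl -/S => H2.
have P0 : 0 < 4 ^+ n :> R by rewrite exprn_gt0.
have {H2} H3 : eps <= 4 * K * (S * S).
 apply: le_trans H _; rewrite -(ler_pM2l P0) in H2; apply: le_trans H2 _.
 have -> : 4 ^+ n = 2 ^+ n * 2 ^+ n :> R by rewrite -exprMn; congr (_ ^+ n); lra.
 rewrite le_eqVlt; apply/orP; left; apply/eqP; field.
 by rewrite expf_neq0.
have : K * (4 * S * S + 1) = eps by rewrite /K divfK // gt_eqF // ltr_wpDl // !mulr_ge0.
nra.
Qed.

Lemma bnd_x0 f a c d : bnd f a a c d = 0.
Proof. by rewrite /bnd !cint0 !subrr mulr0 addr0. Qed.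
Lemma bnd_y0 f a b c : bnd f a b c c = 0.
Proof. by rewrite /bnd !cint0 !subrr mulr0 addr0. Qed.

Lemma goursat_except f a b c d (p : C) : a <= b -> c <= d -> recton (contat f) a b c d ->
 recton (fun w => w != p -> exists A, has_deriv f w A) a b c d -> bnd f a b c d = 0.
Proof.
move=> ab cd fc fd.
have out a' b' c' d' : a' <= b' -> c' <= d' -> a <= a' -> b' <= b -> c <= c' -> d' <= d ->
  ~~ ((a' <= Re p <= b') && (c' <= Im p <= d')) -> bnd f a' b' c' d' = 0.
 move=> ab' cd' h1 h2 h3 h4 np; apply: goursat => // x y xab yc.
 apply: (recton_sub fd h1 h2 h3 h4) => //; apply: contraNneq np => <-.
 by rewrite /= xab yc.
have [pin|] := boolP ((a <= Re p <= b) && (c <= Im p <= d)); last first. by apply: out => //.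
have /andP[px py] := pin.
have fcp : contat f p by case: (p) px py => u v; exact: fc.
have [del del0 delH] := fcp 1 ltr01.
pose M := rn (f p) + 1.
have key : forall del', 0 < del' < del / 2 -> rn (bnd f a b c d) <= 16 * M * del'.
 move=> e /andP[e0 ed].
 (* A square of radius e around p is cut out, clipped to the given rectangle. Each of the four
    surrounding pieces either avoids p or, where clipping occurs, degenerates to a segment. *)
 pose a' := Num.max a (Re p - e); pose b' := Num.min b (Re p + e).
 pose c' := Num.max c (Im p - e); pose d' := Num.min d (Im p + e).
 have [A1 A2 A3] : [/\ a <= a' <= Re p, Re p - e <= a' & a' = a \/ a' < Re p].
  rewrite /a' le_max lexx /= ge_max le_max lexx orbT; split => //; first by lra.
  by case: (leP a (Re p - e)) => h; [right; lra|left].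
 have [B1 B2 B3] : [/\ Re p <= b' <= b, b' <= Re p + e & b' = b \/ Re p < b'].
  rewrite /b' le_min ge_min lexx /= ge_min lexx orbT; split => //; first by lra.
  by case: (leP b (Re p + e)) => h; [left|right; lra].
 have [C1 C2 C3] : [/\ c <= c' <= Im p, Im p - e <= c' & c' = c \/ c' < Im p].
  rewrite /c' le_max lexx /= ge_max le_max lexx orbT; split => //; first by lra.
  by case: (leP c (Im p - e)) => h; [right; lra|left].
 have [D1 D2 D3] : [/\ Im p <= d' <= d, d' <= Im p + e & d' = d \/ Im p < d'].
  rewrite /d' le_min ge_min lexx /= ge_min lexx orbT; split => //; first by lra.
  by case: (leP d (Im p + e)) => h; [left|right; lra].
 clearbody a' b' c' d'.
 have [/andP[a1 a2] /andP[b1 b2] /andP[c1 c2] /andP[d1 d2]] := And4 A1 B1 C1 D1.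
 have [ab' cd'] := (le_trans a2 b1, le_trans c2 d1); have [a'b c'd] := (le_trans ab' b2, le_trans cd' d2).
 have [ab2 cd2] := (le_trans a1 ab', le_trans c1 cd').
 have fc4 := recton_sub fc a1 b2 c1 d2.
 rewrite (bnd_splitv fc cd (m := a')) ?a1 //.
 rewrite (bnd_splitv (recton_sub fc a1 (lexx b) (lexx c) (lexx d)) cd (m := b')) ?ab' //.
 rewrite (bnd_splith (recton_sub fc a1 b2 (lexx c) (lexx d)) ab' (m := c')) ?c1 //.
 rewrite (bnd_splith (recton_sub fc a1 b2 c1 (lexx d)) ab' (m := d')) ?cd' //.
 have -> : bnd f a a' c d = 0.
  by case: A3 => [->|A3]; [exact: bnd_x0|apply: out => //; rewrite (lt_geF A3) andbF].
 have -> : bnd f b' b c d = 0.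
  by case: B3 => [->|B3]; [exact: bnd_x0|apply: out => //; rewrite (lt_geF B3)].
 have -> : bnd f a' b' c c' = 0.
  by case: C3 => [->|C3]; [exact: bnd_y0|apply: out => //; rewrite (lt_geF C3) !andbF].
 have -> : bnd f a' b' d' d = 0.
  by case: D3 => [->|D3]; [exact: bnd_y0|apply: out => //; rewrite (lt_geF D3) andbF].
 rewrite !add0r !addr0.
 have fM : recton (fun w => rn (f w) <= M) a' b' c' d'.
  move=> x y xa yc; have : rn ((x +i* y) - p) < del.
   apply: le_lt_trans (rn_le_ReIm _) _; rewrite cReB cImB /=.
   have : `|x - Re p| <= e by rewrite ler_norml; lra.
   have : `|y - Im p| <= e by rewrite ler_norml; lra.
   lra.
  by move=> /delH; have := rnBl (f (x +i* y)) (f p); rewrite /M; lra.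
 apply: le_trans (bnd_le fc4 ab' cd' fM) _.
 have M0 : 0 <= M by rewrite /M addr_ge0 ?rn_ge0.
 clear -M0 A2 B2 C2 D2; nra.
apply/eqP; rewrite -rn_eq0; apply/eqP/le_anti; rewrite rn_ge0 andbT.
rewrite leNgt; apply/negP => eps0; set eps := rn _ in eps0 key.
have M0 : 0 < M by rewrite /M ltr_wpDl ?rn_ge0.
(* The bound 16 M e is then at most eps / 2. *)
pose e := Num.min (del / 4) (eps / (32 * M)).
have e0 : 0 < e by rewrite lt_min !divr_gt0 // mulr_gt0.
have e1 : e <= del / 4 by rewrite ge_min lexx.
have e2 : e <= eps / (32 * M) by rewrite ge_min lexx orbT.
have := key e; rewrite e0 /= => /(_ ltac:(lra)).
rewrite ler_pdivlMr ?mulr_gt0 // in e2; nra.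
Qed.

End Goursat.

(** * Fourier expansion of periodic holomorphic functions on a half-plane *)

Section Periodic.
Variable R : realType.
Notation C := R[i].
Notation cdf g w := (dff (g : C^o -> C^o) (w : C^o)).

Lemma ccont_bounded (f : R -> C) a b : a <= b -> ccont f a b ->
 exists2 M : R, 0 <= M & forall x, a <= x <= b -> rn (f x) <= M.
Proof.
move=> ab fc.
have cf : {within `[a, b], continuous (fun x => rn (f x))}.
 apply: continuous_in_subspaceT => x; rewrite inE /= in_itv /= => xab.
 apply/cvgrPdist_lt => e e0; have [d d0 dH] := fc x xab e e0.
 apply/nbhs_ballP; exists d => //= t; rewrite /ball /= distrC => /dH H.
 apply: le_lt_trans H; rewrite ler_norml; apply/andP; split.
  by have := rnBl (f t) (f x); lra.
 by have := rnBl (f x) (f t); rewrite rnC.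
have [c _ cH] := EVT_max ab cf.
by exists (rn (f c)) => [|x xab]; [exact: rn_ge0|apply: cH; rewrite in_itv].
Qed.

Lemma has_derivD (f g : C -> C) w A B : has_deriv f w A -> has_deriv g w B ->
 has_deriv (fun z => f z + g z) w (A + B).
Proof.
move=> fA gB e e0; have e2 : 0 < e / 2 by rewrite divr_gt0.
have [d d0 dH] := fA _ e2; have [d' d'0 dH'] := gB _ e2.
exists (Num.min d d') => [|h]; first by rewrite lt_min d0.
rewrite lt_min => /andP[/dH h1 /dH' h2].
have -> : f (w + h) + g (w + h) - (f w + g w) - (A + B) * h =
 (f (w + h) - f w - A * h) + (g (w + h) - g w - B * h) by ring.
by apply: le_trans (rnD _ _) _; lra.
Qed.

Lemma has_deriv_cst (c w : C) : has_deriv (fun=> c) w 0.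
Proof.
by move=> e e0; exists 1 => // h _; rewrite subrr mul0r subrr rn0 mulr_ge0 ?rn_ge0 // ltW.
Qed.

Lemma twopii_neq0 : twopii R != 0.
Proof. by rewrite eq_complex /= negb_and mulf_neq0 ?orbT // gt_eqF // pi_gt0. Qed.

Lemma ee_deriv (z : C) : has_deriv (@ee R) z (twopii R * ee z).
Proof.
move=> e e0; pose K := rn (twopii R); have K0 : 0 < K by rewrite rn_gt0 twopii_neq0.
have [d d0 dH] := cexp_deriv (twopii R * z) (divr_gt0 e0 K0).
exists (d / K) => [|h hd]; first by rewrite divr_gt0.
have := dH (twopii R * h); rewrite rnM -/K mulrC -ltr_pdivlMr // => /(_ hd).
have -> : e / K * (rn h * K) = e * rn h by field; rewrite gt_eqF.
rewrite -mulrDr; have -> : cexp (twopii R * z) * (twopii R * h) = twopii R * ee z * h by rewrite /ee; ring.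
by [].
Qed.

Lemma ee_eq1 (z : C) : ee z = 1 -> Im z = 0 /\ exists n : int, z = n%:~R.
Proof.
move=> z1; have iz : Im z = 0.
 have := congr1 (@rn R _) z1; rewrite rn_ee rn1 => H.
 have /expR_inj/eqP := etrans H (esym (expR0 R)); rewrite oppr_eq0 mulf_eq0 mulf_eq0 pnatr_eq0 /= gt_eqF ?pi_gt0 //=.
 by move=> /eqP.
split => //; pose n := Num.floor (Re z); exists n.
pose x := Re z - n%:~R.
have zE : z = x%:C + n%:~R.
 rewrite -(rmorph_int (real_complex R)) -rmorphD /= /x subrK.
 by apply/eqP; rewrite eq_complex /= iz !eqxx.
have x01 : 0 <= x < 1.
 have /andP[h1 h2] : n%:~R <= Re z < (n + 1)%:~R by rewrite floor_le_tmp /= floorD1_gt.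
 by rewrite intrD in h2; rewrite /x; lra.
have := z1; rewrite zE eeD ee_int mulr1 => /(congr1 (@Re R)).
have -> : Re (ee x%:C) = cos (2 * pi * x).
 rewrite /ee /cexp (_ : twopii R * x%:C = 0 +i* (2 * pi * x)) /=; last first.
  apply/eqP; rewrite eq_complex; apply/andP; split; apply/eqP.
   by rewrite cReM /= mul0r mulr0 subr0.
  by rewrite cImM /= mul0r add0r.
 by rewrite expR0 mul1r mul0r subr0.
rewrite -mulrA mulr_natl cos_mulr2n /= => c1.
have s0 : sin (pi * x) = 0.
 apply/eqP; rewrite -sqrf_eq0; have := cos2Dsin2 (pi * x) => H.
 by apply/eqP; move: c1 H; rewrite -mulr_natl; lra.
have [x0|x0] := eqVneq x 0; first by rewrite x0 add0r.
have : 0 < sin (pi * x).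
 case/andP: x01 => x1 x2; apply: sin_gt0_pi; apply/andP; split.
  by rewrite mulr_gt0 ?pi_gt0 // lt_def x0.
 by rewrite gtr_pMr ?pi_gt0.
by rewrite s0 ltxx.
Qed.

Lemma ee_nat (n : nat) : ee (n%:R : C) = 1.
Proof. exact: (ee_int R n). Qed.

Lemma ee_Nnat (n : nat) : ee (- n%:R : C) = 1.
Proof. by rewrite eeN ee_nat invr1. Qed.

(* The value at a common zero is the limit of the quotient. *)
Definition ratio (u v : C -> C) (L : C) (w : C) : C := if v w == 0 then L else u w / v w.

(** De l'Hospital's rule: near p the numerator is a h and the denominator b h, up to small multiples
    of h. *)
Lemma ratio_contat (u v : C -> C) p a b : has_deriv u p a -> has_deriv v p b ->
 b != 0 -> u p = 0 -> v p = 0 -> contat (ratio u v (a / b)) p.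
Proof.
move=> ua vb b0 u0 v0 e e0.
have nb : 0 < rn b by rewrite rn_gt0.
have na := rn_ge0 a.
pose K := 2 * (rn a + rn b) / (rn b * rn b) + 1.
have K0 : 0 < K by rewrite ltr_wpDl // divr_ge0 ?mulr_ge0 ?addr_ge0 // ltW.
pose e1 := Num.min (rn b / 2) (e / (2 * K)).
have e10 : 0 < e1 by rewrite lt_min !divr_gt0 // mulr_gt0.
have [d1 d10 H1] := ua _ e10; have [d2 d20 H2] := vb _ e10.
exists (Num.min d1 d2) => [|w]; first by rewrite lt_min d10.
rewrite lt_min => /andP[/H1 + /H2]; rewrite [p + _]addrC subrK u0 v0 !subr0 => h1 h2.
rewrite {2}/ratio v0 eqxx /ratio; set h := w - p in h1 h2 *.
have e1b : e1 <= rn b / 2 by rewrite ge_min lexx.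
have e1e : e1 * (2 * K) <= e by rewrite -ler_pdivlMr ?mulr_gt0 // ge_min lexx orbT.
clearbody e1; case: ifP => [_|/negbT vw0]; first by rewrite subrr rn0.
have hv : rn b / 2 * rn h <= rn (v w).
 have := rnBl (b * h) (b * h - v w); rewrite subKr rnM (rnC (b * h)) => H3. by have := rn_ge0 h; nra.
have h0 : 0 < rn h.
 rewrite rn_gt0; apply: contra_neq vw0 => hE.
 by apply/eqP; rewrite -rn_eq0; apply/eqP/le_anti; rewrite rn_ge0 andbT; move: h2; rewrite hE rn0 !mulr0 subr0.
have vw : 0 < rn (v w) by rewrite rn_gt0.
have -> : u w / v w - a / b = ((u w - a * h) * b - a * (v w - b * h)) / (v w * b). by field; rewrite vw0 b0.
rewrite rnM rnV ltr_pdivrMr ?rn_gt0 ?mulf_neq0 //.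
apply: le_lt_trans (rnB _ _) _; rewrite !rnM.
have : e1 * (2 * (rn a + rn b)) < e * (rn b * rn b).
 have : K * (rn b * rn b) = 2 * (rn a + rn b) + rn b * rn b.
  by rewrite /K mulrDl mul1r divfK // mulf_neq0 // gt_eqF.
 have : (0 : R) < rn b * rn b by rewrite mulr_gt0. by nra.
move: (rn (u w - _)) (rn (v w - _)) (rn (v w)) h1 h2 hv vw => x1 x2 x3 h1 h2 hv vw H.
have A1 : x1 * rn b <= e1 * rn h * rn b by rewrite ler_pM2r.
have A2 : rn a * x2 <= rn a * (e1 * rn h) by rewrite ler_wpM2l.
have A3 : e * (rn b / 2 * rn h * rn b) <= e * (x3 * rn b). by rewrite ler_pM2l // ler_pM2r.
have A4 : rn h * (e1 * (2 * (rn a + rn b))) < rn h * (e * (rn b * rn b)) by rewrite ltr_pM2l.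
lra.
Qed.

Lemma contat_h1 (h : C -> C) (y : R) : (forall x : R, 0 <= x <= 1 -> contat h (x +i* y)) ->
 ccont (fun x => h (x +i* y)) 0 1.
Proof.
move=> hc; apply: (@contat_h _ h 0 1 y y); last by rewrite lexx.
by move=> x y' xx /andP[y1 y2]; have -> : y' = y; [apply/le_anti; rewrite y1 y2|exact: hc].
Qed.

(** The vertical sides cancel by periodicity. The strip is halved because [goursat_except] allows a
    single exceptional point, whereas p and p + 1 both lie on the boundary of the strip when Re p =
    0. *)
Lemma horiz_const (h : C -> C) (p : C) (y1 y2 : R) : y1 <= y2 -> 0 <= Re p < 1 ->
 recton (contat h) 0 1 y1 y2 ->
 recton (fun w => w != p -> w != p + 1 -> exists A, has_deriv h w A) 0 1 y1 y2 ->
 (forall y, y1 <= y <= y2 -> h (1 +i* y) = h (0 +i* y)) ->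
 cint (fun x => h (x +i* y1)) 0 1 = cint (fun x => h (x +i* y2)) 0 1.
Proof.
move=> y12 p01 hc hd hp.
have b0 : bnd h 0 1 y1 y2 = 0.
 rewrite (bnd_splitv (m := 1/2) hc) //; last by lra.
 have c1 : recton (contat h) 0 (1/2) y1 y2 by apply: recton_sub hc _ _ _ _; lra.
 have c2 : recton (contat h) (1/2) 1 y1 y2 by apply: recton_sub hc _ _ _ _; lra.
 have -> : bnd h 0 (1 / 2) y1 y2 = 0.
  apply: (goursat_except (p := p)) => //.
  move=> x y xx yy np; apply: hd => //; first by lra.
  apply/eqP => E; have : Re (x +i* y) = Re (p + 1) by rewrite E.
  by rewrite cReD /=; lra.
 rewrite add0r; apply: (goursat_except (p := if Re p == 0 then p + 1 else p)) => //; first by lra.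
 move=> x y xx yy; case: ifP => [/eqP p0 np|/negbT p0 np].
  apply: hd => //; first by lra.
  apply/eqP => E; have : Re (x +i* y) = Re p by rewrite E.
  by rewrite p0 /=; lra.
 apply: hd => //; first by lra.
 apply/eqP => E; have : Re (x +i* y) = Re (p + 1) by rewrite E.
 rewrite cReD /= => H; move/eqP: p0; apply; lra.
move: b0; rewrite /bnd (@eq_cint _ (fun y => h (1 +i* y)) (fun y => h (0 +i* y))) //.
by rewrite subrr mulr0 addr0 => /eqP; rewrite subr_eq0 => /eqP.
Qed.

Definition psum (a : nat -> C) (q l : C) := forall e : R, 0 < e ->
 exists N, forall n, (N <= n)%N -> rn (\sum_(r < n) a r * q ^+ r - l) < e.

Lemma geom_tail (q : R) (K e : R) : 0 <= q < 1 -> 0 < e -> exists N, forall n, (N <= n)%N -> K * q ^+ n < e.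
Proof.
move=> /andP[q0 q1] e0.
have : (fun n => K * q ^+ n) @ \oo --> (K * 0). by apply: cvgMr; apply: cvg_expr; rewrite ger0_norm.
move=> /cvgrPdist_lt/(_ e e0)[N _ NH]; exists N => n nN.
have := NH n nN; rewrite /= mulr0 sub0r normrN.
exact: le_lt_trans (ler_norm _).
Qed.

Variables (g : C -> C) (Y0 : R).
Hypothesis gd : forall w, Y0 < Im w -> exists A, has_deriv g w A.
Hypothesis gper : forall w, Y0 < Im w -> g (w + 1) = g w.

Definition fcoef (r : nat) (y : R) : C := cint (fun x => g (x +i* y) * ee (- (r%:R * (x +i* y)))) 0 1.

Lemma contatM (f h : C -> C) w : contat f w -> contat h w -> contat (fun z => f z * h z) w.
Proof.
move=> fc hc e e0; pose K := rn (f w) + rn (h w) + 1.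
have fx := rn_ge0 (f w); have gx := rn_ge0 (h w).
have K0 : 0 < K by rewrite /K; lra.
have e2 : 0 < Num.min 1 (e / (2 * K)) by rewrite lt_min ltr01 divr_gt0 // mulr_gt0.
have [d d0 dH] := fc _ e2; have [d' d'0 dH'] := hc _ e2.
exists (Num.min d d') => [|t]; first by rewrite lt_min d0.
rewrite lt_min => /andP[/dH + /dH']; rewrite !lt_min => /andP[h1 h2] /andP[h1' h2'].
have -> : f t * h t - f w * h w = (f t - f w) * (h t - h w) + (f t - f w) * h w + f w * (h t - h w) by ring.
rewrite ltr_pdivlMr ?mulr_gt0 // in h2; rewrite ltr_pdivlMr ?mulr_gt0 // in h2'.
apply: le_lt_trans (rnD _ _) _; rewrite rnM.
apply: le_lt_trans (lerD (rnD _ _) (lexx _)) _; rewrite !rnM.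
have := rn_ge0 (f t - f w); have := rn_ge0 (h t - h w).
move: (rn (f t - f w)) (rn (h t - h w)) h1 h1' h2 h2' => u v u1 v1 u2 v2 v0 u0.
rewrite /K in u2 v2; nra.
Qed.

Lemma contat_df (f : C^o -> C^o) (w : C^o) : dff f w -> contat f w.
Proof. by move=> /differentiable_deriv[A]; exact: has_deriv_cont. Qed.

Lemma gdf (w : C) : Y0 < Im w -> cdf g w.
Proof. by move=> /gd H; apply/differentiable_deriv. Qed.

Lemma fcoef_const r y1 y2 : Y0 < y1 <= y2 -> fcoef r y1 = fcoef r y2.
Proof.
move=> /andP[Yy y12].
pose h w := g w * ee (- (r%:R * w)).
have hd w : Y0 < Im w -> cdf h w.
 move=> Yw; apply: dfM; first exact: gdf.
 by dfs.
apply: (@horiz_const h 0) => //=; first by rewrite lexx ltr01.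
- move=> x y _ /andP[yy _]; apply: contat_df; apply: hd => /=; lra.
- move=> x y _ /andP[yy _] _ _; apply/differentiable_deriv/hd => /=; lra.
- move=> y /andP[yy _]; rewrite /h.
 have -> : 1 +i* y = (0 +i* y) + 1 by apply/eqP; rewrite eq_complex /= add0r addr0 !eqxx.
 rewrite gper /=; last by lra.
 by rewrite mulrDr mulr1 opprD eeD ee_Nnat mulr1.
Qed.

Lemma fcoef_le r y M : Y0 < y -> (forall x, 0 <= x <= 1 -> rn (g (x +i* y)) <= M) ->
 rn (fcoef r y) * expR (- (2 * pi * y)) ^+ r <= 2 * M.
Proof.
move=> Yy gM; rewrite /fcoef.
rewrite -(@mulVKf _ (expR (- (2 * pi * y)) ^+ r) _ (2 * M)); last by rewrite expf_neq0 // gt_eqF // expR_gt0.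
rewrite mulrC ler_pM2l ?exprn_gt0 ?expR_gt0 //.
have hc : ccont (fun x => g (x +i* y) * ee (- (r%:R * (x +i* y)))) 0 1.
 apply: (contat_h1 (h := fun w => g w * ee (- (r%:R * w)))) => x xx.
 apply: contat_df; apply: dfM; first exact: gdf.
 by dfs.
apply: le_trans (cint_le ler01 hc (M := M / expR (- (2 * pi * y)) ^+ r) _) _; last first.
 by rewrite subr0 mulr1 mulrA [leRHS]mulrC.
move=> x xx; rewrite rnM eeN rnV; apply: ler_pM; rewrite ?invr_ge0 ?rn_ge0 ?gM //.
by rewrite eeMn rnX rn_ee.
Qed.

Lemma int_ee_shift (tau : C) (r : nat) (y : R) : cint (fun x => ee (tau - (x +i* y)) ^+ r) 0 1 = (r == 0)%:R.
Proof.
case: r => [|r] /=.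
 by under eq_fun do rewrite expr0; rewrite cint_cst // subr0 mul1r.
have hc : ccont (fun x => ee (- (r.+1%:R * (x +i* y)))) 0 1.
 apply: (contat_h1 (h := fun w : C => ee (- (r.+1%:R * w)))) => x _; apply: contat_df.
 by dfs.
rewrite (@eq_cint _ _ (fun x => ee (r.+1%:R * tau) * ee (- (r.+1%:R * (x +i* y))))); last first.
 by move=> x _; rewrite -eeMn mulrBr eeD.
rewrite cintM //; apply/eqP; rewrite mulf_eq0 (negbTE (ee_neq0 _)) /=; apply/eqP.
have key (y1 : R) : cint (fun x => ee (- (r.+1%:R * (x +i* y1)))) 0 1 =
  ee (- (r.+1%:R * (0 +i* y1))) * cint (fun x => ee (- (r.+1%:R * (x +i* 0)))) 0 1.
 rewrite -cintM.
  apply: eq_cint => x _; rewrite -eeD -opprD -mulrDr; congr (ee (- (_ * _))).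
  by apply/eqP; rewrite eq_complex /= add0r addr0 !eqxx.
 apply: (contat_h1 (h := fun w : C => ee (- (r.+1%:R * w)))) => x _; apply: contat_df.
 by dfs.
suff z : cint (fun x : R => ee (- (r.+1%:R * (x +i* 0)))) 0 1 = 0 by rewrite key z mulr0.
have hd (w : C^o) : dff (fun w : C^o => ee (- (r.+1%:R * w)) : C^o) w.
 by dfs.
have H : cint (fun x : R => ee (- (r.+1%:R * (x +i* 0)))) 0 1 =
     cint (fun x : R => ee (- (r.+1%:R * (x +i* 1)))) 0 1.
 apply: (@horiz_const (fun w : C => ee (- (r.+1%:R * w))) 0) => //=; first by rewrite lexx ltr01.
 - by move=> x y' _ _; apply: contat_df; exact: hd.
 - by move=> x y' _ _ _ _; apply/differentiable_deriv; exact: hd.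
 - move=> y' _.
  have -> : 1 +i* y' = (0 +i* y') + 1 by apply/eqP; rewrite eq_complex /= add0r addr0 !eqxx.
  by rewrite mulrDr mulr1 opprD eeD ee_Nnat mulr1.
have : (1 - ee (- (r.+1%:R * (0 +i* 1)))) * cint (fun x : R => ee (- (r.+1%:R * (x +i* 0)))) 0 1 = 0.
 by rewrite mulrBl mul1r -key -H subrr.
move=> /eqP; rewrite mulf_eq0 => /orP[|/eqP//]; rewrite subr_eq0 => /eqP/esym/ee_eq1[].
rewrite cImN cImM /= !(mul0r, mulr0, add0r, addr0) mulr1 -(rmorph_nat (real_complex R)) /= => /eqP.
by rewrite oppr_eq0 pnatr_eq0.
Qed.

Hypothesis gbdd : exists Y B : R, forall w, Y <= Im w -> rn (g w) <= B.

Lemma pi_growth (p t T y2 : R) : 2 <= p -> 0 <= T -> t + T <= y2 -> T <= 2 * p * (y2 - t).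
Proof. by move=> *; nra. Qed.

Lemma vanish_limit (I : C) (K : R) : 0 <= K -> (forall T, 1 <= T -> rn I <= K / T) -> I = 0.
Proof.
move=> K0 H; apply/eqP; rewrite -rn_eq0; apply/eqP/le_anti; rewrite rn_ge0 andbT.
rewrite leNgt; apply/negP => e0.
have T1 : 1 <= K / rn I + 1 by rewrite lerDr divr_ge0 // ltW.
have := H _ T1; rewrite ler_pdivlMr ?(lt_le_trans ltr01) // mulrDr mulr1 mulrC divfK ?gt_eqF //.
lra.
Qed.

Lemma geom_first (g0 M rho : R) : 0 <= g0 -> 0 <= M -> 0 < rho < 1 -> g0 <= 2 * ((M + g0) / (1 - rho)).
Proof.
move=> h1 h2 /andP[h3 h4].
have : g0 <= (M + g0) / (1 - rho) by rewrite ler_pdivlMr ?subr_gt0 //; nra.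
lra.
Qed.

(** With the kernel G(w) = (g(w) - g(tau)) / (1 - e(tau - w)), continuous at its poles by
    [ratio_contat], the horizontal integral of G vanishes: it does not depend on the height and
    tends to 0 at i infinity. On the line of height y1, below tau, the finite geometric sum for 1 /
    (1 - q) turns this into the n-th partial sum and an error of order rho^n. *)
Lemma fourier_aux tau y1 : Y0 < y1 < Im tau -> 0 <= Re tau < 1 -> exists2 K : R, 0 <= K & forall n,
  rn (\sum_(r < n) fcoef r y1 * ee tau ^+ r - g tau) <= K * expR (- (2 * pi * (Im tau - y1))) ^+ n.
Proof.
move=> /andP[Yy yt] t01.
have Yt : Y0 < Im tau by lra.
have [A gA] := gd Yt.
pose u w := g w - g tau; pose v w := 1 - ee (tau - w).
have uA : has_deriv u tau A. by rewrite -[A]addr0; apply: has_derivD gA (has_deriv_cst _ _).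
have vb : has_deriv v tau (twopii R).
 move=> e e0; have [d d0 dH] := ee_deriv 0 e0; exists d => // h hd.
 have := dH (- h); rewrite rnN => /(_ hd); rewrite add0r ee0 mulr1 /v.
 rewrite subrr ee0 subrr subr0 opprD addNKr => H.
 have -> : 1 - ee (- h) - twopii R * h = - (ee (- h) - 1 - twopii R * - h) by ring. by rewrite rnN.
pose G := ratio u v (A / twopii R).
have vd (w : C^o) : cdf v w.
 apply: dfB; first exact: dfcst.
 by dfs.
have Gper w : Y0 < Im w -> G (w + 1) = G w.
 move=> Yw; rewrite /G /ratio /u /v gper // opprD addrA eeD.
 by rewrite eeN ee1 invr1 mulr1.
have v0 w : v w = 0 -> 0 <= Re w <= 1 -> w = tau \/ w = tau + 1.
 rewrite /v => /eqP; rewrite subr_eq0 => /eqP/esym/ee_eq1[_ [n nE]] w01.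
 have : Re (tau - w) = n%:~R. by rewrite nE -(rmorph_int (real_complex R)).
 rewrite cReB => H.
 have n1 : (-2%:Z < n)%R by rewrite -(ltr_int R); lra.
 have n2 : (n < 1)%R by rewrite -(ltr_int R); lra.
 have [n0|n0] : n = 0 \/ n = -1 by lia. by left; apply/esym/eqP; rewrite -subr_eq0 nE n0.
 by right; apply/eqP; rewrite eq_sym -subr_eq0 addrAC nE n0 addNr.
have Gd w : Y0 < Im w -> v w != 0 -> cdf G w.
 move=> Yw vw.
 have vc := contat_df (vd w).
 have nv : 0 < rn (v w) by rewrite rn_gt0.
 have [d d0 dH] := vc _ nv.
 apply: (@differentiable_local _ _ _ (fun z : C^o => u z * (v z)^-1 : C^o) _ _ _ d0).
  move=> z /dH; rewrite /G /ratio; case: ifP => // /eqP ->.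
  by rewrite sub0r rnN ltxx.
 by apply: dfM; [apply: dfB; [exact: gdf|exact: dfcst]|apply: dfV].
have Gt : contat G tau.
 by apply: ratio_contat => //; [exact: twopii_neq0|rewrite /u subrr|rewrite /v subrr ee0 subrr].
have Gt1 : contat G (tau + 1).
 move=> e e0; have [d d0 dH] := Gt e e0.
 exists (Num.min d (Im tau - Y0)) => [|z]; first by rewrite lt_min d0; lra.
 rewrite lt_min => /andP[h1 h2].
 have Yz : Y0 < Im (z - 1).
  have := Im_le_rn (z - (tau + 1)); rewrite ler_norml !cImB cImD /=; lra.
 rewrite -[z](subrK 1) (Gper _ Yz) Gper //; apply: dH.
 by rewrite -addrA -opprD [1 + tau]addrC.
have Gc x y : 0 <= x <= 1 -> Y0 < y -> contat G (x +i* y).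
 move=> xx yy; have [/eqP/v0|vw] := boolP (v (x +i* y) == 0); last by apply: contat_df; apply: Gd.
 by move=> /(_ xx)[->|->].
have Gint y2 : y1 <= y2 -> cint (fun x => G (x +i* y1)) 0 1 = cint (fun x => G (x +i* y2)) 0 1.
 move=> y12; apply: (@horiz_const G tau) => //.
 - by move=> x y xx /andP[yy _]; apply: Gc => //; exact: lt_le_trans Yy yy.
 - move=> x y xx /andP[yy _] w1 w2; apply/differentiable_deriv; apply: Gd => /=; first exact: lt_le_trans Yy yy.
  by apply/eqP => /v0/(_ xx)[E|E]; [rewrite E eqxx in w1|rewrite E eqxx in w2].
 - move=> y /andP[yy _].
  have -> : 1 +i* y = (0 +i* y) + 1 by apply/eqP; rewrite eq_complex /= add0r addr0 !eqxx.
  by apply: Gper => /=; exact: lt_le_trans Yy yy.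
have G0 : cint (fun x => G (x +i* y1)) 0 1 = 0.
 have [Y [B BH]] := gbdd.
 have B0 : 0 <= B + rn (g tau).
  rewrite addr_ge0 ?rn_ge0 // (le_trans (rn_ge0 (g (0 +i* Y)))) //.
  by apply: BH => /=.
 apply: (@vanish_limit _ (2 * (B + rn (g tau)))); first by rewrite mulr_ge0.
 move=> T T1; have T0 : 0 < T by exact: lt_le_trans ltr01 T1.
 (* At height at least Im tau + T the norm of e(tau - w) exceeds 1 + T, so the denominator of G is
    at least T while its numerator stays bounded. *)
 have [y2 [h1 h2 h3]] : exists y2, [/\ y1 <= y2, Y <= y2 & Im tau + T <= y2].
  exists (Num.max (Num.max y1 Y) (Im tau + T)).
  by rewrite !le_max !lexx !orbT.
 rewrite (Gint y2 h1).
 have Gc2 : ccont (fun x => G (x +i* y2)) 0 1.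
  by apply: contat_h1 => x xx; apply: Gc xx _; exact: lt_le_trans Yy h1.
 have GM x : 0 <= x <= 1 -> rn (G (x +i* y2)) <= (B + rn (g tau)) / T.
  move=> xx; rewrite /G /ratio.
  have vT : T <= rn (v (x +i* y2)).
   have := rnBl (ee (tau - (x +i* y2))) 1; rewrite rn1 rnC -/(v _); apply: le_trans.
   rewrite lerBrDl rn_ee cImB /= -mulrN opprB.
   by apply: le_trans (expR_ge1Dx _); rewrite lerD2l; apply: pi_growth (pi_ge2 R) (ltW T0) h3.
  case: ifP => [/eqP vE|_].
   by move: (le_trans T1 vT); rewrite vE rn0 ler10.
  rewrite rnM rnV; apply: ler_pM; [exact: rn_ge0|by rewrite invr_ge0 rn_ge0| |].
   by apply: le_trans (rnB _ _) _; rewrite lerD2r; apply: BH.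
  by rewrite lef_pV2 ?posrE // (lt_le_trans T0).
 have := cint_le ler01 Gc2 GM. by rewrite subr0 mulr1 mulrA.
have gh : ccont (fun x => g (x +i* y1)) 0 1. by apply: contat_h1 => x xx; apply: contat_df; exact: gdf.
have [M M0 gM] := ccont_bounded ler01 gh.
set rho := expR _.
have rho1 : rho < 1. by rewrite /rho expR_lt1 oppr_lt0 mulr_gt0 ?mulr_gt0 ?pi_gt0 // subr_gt0.
have rho0 : 0 < rho by exact: expR_gt0.
have qn x : rn (ee (tau - (x +i* y1))) = rho by rewrite rn_ee cImB.
have r1 : 0 <= 1 - rho by rewrite subr_ge0 ltW.
exists (2 * ((M + rn (g tau)) / (1 - rho))) => [|n].
 by rewrite mulr_ge0 // divr_ge0 // addr_ge0 // rn_ge0.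
have v1 x : v (x +i* y1) != 0.
 rewrite /v subr_eq0; apply/eqP => /(congr1 (@rn R _)); rewrite rn1 qn => E.
 by rewrite -E ltxx in rho1.
pose E1 (r : nat) x := g (x +i* y1) * ee (tau - (x +i* y1)) ^+ r.
pose E2 (r : nat) x := (- g tau) * ee (tau - (x +i* y1)) ^+ r.
pose Rm x := (- (ee (tau - (x +i* y1)) ^+ n)) * G (x +i* y1).
have dee r (w : C^o) : dff (fun z : C^o => ee (tau - z) ^+ r : C^o) w.
 by dfs.
have ceet r : ccont (fun x => ee (tau - (x +i* y1)) ^+ r) 0 1.
 by apply: (contat_h1 (h := fun w : C => ee (tau - w) ^+ r)) => x _; apply: contat_df.
have cE1 r : ccont (E1 r) 0 1 by apply: ccontM.
have cE2 r : ccont (E2 r) 0 1 by apply: ccontM => //; exact: ccont_cst.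
have cG : ccont (fun x => G (x +i* y1)) 0 1 by apply: contat_h1 => x xx; exact: Gc.
have cRm : ccont Rm 0 1 by apply: ccontM => //; exact: ccontN.
have GE x : 0 <= x <= 1 -> G (x +i* y1) + Rm x = \sum_(r < n) (E1 r x + E2 r x).
 move=> xx; rewrite /Rm {2}/G /ratio (negbTE (v1 x)).
 rewrite /G /ratio (negbTE (v1 x)); set q := ee _; set w := x +i* y1.
 have -> : \sum_(r < n) (E1 r x + E2 r x) = (g w - g tau) * \sum_(r < n) q ^+ r.
  by rewrite mulr_sumr; apply: eq_bigr => i _; rewrite /E1 /E2 -mulrDl.
 have : (q - 1) * \sum_(r < n) q ^+ r = q ^+ n - 1 by rewrite subrX1.
 have vw : v w = 1 - q by [].
 have vw0 : 1 - q != 0 := v1 x.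
 move=> H; have -> : \sum_(r < n) q ^+ r = (1 - q ^+ n) / (1 - q).
  by apply: (mulIf vw0); rewrite divfK // mulrC -opprB mulNr H opprB.
 by rewrite vw -[u w]/(g w - g tau); ring.
have [cS1 S1] := cint_sum (index_enum 'I_n) (fun i : 'I_n => cE1 i).
have [cS2 S2] := cint_sum (index_enum 'I_n) (fun i : 'I_n => cE2 i).
have I1 r : cint (E1 r) 0 1 = fcoef r y1 * ee tau ^+ r.
 rewrite /fcoef mulrC -cintM.
  by apply: eq_cint => x _; rewrite /E1 eeB expr_div_n mulrCA eeN eeMn.
 apply: (contat_h1 (h := fun w => g w * ee (- (r%:R * w)))) => x xx.
 apply: contat_df; apply: dfM; first exact: gdf.
 by dfs.
have I2 r : cint (E2 r) 0 1 = - g tau * (r == 0)%:R by rewrite /E2 cintM // int_ee_shift.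
have tot : cint Rm 0 1 = \sum_(r < n) fcoef r y1 * ee tau ^+ r + \sum_(r < n) - g tau * (r == 0 :> nat)%:R.
 transitivity (cint (fun x => G (x +i* y1)) 0 1 + cint Rm 0 1); first by rewrite G0 add0r.
 rewrite -cintD // (eq_cint GE).
 have -> : (fun x => \sum_(r < n) (E1 r x + E2 r x)) = fun x => \sum_(r < n) E1 r x + \sum_(r < n) E2 r x.
  by apply/funext => x; rewrite big_split.
 rewrite cintD // S1 S2; congr (_ + _); apply: eq_bigr => i _; [exact: I1|exact: I2].
have RmB x : 0 <= x <= 1 -> rn (Rm x) <= (M + rn (g tau)) / (1 - rho) * rho ^+ n.
 move=> xx; rewrite /Rm rnM rnN rnX qn mulrC ler_pM2r ?exprn_gt0 //.
 rewrite /G /ratio (negbTE (v1 x)) rnM rnV; apply: ler_pM; rewrite ?invr_ge0 ?rn_ge0 //.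
  by apply: le_trans (rnB _ _) _; rewrite lerD2r gM.
 rewrite lef_pV2 ?posrE ?subr_gt0 ?rn_gt0 //.
 by have := rnBl 1 (ee (tau - (x +i* y1))); rewrite rn1 qn.
have := cint_le ler01 cRm RmB; rewrite subr0 mulr1 tot mulrA.
(* For n = 0 the empty sum does not produce the term - g(tau), and the estimate has to be checked
   directly. *)
case: n {E1 E2 Rm cE1 cE2 cRm GE cS1 S1 cS2 S2 I1 I2 tot RmB} => [|n].
 rewrite !big_ord0 addr0 sub0r rnN => _; rewrite expr0 mulr1.
 by apply: geom_first; rewrite ?rn_ge0 // rho0.
have -> // : \sum_(r < n.+1) - g tau * (r == 0 :> nat)%:R = - g tau.
by rewrite big_ord_recl big1 ?addr0 ?mulr1 // => i _; rewrite mulr0.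
Qed.

Theorem fourier_expand : exists a : nat -> C,
 (forall y M r, Y0 < y -> (forall x, 0 <= x <= 1 -> rn (g (x +i* y)) <= M) ->
   rn (a r) * expR (- (2 * pi * y)) ^+ r <= 2 * M) /\ (forall tau, Y0 < Im tau -> psum a (ee tau) (g tau)).
Proof.
(* The height is arbitrary: by [fcoef_const] the coefficients do not depend on it. *)
exists (fun r => fcoef r (Y0 + 1)).
have cst r y : Y0 < y -> fcoef r (Y0 + 1) = fcoef r y.
 move=> Yy; have [h|h] := leP (Y0 + 1) y; first by apply: fcoef_const; lra.
 by apply/esym/fcoef_const; rewrite Yy ltW.
split=> [y M r Yy gM|tau Yt e e0]; first by rewrite (cst r y) //; exact: fcoef_le.
pose n := Num.floor (Re tau).
pose tau' := tau - n%:~R.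
have tE : tau = tau' + n%:~R by rewrite subrK.
have iE : Im tau' = Im tau. by rewrite cImB -(rmorph_int (real_complex R)) /= subr0.
have gE : g tau' = g tau.
 have per (m : nat) w : Y0 < Im w -> g (w + m%:R) = g w.
  elim: m => [|m IH] Yw; first by rewrite addr0.
  by rewrite -natr1 addrA gper ?IH // cImD -(rmorph_nat (real_complex R)) /= addr0.
 case En: n => [m|m].
  by rewrite [in RHS]tE En -[_%:~R]/(m%:R) per // iE.
 have -> : tau' = tau + m.+1%:R by rewrite /tau' En NegzE rmorphN /= opprK. by rewrite per.
have t01 : 0 <= Re tau' < 1.
 have /andP[h1 h2] : n%:~R <= Re tau < (n + 1)%:~R by rewrite floor_le_tmp /= floorD1_gt.
 rewrite cReB -(rmorph_int (real_complex R)) /=; rewrite intrD in h2; lra.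
pose y1 := (Y0 + Im tau) / 2.
have y1P : Y0 < y1 < Im tau' by rewrite iE /y1; lra.
have [K K0 KH] := fourier_aux y1P t01.
have rho1 : expR (- (2 * pi * (Im tau' - y1))) < 1.
 by rewrite expR_lt1 oppr_lt0 mulr_gt0 ?mulr_gt0 ?pi_gt0 //; lra.
have rho01 : 0 <= expR (- (2 * pi * (Im tau' - y1))) < 1 by rewrite rho1 expR_ge0.
have [N NH] := geom_tail K rho01 e0.
exists N => m /NH; apply: le_lt_trans.
have -> : ee tau = ee tau' by rewrite tE eeD ee_int mulr1.
have [Yy1 _] := andP y1P.
rewrite -gE (eq_bigr (fun r : 'I_m => fcoef r y1 * ee tau' ^+ r)); first exact: KH.
by move=> r _; rewrite (cst r y1 Yy1).
Qed.

End Periodic.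

(** * Power series, Taylor coefficients and removable singularities *)

Section PowerSeries.
Variable R : realType.
Notation C := R[i].
Notation cdf g w := (dff (g : C^o -> C^o) (w : C^o)).
Implicit Types (a b : nat -> C) (g h : C -> C) (w : C).

Lemma geom_sum_le (t : R) m n : 0 <= t < 1 -> (m <= n)%N -> \sum_(m <= r < n) t ^+ r <= t ^+ m / (1 - t).
Proof.
move=> /andP[t0 t1] mn; rewrite ler_pdivlMr ?subr_gt0 //.
have -> : (\sum_(m <= r < n) t ^+ r) * (1 - t) = t ^+ m - t ^+ n.
 rewrite mulr_suml -[RHS]opprB -(telescope_sumr _ mn) -sumrN.
 by apply: eq_bigr => i _; rewrite exprS; ring.
by rewrite gerBl exprn_ge0.
Qed.

Lemma psum_tail a w l (s M : R) : 0 < s -> (forall r, rn (a r) * s ^+ r <= M) ->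
 rn w < s -> psum a w l -> forall n,
 rn (\sum_(r < n) a r * w ^+ r - l) <= M * (rn w / s) ^+ n / (1 - rn w / s).
Proof.
move=> s0 aM ws al n; set t := rn w / s.
have t01 : 0 <= t < 1 by rewrite divr_ge0 ?rn_ge0 ?ltW //= ltr_pdivrMr // mul1r.
have M0 : 0 <= M by apply: le_trans (aM 0%N); rewrite mulr_ge0 ?rn_ge0 // exprn_ge0 // ltW.
have tb r : rn (a r * w ^+ r) <= M * t ^+ r.
 rewrite rnM rnX /t expr_div_n mulrA ler_pdivlMr ?exprn_gt0 //.
 by rewrite mulrAC ler_wpM2r ?exprn_ge0 ?rn_ge0.
apply/ler_addgt0Pr => e e0; have [N NH] := al e e0.
pose m := maxn n N; have := NH m (leq_maxr _ _) => H.
have nm : (n <= m)%N by exact: leq_maxl.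
have -> : \sum_(r < n) a r * w ^+ r - l = (\sum_(r < m) a r * w ^+ r - l) - \sum_(n <= r < m) a r * w ^+ r.
 rewrite -!(big_mkord xpredT (fun r => a r * w ^+ r)) (big_cat_nat _ nm) //=; ring.
apply: le_trans (rnB _ _) _; rewrite addrC lerD ?(ltW H) //.
apply: le_trans (rn_sum _ _ _) _.
apply: le_trans (ler_sum _ (fun r _ => tb r)) _.
by rewrite -mulr_sumr -mulrA ler_wpM2l // geom_sum_le.
Qed.

Lemma rn_small_eq (x y : C) : (forall e : R, 0 < e -> rn (x - y) <= e) -> x = y.
Proof.
move=> H; apply/eqP; rewrite -subr_eq0 -rn_eq0; apply/eqP/le_anti; rewrite rn_ge0 andbT.
by rewrite -[leRHS]addr0; apply/ler_addgt0Pr => e e0; rewrite !add0r H.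
Qed.

Lemma psum_unique a w l l' : psum a w l -> psum a w l' -> l = l'.
Proof.
move=> al al'; apply: rn_small_eq => e e0; have e2 : 0 < e / 2 by rewrite divr_gt0.
have [N NH] := al _ e2; have [N' NH'] := al' _ e2.
have := NH (maxn N N') (leq_maxl _ _); have := NH' (maxn N N') (leq_maxr _ _).
set S := \sum_(_ < _) _ => h1 h2.
have -> : l - l' = (S - l') - (S - l) by ring.
by apply: le_trans (rnB _ _) _; lra.
Qed.

Lemma psumD a b w l l' : psum a w l -> psum b w l' -> psum (fun r => a r + b r) w (l + l').
Proof.
move=> al bl e e0; have e2 : 0 < e / 2 by rewrite divr_gt0.
have [N NH] := al _ e2; have [N' NH'] := bl _ e2.
exists (maxn N N') => n; rewrite geq_max => /andP[/NH h1 /NH' h2].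
under eq_bigr do rewrite mulrDl; rewrite big_split opprD addrACA /=.
by apply: le_lt_trans (rnD _ _) _; lra.
Qed.

Lemma psumZ c a w l : psum a w l -> psum (fun r => c * a r) w (c * l).
Proof.
move=> al e e0; have c1 : 0 < rn c + 1 by rewrite ltr_wpDl ?rn_ge0.
have [N NH] := al _ (divr_gt0 e0 c1); exists N => n /NH H.
under eq_bigr do rewrite -mulrA; rewrite -mulr_sumr -mulrBr rnM.
rewrite ltr_pdivlMr // in H; apply: le_lt_trans H; rewrite mulrC.
by rewrite ler_wpM2l ?rn_ge0 // lerDl.
Qed.

Lemma psum_scale c a w l : psum a (c * w) l -> psum (fun r => c ^+ r * a r) w l.
Proof.
move=> al e e0; have [N NH] := al e e0; exists N => n /NH.
by under eq_bigr do rewrite exprMn mulrA [a _ * _]mulrC.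
Qed.

Lemma psum_coef_bounded a w l : psum a w l -> exists M : R, forall r, rn (a r) * rn w ^+ r <= M.
Proof.
move=> al; have [N NH] := al 1 ltr01.
exists (2 + \sum_(r < N) rn (a r) * rn w ^+ r) => r.
have S0 : 0 <= \sum_(r < N) rn (a r) * rn w ^+ r.
 by apply: sumr_ge0 => i _; rewrite mulr_ge0 ?exprn_ge0 ?rn_ge0.
have [rN|Nr] := ltnP r N.
 rewrite (bigD1 (Ordinal rN)) //= addrCA lerDl addr_ge0 //.
 by apply: sumr_ge0 => i _; rewrite mulr_ge0 ?exprn_ge0 ?rn_ge0.
have h1 := NH r Nr; have h2 := NH r.+1 (leqW Nr).
rewrite big_ord_recr /= in h2; rewrite -rnX -rnM.
set S := \sum_(_ < r) _ in h1 h2; set x := a r * w ^+ r in h2 *.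
have -> : x = (S + x - l) - (S - l) by ring.
by apply: le_trans (rnB _ _) _; lra.
Qed.

(** The circle is the image under [ee] of a horizontal segment of length 1, which is compact. *)
Lemma circle_bound g (s : R) : 0 < s -> (forall w, rn w = s -> contat g w) ->
 exists2 M : R, 0 <= M & forall w, rn w = s -> rn (g w) <= M.
Proof.
move=> s0 gc; pose y : R := - ln s / (2 * pi).
have p0 : 0 < 2 * @pi R by rewrite mulr_gt0 // pi_gt0.
have sE x : rn (ee (x +i* y)) = s. by rewrite rn_ee /= /y mulrC divfK ?gt_eqF // opprK lnK.
have cc : ccont (fun x => g (ee (x +i* y))) 0 1.
 apply: (contat_h1 (h := fun w => g (ee w))) => x _ e e0.
 have [d d0 dH] := gc _ (sE x) e e0.
 have [d' d'0 dH'] := has_deriv_cont (ee_deriv (x +i* y)) d0. by exists d' => // v /dH' /dH.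
have [M M0 MH] := ccont_bounded ler01 cc; exists M => // w ws.
have [|t tE] := @ee_surj R w; first by rewrite -rn_gt0 ws.
have iE : Im t = y.
 move: ws; rewrite tE rn_ee => /(congr1 (@ln R)); rewrite expRK => H.
 by rewrite /y -H opprK mulrAC divff ?mul1r // gt_eqF.
pose n := Num.floor (Re t).
have /andP[h1 h2] : n%:~R <= Re t < (n + 1)%:~R by rewrite floor_le_tmp /= floorD1_gt.
have -> : w = ee ((Re t - n%:~R) +i* y).
 rewrite tE; have {1}-> : t = ((Re t - n%:~R) +i* y) + n%:~R.
  rewrite -(rmorph_int (real_complex R)) -iE; apply/eqP.
  by rewrite eq_complex /= subrK addr0 !eqxx.
 by rewrite eeD ee_int mulr1.
by apply: MH; rewrite intrD in h2; lra.
Qed.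

Definition coef_bound a g (rho : R) := forall (s M : R) r, 0 < s < rho ->
 (forall w, rn w = s -> rn (g w) <= M) -> rn (a r) * s ^+ r <= 2 * M.

(** Composition with [ee] turns the punctured disc into the half-plane above - ln rho / (2 pi), and
    boundedness near 0 into boundedness at i infinity; the Fourier expansion then is a power series
    in w = e(t). *)
Lemma disc_expand g (rho : R) : 0 < rho -> (forall w, 0 < rn w < rho -> cdf g w) ->
 (exists2 d : R, 0 < d & exists B : R, forall w, 0 < rn w < d -> rn (g w) <= B) ->
 exists a, coef_bound a g rho /\ forall w, 0 < rn w < rho -> psum a w (g w).
Proof.
move=> rho0 gd [d d0 [B gB]].
have p0 : 0 < 2 * @pi R by rewrite mulr_gt0 // pi_gt0.
pose Y (s : R) : R := - ln s / (2 * pi).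
have Yl (s : R) w : 0 < s -> (rn (ee w) < s) = (Y s < Im w).
 move=> s0; rewrite rn_ee -{1}(lnK (x := s)) ?posrE // ltr_expR.
 by rewrite /Y ltr_pdivrMr // ltrNl mulrC.
have Ye (s : R) w : 0 < s -> Im w = Y s -> rn (ee w) = s.
 by move=> s0 wE; rewrite rn_ee wE /Y mulrC divfK ?gt_eqF // opprK lnK.
have ep w : 0 < rn (ee w) by rewrite rn_gt0 ee_neq0.
have [|||a [ab ap]] := @fourier_expand R (fun w => g (ee w)) (Y rho).
- move=> w; rewrite -Yl // => wr; apply/differentiable_deriv.
 dfc g.
 by apply: gd; rewrite ep.
- by move=> w _; rewrite eeD ee1 mulr1.
- exists (Y d + 1), B => w wY; apply: gB; rewrite ep Yl //=.
 by apply: lt_le_trans wY; rewrite ltrDl.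
exists a; split=> [s M r /andP[s0 sr] gM|w /andP[w0 wr]].
 have H := @ab (Y s) M r.
 have -> : s = expR (- (2 * pi * Y s)) by rewrite /Y mulrC divfK ?gt_eqF // opprK lnK.
 apply: H; first by rewrite -(Yl rho (0 +i* Y s)) // (Ye s).
 by move=> x _; apply: gM; apply: Ye.
have [|t tE] := @ee_surj R w; first by rewrite -rn_gt0.
by rewrite tE; apply: ap; rewrite -Yl // -tE.
Qed.

(** [disc_expand] says nothing at w = 0. There the expansion amounts to a_0 = g(0), which follows by
    continuity from the expansion at small nonzero w. *)
Lemma taylor_expand g (rho : R) : 0 < rho -> (forall w, rn w < rho -> cdf g w) ->
 exists a, coef_bound a g rho /\ forall w, rn w < rho -> psum a w (g w).
Proof.
move=> rho0 gd.
have g0c : contat g 0 by apply: contat_df; apply: gd; rewrite rn0.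
have [d d0 dH] := g0c 1 ltr01.
have [|||a [ab ap]] := @disc_expand g rho => //.
- by move=> w /andP[_]; exact: gd.
- exists d => //; exists (rn (g 0) + 1) => w /andP[_ wd].
 by have := dH w; rewrite subr0 => /(_ wd); have := rnBl (g w) (g 0); lra.
exists a; split => // w wr; have [w0|w0] := eqVneq w 0; last by apply: ap; rewrite rn_gt0 w0.
suff a0 : a 0%N = g 0.
 move=> e e0; exists 1%N => n; case: n => // n _.
 rewrite w0 big_ord_recl expr0 mulr1 a0 big1 ?addr0 ?subrr ?rn0 //.
 by move=> i _; rewrite expr0n /= mulr0.
pose s := rho / 2; have s0 : 0 < s by rewrite divr_gt0.
have [|M M0 MH] := @circle_bound g s s0. by move=> v vs; apply: contat_df; apply: gd; rewrite vs /s; lra.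
have aM r : rn (a r) * s ^+ r <= 2 * M by apply: ab => //; rewrite s0 /s; lra.
apply: rn_small_eq => e e0; have e2 : 0 < e / 2 by rewrite divr_gt0.
have [d' d'0 dH'] := g0c _ e2.
have K0 : 0 < 8 * M + 1 by lra.
pose x := Num.min (d' / 2) (Num.min (s / 2) (e * s / (8 * M + 1))).
have x0 : 0 < x by rewrite !lt_min !divr_gt0 // mulr_gt0.
have [x1 x2 x3] : [/\ x <= d' / 2, x <= s / 2 & x <= e * s / (8 * M + 1)]. by rewrite /x !ge_min !lexx !orbT.
have xn : rn (x%:C) = x by rewrite rn_real gtr0_norm.
clearbody x.
have := @psum_tail a x%:C (g x%:C) s (2 * M) s0 aM.
rewrite xn => /(_ _ _ 1%N); rewrite big_ord1 !expr0 mulr1 expr1 => H.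
have {}H : rn (a 0%N - g x%:C) <= 2 * M * (x / s) / (1 - x / s).
 by apply: H; [lra|apply: ap; rewrite xn x0 /s in x2 *; lra].
have xs : x / s <= 1 / 2 by rewrite ler_pdivrMr //; lra.
have xs0 : 0 <= x / s by rewrite divr_ge0 // ltW.
have H2 : 2 * M * (x / s) / (1 - x / s) <= 4 * M * (x / s).
 rewrite ler_pdivrMr; last by lra.
 have : 0 <= M * (x / s) by rewrite mulr_ge0.
 nra.
have H3 : 4 * M * (x / s) <= e / 2.
 rewrite mulrA ler_pdivrMr //; move: x3; rewrite ler_pdivlMr //; nra.
have := dH' x%:C; rewrite subr0 xn => /(_ _) H4.
have {}H4 : rn (g x%:C - g 0) < e / 2 by apply: H4; lra.
have -> : a 0%N - g 0 = (a 0%N - g x%:C) + (g x%:C - g 0) by ring.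
by apply: le_trans (rnD _ _) _; lra.
Qed.

Lemma small_pos (x K : R) : 0 <= x -> 0 <= K -> (forall t : R, 0 < t <= 1 -> x <= K * t) -> x = 0.
Proof.
move=> x0 K0 H; apply/le_anti; rewrite x0 andbT leNgt; apply/negP => xp.
pose t := Num.min 1 (x / (2 * (K + 1))).
have K1 : 0 < 2 * (K + 1) by lra.
have tp : 0 < t by rewrite lt_min ltr01 divr_gt0.
have t1 : t <= 1 by rewrite ge_min lexx.
have t2 : t * (2 * (K + 1)) <= x by rewrite -ler_pdivlMr // ge_min lexx orbT.
have := H t; rewrite tp t1 => /(_ isT); nra.
Qed.

Lemma poly_approx_unique (p q : {poly C}) (n : nat) (K d : R) : 0 < d ->
 (forall w, rn w < d -> rn (p.[w] - q.[w]) <= K * rn w ^+ n) -> forall i, (i < n)%N -> p`_i = q`_i.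
Proof.
move=> d0 H i; have [m] := ubnP i; elim: m i => // m IH i im ilt.
have K0 : 0 <= K.
 have d2 : rn ((d / 2)%:C) = d / 2 by rewrite rn_real ger0_norm // divr_ge0 // ltW.
 have := H (d / 2)%:C; rewrite d2 => /(_ ltac:(lra)) h.
 rewrite -(pmulr_lge0 (x := (d / 2) ^+ n)) ?exprn_gt0 ?divr_gt0 //.
 exact: le_trans (rn_ge0 _) h.
pose r := p - q.
have r0 j : (j < i)%N -> r`_j = 0. by move=> ji; rewrite coefB IH ?subrr // (leq_trans ji) // ltnW.
apply/eqP; rewrite -subr_eq0 -coefB -/r -rn_eq0; apply/eqP.
pose B := \sum_(j < size r) rn (r`_j).
have B0 : 0 <= B by apply: sumr_ge0 => j _; exact: rn_ge0.
pose dd := Num.min 1 (d / 2).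
have dd0 : 0 < dd by rewrite lt_min ltr01 divr_gt0.
have dd1 : dd <= 1 by rewrite ge_min lexx.
have dd2 : dd < d. by apply: le_lt_trans (_ : d / 2 < d); [rewrite ge_min lexx orbT|lra].
clearbody dd.
apply: (@small_pos _ ((K + B) / 1)); rewrite ?rn_ge0 ?divr1 ?addr_ge0 // => t /andP[t0 t1].
pose x := dd * t; have x0 : 0 < x by rewrite mulr_gt0.
have x1 : x <= 1 by rewrite /x; nra.
have xt : x <= t by rewrite /x ger_pMl.
have xn : rn (x%:C) = x by rewrite rn_real gtr0_norm.
have xd : x < d by apply: le_lt_trans dd2; rewrite /x ger_pMr.
clearbody x.
have := H x%:C; rewrite xn -hornerN -hornerD -/r => /(_ xd) h.
have key : rn (r`_i) * x ^+ i <= (K + B) * x ^+ i.+1.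
 have [si|si] := leqP (size r) i. by rewrite nth_default // rn0 mul0r mulr_ge0 ?addr_ge0 ?exprn_ge0 // ltW.
 have E : r`_i * x%:C ^+ i = r.[x%:C] - \sum_(j < size r | j != Ordinal si) r`_j * x%:C ^+ j.
  by rewrite horner_coef (bigD1 (Ordinal si)) //= addrK.
 rewrite -{1}xn -rnX -rnM E; apply: le_trans (rnB _ _) _; rewrite mulrDl lerD //.
  apply: le_trans h _; rewrite ler_wpM2l //.
  by rewrite -(subnK ilt) exprD ger_pMl ?exprn_gt0 // exprn_ile1 // ltW.
 apply: le_trans (rn_sum _ _ _) _; rewrite /B mulr_suml [leRHS](bigD1 (Ordinal si)) //=.
 apply: ler_wpDl; first by rewrite mulr_ge0 ?rn_ge0 // exprn_ge0 // ltW.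
 apply: ler_sum => j ji; rewrite rnM rnX xn.
 have [jlt|jge] := ltnP j i; first by rewrite r0 // rn0 !mul0r.
 have jgt : (i < j)%N by rewrite ltn_neqAle jge andbT eq_sym.
 rewrite ler_wpM2l ?rn_ge0 // -(subnK jgt) exprD ger_pMl ?exprn_gt0 //.
 by rewrite exprn_ile1 // ltW.
have : rn (r`_i) <= (K + B) * x. by rewrite -(ler_pM2r (exprn_gt0 i x0)) -mulrA -exprS.
by move=> /le_trans; apply; rewrite ler_wpM2l // addr_ge0.
Qed.

(* [tc g] is the sequence of Taylor coefficients of g at 0; it is meaningful
   when g is holomorphic near 0. *)
Definition expands g : set (nat -> C) :=
 [set a | exists2 rho : R, 0 < rho & forall w, rn w < rho -> psum a w (g w)].
Definition tc g : nat -> C := xget (fun=> 0) (expands g).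

(** g = p + O(w^n) at 0. This determines the coefficients of p below n, so uniqueness and products
    of Taylor expansions reduce to polynomials. *)
Definition has_approx g (p : {poly C}) (n : nat) := exists K, exists2 d : R, 0 < d &
 forall w, rn w < d -> rn (g w - p.[w]) <= K * rn w ^+ n.

Lemma psum_approx a g (rho : R) n : 0 < rho -> (forall w, rn w < rho -> psum a w (g w)) ->
 has_approx g (\poly_(i < n) a i) n.
Proof.
move=> rho0 ap; pose s := rho / 2; have s0 : 0 < s by rewrite divr_gt0.
have [M MH] : exists M, forall r, rn (a r) * s ^+ r <= M.
 have sn : rn (s%:C) = s by rewrite rn_real gtr0_norm.
 have [|M MH] := @psum_coef_bounded a s%:C (g s%:C); last by exists M; rewrite sn in MH.
 by apply: ap; rewrite sn /s; lra.
have M0 : 0 <= M by apply: le_trans (MH 0%N); rewrite mulr_ge0 ?rn_ge0 // exprn_ge0 // ltW.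
exists (2 * M / s ^+ n), (s / 2) => [|w ws]; first by rewrite divr_gt0.
have := @psum_tail a w (g w) s M s0 MH => /(_ _ _ n) H.
have {}H : rn (\sum_(r < n) a r * w ^+ r - g w) <= M * (rn w / s) ^+ n / (1 - rn w / s).
 by apply: H; [lra|apply: ap; rewrite /s in ws *; lra].
rewrite horner_poly rnC; apply: le_trans H _.
have ts : rn w / s < 1 / 2 by rewrite ltr_pdivrMr //; lra.
rewrite ler_pdivrMr; last by lra.
have e0 : 0 <= M * (rn w ^+ n / s ^+ n) by rewrite mulr_ge0 // divr_ge0 ?exprn_ge0 ?rn_ge0 // ltW.
have -> : 2 * M / s ^+ n * rn w ^+ n = 2 * (M * (rn w ^+ n / s ^+ n)) by ring.
rewrite expr_div_n; nra.
Qed.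

Lemma has_approx_unique g p q n : has_approx g p n -> has_approx g q n -> forall i, (i < n)%N -> p`_i = q`_i.
Proof.
move=> [K [d d0 H]] [K' [d' d'0 H']].
apply: (@poly_approx_unique p q n (K + K') (Num.min d d')); first by rewrite lt_min d0.
move=> w; rewrite lt_min => /andP[/H h /H' h'].
have -> : p.[w] - q.[w] = (g w - q.[w]) - (g w - p.[w]) by ring.
by apply: le_trans (rnB _ _) _; lra.
Qed.

Lemma tc_psum a g (rho : R) : 0 < rho -> (forall w, rn w < rho -> psum a w (g w)) -> tc g = a.
Proof.
move=> rho0 ap.
have [rho' rho'0 tp] : exists2 rho' : R, 0 < rho' & forall w, rn w < rho' -> psum (tc g) w (g w).
 by apply: (@xgetPex _ (fun=> 0) (expands g)); exists a; exists rho.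
apply/funext => i.
have := has_approx_unique (psum_approx i.+1 rho'0 tp) (psum_approx i.+1 rho0 ap) (ltnSn i).
by rewrite !coef_poly ltnSn.
Qed.

Definition cdisc g (rho : R) := 0 < rho /\ forall w, rn w < rho -> cdf g w.

Lemma cdiscD g h rho : cdisc g rho -> cdisc h rho -> cdisc (fun w => g w + h w) rho.
Proof.
move=> [r0 gd] [_ hd]; split=> [//|w wr].
exact: dfD (gd w wr) (hd w wr).
Qed.

Lemma cdiscM g h rho : cdisc g rho -> cdisc h rho -> cdisc (fun w => g w * h w) rho.
Proof.
move=> [r0 gd] [_ hd]; split=> [//|w wr].
exact: dfM (gd w wr) (hd w wr).
Qed.

Lemma cdisc_cst c (rho : R) : 0 < rho -> cdisc (fun=> c) rho.
Proof. by move=> r0; split=> [//|w _]; exact: dfcst. Qed.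

Lemma tcP g rho : cdisc g rho -> coef_bound (tc g) g rho /\ forall w, rn w < rho -> psum (tc g) w (g w).
Proof.
by move=> [rho0 gd]; have [a [ab ap]] := taylor_expand rho0 gd; rewrite (tc_psum rho0 ap).
Qed.

Lemma tc_approx g rho n : cdisc g rho -> has_approx g (\poly_(i < n) tc g i) n.
Proof. by move=> gd; have [_ H] := tcP gd; case: gd => r0 _; exact: psum_approx H. Qed.

Lemma tc_unique g rho p n : cdisc g rho -> has_approx g p n -> forall i, (i < n)%N -> tc g i = p`_i.
Proof.
move=> gd gp i ilt; rewrite -(has_approx_unique (tc_approx n gd) gp ilt).
by rewrite coef_poly ilt.
Qed.

Lemma tc_le g rho (s M : R) r : cdisc g rho -> 0 < s < rho ->
 (forall w, rn w = s -> rn (g w) <= M) -> rn (tc g r) * s ^+ r <= 2 * M.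
Proof. by move=> /tcP[H _]; exact: H. Qed.

(** Cauchy's estimate with factor 2, and a geometric tail whose ratio is at most 1 / 2, give the
    constant 4. This is the form of Schwarz's lemma used below: a function vanishing to order n is
    small well inside a circle on which it is bounded. *)
Lemma tc_rem g rho (s M : R) n w : cdisc g rho -> 0 < s < rho ->
 (forall v, rn v = s -> rn (g v) <= M) -> rn w <= s / 2 ->
 rn (g w - \sum_(r < n) tc g r * w ^+ r) <= 4 * M * (rn w / s) ^+ n.
Proof.
move=> gd /andP[s0 sr] gM ws; have [gb gp] := tcP gd.
have MH r : rn (tc g r) * s ^+ r <= 2 * M by apply: gb => //; rewrite s0.
have wr : rn w < rho by lra.
have ws' : rn w < s by lra.
have := psum_tail s0 MH ws' (gp w wr) n; rewrite rnC => /le_trans; apply.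
have ts : rn w / s <= 1 / 2 by rewrite ler_pdivrMr //; lra.
have t0 : 0 <= rn w / s by rewrite divr_ge0 ?rn_ge0 // ltW.
have M0 : 0 <= 2 * M by apply: le_trans (MH 0%N); rewrite mulr_ge0 ?rn_ge0 // exprn_ge0 // ltW.
rewrite ler_pdivrMr; last by lra.
have : 0 <= 2 * M * (rn w / s) ^+ n by rewrite mulr_ge0 // exprn_ge0.
nra.
Qed.

Lemma tc_0 g rho : cdisc g rho -> tc g 0 = g 0.
Proof.
move=> gd; have [_ /(_ 0)] := tcP gd; rewrite rn0; case: (gd) => r0 _ /(_ r0) H.
apply: rn_small_eq => e e0; have [N /(_ (maxn N 1) (leq_maxl _ _))] := H e e0.
case E : (maxn N 1) => [|n]; first by move: (leq_maxr N 1); rewrite E.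
rewrite big_ord_recl expr0 mulr1 big1 ?addr0 => [/ltW//|i _].
by rewrite expr0n /= mulr0.
Qed.

Lemma tc_eq0 g rho : cdisc g rho -> (forall r, tc g r = 0) -> forall w, rn w < rho -> g w = 0.
Proof.
move=> gd t0 w wr; have [_ /(_ w wr) H] := tcP gd.
apply: (psum_unique H) => e e0; exists 0%N => n _.
by rewrite big1 ?subrr ?rn0 // => i _; rewrite t0 mul0r.
Qed.

Lemma tc_ext g h rho (d : R) : cdisc g rho -> 0 < d -> (forall w, rn w < d -> g w = h w) -> tc h = tc g.
Proof.
move=> gd d0 gh; have [_ H] := tcP gd; case: (gd) => r0 _.
apply: (@tc_psum _ _ (Num.min d rho)) => [|w]; first by rewrite lt_min d0.
by rewrite lt_min => /andP[/gh <- /H].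
Qed.

Lemma tcD g h rho : cdisc g rho -> cdisc h rho -> tc (fun w => g w + h w) = fun r => tc g r + tc h r.
Proof.
move=> gd hd; have [_ H] := tcP gd; have [_ H'] := tcP hd; case: (gd) => r0 _.
by apply: (tc_psum r0) => w wr; apply: psumD; [exact: H|exact: H'].
Qed.

Lemma tcZ c g rho : cdisc g rho -> tc (fun w => c * g w) = fun r => c * tc g r.
Proof.
move=> gd; have [_ H] := tcP gd; case: (gd) => r0 _.
by apply: (tc_psum r0) => w wr; apply: psumZ; exact: H.
Qed.

Lemma tc_scale c g rho : cdisc g rho -> tc (fun w => g (c * w)) = fun r => c ^+ r * tc g r.
Proof.
move=> gd; have [_ H] := tcP gd; case: (gd) => r0 _.
have c1 : 0 < rn c + 1 by rewrite ltr_wpDl ?rn_ge0.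
apply: (@tc_psum _ _ (rho / (rn c + 1))) => [|w]; first by rewrite divr_gt0.
rewrite ltr_pdivlMr // => wr; apply: psum_scale; apply: H; rewrite rnM.
by apply: le_lt_trans wr; rewrite mulrC ler_wpM2l ?rn_ge0 // lerDl.
Qed.

Lemma tc_poly (p : {poly C}) : tc (fun w => p.[w]) = fun i => p`_i.
Proof.
apply: (@tc_psum _ _ 1) => // w _ e e0; exists (size p) => n sn.
by rewrite (horner_coef_wide _ sn) subrr rn0.
Qed.

Lemma has_approxM g h p q n : has_approx g p n -> has_approx h q n ->
 has_approx (fun w => g w * h w) (p * q) n.
Proof.
move=> [K [d d0 H]] [K' [d' d'0 H']].
have pb (r : {poly C}) : exists2 B : R, 0 <= B & forall w, rn w < 1 -> rn r.[w] <= B.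
 exists (\sum_(i < size r) rn r`_i) => [|w w1]; first by apply: sumr_ge0 => i _; exact: rn_ge0.
 rewrite horner_coef; apply: le_trans (rn_sum _ _ _) _; apply: ler_sum => i _.
 by rewrite rnM rnX ler_piMr ?rn_ge0 // exprn_ile1 ?rn_ge0 // ltW.
have [P P0 PH] := pb p; have [Q Q0 QH] := pb q.
pose L := `|K| * (Q + `|K'|) + P * `|K'|.
exists L, (Num.min (Num.min d d') 1) => [|w]; first by rewrite !lt_min d0 d'0 ltr01.
rewrite !lt_min => /andP[/andP[/H h1 /H' h2] w1].
have := PH w w1; have := QH w w1 => hq hp.
have x1 : rn w ^+ n <= 1 by rewrite exprn_ile1 ?rn_ge0 // ltW.
have x0 : 0 <= rn w ^+ n by rewrite exprn_ge0 ?rn_ge0.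
have h1' : rn (g w - p.[w]) <= `|K| * rn w ^+ n. by apply: le_trans h1 _; rewrite ler_wpM2r // ler_norm.
have h2' : rn (h w - q.[w]) <= `|K'| * rn w ^+ n. by apply: le_trans h2 _; rewrite ler_wpM2r // ler_norm.
rewrite hornerM.
have -> : g w * h w - p.[w] * q.[w] = (g w - p.[w]) * (q.[w] + (h w - q.[w])) + p.[w] * (h w - q.[w]) by ring.
apply: le_trans (rnD _ _) _; rewrite !rnM /L mulrDl lerD //.
 rewrite mulrAC; apply: ler_pM; rewrite ?rn_ge0 //.
 apply: le_trans (rnD _ _) _; rewrite lerD //; apply: le_trans h2' _.
 by rewrite ler_piMr.
by rewrite -mulrA; apply: ler_pM; rewrite ?rn_ge0.
Qed.

Lemma removable g (rho : R) : 0 < rho -> (forall w, 0 < rn w < rho -> cdf g w) ->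
 (exists2 d : R, 0 < d & exists B : R, forall w, 0 < rn w < d -> rn (g w) <= B) ->
 exists2 h, cdisc h rho & forall w, w != 0 -> h w = g w.
Proof.
move=> rho0 gd gB; have [a [ab ap]] := disc_expand rho0 gd gB.
pose h w := if w == 0 then a 0%N else g w.
exists h => [|w w0]; last by rewrite /h (negbTE w0).
have hp w : rn w < rho -> psum a w (h w).
 rewrite /h; case: eqVneq => [->|w0] wr; last by apply: ap; rewrite rn_gt0 w0.
 move=> e e0; exists 1%N => n; case: n => // n _.
 rewrite big_ord_recl expr0 mulr1 big1 ?addr0 ?subrr ?rn0 // => i _.
 by rewrite expr0n /= mulr0.
split => // w wr; have [w0|w0] := eqVneq w 0; last first.
 apply: (@differentiable_local _ _ _ (g : C^o -> C^o) _ _ (rn w)); last by apply: gd; rewrite rn_gt0 w0.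
  by rewrite rn_gt0.
 move=> v vw; rewrite /h; case: eqVneq => // v0.
 by move: vw; rewrite v0 sub0r rnN ltxx.
apply/differentiable_deriv; exists (a 1%N); rewrite w0 => e e0.
have [K [d d0 H]] := psum_approx 2 rho0 hp.
have K1 : 0 < `|K| + 1 by rewrite ltr_wpDl.
exists (Num.min d (e / (`|K| + 1))) => [|v]; first by rewrite lt_min d0 divr_gt0.
rewrite lt_min => /andP[/H]; rewrite horner_poly !big_ord_recl big_ord0 /= expr0 mulr1 addr0.
rewrite expr1 add0r ltr_pdivlMr // => h1 h2.
(* At 0 the derivative is the coefficient a_1: the expansion up to order 2 leaves an error K
   |v|^2. *)
have -> : h v - h 0 - a 1%N * v = h v - (a 0%N + a 1%N * v). by rewrite {2}/h eqxx opprD addrA.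
apply: le_trans h1 _; have := ler_norm K; have := rn_ge0 v; nra.
Qed.

Lemma order_split g rho n : cdisc g rho -> (forall i, (i < n)%N -> tc g i = 0) ->
 exists2 h, cdisc h rho & (forall w, rn w < rho -> g w = w ^+ n * h w) /\ h 0 = tc g n.
Proof.
move=> gd g0; have [r0 gd'] := gd.
have [K [d d0 H]] := tc_approx n.+1 gd.
have gE w : rn w < d -> rn (g w - tc g n * w ^+ n) <= K * rn w ^+ n.+1.
 move=> /H; rewrite horner_poly big_ord_recr /= big1 ?add0r // => i _.
 by rewrite g0 // mul0r.
have [||h hd hE] := @removable (fun w => g w / w ^+ n) rho r0.
- move=> w /andP[w0 wr]; rewrite rn_gt0 in w0.
 by apply: dfM; [exact: gd'|apply: dfV; [apply: dfX; exact: dfid|rewrite expf_neq0]].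
- exists (Num.min d 1); first by rewrite lt_min d0 ltr01.
 exists (rn (tc g n) + `|K|) => w /andP[w0]; rewrite lt_min => /andP[/gE h1 w1].
 rewrite rnM rnV rnX ler_pdivrMr ?exprn_gt0 // mulrDl.
 have -> : g w = tc g n * w ^+ n + (g w - tc g n * w ^+ n) by ring.
 apply: le_trans (rnD _ _) _; rewrite rnM rnX lerD2l; apply: le_trans h1 _.
 rewrite exprS mulrA ler_wpM2r ?exprn_ge0 ?rn_ge0 //.
 by have := ler_norm K; have := normr_ge0 K; nra.
have h0 : h 0 = tc g n.
 apply: rn_small_eq => e e0; have e2 : 0 < e / 2 by rewrite divr_gt0.
 have hc : contat h 0 by apply: contat_df; case: hd => _; apply; rewrite rn0.
 have [d' d'0 dH'] := hc _ e2; have K1 : 0 < 2 * (`|K| + 1) by rewrite mulr_gt0 // ltr_wpDl.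
 pose x := Num.min (d' / 2) (Num.min (d / 2) (e / (2 * (`|K| + 1)))).
 have x0 : 0 < x by rewrite !lt_min !divr_gt0.
 have [x1 x2 x3] : [/\ x <= d' / 2, x <= d / 2 & x <= e / (2 * (`|K| + 1))].
  by rewrite /x !ge_min !lexx !orbT.
 have xn : rn (x%:C) = x by rewrite rn_real gtr0_norm.
 clearbody x; have xC : x%:C != 0 by rewrite -rn_gt0 xn.
 have := dH' x%:C; rewrite subr0 xn => /(_ ltac:(lra)) => h1.
 have := gE x%:C; rewrite xn => /(_ ltac:(lra)) => h2.
 have h3 : rn (h x%:C - tc g n) <= K * x.
  rewrite hE //; have -> : g x%:C / x%:C ^+ n - tc g n = (g x%:C - tc g n * x%:C ^+ n) / x%:C ^+ n.
   by rewrite mulrBl mulfK // expf_neq0.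
  by rewrite rnM rnV rnX xn ler_pdivrMr ?exprn_gt0 // -mulrA -exprS.
 have h4 : K * x <= e / 2.
  rewrite ler_pdivlMr // in x3; have := ler_norm K; nra.
 have -> : h 0 - tc g n = (h x%:C - tc g n) - (h x%:C - h 0) by ring. by apply: le_trans (rnB _ _) _; lra.
exists h => //; split => // w wr; have [->|w0] := eqVneq w 0; last by rewrite hE // mulrC divfK // expf_neq0.
case: (n) g0 h0 => [|m] g0 h0; first by rewrite expr0 mul1r h0 (tc_0 gd).
by rewrite expr0n /= mul0r -(tc_0 gd) g0.
Qed.

End PowerSeries.

(** * Uniform limits and holomorphic dependence on parameters *)

Section Limits.
Variable R : realType.
Notation C := R[i].
Notation cdf g w := (dff (g : C^o -> C^o) (w : C^o)).

Lemma cauchy_R (u : nat -> R) : (forall e : R, 0 < e -> exists N, forall n m,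
  (N <= n)%N -> (N <= m)%N -> `|u n - u m| <= e) ->
 exists l : R, forall e : R, 0 < e -> exists N, forall n, (N <= n)%N -> `|u n - l| <= e.
Proof.
move=> H; have : cvg (u @ \oo).
 apply/cauchy_cvgP; apply: cauchy_exP => e e0.
 have [N NH] := H _ (divr_gt0 e0 (ltr0n _ 2)); exists (u N), N => // n nN /=.
 by rewrite /ball /=; apply: le_lt_trans (NH _ _ (leqnn N) nN) _; lra.
move=> /cvg_ex[l /cvgrPdist_le ul]; exists l => e e0.
by have [N _ NH] := ul e e0; exists N => n nN; rewrite distrC; apply: NH.
Qed.

Lemma cauchy_C (u : nat -> C) : (forall e : R, 0 < e -> exists N, forall n m,
  (N <= n)%N -> (N <= m)%N -> rn (u n - u m) <= e) ->
 exists l : C, forall e : R, 0 < e -> exists N, forall n, (N <= n)%N -> rn (u n - l) <= e.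
Proof.
move=> H; have [|a aH] := @cauchy_R (fun n => Re (u n)).
 move=> e /H[N NH]; exists N => n m nN mN.
 by apply: le_trans (NH n m nN mN); rewrite -cReB Re_le_rn.
have [|b bH] := @cauchy_R (fun n => Im (u n)).
 move=> e /H[N NH]; exists N => n m nN mN.
 by apply: le_trans (NH n m nN mN); rewrite -cImB Im_le_rn.
exists (a +i* b) => e e0; have e2 : 0 < e / 2 by rewrite divr_gt0.
have [N NH] := aH _ e2; have [N' NH'] := bH _ e2.
exists (maxn N N') => n; rewrite geq_max => /andP[/NH h1 /NH' h2].
apply: le_trans (rn_le_ReIm _) _; rewrite cReB cImB /=; lra.
Qed.

Lemma tc_deriv (g : C -> C) rho a : cdisc g rho -> has_deriv g 0 a -> tc g 1 = a.
Proof.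
move=> gd ga; have [K [d d0 H]] := tc_approx 2 gd.
apply: rn_small_eq => e e0; have e2 : 0 < e / 2 by rewrite divr_gt0.
have [d' d'0 dH] := ga _ e2.
have K1 : 0 < 2 * (`|K| + 1) by rewrite mulr_gt0 // ltr_wpDl.
pose x := Num.min (d' / 2) (Num.min (d / 2) (e / (2 * (`|K| + 1)))).
have x0 : 0 < x by rewrite !lt_min !divr_gt0.
have [x1 x2 x3] : [/\ x <= d' / 2, x <= d / 2 & x <= e / (2 * (`|K| + 1))]. by rewrite /x !ge_min !lexx !orbT.
have xn : rn (x%:C) = x by rewrite rn_real gtr0_norm.
clearbody x.
have := dH x%:C; rewrite add0r xn => /(_ ltac:(lra)) => h1.
have := H x%:C; rewrite xn => /(_ ltac:(lra)).
rewrite horner_poly !big_ord_recl big_ord0 /= (tc_0 gd) expr0 mulr1 addr0 expr1 => h2.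
rewrite -(ler_pM2r x0) -{1}xn -rnM.
have -> : (tc g 1 - a) * x%:C = (g x%:C - g 0 - a * x%:C) - (g x%:C - (g 0 + tc g 1 * x%:C)) by ring.
apply: le_trans (rnB _ _) _.
have : K * x ^+ 2 <= e / 2 * x.
 rewrite expr2 mulrA ler_pM2r // ; rewrite ler_pdivlMr // in x3; have := ler_norm K; nra.
lra.
Qed.

Lemma limit_le (u : nat -> C) (l : C) (B : R) :
 (forall e : R, 0 < e -> exists N, forall n, (N <= n)%N -> rn (u n - l) <= e) ->
 (exists N, forall n, (N <= n)%N -> rn (u n) <= B) -> rn l <= B.
Proof.
move=> ul [N uB]; apply/ler_addgt0Pr => e e0; have [N' NH] := ul e e0.
have h1 := uB _ (leq_maxl N N'); have h2 := NH _ (leq_maxr N N').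
have -> : l = u (maxn N N') - (u (maxn N N') - l) by ring.
by apply: le_trans (rnB _ _) _; lra.
Qed.

(* Cauchy's estimates along complex lines make the differentials converge. *)
Lemma uniform_limit_differentiable (V : normedModType C) (fn : nat -> V -> C^o) (f : V -> C^o)
  (p : V) (rho M : R) : 0 < rho -> (forall n v, rn (v - p) < rho -> dff (fn n) v) ->
 (forall n v, rn (v - p) < rho -> rn (fn n v) <= M) ->
 (forall e : R, 0 < e -> exists N, forall n v, (N <= n)%N -> rn (v - p) < rho -> rn (fn n v - f v) <= e) ->
 dff f p.
Proof.
move=> rho0 fd fM fu.
have pp : rn (p - p) < rho by rewrite subrr rn0.
have M0 : 0 <= M by apply: le_trans (fM 0%N p pp); exact: rn_ge0.
have /choice[L LP] : forall n, exists L : {linear V -> C^o}, continuous L /\ approx (fn n) p L.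
 by move=> n; apply: differentiable_approx; apply: fd.
(* For |u| <= rho / 2 the restriction to this line is holomorphic for |t| < 2, so Cauchy's estimates
   on |t| = 1 bound the differentials and their differences. *)
pose line (h : V -> C^o) (u : V) (t : C) : C := h (p + t *: u).
have inb (u : V) (t : C) : rn u <= rho / 2 -> rn t < 2 -> rn (p + t *: u - p) < rho.
 move=> ur t2; rewrite [p + _]addrC addrK rnZ.
 have [u0|u0] := eqVneq (rn u) 0; first by rewrite u0 mulr0.
 have up : 0 < rn u by rewrite lt_def u0 rn_ge0.
 have : rn t * rn u < 2 * rn u by rewrite ltr_pM2r.
 lra.
have lined n (u : V) : rn u <= rho / 2 -> cdisc (line (fn n) u) 2.
 move=> ur; split=> [//|t t2]; rewrite /line.
 dfc (fn n).
 by apply: fd; apply: inb.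
have linetc n (u : V) : rn u <= rho / 2 -> tc (line (fn n) u) 1 = L n u.
 move=> ur; apply: (tc_deriv (lined n u ur)) => e e0.
 have u1 : 0 < rn u + 1 by rewrite ltr_wpDl ?rn_ge0.
 have [d d0 dH] := (LP n).2 _ (divr_gt0 e0 u1).
 exists (d / (rn u + 1)) => [|t]; first by rewrite divr_gt0.
 rewrite ltr_pdivlMr // => td; rewrite /line add0r scale0r addr0.
 have h : rn (t *: u) < d. by apply: le_lt_trans td; rewrite rnZ ler_wpM2l ?rn_ge0 // lerDl.
 have := dH _ h; rewrite linearZZ -[t *: L n u]/(t * L n u) [t * _]mulrC => /le_trans; apply.
 rewrite rnZ mulrCA mulrC ler_wpM2r ?rn_ge0 // mulrAC ler_pdivrMr // ler_pM2l //.
 by rewrite lerDl.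
have one2 : 0 < (1 : R) < 2 by lra.
have Lb n (u : V) : rn u <= rho / 2 -> rn (L n u) <= 2 * M.
 move=> ur; rewrite -(linetc n u ur); have := @tc_le _ _ _ 1 M 1%N (lined n u ur) one2.
 rewrite expr1 mulr1; apply => w w1; apply: fM; apply: inb => //; lra.
have Ld n m (u : V) (e : R) : rn u <= rho / 2 ->
  (forall v, rn (v - p) < rho -> rn (fn n v - fn m v) <= e) -> rn (L n u - L m u) <= 2 * e.
 move=> ur H; have d1 := lined n u ur; have d2 := lined m u ur.
 have d3 : cdisc (fun w => -1 * line (fn m) u w) 2. by apply: cdiscM d2; apply: cdisc_cst.
 have d4 := cdiscD d1 d3.
 have := @tc_le _ _ _ 1 e 1%N d4 one2; rewrite expr1 mulr1 (tcD d1 d3) (tcZ _ d2).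
 rewrite !linetc // mulN1r; apply => w w1; rewrite mulN1r.
 apply: H; apply: inb => //; lra.
have half : 0 < rho / 2 by rewrite divr_gt0.
have Lc (u : V) : forall e : R, 0 < e -> exists N, forall n m,
  (N <= n)%N -> (N <= m)%N -> rn (L n u - L m u) <= e.
 move=> e e0; have u1 : 0 < rn u + 1 by rewrite ltr_wpDl ?rn_ge0.
 pose c := rho / 2 / (rn u + 1); have c0 : 0 < c by rewrite divr_gt0.
 have cu : rn (c%:C *: u) <= rho / 2.
  rewrite rnZ rn_real gtr0_norm // /c mulrAC ler_pdivrMr // ler_pM2l //.
  by rewrite lerDl.
 have [N NH] := fu _ (divr_gt0 (mulr_gt0 c0 e0) (ltr0n R 4)).
 exists N => n m nN mN; rewrite -(ler_pM2l c0).
 have := @Ld n m (c%:C *: u) (c * e / 2) cu.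
 have E k : L k (c%:C *: u) = c%:C * L k u by rewrite linearZZ.
 rewrite !E -mulrBr rnM rn_real gtr0_norm //.
 move=> H; have {}H := H _; apply: le_trans (H _) _; last by lra.
 move=> v vp; have h1 := NH n v nN vp; have h2 := NH m v mN vp.
 have -> : fn n v - fn m v = (fn n v - f v) - (fn m v - f v) by ring. by apply: le_trans (rnB _ _) _; lra.
have /choice[l lP] : forall u : V, exists l : C, forall e : R, 0 < e ->
  exists N, forall n, (N <= n)%N -> rn (L n u - l) <= e.
 by move=> u; apply: cauchy_C; exact: Lc.
have llin : linear (l : V -> C^o).
 move=> c u v; apply: rn_small_eq => e e0.
 have c1 : 0 < rn c + 2 by rewrite ltr_wpDl ?rn_ge0.
 have e3 := divr_gt0 e0 c1.
 have [N1 H1] := lP (c *: u + v) _ e3; have [N2 H2] := lP u _ e3; have [N3 H3] := lP v _ e3.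
 pose n := maxn N1 (maxn N2 N3).
 have h1 := H1 n (leq_maxl _ _).
 have h2 := H2 n (leq_trans (leq_maxl _ _) (leq_maxr _ _)).
 have h3 := H3 n (leq_trans (leq_maxr _ _) (leq_maxr _ _)).
 have E1 : L n (c *: u + v) = c * L n u + L n v by rewrite linearP.
 rewrite E1 in h1; rewrite -[c *: l u]/(c * l u); clearbody n.
 have -> : l (c *: u + v) - (c * l u + l v) =
  c * (L n u - l u) + (L n v - l v) - (c * L n u + L n v - l (c *: u + v)) by ring.
 apply: le_trans (rnB _ _) _; apply: le_trans (lerD (rnD _ _) (lexx _)) _; rewrite rnM.
 have : rn c * rn (L n u - l u) <= rn c * (e / (rn c + 2)) by rewrite ler_wpM2l ?rn_ge0.
 have : (rn c + 2) * (e / (rn c + 2)) = e by rewrite mulrC divfK // gt_eqF.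
 move: (e / _) h1 h2 h3 => x h1 h2 h3; lra.
pose LL : {linear V -> C^o} := HB.pack (l : V -> C^o) (GRing.isLinear.Build C V C^o *:%R (l : V -> C^o) llin).
have lb u : rn (l u) <= 4 * M / rho * rn u.
 have [->|u0] := eqVneq u 0; first by rewrite -[l 0]/(LL 0) linear0 !rn0 mulr0.
 have up : 0 < rn u by rewrite rn_gt0.
 pose c := rho / (2 * rn u); have c0 : 0 < c by rewrite divr_gt0 // mulr_gt0.
 have cu : rn (c%:C *: u) = rho / 2. by rewrite rnZ rn_real gtr0_norm // /c; field; rewrite gt_eqF.
 have : rn (l (c%:C *: u)) <= 2 * M. by apply: (limit_le (lP _)); exists 0%N => n _; apply: Lb; rewrite cu.
 have -> : l (c%:C *: u) = c%:C * l u by rewrite -[l _]/(LL _) linearZZ.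
 rewrite rnM rn_real gtr0_norm // mulrC -ler_pdivlMr //.
 by move=> /le_trans; apply; rewrite /c le_eqVlt; apply/orP; left; apply/eqP; field; rewrite !gt_eqF.
have LLc : continuous LL by apply: (@bounded_continuous _ _ _ LL _ lb).
apply: (approx_differentiable LLc) => e e0.
pose K := 16 * M / rho ^+ 2 + 1.
have K0 : 0 < K. by apply: ltr_wpDl => //; apply: divr_ge0; [apply: mulr_ge0|apply: exprn_ge0; apply: ltW].
exists (Num.min (rho / 4) (e / K)) => [|u]; first by rewrite lt_min !divr_gt0.
rewrite lt_min => /andP[u4]; rewrite ltr_pdivlMr // => uK.
have [->|u0] := eqVneq u 0; first by rewrite addr0 (linear0 LL) !subrr !rn0 mulr0.
have up : 0 < rn u by rewrite rn_gt0.
suff H : rn (f (p + u) - f p - LL u) <= 16 * M / rho ^+ 2 * rn u ^+ 2.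
 apply: le_trans H _; rewrite expr2 mulrA ler_pM2r //; apply: le_trans (ltW uK).
 by rewrite mulrC ler_wpM2l ?rn_ge0 // /K lerDl.
(* u is written as lam u' with |u'| = rho / 2. The second-order remainder on the line through u' is
   at most 4 M lam^2 = 16 M |u|^2 / rho^2, uniformly in n. *)
pose lam := 2 * rn u / rho.
have lam0 : 0 < lam by rewrite divr_gt0 // mulr_gt0.
have lam1 : lam <= 1 / 2 by rewrite ler_pdivrMr //; lra.
pose u' := lam^-1%:C *: u.
have u'n : rn u' = rho / 2. by rewrite rnZ rn_real gtr0_norm ?invr_gt0 // /lam; field; rewrite !gt_eqF.
have uE : u = lam%:C *: u'. by rewrite scalerA -rmorphM /= divff ?gt_eqF // scale1r.
have lamn : rn (lam%:C) = lam by rewrite rn_real gtr0_norm.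
have key n : rn (fn n (p + u) - fn n p - L n u) <= 16 * M / rho ^+ 2 * rn u ^+ 2.
 have u'r : rn u' <= rho / 2 by rewrite u'n.
 have := @tc_rem _ (line (fn n) u') 2 1 M 2%N lam%:C (lined n _ u'r) one2.
 rewrite lamn => H; have {}H := H _ lam1.
 rewrite !big_ord_recl big_ord0 /= (tc_0 (lined n _ u'r)) linetc // expr0 mulr1 addr0 expr1 in H.
 rewrite /line scale0r addr0 -uE divr1 in H.
 have -> : L n u = L n u' * lam%:C by rewrite {1}uE linearZZ; exact: mulrC.
 rewrite -addrA -opprD; apply: le_trans (H _) _.
  by move=> w w1; apply: fM; apply: inb => //; lra.
 by rewrite /lam le_eqVlt; apply/orP; left; apply/eqP; field; rewrite gt_eqF.
apply: (@limit_le (fun n => fn n (p + u) - fn n p - L n u)); last by exists 0%N.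
move=> e1 e10; have e3 : 0 < e1 / 3 by rewrite divr_gt0.
have [N1 H1] := fu _ e3; have [N2 H2] := lP u _ e3.
exists (maxn N1 N2) => n; rewrite geq_max => /andP[n1 n2].
have h1 := H1 n p n1 pp; have h2 := H2 n n2.
have h3 : rn (fn n (p + u) - f (p + u)) <= e1 / 3. by apply: H1 => //; rewrite [p + u]addrC addrK; lra.
have -> : fn n (p + u) - fn n p - L n u - (f (p + u) - f p - LL u) =
 (fn n (p + u) - f (p + u)) - (fn n p - f p) - (L n u - l u) by rewrite -[LL u]/(l u); ring.
apply: le_trans (rnB _ _) _; apply: le_trans (lerD (rnB _ _) (lexx _)) _; clear -h1 h2 h3; lra.
Qed.

(** Compactness of the circle, used through its parameter interval: the product filter carries the
    neighbourhood of p and the bound together, so finitely many local bounds combine. *)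
Lemma tube_bound (V : normedModType C) (G : V -> C -> C) (p : V) (s : R) : 0 < s ->
 (forall t, rn t = s -> exists2 d : R, 0 < d & exists B : R, forall v t',
   rn (v - p) < d -> rn (t' - t) < d -> rn (G v t') <= B) ->
 exists2 d : R, 0 < d & exists B : R, forall v t, rn (v - p) < d -> rn t = s -> rn (G v t) <= B.
Proof.
move=> s0 H; pose y : R := - ln s / (2 * pi).
have p0 : 0 < 2 * @pi R by rewrite mulr_gt0 // pi_gt0.
have sE x : rn (ee (x +i* y)) = s. by rewrite rn_ee /= /y mulrC divfK ?gt_eqF // opprK lnK.
have := @segment_compact R 0 1; rewrite compact_near_coveringP => cc.
have := cc (V * R)%type (filter_prod (nbhs p) (pinfty_nbhs R))
 (fun vM x => rn (G vM.1 (ee (x +i* y))) <= vM.2) _.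
case.
 move=> x _; have [d d0 [B BH]] := H _ (sE x).
 have [d' d'0 dH'] := has_deriv_cont (ee_deriv (x +i* y)) d0.
 exists ([set x' | `|x' - x| < d'], [set vM : V * R | rn (vM.1 - p) < d /\ B <= vM.2]) => /=.
  split; first by apply/nbhs_ballP; exists d' => //= z; rewrite /ball /= distrC.
  exists ([set v | rn (v - p) < d], [set M | B <= M]) => /=.
   split; first by apply/nbhs_rnP; exists d.
   by apply: nbhs_pinfty_ge; exact: num_real.
  by move=> [v M] /= [].
 move=> [x' [v M]] /= [h1 [h2 h3]]; apply: le_trans h3; apply: BH => //; apply: dH'.
 have -> : (x' +i* y) - (x +i* y) = (x' - x)%:C by apply/eqP; rewrite eq_complex /= subrr !eqxx.
 by rewrite rn_real.
move=> [A1 A2] /= [/nbhs_rnP[d d0 dA] [B [Br BA]]] AH.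
exists d => //; exists (B + 1) => v t vd ts.
have [|u tE] := @ee_surj R t; first by rewrite -rn_gt0 ts.
have iE : Im u = y.
 move: ts; rewrite tE rn_ee => /(congr1 (@ln R)); rewrite expRK => E.
 by rewrite /y -E opprK mulrAC divff ?mul1r // gt_eqF.
pose n := Num.floor (Re u).
have /andP[h1 h2] : n%:~R <= Re u < (n + 1)%:~R by rewrite floor_le_tmp /= floorD1_gt.
have -> : t = ee ((Re u - n%:~R) +i* y).
 rewrite tE; have {1}-> : u = ((Re u - n%:~R) +i* y) + n%:~R.
  rewrite -(rmorph_int (real_complex R)) -iE; apply/eqP.
  by rewrite eq_complex /= subrK addr0 !eqxx.
 by rewrite eeD ee_int mulr1.
have := AH (v, B + 1) => /= /(_ _)/(_ _); apply; last by rewrite /= in_itv /=; rewrite intrD in h2; lra.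
by split; [exact: dA|apply: BA; lra].
Qed.

(* The j-th coefficient is a locally uniform limit of difference quotients. *)
Lemma tc_param (V : normedModType C) (F : V -> C -> C) (p : V) (rho s M : R) : 0 < rho -> 0 < s ->
 (forall v, rn (v - p) < rho -> cdisc (F v) (2 * s)) ->
 (forall v t, rn (v - p) < rho -> rn t < 2 * s -> dff ((fun u => F u t) : V -> C^o) v) ->
 (forall v t, rn (v - p) < rho -> rn t = s -> rn (F v t) <= M) ->
 forall j, dff ((fun v => tc (F v) j) : V -> C^o) p.
Proof.
move=> rho0 s0 Fd Fv FM.
suff H j : forall v, rn (v - p) < rho -> dff ((fun u => tc (F u) j) : V -> C^o) v.
 by move=> j; apply: H; rewrite subrr rn0.
have [m] := ubnP j; elim: m j => // m IH j jm p' p'r.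
have r'0 : 0 < rho - rn (p' - p) by rewrite subr_gt0.
have inb v : rn (v - p') < rho - rn (p' - p) -> rn (v - p) < rho.
 have -> : v - p = (v - p') + (p' - p) by rewrite addrA subrK. by have := rnD (v - p') (p' - p); lra.
have pp : rn (p - p) < rho by rewrite subrr rn0.
have M0 : 0 <= M.
 have sn : rn (s%:C) = s by rewrite rn_real gtr0_norm. by apply: le_trans (FM p s%:C pp sn); exact: rn_ge0.
pose t (n : nat) : R := s / 2 / n.+1%:R.
have t0 n : 0 < t n by rewrite !divr_gt0.
have tn n : rn ((t n)%:C) = t n by rewrite rn_real gtr0_norm.
have ts n : t n <= s / 2 by rewrite ler_pdivrMr // ler_pMr ?divr_gt0 // ler1n.
have tt n : rn ((t n)%:C) < 2 * s by rewrite tn; have := ts n; lra.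
pose fn n (v : V) : C^o := (F v (t n)%:C - \sum_(i < j) tc (F v) i * (t n)%:C ^+ i) / (t n)%:C ^+ j.
have ss : 0 < s < 2 * s by lra.
have err n v : rn (v - p) < rho -> rn (fn n v - tc (F v) j) <= 4 * M / s ^+ j.+1 * t n.
 move=> vp; have := @tc_rem _ (F v) (2 * s) s M j.+1 (t n)%:C (Fd v vp) ss.
 rewrite tn => H; have {}H := H (fun w => FM v w vp) (ts n).
 have tj : (t n)%:C ^+ j != 0 by rewrite expf_neq0 // -rn_gt0 tn.
 have -> : fn n v - tc (F v) j = (F v (t n)%:C - \sum_(r < j.+1) tc (F v) r * (t n)%:C ^+ r) / (t n)%:C ^+ j.
  by rewrite /fn big_ord_recr /= opprD addrA [RHS]mulrBl mulfK.
 rewrite rnM rnV rnX tn ler_pdivrMr ?exprn_gt0 //; apply: le_trans H _.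
 by rewrite expr_div_n exprS le_eqVlt; apply/orP; left; apply/eqP; ring.
have sj : 0 < s ^+ j.+1 by rewrite exprn_gt0.
apply: (@uniform_limit_differentiable V fn _ p' (rho - rn (p' - p)) (4 * M / s ^+ j.+1 * s + 2 * M / s ^+ j)) => [//|||].
- move=> n v /inb vp; apply: dfM; last exact: dfcst.
 apply: dfB; first exact: Fv.
 apply: df_sum => i _; apply: dfM; last exact: dfcst.
 by apply: IH => //; apply: leq_trans (ltn_ord i) _.
- move=> n v /inb vp.
 have -> : fn n v = (fn n v - tc (F v) j) + tc (F v) j by rewrite subrK.
 apply: le_trans (rnD _ _) _; apply: lerD.
  apply: le_trans (err n v vp) _; rewrite ler_wpM2l // ?divr_ge0 ?mulr_ge0 // ?ltW //.
  by have := ts n; lra.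
 by rewrite ler_pdivlMr ?exprn_gt0 //; apply: (tc_le _ (Fd v vp)) => // w; exact: FM.
- move=> e e0; pose K := 4 * M / s ^+ j.+1.
 have K0 : 0 <= K by rewrite divr_ge0 ?mulr_ge0 // ltW.
 have [N NH] : exists N : nat, K * s / e < N%:R.
  by exists (Num.Def.archi_bound (K * s / e)); apply: archi_boundP; exact: divr_ge0 (mulr_ge0 K0 (ltW s0)) (ltW e0).
 exists N => n v nN /inb vp; apply: le_trans (err n v vp) _; rewrite -/K.
 have n1 : N%:R <= n.+1%:R :> R by rewrite ler_nat leqW.
 rewrite /t mulrA ler_pdivrMr //; rewrite ltr_pdivrMr // in NH.
 have : 0 <= K * s by rewrite mulr_ge0 // ltW.
 have : N%:R * e <= n.+1%:R * e by rewrite ler_pM2r.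
 lra.
Qed.

Lemma deriv_holo (g : C -> C) (p : C) (rho : R) : 0 < rho -> (forall w, rn (w - p) < rho -> cdf g w) ->
 cdf (fun w => tc (fun t => g (w + t)) 1) p.
Proof.
move=> r0 gd; pose s := rho / 4; have s0 : 0 < s by rewrite divr_gt0.
have s2 : 0 < rho / 2 by rewrite divr_gt0.
have gs (v t : C) : rn (v - p) < rho / 2 -> rn t < 2 * s -> cdf g (v + t).
 move=> vp ts; apply: gd; rewrite addrAC; apply: le_lt_trans (rnD _ _) _.
 by rewrite /s in ts; lra.
have dsh (v t : C) : rn (v - p) < rho / 2 -> rn t < 2 * s ->
  cdf (fun u => g (u + t)) v /\ cdf (fun u => g (v + u)) t.
 move=> vp ts; split.
  by dfc g; exact: gs.
 by dfc g; exact: gs.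
have [|d d0 [B BH]] := @tube_bound C^o (fun v t => g (v + t)) p s s0.
 move=> t ts; have gc : contat g (p + t).
  by apply: contat_df; apply: gs; rewrite ?subrr ?rn0 // ts; lra.
 have [d d0 dH] := gc 1 ltr01; exists (d / 2); first by rewrite divr_gt0.
 exists (rn (g (p + t)) + 1) => v t' h1 h2.
 have : rn (g (v + t') - g (p + t)) < 1.
  apply: dH; rewrite opprD addrACA; apply: le_lt_trans (rnD _ _) _; lra.
 by have := rnBl (g (v + t')) (g (p + t)); lra.
apply: (@tc_param C^o (fun v t => g (v + t)) p (Num.min d (rho / 2)) s B) => //.
- by rewrite lt_min d0.
- move=> v; rewrite lt_min => /andP[_ vp]; split; first by rewrite mulr_gt0.
 by move=> w ws; exact: (dsh v w vp ws).2.
- by move=> v t; rewrite lt_min => /andP[_ vp] ts; exact: (dsh v t vp ts).1.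
- by move=> v t; rewrite lt_min => /andP[vd _]; exact: BH.
Qed.

End Limits.

(** * Maximum principle, identity theorem, orders of zeros and division *)

Section Plane.
Variable R : realType.
Notation C := R[i].
Notation cdf g w := (dff (g : C^o -> C^o) (w : C^o)).

Lemma cont_punct (u v : C -> C) (p : C) (rho : R) : 0 < rho -> contat u p -> contat v p ->
 (forall w, 0 < rn (w - p) < rho -> u w = v w) -> u p = v p.
Proof.
move=> r0 cu cv uv; apply: rn_small_eq => e e0; have e2 : 0 < e / 2 by rewrite divr_gt0.
have [d1 d10 H1] := cu _ e2; have [d2 d20 H2] := cv _ e2.
pose m := Num.min rho (Num.min d1 d2).
have m0 : 0 < m by rewrite !lt_min r0 d10 d20.
pose w := p + (m / 2)%:C; have wp : rn (w - p) = m / 2.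
 by rewrite /w addrC addKr rn_real ger0_norm // divr_ge0 // ltW.
have wm : rn (w - p) < m by rewrite wp ltr_pdivrMr // ltr_pMr // ltr1n.
have := wm; rewrite !lt_min => /and3P[w1 w2 w3].
have w0 : 0 < rn (w - p) by rewrite wp divr_gt0.
have := H1 w w2; have := H2 w w3; rewrite uv ?w0 //.
have -> : u p - v p = (v w - v p) - (v w - u p) by ring.
by have := rnB (v w - v p) (v w - u p); move: (rn _) (rn _) (rn _) => a b c; lra.
Qed.

(** A constant factor disappears from an estimate valid for all powers. *)
Lemma pow_bound_le (x M K : R) : 0 <= x -> 0 <= M -> (forall n : nat, x ^+ n.+1 <= K * M ^+ n.+1) -> x <= M.
Proof.
move=> x0 M0 H; rewrite leNgt; apply/negP => Mx.
have [M00|Mn] := eqVneq M 0. by have := H 0%N; rewrite M00 expr1 expr0n /= mulr0 in Mx *; rewrite leNgt Mx.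
have Mp : 0 < M by rewrite lt_def Mn.
pose y := M / x; have xp : 0 < x by exact: lt_trans Mx.
have y01 : 0 <= y < 1 by rewrite divr_ge0 //= ltr_pdivrMr // mul1r.
have [N NH] := geom_tail K y01 ltr01.
have := H N; have := NH N.+1 (leqnSn N).
rewrite /y expr_div_n mulrA ltr_pdivrMr ?exprn_gt0 // mul1r => h1 h2.
by move: (le_lt_trans h2 h1); rewrite ltxx.
Qed.

Section HalfPlane.
Variables (g : C -> C) (Y0 : R).
Hypothesis gd : forall w, Y0 < Im w -> cdf g w.
Hypothesis gper : forall w, Y0 < Im w -> g (w + 1) = g w.
Hypothesis gbdd : exists Y B : R, forall w, Y <= Im w -> rn (g w) <= B.

Lemma half_plane_expand : exists a : nat -> C,
 (forall y M r, Y0 < y -> (forall x, 0 <= x <= 1 -> rn (g (x +i* y)) <= M) ->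
   rn (a r) * expR (- (2 * pi * y)) ^+ r <= 2 * M) /\ (forall tau, Y0 < Im tau -> psum a (ee tau) (g tau)).
Proof.
apply: fourier_expand gper gbdd => w /gd H; exact/differentiable_deriv.
Qed.

Lemma gper_int (n : int) w : Y0 < Im w -> g (w + n%:~R) = g w.
Proof.
have per (m : nat) v : Y0 < Im v -> g (v + m%:R) = g v.
 elim: m => [|m IH] Yw; first by rewrite addr0.
 by rewrite -natr1 addrA gper ?IH // cImD -(rmorph_nat (real_complex R)) /= addr0.
move=> Yw; case: n => m; first exact: per.
rewrite NegzE rmorphN /= -[g (w - _)](per m.+1) ?subrK //.
by rewrite cImB -[m.+1%:~R]/(m.+1%:R) -(rmorph_nat (real_complex R)) /= subr0.
Qed.

Lemma gper_cover (P : R -> Prop) (x0 y : R) : Y0 < y ->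
 (forall x, x0 <= x <= x0 + 1 -> rn (g (x +i* y)) = 0) -> forall x, rn (g (x +i* y)) = 0.
Proof.
move=> Yy H x; pose n := Num.floor (x - x0).
have /andP[h1 h2] : n%:~R <= x - x0 < (n + 1)%:~R by rewrite floor_le_tmp /= floorD1_gt.
have -> : x +i* y = ((x - n%:~R) +i* y) + n%:~R.
 by rewrite -(rmorph_int (real_complex R)); apply/eqP; rewrite eq_complex /= subrK addr0 !eqxx.
by rewrite gper_int // H // ; rewrite intrD in h2; lra.
Qed.

End HalfPlane.

(** The coefficient bounds give |g| <= K M above the line, with K independent of g. Applied to the
    powers of g, this yields K = 1 by [pow_bound_le]. *)
Lemma maxmod g (Y0 y1 M : R) : (forall w, Y0 < Im w -> cdf g w) -> (forall w, Y0 < Im w -> g (w + 1) = g w) ->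
 (exists Y B : R, forall w, Y <= Im w -> rn (g w) <= B) ->
 Y0 < y1 -> (forall x, 0 <= x <= 1 -> rn (g (x +i* y1)) <= M) -> forall tau, y1 < Im tau -> rn (g tau) <= M.
Proof.
move=> gd gper [Y [B gB]] Yy gM tau ty.
have M0 : 0 <= M by apply: le_trans (gM 0 _); rewrite ?rn_ge0 // lexx ler01.
pose rho := expR (- (2 * pi * y1)); have rho0 : 0 < rho by exact: expR_gt0.
have trho : rn (ee tau) < rho.
 rewrite rn_ee /rho ltr_expR ltrN2 ltr_pM2l // mulr_gt0 //; exact: pi_gt0.
apply: (@pow_bound_le _ _ (2 / (1 - rn (ee tau) / rho))); rewrite ?rn_ge0 // => n.
have [|||a [ab ap]] := @half_plane_expand (fun w => g w ^+ n.+1) Y0.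
- by move=> w /gd H; apply: dfX.
- by move=> w Yw; rewrite gper.
- exists Y, (B ^+ n.+1) => w /gB H; rewrite rnX lerXn2r ?nnegrE ?rn_ge0 //.
 exact: le_trans (rn_ge0 _) H.
have aM r : rn (a r) * rho ^+ r <= 2 * M ^+ n.+1.
 apply: ab => // x xx; rewrite rnX lerXn2r ?nnegrE ?rn_ge0 //; exact: gM.
have := psum_tail rho0 aM trho (ap tau (lt_trans Yy ty)) 0.
rewrite big_ord0 sub0r rnN rnX expr0 mulr1 => /le_trans; apply.
by rewrite le_eqVlt; apply/orP; left; apply/eqP; ring.
Qed.

Lemma zero_disc (g : C -> C) (p : C) (rho d : R) :
 (forall w, rn (w - p) < rho -> cdf g w) -> 0 < rho -> 0 < d ->
 (forall w, rn (w - p) < d -> g w = 0) -> forall w, rn (w - p) < rho -> g w = 0.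
Proof.
move=> gd r0 d0 g0 w wr.
have gD : cdisc (fun t => g (p + t)) rho.
 split=> [//|t tr].
 by dfc g; apply: gd; rewrite [p + t]addrC addrK.
have := tc_eq0 gD _ wr; rewrite [p + _]addrC subrK; apply => r.
have -> // : tc (fun t => g (p + t)) = fun=> 0.
apply: (@tc_psum _ _ _ d) => // t td e e0; exists 0%N => n _.
rewrite g0 ?subr0; last by rewrite [p + t]addrC addrK.
by rewrite big1 ?rn0 // => i _; rewrite mul0r.
Qed.

Lemma identity_H (g : C -> C) (tau0 : C) (d : R) : (forall w, 0 < Im w -> cdf g w) ->
 (forall w, 0 < Im w -> g (w + 1) = g w) -> (exists Y B : R, forall w, Y <= Im w -> rn (g w) <= B) ->
 0 < Im tau0 -> 0 < d -> (forall w, rn (w - tau0) < d -> g w = 0) -> forall w, 0 < Im w -> g w = 0.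
Proof.
move=> gd gper gbdd t0 d0 g0.
have gball p : 0 < Im p -> forall w, rn (w - p) < Im p -> cdf g w.
 move=> p0 w wp; apply: gd; have := Im_le_rn (w - p); rewrite cImB ler_norml; lra.
(* Vanishing is carried upwards through discs: the disc around p k of radius Im (p k) contains a
   smaller one around p k.+1. Once the radius exceeds 1, the disc contains a full period of a
   horizontal line, which makes all Fourier coefficients zero. *)
pose p (k : nat) : C := Re tau0 +i* (Im tau0 * (3 / 2) ^+ k).
have p0 k : 0 < Im (p k) by rewrite /= mulr_gt0 // exprn_gt0.
have step k : exists2 d' : R, 0 < d' & forall w, rn (w - p k) < d' -> g w = 0.
 elim: k => [|k [d' d'0 IH]].
  by exists d => //; rewrite /p expr0 mulr1; case: (tau0) g0.
 have z := zero_disc (gball _ (p0 k)) (p0 k) d'0 IH.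
 exists (Im (p k) / 4); first by rewrite divr_gt0.
 move=> w wp; apply: z.
 have -> : w - p k = (w - p k.+1) + (p k.+1 - p k) by rewrite addrA subrK.
 apply: le_lt_trans (rnD _ _) _.
 have -> : p k.+1 - p k = 'i * (Im (p k) / 2)%:C.
  by apply/eqP; rewrite eq_complex /= exprS; apply/andP; split; apply/eqP; field.
 rewrite rnM rn_i mul1r rn_real gtr0_norm ?divr_gt0 //.
 move: (Im (p k)) (p0 k) wp => y y0 wp; lra.
have [k k1] : exists k, 1 < Im (p k).
 have q01 : 0 <= (2 / 3 : R) < 1 by lra.
 have [k kH] := geom_tail 1 q01 t0; exists k; have := kH k (leqnn k).
 rewrite mul1r /p /=; have -> : (2 / 3 : R) = (3 / 2)^-1 by field.
 by rewrite exprVn -[X in X < _]mul1r ltr_pdivrMr ?exprn_gt0.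
have [d' d'0 gk] := step k; have z := zero_disc (gball _ (p0 k)) (p0 k) d'0 gk.
have z2 : forall x, rn (g (x +i* Im (p k))) = 0.
 apply: (@gper_cover g 0 gper xpredT (Re tau0 - 1 / 2)) => // x xx.
 rewrite z ?rn0 //; have -> : (x +i* Im (p k)) - p k = (x - Re tau0)%:C.
  by apply/eqP; rewrite eq_complex /= subrr !eqxx.
 rewrite rn_real; apply: le_lt_trans k1; rewrite ler_norml; lra.
have [a [ab ap]] := half_plane_expand gd gper gbdd.
have a0 r : a r = 0.
 have := ab (Im (p k)) 0 r (p0 k) _; rewrite mulr0 => H.
 have {}H : rn (a r) * expR (- (2 * pi * Im (p k))) ^+ r <= 0 by apply: H => x _; rewrite z2.
 apply/eqP; rewrite -rn_eq0; apply/eqP/le_anti; rewrite rn_ge0 andbT.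
 by move: H; rewrite pmulr_lle0 // exprn_gt0 // expR_gt0.
move=> w w0; apply: (psum_unique (ap w w0)) => e e0; exists 0%N => n _.
by rewrite big1 ?subrr ?rn0 // => i _; rewrite a0 mul0r.
Qed.

Lemma finite_order (g : C -> C) (p : C) (rho : R) : 0 < rho -> (forall w, rn (w - p) < rho -> cdf g w) ->
 ~ (forall w, rn (w - p) < rho -> g w = 0) -> exists n, exists2 h, cdisc h rho & h 0 != 0 /\
  forall w, rn w < rho -> g (p + w) = w ^+ n * h w.
Proof.
move=> r0 gd gn.
have gD : cdisc (fun t => g (p + t)) rho.
 split=> [//|t tr].
 by dfc g; apply: gd; rewrite [p + t]addrC addrK.
have ex : exists n, tc (fun t => g (p + t)) n != 0.
 apply: contrapT => H; apply: gn => w wr.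
 have := tc_eq0 gD _ wr; rewrite [p + _]addrC subrK; apply => r.
 by apply/eqP; apply: contrapT => /negP Hr; apply: H; exists r.
have [n nz mn] := ex_minnP ex.
have [i ilt|h hd [hE h0]] := order_split (n := n) gD.
 by apply/eqP; apply: contraTT ilt => /mn; rewrite leqNgt.
by exists n, h => //; rewrite h0.
Qed.

Lemma isolated_zero (g : C -> C) (p : C) (rho : R) : 0 < rho -> (forall w, rn (w - p) < rho -> cdf g w) ->
 ~ (forall w, rn (w - p) < rho -> g w = 0) -> exists2 d : R, 0 < d & forall w, 0 < rn (w - p) < d -> g w != 0.
Proof.
move=> r0 gd gn; have [n [h hd [h0 hE]]] := finite_order r0 gd gn.
have hc : contat h 0 by apply: contat_df; case: hd => _; apply; rewrite rn0.
have hp : 0 < rn (h 0) by rewrite rn_gt0.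
have [d d0 dH] := hc _ hp.
exists (Num.min d rho); first by rewrite lt_min d0.
move=> w /andP[w0]; rewrite lt_min => /andP[wd wr].
have -> : w = p + (w - p) by rewrite addrC subrK.
rewrite hE // mulf_neq0 ?expf_neq0 -?rn_gt0 //.
have := dH (w - p); rewrite subr0 => /(_ wd); have := rnBl (h 0) (h (w - p)); rewrite rnC; lra.
Qed.

Lemma rn_pair (V W : normedModType C) (p : V * W) : rn p = Num.max (rn p.1) (rn p.2).
Proof.
apply: (@complexI R); rewrite -rnE prod_normE /= !rnE.
case: (leP (rn p.1) (rn p.2)) => h; first by rewrite max_r // lecR.
by rewrite max_l // lecR ltW.
Qed.

Lemma rn_fst_le (V W : normedModType C) (p : V * W) : rn p.1 <= rn p.
Proof. by rewrite rn_pair le_max lexx. Qed.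

Lemma rn_snd_le (V W : normedModType C) (p : V * W) : rn p.2 <= rn p.
Proof. by rewrite rn_pair le_max lexx orbT. Qed.

Lemma geom_scale (A x s : R) j : A / s ^+ j.+1 * x ^+ j = A / s * (x / s) ^+ j.
Proof. by rewrite exprS invfM expr_div_n !mulrA mulrAC. Qed.

Section Division.
Variable V : normedModType C.

(** On the slice t = tau0 the quotient is the first Taylor coefficient in t. Differentiability
    across the slice holds because the quotient is the uniform limit of the shifted Taylor
    polynomials [fn], whose coefficients are differentiable in z by [tc_param]. *)
Lemma divide_linear (K : C^o * V -> C^o) (tau0 : C) (rho : R) : 0 < rho ->
 (forall p : C^o * V, rn (p.1 - tau0) < rho -> dff K p) -> (forall z, K (tau0, z) = 0) ->
 exists2 K' : C^o * V -> C^o, (forall p : C^o * V, rn (p.1 - tau0) < rho -> dff K' p) &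
  forall p : C^o * V, K p = (p.1 - tau0) * K' p.
Proof.
move=> r0 Kd K0.
(* The expansion point is tau0 for every q, so F q depends on q only through its z-component and
   vanishes at t = 0. *)
pose F (q : C^o * V) (t : C) : C := K (tau0 + t, q.2).
pose K' (q : C^o * V) : C^o := if q.1 == tau0 then tc (F q) 1 else K q / (q.1 - tau0).
have KE q : K q = (q.1 - tau0) * K' q.
 rewrite /K'; case: eqVneq => [E|ne]; first by rewrite E subrr mul0r; case: q E => [a z] /= ->.
 by rewrite mulrC divfK // subr_eq0.
exists K' => // -[t z] /= tr.
have [tE|tne] := eqVneq t tau0; last first.
 have d0 : 0 < rn (t - tau0) by rewrite rn_gt0 subr_eq0.
 apply: (@differentiable_local _ _ _ (fun q : C^o * V => K q * (q.1 - tau0)^-1 : C^o) _ _ _ d0).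
  move=> q qd; rewrite /K'; case: eqVneq => // qE.
  by have := le_lt_trans (rn_fst_le (q - (t, z))) qd; rewrite /= qE rnC ltxx.
 by dfs; [exact: Kd|rewrite subr_eq0].
rewrite tE {t tr tE}.
pose s := rho / 4; have s0 : 0 < s by rewrite divr_gt0.
have Kc (t : C) z' : rn t < rho -> dff K ((tau0 + t, z') : C^o * V).
 by move=> tr; apply: Kd; rewrite /= [tau0 + t]addrC addrK.
have Fd q : cdisc (F q) (2 * s).
 split => [|t ts]; first by rewrite mulr_gt0.
 rewrite /F; dfc K.
 by apply: Kc; rewrite /s in ts; lra.
have Fv (q : C^o * V) t : rn t < 2 * s -> dff ((fun u => F u t) : C^o * V -> C^o) q.
 move=> ts; rewrite /F; dfc K.
 by apply: Kc; rewrite /s in ts; lra.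
have [|d d0 [M MH]] := @tube_bound R (C^o * V)%type F (tau0, z) s s0.
 move=> t ts; have /differentiable_continuous/continuous_rnP/(_ 1 ltr01)[d d0 dH] : dff K ((tau0 + t, z) : C^o * V).
  by apply: Kc; rewrite ts /s; lra.
 exists d => //; exists (rn (K (tau0 + t, z)) + 1) => v t' h1 h2.
 have : rn (K (tau0 + t', v.2) - K (tau0 + t, z)) < 1.
  apply: dH; rewrite rn_pair /= gt_max opprD addrACA subrr add0r h2 /=.
  exact: le_lt_trans (rn_snd_le (v - (tau0, z))) h1.
 by rewrite /F; have := rnBl (K (tau0 + t', v.2)) (K (tau0 + t, z)); lra.
have pp : rn ((tau0, z) - (tau0, z) : C^o * V) < d by rewrite subrr rn0.
have M0 : 0 <= M.
 have sn : rn (s%:C) = s by rewrite rn_real gtr0_norm. by apply: le_trans (MH _ s%:C pp sn); exact: rn_ge0.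
have ss : 0 < s < 2 * s by lra.
have tcd j (q : C^o * V) : rn (q - (tau0, z)) < d -> dff ((fun u => tc (F u) j) : C^o * V -> C^o) q.
 move=> qd; apply: (@tc_param R _ F q (d - rn (q - (tau0, z))) s M) => //.
 - by rewrite subr_gt0.
 - by move=> v t _; exact: Fv.
 move=> v t vq; apply: MH; have -> : v - (tau0, z) = (v - q) + (q - (tau0, z)) by rewrite addrA subrK.
 by have h := rnD (v - q) (q - (tau0, z)); clear -h vq; lra.
have tcb j (q : C^o * V) : rn (q - (tau0, z)) < d -> rn (tc (F q) j) <= 2 * M / s ^+ j.
 move=> qd; rewrite ler_pdivlMr ?exprn_gt0 //; apply: (tc_le _ (Fd q)) => // w; exact: MH.
pose fn (N : nat) (q : C^o * V) : C^o := \sum_(r < N) tc (F q) r.+1 * (q.1 - tau0) ^+ r.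
pose d1 := Num.min d (s / 2).
have d10 : 0 < d1 by rewrite lt_min d0 divr_gt0.
have inb (q : C^o * V) : rn (q - (tau0, z)) < d1 -> rn (q - (tau0, z)) < d /\ rn (q.1 - tau0) < s / 2.
 rewrite lt_min => /andP[h1 h2]; split => //.
 exact: le_lt_trans (rn_fst_le (q - (tau0, z))) h2.
clearbody d1.
have Ms : 0 <= 4 * M / s by rewrite divr_ge0 ?mulr_ge0 // ltW.
have hs (j : nat) (x : R) : 0 <= x <= s / 2 -> 2 * M / s ^+ j.+1 * x ^+ j <= 2 * M / s * (1 / 2) ^+ j.
 move=> /andP[x0 x1].
 have -> : 2 * M / s ^+ j.+1 * x ^+ j = 2 * M / s * (x / s) ^+ j.
  exact: geom_scale.
 apply: ler_wpM2l; first by apply: divr_ge0; [apply: mulr_ge0|exact: ltW].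
 have xs0 : 0 <= x / s by apply: divr_ge0 => //; exact: ltW.
 have xs : x / s <= 1 / 2 by rewrite ler_pdivrMr //; lra. by apply: lerXn2r => //; rewrite nnegrE // divr_ge0.
have half01 : 0 <= (1 / 2 : R) < 1 by lra.
apply: (@uniform_limit_differentiable R _ fn K' (tau0, z) d1 (4 * M / s)) => [//|||].
- move=> N q /inb[qd _]; apply: df_sum => i _.
 by dfs; exact: tcd.
- move=> N q /inb[qd qs]; apply: le_trans (rn_sum _ _ _) _.
 have bnd (i : 'I_N) : rn (tc (F q) i.+1 * (q.1 - tau0) ^+ i) <= 2 * M / s * (1 / 2) ^+ i.
  have hx : 0 <= rn (q.1 - tau0) <= s / 2 by rewrite rn_ge0 ltW.
  rewrite rnM rnX; apply: le_trans (hs i _ hx).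
  by rewrite ler_wpM2r ?exprn_ge0 ?rn_ge0 // tcb.
 apply: le_trans (ler_sum _ (fun i _ => bnd i)) _; rewrite -mulr_sumr.
 have := @geom_sum_le R (1 / 2) 0 N half01 (leq0n N); rewrite big_mkord expr0 => H.
 have H2 : \sum_(i < N) (1 / 2 : R) ^+ i <= 2 by apply: le_trans H _; rewrite ler_pdivrMr; lra.
 have := ler_wpM2l (divr_ge0 (mulr_ge0 (ler0n R 2) M0) (ltW s0)) H2; lra.
- move=> e e0; have [N NH] := geom_tail (4 * M / s) half01 e0.
 exists N => n q nN /inb[qd qs]; apply: le_trans (ltW (NH n nN)).
 pose w := q.1 - tau0.
 have F0 : tc (F q) 0 = 0 by rewrite (tc_0 (Fd q)) /F addr0 K0.
 rewrite /K'; case: eqVneq => [qE|qne].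
  rewrite /fn qE subrr; case: n nN => [|n] nN.
   rewrite big_ord0 sub0r rnN expr0 mulr1; apply: le_trans (tcb 1%N q qd) _; rewrite expr1.
   by rewrite ler_pM2r ?invr_gt0 //; lra.
  rewrite big_ord_recl expr0 mulr1 big1 => [|i _]; last by rewrite expr0n /= mulr0.
  by rewrite addr0 subrr rn0 mulr_ge0 // exprn_ge0.
 have w0 : w != 0 by rewrite subr_eq0.
 have wp : 0 < rn w by rewrite rn_gt0.
 have KF : K q = F q w. by rewrite /F /w addrC subrK; case: (q).
 have := @tc_rem R (F q) (2 * s) s M n.+1 w (Fd q) ss (fun v => MH q v qd) (ltW qs).
 rewrite -KF big_ord_recl F0 mul0r add0r => H.
 have -> : fn n q - K q / (q.1 - tau0) = - (K q - \sum_(i < n) tc (F q) (bump 0 i) * w ^+ bump 0 i) / w.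
  rewrite opprB mulrBl; congr (_ - _); rewrite /fn mulr_suml; apply: eq_bigr => i _.
  by rewrite /bump /= add1n exprSr mulrA mulfK.
 rewrite rnM rnN rnV ler_pdivrMr //; apply: le_trans H _.
 have ws : rn w / s <= 1 / 2 by rewrite ler_pdivrMr //; rewrite /w; lra.
 have w1 : 0 <= rn w / s by rewrite divr_ge0 ?rn_ge0 // ltW.
 have -> : 4 * M / s * (1 / 2) ^+ n * rn w = 4 * M * ((1 / 2) ^+ n * (rn w / s)) by ring.
 rewrite exprSr ler_wpM2l ?mulr_ge0 // ler_wpM2r //.
 by rewrite lerXn2r ?nnegrE //; lra.
Qed.

End Division.
End Plane.

(** * Convergent power series and the q-series of Eisenstein series *)

Section Series.
Variable R : realType.
Notation C := R[i].

Lemma tcM (g h : C -> C) rho n : cdisc g rho -> cdisc h rho ->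
 tc (fun w => g w * h w) n = \sum_(i < n.+1) tc g i * tc h (n - i).
Proof.
move=> gd hd.
have H := has_approxM (tc_approx n.+1 gd) (tc_approx n.+1 hd).
rewrite (tc_unique (cdiscM gd hd) H (ltnSn n)) coefM; apply: eq_bigr => i _.
by rewrite !coef_poly ltn_ord ltnS leq_subr.
Qed.

Lemma tc_limit (fn : nat -> C -> C) (f : C -> C) (rho s : R) j :
 (forall n, cdisc (fn n) rho) -> cdisc f rho -> 0 < s < rho ->
 (forall e : R, 0 < e -> exists N, forall n w, (N <= n)%N -> rn w = s -> rn (fn n w - f w) <= e) ->
 forall e : R, 0 < e -> exists N, forall n, (N <= n)%N -> rn (tc (fn n) j - tc f j) <= e.
Proof.
move=> fd gd /andP[s0 sr] fu e e0.
have sj : 0 < s ^+ j by rewrite exprn_gt0.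
have [N NH] := fu _ (divr_gt0 (mulr_gt0 e0 sj) (ltr0n R 2)); exists N => n nN.
have d3 : cdisc (fun w => -1 * f w) rho by exact: cdiscM (cdisc_cst _ gd.1) gd.
have d4 := cdiscD (fd n) d3.
have := @tc_le _ _ _ s (e * s ^+ j / 2) j d4; rewrite s0 sr => /(_ isT).
rewrite (tcD (fd n) d3) (tcZ _ gd) mulN1r => H.
rewrite -(ler_pM2r sj); apply: le_trans (H _) _; last by lra.
by move=> w ws; rewrite mulN1r; apply: NH.
Qed.

Lemma conv_geom (f : nat -> C) (K t : R) n0 : 0 <= K -> 0 <= t < 1 ->
 (forall n, (n0 <= n)%N -> rn (f n) <= K * t ^+ n) ->
 exists l, forall N, (n0 <= N)%N -> rn (\sum_(n < N) f n - l) <= K * t ^+ N / (1 - t).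
Proof.
move=> K0 t01 fK.
have tail N m : (n0 <= N)%N -> (N <= m)%N -> rn (\sum_(n < N) f n - \sum_(n < m) f n) <= K * t ^+ N / (1 - t).
 move=> nN Nm; rewrite -!(big_mkord xpredT f) [X in _ - X](big_cat_nat _ Nm) //=.
 rewrite opprD addrA subrr sub0r rnN; apply: le_trans (rn_sum _ _ _) _.
 have : \sum_(N <= i < m) rn (f i) <= \sum_(N <= i < m) K * t ^+ i.
  rewrite big_nat_cond [leRHS]big_nat_cond; apply: ler_sum => i /andP[/andP[Ni _] _].
  by apply: fK; exact: leq_trans nN Ni.
 by move=> /le_trans; apply; rewrite -mulr_sumr -mulrA ler_wpM2l // geom_sum_le.
have t1 : 0 < 1 - t by case/andP: t01; rewrite subr_gt0.
have [e e0|l lP] := @cauchy_C R (fun N => \sum_(n < N) f n).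
 have [N NH] := geom_tail (K / (1 - t)) t01 (divr_gt0 e0 (ltr0n R 2)).
 exists (maxn n0 N) => n m nN mN.
 have a1 : (n0 <= maxn n0 N)%N by exact: leq_maxl.
 have h1 := tail _ _ a1 nN; have h2 := tail _ _ a1 mN.
 have h3 := NH (maxn n0 N) (leq_maxr _ _); rewrite mulrAC in h3.
 set S := \sum_(i < maxn n0 N) f i in h1 h2.
 have -> : \sum_(i < n) f i - \sum_(i < m) f i = (S - \sum_(i < m) f i) - (S - \sum_(i < n) f i) by ring.
 by apply: le_trans (rnB _ _) _; lra.
exists l => N nN; apply/ler_addgt0Pr => e e0; have [N' NH] := lP e e0.
have h1 := tail N (maxn N N') nN (leq_maxl _ _); have h2 := NH _ (leq_maxr N N').
set S := \sum_(i < maxn N N') f i in h1 h2.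
have -> : \sum_(n < N) f n - l = (\sum_(n < N) f n - S) + (S - l) by ring.
by apply: le_trans (rnD _ _) _; lra.
Qed.

(** Equivalently, the radius of convergence is at least 1. *)
Definition subexp (a : nat -> C) := forall s : R, 0 < s < 1 -> exists M : R, forall r, rn (a r) * s ^+ r <= M.

Lemma pser_exists (a : nat -> C) : subexp a ->
 exists2 S : C -> C, cdisc S 1 & forall w, rn w < 1 -> psum a w (S w).
Proof.
move=> ha.
have key (s : R) : 0 < s < 1 -> exists2 M : R, 0 <= M & forall w, rn w < s ->
  exists l, forall N, rn (\sum_(n < N) a n * w ^+ n - l) <= M * (rn w / s) ^+ N / (1 - rn w / s).
 move=> s01; have [M MH] := ha s s01; have s0 : 0 < s by case/andP: s01.
 have M0 : 0 <= M by apply: le_trans (MH 0%N); rewrite mulr_ge0 ?rn_ge0 // exprn_ge0 // ltW.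
 exists M => // w ws.
 have t01 : 0 <= rn w / s < 1 by rewrite divr_ge0 ?rn_ge0 ?ltW //= ltr_pdivrMr // mul1r.
 have [|l lP] := @conv_geom (fun n => a n * w ^+ n) M (rn w / s) 0 M0 t01.
  move=> n _; rewrite rnM rnX expr_div_n mulrA ler_pdivlMr ?exprn_gt0 //.
  by rewrite mulrAC ler_wpM2r ?exprn_ge0 ?rn_ge0.
 by exists l => N; apply: lP.
have /choice[S SP] : forall w, exists l, rn w < 1 -> psum a w l.
 move=> w; have [w1|w1] := ltP (rn w) 1; last by exists 0.
 have s01 : 0 < (rn w + 1) / 2 < 1 by have := rn_ge0 w; lra.
 have [M M0 MH] := key _ s01.
 have ws : rn w < (rn w + 1) / 2 by lra.
 have [l lP] := MH w ws; exists l => _ e e0.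
 have s0 : 0 < (rn w + 1) / 2 by case/andP: s01.
 have t01 : 0 <= rn w / ((rn w + 1) / 2) < 1 by rewrite divr_ge0 ?rn_ge0 ?ltW //= ltr_pdivrMr // mul1r.
 have [N NH] := geom_tail (M / (1 - rn w / ((rn w + 1) / 2))) t01 e0.
 by exists N => n /NH; apply: le_lt_trans; rewrite mulrAC; exact: lP.
exists S => //; split => // w w1.
pose s := (rn w + 1) / 2; have s01 : 0 < s < 1 by rewrite /s; have := rn_ge0 w; lra.
have [s0 s1] := andP s01.
have [M MH] := ha s s01.
have M0 : 0 <= M by apply: le_trans (MH 0%N); rewrite mulr_ge0 ?rn_ge0 // exprn_ge0 // ltW.
pose t := ((rn w + s) / 2) / s.
have t01 : 0 <= t < 1.
 rewrite /t divr_ge0 //=; [|by have := rn_ge0 w; lra|exact: ltW].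
 by rewrite ltr_pdivrMr // mul1r /s; lra.
have inb v : rn (v - w) < (s - rn w) / 2 -> rn v / s <= t /\ rn v < s.
 move=> vw; have : rn v <= (rn w + s) / 2.
  have -> : v = w + (v - w) by rewrite addrC subrK. by have := rnD w (v - w); lra.
 by move=> h; split; [rewrite ler_pM2r ?invr_gt0|rewrite /s in h *; lra].
have tr v N : rn (v - w) < (s - rn w) / 2 -> rn (\sum_(n < N) a n * v ^+ n - S v) <= M / (1 - t) * t ^+ N.
 move=> /inb[vt vs]; have v1 : rn v < 1 by exact: lt_trans s1.
 have := psum_tail s0 MH vs (SP v v1) N => /le_trans; apply.
 rewrite [leRHS]mulrAC; have [t0 t1] := andP t01; have v0 : 0 <= rn v / s by rewrite divr_ge0 ?rn_ge0 // ltW.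
 apply: ler_pM; rewrite ?mulr_ge0 ?exprn_ge0 ?invr_ge0 ?subr_ge0 //.
 - by apply: le_trans vt _; exact: ltW.
 - by rewrite ler_wpM2l // lerXn2r // nnegrE.
 - by rewrite lef_pV2 ?posrE ?subr_gt0 ?(le_lt_trans vt) // lerD2l lerN2.
have t1 : 0 < 1 - t by case/andP: t01; rewrite subr_gt0.
apply: (@uniform_limit_differentiable R C^o (fun n v => \sum_(i < n) a i * v ^+ i) S w ((s - rn w) / 2) (M / (1 - t))).
- by rewrite /s; lra.
- move=> n v _; apply: df_sum => i _.
 by dfs.
- move=> n v /inb[vt vs]; apply: le_trans (rn_sum _ _ _) _.
 have b (i : 'I_n) : rn (a i * v ^+ i) <= M * t ^+ i.
  rewrite rnM rnX; apply: le_trans (_ : M * (rn v / s) ^+ i <= _).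
   rewrite expr_div_n mulrA ler_pdivlMr ?exprn_gt0 // mulrAC.
   by rewrite ler_wpM2r ?exprn_ge0 ?rn_ge0.
  rewrite ler_wpM2l // lerXn2r // nnegrE ?(andP t01).1 //.
  by rewrite divr_ge0 ?rn_ge0 // ltW.
 apply: le_trans (ler_sum _ (fun i _ => b i)) _; rewrite -mulr_sumr ler_wpM2l //.
 by have := @geom_sum_le R t 0 n t01 (leq0n n); rewrite big_mkord expr0 mul1r.
- move=> e e0; have [N NH] := geom_tail (M / (1 - t)) t01 e0.
 by exists N => n v nN vw; apply: le_trans (tr v n vw) (ltW (NH n nN)).
Qed.

(** Induction on p with s replaced by its square root r: the extra factor m r^m is at most the
    geometric sum of r^i for i < m, hence at most 1 / (1 - r). *)
Lemma nat_pow_geom (p : nat) (s : R) : 0 < s < 1 -> exists M : R, forall m : nat, m%:R ^+ p * s ^+ m <= M.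
Proof.
elim: p s => [|p IH] s /andP[s0 s1].
 by exists 1 => m; rewrite expr0 mul1r exprn_ile1 // ltW.
have r0 : 0 < Num.sqrt s by rewrite sqrtr_gt0.
have r1 : Num.sqrt s < 1 by rewrite -sqrtr1 ltr_sqrt.
have [|M MH] := IH (Num.sqrt s); first by rewrite r0.
exists (1 / (1 - Num.sqrt s) * M) => m.
have -> : s ^+ m = Num.sqrt s ^+ m * Num.sqrt s ^+ m. by rewrite -exprMn -expr2 sqr_sqrtr // ltW.
have e0 : 0 <= Num.sqrt s ^+ m by rewrite exprn_ge0 // ltW.
rewrite exprS mulrACA; apply: ler_pM; [by rewrite mulr_ge0|by rewrite mulr_ge0 // exprn_ge0| |exact: MH].
have t01 : 0 <= Num.sqrt s < 1 by rewrite ltW.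
apply: le_trans (_ : \sum_(0 <= r < m) Num.sqrt s ^+ r <= _); last first.
 by have := geom_sum_le t01 (leq0n m); rewrite expr0.
rewrite big_mkord mulr_natl -[X in _ *+ X]card_ord -sumr_const; apply: ler_sum => i _.
by apply: ler_wiXn2l; [exact: ltW|exact: ltW|exact: ltnW (ltn_ord i)].
Qed.

Lemma divisor_sigma_le l m : (divisor_sigma l m.+1 <= m.+1 * m.+1 ^ l)%N.
Proof.
rewrite /divisor_sigma.
apply: leq_trans (_ : \sum_(d <- divisors m.+1) m.+1 ^ l <= _)%N.
 rewrite big_seq [X in (_ <= X)%N]big_seq; apply: leq_sum => d; rewrite -dvdn_divisors // => dm.
 by case: l => [|l]; rewrite ?expn0 // leq_exp2r // dvdn_leq.
rewrite big_const_seq count_predT iter_addn_0 mulnC leq_mul2r; apply/orP; right.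
rewrite -[X in (_ <= X)%N](size_iota 1); apply: uniq_leq_size (divisors_uniq _) _ => d.
rewrite -dvdn_divisors // => dm; rewrite mem_iota add1n ltnS (dvdn_leq _ dm) // andbT.
exact: dvdn_gt0 dm.
Qed.

Definition sigq (l : nat) (m : nat) : C := if m is m'.+1 then (divisor_sigma l m)%:R else 0.

Lemma sigq_subexp l : subexp (sigq l).
Proof.
move=> s s01; have [M MH] := nat_pow_geom l.+1 s01; exists M => -[|m] /=.
 by apply: le_trans (MH 0%N); rewrite rn0 mul0r expr0n /= mul0r.
apply: le_trans (MH m.+1); case/andP: s01 => s0 _.
apply: ler_wpM2r; first by rewrite exprn_ge0 // ltW.
by rewrite rn_nat exprS -natrX -natrM ler_nat divisor_sigma_le.
Qed.

Definition sigser (l : nat) : C -> C := sval (cid2 (pser_exists (sigq_subexp l))).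
Lemma sigser_disc l : cdisc (sigser l) 1.
Proof. by rewrite /sigser; case: cid2. Qed.
Lemma sigser_psum l w : rn w < 1 -> psum (sigq l) w (sigser l w).
Proof. by rewrite /sigser; case: cid2 => S _ H /=; exact: H. Qed.

Lemma rn_q (tau : C) : 0 < Im tau -> rn (ee tau) < 1.
Proof. by move=> t0; rewrite rn_ee expR_lt1 oppr_lt0 mulr_gt0 // mulr_gt0 // pi_gt0. Qed.

Lemma eisensteinE (c : C) l (tau : uhp R) : eisenstein c l tau = 1 + c * sigser l (ee (val tau)).
Proof.
rewrite /eisenstein; congr (1 + c * _).
have h : series (fun m => (divisor_sigma l m.+1)%:R * qpar tau ^+ m.+1 : C^o) @ \oo --> (sigser l (ee (val tau)) : C^o).
 apply/cvg_rnP => e e0.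
 have [N NH] := sigser_psum l (rn_q (valP tau)) e0.
 exists N => n nN; have := NH n.+1 (leqW nN).
 rewrite big_ord_recl mul0r add0r /series /= big_mkord.
 by under eq_bigr do rewrite /bump /= add1n.
exact: (cvg_lim (@norm_hausdorff _ _) h).
Qed.

End Series.

(** * The Weierstrass zeta function as a q-series *)

Section Xi.
Variable R : realType.
Notation C := R[i].
Notation cdf g w := (dff (g : C^o -> C^o) (w : C^o)).

(** The geometric series x + x^2 + ... when |x| < 1. *)
Definition aq (x : C) : C := x / (1 - x).

Lemma aq_le x : rn x <= 1 / 2 -> rn (aq x) <= 2 * rn x.
Proof.
move=> x2; rewrite rnM rnV.
have h : 1 / 2 <= rn (1 - x) by have := rnBl 1 x; rewrite rn1; lra.
have x0 := rn_ge0 x; rewrite ler_pdivrMr; last by lra.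
by move: (rn x) (rn (1 - x)) h x0 {x2} => u v; nra.
Qed.

Lemma df_aq (V : normedModType C) (f : V -> C^o) p : dff f p -> f p != 1 -> dff (fun v => aq (f v) : C^o) p.
Proof.
by move=> fd f1; rewrite /aq; dfs => //; rewrite subr_eq0 eq_sym.
Qed.

Section Sq.
Variable q : C.
Hypothesis q1 : rn q < 1.
Hypothesis q0 : q != 0.

(** One term of the q-expansion of the zeta function, odd under x -> 1 / x. Summed over n, these
    terms form the part that is regular at x = 1. *)
Definition fq (n : nat) (x : C) : C := aq (q ^+ n.+1 * x) - aq (q ^+ n.+1 / x).
Definition Sq (x : C) : C := xget 0 [set l | psum (fun n => fq n x) 1 l].

Let t01 : 0 <= rn q < 1. Proof. by rewrite rn_ge0 q1. Qed.

Lemma qn_small n (x : C) (M : R) n0 : (n0 <= n)%N -> rn x <= M -> rn q ^+ n0 * M <= 1 / 2 ->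
 rn (q ^+ n.+1 * x) <= 1 / 2 /\ rn (q ^+ n.+1 * x) <= M * rn q ^+ n.
Proof.
move=> n0n xM h; rewrite rnM rnX; have M0 : 0 <= M by exact: le_trans (rn_ge0 _) xM.
have h2 : rn q ^+ n.+1 * rn x <= rn q ^+ n * M.
 apply: ler_pM; rewrite ?exprn_ge0 ?rn_ge0 //.
 by apply: ler_wiXn2l; rewrite ?rn_ge0 ?ltW.
split; last by rewrite [M * _]mulrC.
apply: le_trans h2 _; apply: le_trans h; rewrite ler_wpM2r //.
by apply: ler_wiXn2l; rewrite ?rn_ge0 ?ltW.
Qed.

Lemma fq_le n x (M : R) n0 : (n0 <= n)%N -> rn x <= M -> rn x^-1 <= M -> rn q ^+ n0 * M <= 1 / 2 ->
 rn (fq n x) <= 4 * M * rn q ^+ n.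
Proof.
move=> n0n x1 x2 h; have [h1 h2] := qn_small n0n x1 h; have [h3 h4] := qn_small n0n x2 h.
apply: le_trans (rnB _ _) _; have := aq_le h1; have := aq_le h3.
move: (rn (aq _)) (rn (aq _)) (rn (_ * _)) (rn (_ * _)) h2 h4 => u1 u2 u3 u4; lra.
Qed.

Lemma Sq_tail x (M : R) n0 : rn x <= M -> rn x^-1 <= M -> rn q ^+ n0 * M <= 1 / 2 ->
 forall N, (n0 <= N)%N -> rn (\sum_(n < N) fq n x - Sq x) <= 4 * M * rn q ^+ N / (1 - rn q).
Proof.
move=> x1 x2 h; have M0 : 0 <= M by exact: le_trans (rn_ge0 _) x1.
have K0 : 0 <= 4 * M by rewrite mulr_ge0.
have [n nn|l lP] := @conv_geom R (fq ^~ x) (4 * M) (rn q) n0 K0 t01.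
 exact: fq_le x1 x2 h.
have pl : psum (fun n => fq n x) 1 l.
 move=> e e0; have [N NH] := geom_tail (4 * M / (1 - rn q)) t01 e0.
 exists (maxn n0 N) => n; rewrite geq_max => /andP[n1 n2].
 under eq_bigr do rewrite expr1n mulr1.
 by apply: le_lt_trans (lP n n1) _; rewrite mulrAC; exact: NH.
have ps : psum (fun n => fq n x) 1 (Sq x).
 by apply: (@xgetPex _ 0 [set l | psum (fun n => fq n x) 1 l]); exists l.
by rewrite (psum_unique ps pl).
Qed.

Lemma n0_ex (M : R) : exists n0, rn q ^+ n0 * M <= 1 / 2.
Proof.
have [|N NH] := geom_tail M t01 (_ : 0 < 1 / 2); first by lra.
by exists N; rewrite mulrC ltW // NH.
Qed.

Lemma Sq_df (z : C) : (forall n, q ^+ n.+1 * ee z != 1) -> (forall n, q ^+ n.+1 / ee z != 1) ->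
 cdf (fun v => Sq (ee v)) z.
Proof.
move=> z1 z2; pose M := expR (2 * pi * (`|Im z| + 1)).
have pi2 : 0 < 2 * @pi R by rewrite mulr_gt0 // pi_gt0.
have inb v : rn (v - z) < 1 -> rn (ee v) <= M /\ rn (ee v)^-1 <= M.
 move=> vz; have := Im_le_rn (v - z); rewrite cImB => h.
 rewrite -eeN !rn_ee !ler_expR cImN -!mulrN !ler_pM2l //.
 have := ler_norm (Im z); have := ler_norm (- Im z); rewrite normrN.
 by move: h; rewrite ler_norml; split; lra.
have [n0 h] := n0_ex M.
have M0 : 0 <= M by exact: expR_ge0.
have dfq n (v : C^o) : q ^+ n.+1 * ee v != 1 -> q ^+ n.+1 / ee v != 1 ->
  dff (fun v : C^o => fq n (ee v) : C^o) v.
 move=> h1 h2; rewrite /fq; dfs.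
  by apply: (df_aq (f := fun v : C^o => q ^+ n.+1 * ee v : C^o)); [dfs|exact: h1].
 by apply: (df_aq (f := fun v : C^o => q ^+ n.+1 / ee v : C^o)); [dfs; exact: ee_neq0|exact: h2].
(* The first n0 terms may be large, but are differentiable away from their poles. The later ones are
   dominated by a geometric series on the unit ball around z, and T is the uniform limit of their
   sums. *)
pose T (v : C^o) : C^o := Sq (ee v) - \sum_(n < n0) fq n (ee v).
have -> : (fun v => Sq (ee v)) = fun v => (\sum_(n < n0) fq n (ee v)) + T v.
 by apply/funext => v; rewrite /T addrC subrK.
apply: (dfD (f := fun v : C^o => \sum_(n < n0) fq n (ee v) : C^o)).
 by apply: df_sum => i _; apply: dfq.
apply: (@uniform_limit_differentiable R C^o (fun N v => \sum_(n < N) fq (n0 + n) (ee v)) T z 1 (4 * M / (1 - rn q))) => [//|||].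
- move=> N v /inb[v1 v2]; apply: df_sum => i _; apply: dfq.
  by apply/eqP => E; have [] := qn_small (leq_addr i n0) v1 h; rewrite E rn1; lra.
 by apply/eqP => E; have [] := qn_small (leq_addr i n0) v2 h; rewrite E rn1; lra.
- move=> N v /inb[v1 v2]; apply: le_trans (rn_sum _ _ _) _.
 have b (i : 'I_N) : rn (fq (n0 + i) (ee v)) <= 4 * M * rn q ^+ i.
  apply: le_trans (fq_le (leq_addr i n0) v1 v2 h) _; rewrite ler_wpM2l ?mulr_ge0 //.
  by apply: ler_wiXn2l; rewrite ?rn_ge0 ?ltW ?leq_addl.
 apply: le_trans (ler_sum _ (fun i _ => b i)) _; rewrite -mulr_sumr ler_wpM2l ?mulr_ge0 //.
 by have := @geom_sum_le R (rn q) 0 N t01 (leq0n N); rewrite big_mkord expr0 mul1r.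
- move=> e e0; have [N NH] := geom_tail (4 * M / (1 - rn q)) t01 e0.
 exists N => n v nN /inb[v1 v2].
 have := Sq_tail v1 v2 h (leq_addr n n0); rewrite big_split_ord /=.
 have -> : \sum_(i < n0) fq i (ee v) + \sum_(i < n) fq (n0 + i) (ee v) - Sq (ee v) =
   \sum_(i < n) fq (n0 + i) (ee v) - T v by rewrite /T; ring.
 move=> /le_trans; apply; rewrite mulrAC; apply: ltW; apply: NH.
 by rewrite (leq_trans nN) // leq_addl.
Qed.

End Sq.

Definition lat (tau z : C) := exists m n : int, z = m%:~R + n%:~R * tau.

Lemma lat0 tau : lat tau 0.
Proof. by exists 0, 0; rewrite mul0r addr0. Qed.
Lemma lat1 tau : lat tau 1.
Proof. by exists 1, 0; rewrite mul0r addr0. Qed.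
Lemma lat_tau tau : lat tau tau.
Proof. by exists 0, 1; rewrite mul1r add0r. Qed.
Lemma latD tau z w : lat tau z -> lat tau w -> lat tau (z + w).
Proof. by move=> [m [n ->]] [k [l ->]]; exists (m + k), (n + l); rewrite !intrD; ring. Qed.
Lemma latN tau z : lat tau z -> lat tau (- z).
Proof. by move=> [m [n ->]]; exists (- m), (- n); rewrite !intrN; ring. Qed.
Lemma lat_add tau z l : lat tau l -> lat tau (z + l) <-> lat tau z.
Proof. by move=> ll; split=> h; [rewrite -(addrK l z); apply: latD (latN ll)|exact: latD]. Qed.

Lemma rn_int (m : int) : rn (m%:~R : C) = `|m|%:~R.
Proof. by rewrite -(rmorph_int (real_complex R)) rn_real -intr_norm. Qed.

Lemma Im_int (m : int) : Im (m%:~R : C) = 0.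
Proof. by rewrite -(rmorph_int (real_complex R)). Qed.
Lemma Re_int (m : int) : Re (m%:~R : C) = m%:~R.
Proof. by rewrite -(rmorph_int (real_complex R)). Qed.

Lemma lat_discrete tau w : 0 < Im tau -> lat tau w -> rn w < 1 -> rn w < Im tau -> w = 0.
Proof.
move=> t0 [m [n ->]] h1 h2; have := le_lt_trans (Im_le_rn _) h2.
rewrite cImD cImM Im_int Im_int Re_int mul0r addr0 add0r normrM (gtr0_norm t0).
rewrite -[X in _ < X]mul1r ltr_pM2r // -intr_norm -[1]/(1%:~R) ltr_int => n1.
have n0 : n = 0 by lia.
move: h1; rewrite n0 mul0r addr0 rn_int -[1]/(1%:~R) ltr_int => m1.
by have -> : m = 0 by lia.
Qed.

Lemma lat_isolated tau z : 0 < Im tau -> ~ lat tau z ->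
 exists2 e : R, 0 < e & forall v, rn (v - z) < e -> ~ lat tau v.
Proof.
move=> t0 nz; pose d := Num.min 1 (Im tau).
have d0 : 0 < d by rewrite lt_min ltr01 t0.
have [[w wd lw]|H] := pselect (exists2 w, rn (w - z) < d / 2 & lat tau w); last first.
 by exists (d / 2); rewrite ?divr_gt0 // => v vd lv; apply: H; exists v.
exists (rn (w - z)).
 by rewrite rn_gt0 subr_eq0; apply/eqP => wz; apply: nz; rewrite -wz.
move=> v vd lv; have : rn (v - w) < d.
 have -> : v - w = (v - z) - (w - z) by ring.
 by have := rnB (v - z) (w - z); lra.
rewrite lt_min => /andP[h1 h2].
by move: vd; have /eqP := lat_discrete t0 (latD lv (latN lw)) h1 h2; rewrite subr_eq0 => /eqP ->; rewrite ltxx.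
Qed.

Lemma per_int (f : C -> C) (w : C) : (forall z, f (z + w) = f z) ->
 forall (n : int) z, f (z + n%:~R * w) = f z.
Proof.
move=> fw.
have per (m : nat) z : f (z + m%:R * w) = f z.
 elim: m => [|m IH]; first by rewrite mul0r addr0.
 by rewrite -natr1 mulrDl mul1r addrA fw.
case=> m z; first exact: per.
by rewrite NegzE intrN -[RHS](per m.+1) mulNr -[m.+1%:~R]/(m.+1%:R) -[f (z - _)](per m.+1) subrK per.
Qed.

Lemma liouville (E : C -> C) (B : R) : (forall z, cdf E z) -> (forall z, rn (E z) <= B) ->
 forall r, tc E r.+1 = 0.
Proof.
move=> Ed EB r; have B0 : 0 <= B by exact: le_trans (rn_ge0 _) (EB 0).
apply/eqP; rewrite -rn_eq0; apply/eqP.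
apply: (@small_pos R _ (2 * B)); rewrite ?rn_ge0 ?mulr_ge0 // => t /andP[t0 t1].
have tV : 0 < t^-1 by rewrite invr_gt0.
have Ec : cdisc E (2 * t^-1) by split => [|w _]; [rewrite mulr_gt0|exact: Ed].
have := @tc_le _ _ _ t^-1 B r.+1 Ec; rewrite tV ltr_pMl // ltr1n => /(_ isT (fun w _ => EB w)).
rewrite exprVn ler_pdivrMr ?exprn_gt0 // => /le_trans; apply.
by rewrite ler_wpM2l ?mulr_ge0 // exprS ger_pMr // exprn_ile1 // ltW.
Qed.

(** Every z is congruent modulo the lattice to a point of norm at most s = 1 + |tau|, so a bound on
    the disc of radius s is a global bound. *)
Lemma liouville_lattice (tau : C) (E : C -> C) : 0 < Im tau -> (forall z, cdf E z) ->
 (forall z, E (z + 1) = E z) -> (forall z, E (z + tau) = E z) -> forall r, tc E r.+1 = 0.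
Proof.
move=> t0 Ed E1 Et.
pose s := 1 + rn tau; have s0 : 0 < s by rewrite ltr_pwDl ?rn_ge0.
have s20 : 0 < 2 * s by rewrite mulr_gt0.
have Ec : cdisc E (4 * s) by split => [|w _]; [rewrite mulr_gt0|exact: Ed].
have [M M0 MH] := circle_bound s20 (fun w _ => contat_df (Ed w)).
have s24 : 0 < 2 * s < 4 * s by rewrite s20 ltr_pM2r // ltr_nat.
apply: (@liouville E (4 * M) Ed) => z.
pose y := Im z / Im tau; pose n := Num.floor y.
pose x := Re z - y * Re tau; pose m := Num.floor x.
have /andP[n1 n2] : n%:~R <= y < (n + 1)%:~R by rewrite floor_le_tmp /= floorD1_gt.
have /andP[m1 m2] : m%:~R <= x < (m + 1)%:~R by rewrite floor_le_tmp /= floorD1_gt.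
pose w := (x - m%:~R)%:C + (y - n%:~R)%:C * tau.
have zE : z = w + m%:~R * 1 + n%:~R * tau.
 rewrite mulr1 /w (rmorphB (real_complex R) x) (rmorphB (real_complex R) y) /= !(rmorph_int (real_complex R)).
 transitivity (x%:C + y%:C * tau); last by move: (x%:C) (y%:C) (m%:~R) (n%:~R) => x' y' m' n'; ring.
 apply/eqP; rewrite eq_complex cReD cImD cReM cImM /= !mul0r subr0 addr0 add0r.
 by rewrite subrK eqxx /y divfK ?eqxx // gt_eqF.
rewrite zE (per_int Et) (per_int E1).
have ws : rn w <= s.
 apply: le_trans (rnD _ _) _; rewrite rnM !rn_real; apply: lerD.
  by rewrite ger0_norm ?subr_ge0 //; rewrite intrD in m2; lra.
 rewrite ler_piMl ?rn_ge0 // ger0_norm ?subr_ge0 //; rewrite intrD in n2; lra.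
have := @tc_rem R E (4 * s) (2 * s) M 0 w Ec s24 MH; rewrite big_ord0 subr0 expr0 mulr1; apply.
by apply: le_trans ws _; lra.
Qed.

(* The Weierstrass zeta function, normalised to be 1-periodic with quasi-period -1 at tau.  Comparing
   it for tau and for an equivalent point makes its Taylor coefficients (quasi-)modular. *)
Definition Xq (tau z : C) : C := (ee z + 1) / (ee z - 1) / 2 - Sq (ee tau) (ee z).

Lemma Xq_1 tau z : Xq tau (z + 1) = Xq tau z.
Proof. by rewrite /Xq eeD ee1 mulr1. Qed.

Lemma nlat_ee tau z (n : int) : ~ lat tau z -> ee (z + n%:~R * tau) != 1.
Proof.
move=> nz; apply/eqP => /ee_eq1[_ [m E]]; apply: nz; exists m, (- n).
by rewrite -E intrN mulNr addrK.
Qed.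

Lemma nlat_qM tau z n : ~ lat tau z -> ee tau ^+ n * ee z != 1.
Proof. by move=> /(nlat_ee (Posz n)); rewrite eeD -[(Posz n)%:~R]/(n%:R) eeMn mulrC. Qed.

Lemma nlat_qV tau z n : ~ lat tau z -> ee tau ^+ n / ee z != 1.
Proof.
move=> nz; have /(nlat_qM n) : ~ lat tau (- z) by move=> /latN; rewrite opprK.
by rewrite eeN.
Qed.

Lemma Xq_df tau z : 0 < Im tau -> ~ lat tau z -> cdf (Xq tau) z.
Proof.
move=> t0 nz; rewrite /Xq; dfs.
 by have := nlat_qM 0 nz; rewrite expr0 mul1r subr_eq0.
by apply: Sq_df => [|n|n]; [exact: rn_q|exact: nlat_qM|exact: nlat_qV].
Qed.

(** Replacing x by q x moves the index of one half of each term up by one and that of the other half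
    down by one, so the partial sums telescope, up to two terms that tend to 0. *)
Lemma Sq_shift (q x : C) : rn q < 1 -> q != 0 -> x != 0 -> Sq q (q * x) = Sq q x - aq (q * x) - aq x^-1.
Proof.
move=> q1 q0 x0; pose M := Num.max (Num.max (rn x) (rn x^-1)) (Num.max (rn (q * x)) (rn (q * x)^-1)).
have [n0 h] := n0_ex q1 M; have t01 : 0 <= rn q < 1 by rewrite rn_ge0.
have xM : rn x <= M by rewrite !le_max lexx.
have xM' : rn x^-1 <= M by rewrite !le_max lexx ?orbT.
have T1 := Sq_tail q1 xM xM' h.
have yM : rn (q * x) <= M by rewrite !le_max lexx ?orbT.
have yM' : rn (q * x)^-1 <= M by rewrite !le_max lexx ?orbT.
have T2 := Sq_tail q1 yM yM' h.
have tel N : \sum_(n < N) fq q n (q * x) =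
  \sum_(n < N) fq q n x - aq (q * x) - aq x^-1 + aq (q ^+ N * (q * x)) + aq (q ^+ N * x^-1).
 elim: N => [|N IH]; first by rewrite !big_ord0 expr0 !mul1r; ring.
 rewrite !big_ord_recr /= IH /fq !exprS.
 have -> : q * q ^+ N / (q * x) = q ^+ N * x^-1 by rewrite invfM mulrACA divff // mul1r.
 have -> : q * q ^+ N * x = q ^+ N * (q * x) by ring.
 by move: (aq _) (aq _) (aq _) (aq _) (aq _) (aq _) (\sum_(i < N) _) => *; ring.
apply: rn_small_eq => e e0; have e4 : 0 < e / 4 by rewrite divr_gt0.
have [N1 H1] := geom_tail (4 * M / (1 - rn q)) t01 e4; have [N2 H2] := geom_tail (4 * M) t01 e4.
pose N := maxn n0 (maxn N1 N2).
have NE : (n0 <= N)%N /\ (N1 <= N)%N /\ (N2 <= N)%N by rewrite !leq_max !leqnn ?orbT.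
have [n0N [N1N N2N]] := NE; move: (T1 _ n0N) (T2 _ n0N) (H1 _ N1N) (H2 _ N2N).
have small (y : C) : rn y <= M -> rn (aq (q ^+ N * y)) <= 2 * (M * rn q ^+ N).
 move=> yM0; have b : rn (q ^+ N * y) <= M * rn q ^+ N by rewrite rnM rnX mulrC ler_wpM2r ?exprn_ge0 ?rn_ge0.
 apply: le_trans (aq_le _) _; last by rewrite ler_wpM2l.
 apply: le_trans b _; apply: le_trans h; rewrite mulrC ler_wpM2r //; first exact: le_trans (rn_ge0 _) xM.
 by apply: ler_wiXn2l; rewrite ?rn_ge0 ?ltW.
move: (small _ yM) (small _ xM'); rewrite tel {tel small T1 T2 H1 H2}.
set S := \sum_(n < N) _; set u := aq (_ * (q * x)); set v := aq (_ * x^-1); set a := aq (q * x); set b := aq x^-1.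
move=> hu hv h1 h2 h3 h4.
have -> : Sq q (q * x) - (Sq q x - a - b) = (S - Sq q x) - (S - a - b + u + v - Sq q (q * x)) + u + v by ring.
move: h1 h2; set A := S - Sq q x; set B := S - a - b + u + v - Sq q (q * x); move=> h1 h2.
have := rnD (A - B + u) v; have := rnD (A - B) u; have := rnB A B.
rewrite [_ * _ / _]mulrAC in h1 h2.
move: (4 * M / (1 - rn q) * rn q ^+ N) h1 h2 h3 => c h1 h2 h3; rewrite -mulrA in h4; move: (M * rn q ^+ N) hu hv h4 => k; lra.
Qed.

Lemma Xq_tau tau z : 0 < Im tau -> ~ lat tau z -> Xq tau (z + tau) = Xq tau z - 1.
Proof.
move=> t0 nz; rewrite /Xq eeD [ee z * _]mulrC Sq_shift ?rn_q ?ee_neq0 // /aq.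
have h0 := nlat_qM 0 nz; have h1 := nlat_qM 1 nz; rewrite expr0 mul1r in h0; rewrite expr1 in h1.
have := ee_neq0 z; move: (ee z) (ee tau * ee z) (Sq _ _) h0 h1 => x y s x1 y1 x0.
field; rewrite -?[1 - y]opprB ?oppr_eq0 !subr_eq0 ?x0 ?x1 ?y1 //=.
Qed.

Lemma Xq_lat tau z (m n : int) : 0 < Im tau -> ~ lat tau z -> Xq tau (z + (m%:~R + n%:~R * tau)) = Xq tau z - n%:~R.
Proof.
move=> t0; have P (k : nat) v : ~ lat tau v -> Xq tau (v + k%:R * tau) = Xq tau v - k%:R.
 elim: k => [|k IH] nv; first by rewrite mul0r addr0 subr0.
 rewrite -natr1 mulrDl mul1r addrA Xq_tau ?IH //; first by rewrite opprD addrA.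
 by move=> /lat_add H; apply: nv; apply: H; exists 0, (Posz k); rewrite add0r.
move=> nz; rewrite [m%:~R + _]addrC addrA -[m%:~R]mulr1 (per_int (@Xq_1 tau)).
case: n => k; first exact: P.
have nv : ~ lat tau (z + (Negz k)%:~R * tau).
 by move=> /lat_add H; apply: nz; apply: H; exists 0, (Negz k); rewrite add0r.
have := P k.+1 _ nv; rewrite NegzE intrN -[k.+1%:~R]/(k.+1%:R) mulNr subrK => ->.
by rewrite opprK subrK.
Qed.

End Xi.

(** * Taylor coefficients of the zeta function and their modular behaviour *)

Section Weierstrass.
Variable R : realType.
Notation C := R[i].
Notation cdf g w := (dff (g : C^o -> C^o) (w : C^o)).
Notation pii := (twopii R).

Lemma rn_twopii : rn pii = 2 * pi.
Proof.
have -> : pii = 'i * (2 * pi)%:C by apply/eqP; rewrite eq_complex /=; apply/andP; split; apply/eqP; ring.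
by rewrite rnM rn_i mul1r rn_real ger0_norm // mulr_ge0 // pi_ge0.
Qed.

Lemma cexp_neq1 (u : C) : 0 < rn u < 1 -> cexp u != 1.
Proof.
move=> /andP[u0 u1]; apply/eqP => E; have p0 := twopii_neq0 R.
have : ee (u / pii) = 1 by rewrite /ee mulrCA divff // mulr1.
move=> /ee_eq1[_ [n nE]]; have uE : u = n%:~R * pii by rewrite -nE divfK.
have n0 : n != 0 by apply/eqP => n0; move: u0; rewrite uE n0 mul0r rn0 ltxx.
have n1 : 1 <= (`|n|%:~R : R) by rewrite -[1]/(1%:~R) ler_int; lia.
move: u1; rewrite uE rnM rn_int rn_twopii; have := pi_ge2 R.
move: (pi : R) (`|n|%:~R : R) n1 => p k k1 p2; nra.
Qed.

Lemma cexp_disc (rho : R) : 0 < rho -> cdisc (@cexp R) rho.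
Proof. by move=> r0; split=> [//|w _]; apply: (df_cexp (f := fun w : C^o => w)); exact: dfid. Qed.

(** This function is (u / 2) coth (u / 2), the generating function of the even Bernoulli numbers
    over factorials; they supply the constant terms of the Eisenstein series. Near 0 the quotient is
    at most (7 / 4) / (1 / 2), so the singularity is removable. *)
Lemma eta_ex : exists2 eta : C -> C, cdisc eta 1 &
 forall u, rn u < 1 -> eta u * (cexp u - 1) = u * ((cexp u + 1) / 2).
Proof.
pose g (u : C) : C := u * ((cexp u + 1) / 2) / (cexp u - 1).
have [||eta ed eE] := @removable R g 1 ltr01.
- by move=> w w1; rewrite /g; dfs; rewrite subr_eq0 cexp_neq1.
- have [|d d0 dH] := @cexp_deriv0 R (1 / 2); first by lra.
 exists (Num.min d 1); first by rewrite lt_min d0 ltr01.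
 exists (7 / 2) => w; rewrite lt_min => /and3P[w0 wd w1].
 have := dH w wd; rewrite add0r cexp0 mul1r => h1.
 have h2 : rn w / 2 <= rn (cexp w - 1).
  have := rnDl w (cexp w - 1 - w); have -> : w + (cexp w - 1 - w) = cexp w - 1 by ring.
  lra.
 have h3 : rn ((cexp w + 1) / 2) <= 7 / 4.
  have -> : (cexp w + 1) / 2 = (cexp w - 1 - w) / 2 + w / 2 + 1 by field.
  have := rnD ((cexp w - 1 - w) / 2 + w / 2) 1; have := rnD ((cexp w - 1 - w) / 2) (w / 2).
  rewrite !rnM rnV rn_nat rn1; move: (rn (_ + _)) (rn (_ + _)) h1 => a b; lra.
 rewrite /g 2!rnM rnV ler_pdivrMr; last by apply: lt_le_trans h2; rewrite divr_gt0.
 move: (rn w) (rn (cexp w - 1)) (rn ((cexp w + 1) / 2)) w0 h2 h3 => a b c a0 h2 h3; nra.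
exists eta => // u u1; have [->|u0] := eqVneq u 0; first by rewrite cexp0 subrr mulr0 mul0r.
by rewrite eE // /g divfK // subr_eq0 cexp_neq1 // rn_gt0 u0 u1.
Qed.

Definition eta : C -> C := s2val (cid2 eta_ex).
Lemma eta_disc : cdisc eta 1. Proof. exact: s2valP (cid2 eta_ex). Qed.
Lemma etaE u : rn u < 1 -> eta u * (cexp u - 1) = u * ((cexp u + 1) / 2).
Proof. exact: s2valP' (cid2 eta_ex) u. Qed.

Lemma tc_id : tc (fun w : C => w) = fun i => (i == 1%N)%:R.
Proof.
have -> : (fun w : C => w) = fun w => ('X : {poly C}).[w] by apply/funext => w; rewrite hornerX.
by rewrite tc_poly; apply/funext => i; rewrite coefX.
Qed.

Lemma tc_cst (c : C) : tc (fun=> c) = fun i => c * (i == 0%N)%:R.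
Proof.
have -> : (fun _ : C => c) = fun w => (c%:P : {poly C}).[w] by apply/funext => w; rewrite hornerC.
by rewrite tc_poly; apply/funext => i; rewrite coefC; case: eqP; rewrite ?mulr1 ?mulr0.
Qed.

Lemma tc_mulX (g : C -> C) rho n : cdisc g rho -> tc (fun w => w * g w) n.+1 = tc g n.
Proof.
move=> gd; have idd : cdisc (fun w : C => w) rho by split; [exact: gd.1|move=> w _; exact: dfid].
rewrite (tcM n.+1 idd gd) tc_id !big_ord_recl /= mul0r add0r mul1r big1 ?addr0 ?subn1 //.
by move=> i _; rewrite mul0r.
Qed.

Notation ce := (tc (@cexp R)).

(** From exp(2 w) = exp(w)^2. As 2^l - 2 is nonzero for l > 1, this determines the Taylor
    coefficients of exp from those of degree 0 and 1. *)
Lemma ce_rec l : 2 ^+ l * ce l = \sum_(i < l.+1) ce i * ce (l - i).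
Proof.
have d1 := cexp_disc ltr01.
rewrite -(tcM l d1 d1).
have -> : (fun w : C => cexp w * cexp w) = fun w => cexp (2 * w). by apply/funext => w; rewrite cexpMn expr2.
by rewrite (tc_scale 2 d1).
Qed.

Lemma ce0 : ce 0 = 1. Proof. by rewrite (tc_0 (cexp_disc ltr01)) cexp0. Qed.
Lemma ce1 : ce 1 = 1. Proof. exact: tc_deriv (cexp_disc ltr01) (@cexp_deriv0 R). Qed.

Lemma two_pow_neq l : (1 < l)%N -> 2 ^+ l - 2 != 0 :> C.
Proof.
move=> l1; rewrite subr_eq0 -natrX eqr_nat; apply/eqP => E.
by have := ltn_exp2l 1 l (leqnn 2); rewrite l1 expn1 E ltnn.
Qed.

Lemma ce_solve l x : (1 < l)%N -> \sum_(i < l.+1) ce i * ce (l - i) - 2 * ce l = (2 ^+ l - 2) * x -> ce l = x.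
Proof. by move=> l1 H; apply: (mulfI (two_pow_neq l1)); rewrite -H mulrBl ce_rec. Qed.

Lemma ce2 : ce 2 = 1 / 2.
Proof. by apply: ce_solve => //; rewrite !big_ord_recr big_ord0 /= !subSS !subn0 ce0 ce1; field. Qed.
Lemma ce3 : ce 3 = 1 / 6.
Proof. by apply: ce_solve => //; rewrite !big_ord_recr big_ord0 /= !subSS !subn0 ce0 ce1 ce2; field. Qed.
Lemma ce4 : ce 4 = 1 / 24.
Proof. by apply: ce_solve => //; rewrite !big_ord_recr big_ord0 /= !subSS !subn0 ce0 ce1 ce2 ce3; field. Qed.
Lemma ce5 : ce 5 = 1 / 120.
Proof. by apply: ce_solve => //; rewrite !big_ord_recr big_ord0 /= !subSS !subn0 ce0 ce1 ce2 ce3 ce4; field. Qed.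
Lemma ce6 : ce 6 = 1 / 720.
Proof. by apply: ce_solve => //; rewrite !big_ord_recr big_ord0 /= !subSS !subn0 ce0 ce1 ce2 ce3 ce4 ce5; field. Qed.
Lemma ce7 : ce 7 = 1 / 5040.
Proof. by apply: ce_solve => //; rewrite !big_ord_recr big_ord0 /= !subSS !subn0 ce0 ce1 ce2 ce3 ce4 ce5 ce6; field. Qed.

(** The coefficient of u^(n+1) in the functional equation [etaE], solved for its top term, whose
    factor is the coefficient 1 of u in exp u - 1. *)
Lemma eta_rec n : tc eta n = (ce n + (n == 0)%:R) / 2 - \sum_(i < n) tc eta i * ce (n.+1 - i).
Proof.
have d1 := cexp_disc ltr01; have m1 := cdisc_cst (-1 : C) ltr01; have p1 := cdisc_cst (1 : C) ltr01.
have h1 := cdisc_cst (2^-1 : C) ltr01.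
have dm := cdiscD d1 m1; have dp := cdiscM (cdiscD d1 p1) h1.
have E : tc (fun u => u * ((cexp u + 1) / 2)) = tc (fun u => eta u * (cexp u + -1)).
 by apply: (tc_ext (cdiscM eta_disc dm) ltr01) => u u1; rewrite etaE.
have := congr1 (fun f => f n.+1) E; rewrite (tc_mulX n dp) (tcM n.+1 eta_disc dm).
have -> : (fun w : C => (cexp w + 1) / 2) = fun w => 2^-1 * (cexp w + 1) by apply/funext => w; rewrite mulrC.
rewrite (tcZ _ (cdiscD d1 p1)) (tcD d1 p1) (tcD d1 m1) !tc_cst mul1r [2^-1 * _]mulrC => ->.
rewrite !big_ord_recr /= subnn ce0 /= mulr1 subrr mulr0 addr0 subSnn ce1 mulr0 addr0 mulr1.
rewrite addrAC -[LHS]add0r; congr (_ + _); apply/esym/eqP; rewrite subr_eq0; apply/eqP.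
apply: eq_bigr => i _; congr (_ * _); rewrite subSn; last exact: ltnW.
by rewrite /= mulr0 addr0.
Qed.

Lemma eta_0 : tc eta 0 = 1.
Proof. by rewrite eta_rec big_ord0 ce0 /=; field. Qed.
Lemma eta_1 : tc eta 1 = 0.
Proof.
have -> : tc eta 1 = (ce 1 + 0) / 2 - (tc eta 0 * ce 2).
 by rewrite eta_rec !big_ord_recr big_ord0 /= ?subSS ?subn0 add0r.
by rewrite eta_0 ce2 ce1; field.
Qed.
Lemma eta_2 : tc eta 2 = 1 / 12.
Proof.
have -> : tc eta 2 = (ce 2 + 0) / 2 - (tc eta 0 * ce 3 + tc eta 1 * ce 2).
 by rewrite eta_rec !big_ord_recr big_ord0 /= ?subSS ?subn0 add0r.
by rewrite eta_0 eta_1 ce2 ce3; field.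
Qed.
Lemma eta_3 : tc eta 3 = 0.
Proof.
have -> : tc eta 3 = (ce 3 + 0) / 2 - (tc eta 0 * ce 4 + tc eta 1 * ce 3 + tc eta 2 * ce 2).
 by rewrite eta_rec !big_ord_recr big_ord0 /= ?subSS ?subn0 add0r.
by rewrite eta_0 eta_1 eta_2 ce2 ce3 ce4; field.
Qed.
Lemma eta_4 : tc eta 4 = - (1 / 720).
Proof.
have -> : tc eta 4 = (ce 4 + 0) / 2 - (tc eta 0 * ce 5 + tc eta 1 * ce 4 + tc eta 2 * ce 3 + tc eta 3 * ce 2).
 by rewrite eta_rec !big_ord_recr big_ord0 /= ?subSS ?subn0 add0r.
by rewrite eta_0 eta_1 eta_2 eta_3 ce2 ce3 ce4 ce5; field.
Qed.
Lemma eta_5 : tc eta 5 = 0.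
Proof.
have -> : tc eta 5 = (ce 5 + 0) / 2 - (tc eta 0 * ce 6 + tc eta 1 * ce 5 + tc eta 2 * ce 4 + tc eta 3 * ce 3 + tc eta 4 * ce 2).
 by rewrite eta_rec !big_ord_recr big_ord0 /= ?subSS ?subn0 add0r.
by rewrite eta_0 eta_1 eta_2 eta_3 eta_4 ce2 ce3 ce4 ce5 ce6; field.
Qed.
Lemma eta_6 : tc eta 6 = 1 / (720 * 42).
Proof.
have -> : tc eta 6 = (ce 6 + 0) / 2 - (tc eta 0 * ce 7 + tc eta 1 * ce 6 + tc eta 2 * ce 5 + tc eta 3 * ce 4 + tc eta 4 * ce 3 + tc eta 5 * ce 2).
 by rewrite eta_rec !big_ord_recr big_ord0 /= ?subSS ?subn0 add0r.
by rewrite eta_0 eta_1 eta_2 eta_3 eta_4 eta_5 ce2 ce3 ce4 ce5 ce6 ce7; field.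
Qed.

(** B(u) = (exp u + 1) / (2 (exp u - 1)) - 1 / u, the regular part at 0 of the first summand of
    [Xq]. *)
Lemma Bh_ex : exists2 B : C -> C, cdisc B 1 & forall u, rn u < 1 -> eta u = 1 + u * B u.
Proof.
have m1 := cdisc_cst (-1 : C) ltr01; have dm := cdiscD eta_disc m1.
have [[|//] _|h hd [hE _]] := order_split (n := 1) dm. by rewrite (tcD eta_disc m1) tc_cst eta_0 mulr1 subrr.
by exists h => // u u1; have := hE u u1; rewrite expr1 => <-; ring.
Qed.

Definition Bh : C -> C := s2val (cid2 Bh_ex).
Lemma Bh_disc : cdisc Bh 1. Proof. exact: s2valP (cid2 Bh_ex). Qed.
Lemma BhE u : rn u < 1 -> eta u = 1 + u * Bh u.
Proof. exact: s2valP' (cid2 Bh_ex) u. Qed.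
Lemma Bh_tc l : tc Bh l = tc eta l.+1.
Proof.
have id1 : cdisc (fun u => u * Bh u) 1. by apply: cdiscM Bh_disc; split=> [//|w _]; exact: dfid.
have c1 := cdisc_cst (1 : C) ltr01.
have -> : tc eta = tc (fun u => 1 + u * Bh u). by apply: (tc_ext (cdiscD c1 id1) ltr01) => u u1; rewrite BhE.
by rewrite (tcD c1 id1) tc_cst /= mulr0 add0r (tc_mulX _ Bh_disc).
Qed.

(** The zeta function without its pole 1 / (2 pi i z) at the origin. Its odd Taylor coefficients are
    Eisenstein series up to constants. *)
Definition Gq (tau z : C) : C := Bh (pii * z) - Sq (ee tau) (ee z).

Lemma Xq_Gq tau z : 0 < rn (pii * z) < 1 -> Xq tau z = (pii * z)^-1 + Gq tau z.
Proof.
move=> /[dup] h /andP[z0 z1]; rewrite /Gq addrA; congr (_ - _).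
have e1 : ee z - 1 != 0 by rewrite subr_eq0 cexp_neq1.
have := etaE z1; rewrite BhE // -/(ee z); rewrite rn_gt0 in z0.
move: (pii * z) (Bh _) (ee z) e1 z0 => u B e e1 u0 H.
apply: (mulIf u0); rewrite [RHS]mulrDl mulVf // [B * u]mulrC; apply: (mulIf e1); rewrite H.
by field; rewrite e1.
Qed.

Section Tau.
Variable tau : C.
Hypothesis tau0 : 0 < Im tau.
Let q1 := rn_q tau0.
Let q0 := ee_neq0 tau.

Lemma Sq_df_small z : rn z < Im tau -> cdf (fun v => Sq (ee tau) (ee v)) z.
Proof.
move=> zt; have zI := le_lt_trans (Im_le_rn z) zt; apply: Sq_df => // n.
 apply/eqP => /(congr1 (@rn R C)); rewrite rn1 -eeMn -eeD rn_ee => /eqP; rewrite lt_eqF // expR_lt1 oppr_lt0.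
 rewrite mulr_gt0 ?mulr_gt0 ?pi_gt0 // cImD cImM -[n.+1%:R]/(n.+1%:~R) Im_int Re_int mul0r addr0.
 have n1 : 1 <= (n.+1%:~R : R) by rewrite -[1]/(1%:~R) ler_int.
 by move: zI; rewrite ltr_norml; move: (n.+1%:~R : R) n1 => k k1; nra.
apply/eqP => /(congr1 (@rn R C)); rewrite rn1 -eeMn -eeB rn_ee => /eqP; rewrite lt_eqF // expR_lt1 oppr_lt0.
rewrite mulr_gt0 ?mulr_gt0 ?pi_gt0 // cImB cImM -[n.+1%:R]/(n.+1%:~R) Im_int Re_int mul0r addr0.
have n1 : 1 <= (n.+1%:~R : R) by rewrite -[1]/(1%:~R) ler_int.
by move: zI; rewrite ltr_norml; move: (n.+1%:~R : R) n1 => k k1; nra.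
Qed.

Lemma Gq_disc (rho : R) : 0 < rho -> rho <= Im tau -> rho <= (2 * pi)^-1 -> cdisc (Gq tau) rho.
Proof.
move=> r0 r1 r2; split; first exact: r0.
move=> w wr.
have p0 : 0 < 2 * @pi R by rewrite mulr_gt0 // pi_gt0.
rewrite /Gq; dfs.
 by dfc Bh; apply: (Bh_disc).2; rewrite rnM rn_twopii -ltr_pdivlMl // mulr1; exact: lt_le_trans r2.
by apply: Sq_df_small; exact: lt_le_trans r1.
Qed.

End Tau.

Lemma jfactor_neq0 (a b c d : int) (tau : uhp R) : a * d - b * c = 1 -> jfactor c d tau != 0.
Proof.
move=> abcd; apply/eqP => j0; have := im_mobius tau abcd.
by rewrite j0 invr0 mulr0 /= ltxx.
Qed.

Lemma weight_solve (j x y c : C) l : j != 0 -> j^-1 * (j^-1 ^+ l.+1 * x) = c / j * (l == 0)%:R + y ->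
 x = j ^+ l.+2 * y + (l == 0)%:R * (c * j).
Proof.
move=> j0 H; have -> : x = j ^+ l.+2 * (j^-1 * (j^-1 ^+ l.+1 * x)).
 by rewrite [j^-1 * (_ * _)]mulrA -exprS mulrA -exprMn divff // expr1n mul1r.
rewrite H mulrDr addrC; congr (_ + _).
case: (l) => [|l'] /=; last by rewrite !mulr0 mul0r.
by rewrite mulr1 mul1r expr2 mulrC mulrA divfK.
Qed.

Section Modular.
Variables (a b c d : int) (t t' j : C).
Hypotheses (abcd : a * d - b * c = 1) (tp : 0 < Im t) (tp' : 0 < Im t').
Hypotheses (j0 : j != 0) (jE : j = c%:~R * t + d%:~R) (t'E : t' = (a%:~R * t + b%:~R) / j).

Let abcdC : a%:~R * d%:~R - b%:~R * c%:~R = 1 :> C.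
Proof. by rewrite -!intrM -intrB abcd. Qed.

Let inv_j : 1 / j = a%:~R + (- c)%:~R * t'.
Proof.
apply: (mulIf j0); rewrite divfK // mulrDl -mulrA t'E divfK // jE intrN.
transitivity (a%:~R * d%:~R - b%:~R * c%:~R : C); first by rewrite abcdC.
by ring.
Qed.

Let tau_j : t / j = (- b)%:~R + d%:~R * t'.
Proof.
apply: (mulIf j0); rewrite divfK // mulrDl -mulrA t'E divfK // jE intrN.
transitivity ((a%:~R * d%:~R - b%:~R * c%:~R) * t); first by rewrite abcdC mul1r.
by ring.
Qed.

Let lat_j z : lat t' (z / j) -> lat t z.
Proof.
move=> [m [n E]]; exists (m * d + n * b), (m * c + n * a).
have -> : z = (m%:~R + n%:~R * t') * j by rewrite -E divfK.
rewrite mulrDl -mulrA t'E divfK // jE !intrD !intrM.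
by move: (a%:~R) (b%:~R) (c%:~R) (d%:~R) (m%:~R) (n%:~R) => *; ring.
Qed.

(** The zeta function of the equivalent lattice, rescaled, minus the original one has cancelling
    poles. The linear term corrects the quasi-periods, so that D is doubly periodic, hence constant.
    Comparing Taylor coefficients with those of [D0] gives weight l + 2 in degree l + 1, and for l =
    0 the linear term becomes the quasi-modular defect. *)
Let D z : C := j^-1 * Xq t' (z / j) - Xq t z - c%:~R / j * z.
Let D0 w : C := j^-1 * Gq t' (j^-1 * w) - Gq t w - c%:~R / j * w.

Let D_1 z : ~ lat t z -> D (z + 1) = D z.
Proof.
move=> nz; rewrite /D mulrDl inv_j Xq_lat // => [|/lat_j //].
by rewrite Xq_1 intrN; move: (Xq t' _) (Xq t z) => x y; ring.
Qed.

Let D_t z : ~ lat t z -> D (z + t) = D z.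
Proof.
move=> nz; rewrite /D mulrDl tau_j Xq_lat // => [|/lat_j //].
rewrite Xq_tau //; move: (Xq t' _) (Xq t z) => x y.
have e : j^-1 * d%:~R + c%:~R / j * t = 1.
 by rewrite [j^-1 * _]mulrC [_ / j * t]mulrAC -mulrDl addrC -jE divff.
apply/eqP; rewrite -subr_eq0; apply/eqP; transitivity (1 - (j^-1 * d%:~R + c%:~R / j * t)).
 by move: (j^-1) => k; ring.
by rewrite e subrr.
Qed.

Let D_lat z l : ~ lat t z -> lat t l -> D (z + l) = D z.
Proof.
move=> nz [m [n ->]].
(* The arbitrary value 0 on the lattice makes the function periodic at every point, as iterating the
   two periods requires. *)
pose E z := if `[< lat t z >] then 0 else D z.
have E1 v : E (v + 1) = E v.
 rewrite /E; case: (asboolP (lat t v)) => h1; case: (asboolP (lat t (v + 1))) => h2 //.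
 - by case: h2; apply/(lat_add v (lat1 t)).
 - by case: h1; apply/(lat_add v (lat1 t)).
 - exact: D_1.
have Et v : E (v + t) = E v.
 rewrite /E; case: (asboolP (lat t v)) => h1; case: (asboolP (lat t (v + t))) => h2 //.
 - by case: h2; apply/(lat_add v (lat_tau t)).
 - by case: h1; apply/(lat_add v (lat_tau t)).
 - exact: D_t.
have ED v : ~ lat t v -> E v = D v by move=> h; rewrite /E; case: asboolP.
rewrite -!ED //; last by move=> /lat_add H; apply: nz; apply: H; exists m, n.
by rewrite addrA (per_int Et) -[m%:~R]mulr1 (per_int E1).
Qed.

Variable rho : R.
Hypotheses (rho0 : 0 < rho) (r1 : rho <= Im t) (r2 : rho <= (2 * pi)^-1) (r3 : rho <= 1)
 (r4 : rho / rn j <= Im t') (r5 : rho / rn j <= (2 * pi)^-1).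

Let jp : 0 < rn j. Proof. by rewrite rn_gt0. Qed.
Let p0 : 0 < (2 * @pi R)^-1. Proof. by rewrite invr_gt0 mulr_gt0 // pi_gt0. Qed.

Let pii_small w : rn w < (2 * pi)^-1 -> rn (pii * w) < 1.
Proof.
rewrite rnM rn_twopii => h; rewrite -[ltRHS](@mulfV _ (2 * pi)); last by rewrite gt_eqF // -invr_gt0.
by rewrite ltr_pM2l // -invr_gt0.
Qed.

Let small_j w : rn w < rho -> rn (j^-1 * w) < rho / rn j.
Proof. by move=> wr; rewrite rnM rnV mulrC ltr_pM2r // invr_gt0. Qed.

Let small w : rn w < rho -> [/\ rn w < Im t, rn (pii * w) < 1, rn w < 1 & rn (pii * (j^-1 * w)) < 1].
Proof.
move=> wr; split; [exact: lt_le_trans r1| |exact: lt_le_trans r3|].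
 by apply: pii_small; exact: lt_le_trans r2.
by apply: pii_small; exact: lt_le_trans (small_j wr) r5.
Qed.

Let G'disc : cdisc (fun w => Gq t' (j^-1 * w)) rho.
Proof.
split; first exact: rho0.
move=> w wr.
dfc (Gq t').
have rj : 0 < rho / rn j by rewrite divr_gt0.
by apply: (Gq_disc tp' rj r4 r5).2; exact: small_j.
Qed.

Let Gdisc : cdisc (Gq t) rho.
Proof. exact: Gq_disc. Qed.

Let m1 := cdisc_cst (-1 : C) rho0.
Let idd : cdisc (fun w : C => w) rho. Proof. by split=> [//|w _]; exact: dfid. Qed.
Let jd := cdiscM (cdisc_cst j^-1 rho0) G'disc.
Let cd := cdiscM (cdisc_cst (- (c%:~R / j)) rho0) idd.
Let md := cdiscM m1 Gdisc.

Let D0E : D0 = fun w => j^-1 * Gq t' (j^-1 * w) + -1 * Gq t w + - (c%:~R / j) * w.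
Proof. by apply/funext => w; rewrite /D0 mulN1r mulNr. Qed.

Let D0disc : cdisc D0 rho.
Proof. by rewrite D0E; exact: cdiscD (cdiscD jd md) cd. Qed.

Let DD0 w : w != 0 -> rn w < rho -> D w = D0 w.
Proof.
move=> w0 /small[_ h1 _ h2]; have wp : 0 < rn w by rewrite rn_gt0.
have pp := twopii_neq0 R.
have X1 : Xq t w = (pii * w)^-1 + Gq t w. by apply: Xq_Gq; rewrite h1 andbT rn_gt0 mulf_neq0.
have X2 : Xq t' (w / j) = (pii * (j^-1 * w))^-1 + Gq t' (j^-1 * w).
 by rewrite [w / j]mulrC; apply: Xq_Gq; rewrite h2 andbT rn_gt0 !mulf_neq0 ?invr_eq0.
rewrite /D /D0 X1 X2; move: (Gq t' _) (Gq t w) (c%:~R / j * w) => x y u.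
rewrite mulrDr; have -> : j^-1 / (pii * (j^-1 * w)) = (pii * w)^-1.
 by rewrite !invfM invrK mulrCA mulKf.
by ring.
Qed.

(** D with its removable singularities filled in; by periodicity one value serves at all lattice
    points. *)
Let E z := if `[< lat t z >] then D0 0 else D z.

Let E_df z : cdf E z.
Proof.
have [lz|nz] := pselect (lat t z).
 apply: (@differentiable_local _ _ _ (fun v : C^o => D0 (v - z) : C^o) _ _ _ rho0).
  move=> v vz; rewrite /E; case: asboolP => lv.
   have [_ _ h1 _] := small vz; have [h2 _ _ _] := small vz.
   by rewrite (lat_discrete tp (latD lv (latN lz)) h1 h2).
  have vz0 : v - z != 0 by apply/eqP => /eqP; rewrite subr_eq0 => /eqP vE; apply: lv; rewrite vE.
  have nv : ~ lat t (v - z) by move=> /(lat_add (v - z) lz); rewrite subrK.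
  by rewrite -DD0 // -(D_lat nv lz) subrK.
 by dfc D0; apply: D0disc.2; rewrite subrr rn0.
have [e e0 eH] := lat_isolated tp nz.
apply: (@differentiable_local _ _ _ (D : C^o -> C^o) _ _ _ e0).
 by move=> v /eH lv; rewrite /E; case: asboolP.
rewrite /D; dfs; last exact: Xq_df.
by dfc (Xq t'); apply: Xq_df => // /lat_j.
Qed.

Let E_per z l : lat t l -> E (z + l) = E z.
Proof.
move=> ll; rewrite /E; case: (asboolP (lat t z)) => h1; case: (asboolP (lat t (z + l))) => h2 //.
- by case: h2; apply/(lat_add z ll).
- by case: h1; apply/(lat_add z ll).
- exact: D_lat.
Qed.

Lemma Gq_modular_aux l : tc (Gq t') l.+1 = j ^+ l.+2 * tc (Gq t) l.+1 + (l == 0)%:R * (c%:~R * j).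
Proof.
have E0 := liouville_lattice tp E_df (fun z => E_per z (lat1 t)) (fun z => E_per z (lat_tau t)) l.
have ED : tc E = tc D0.
 apply: (tc_ext D0disc rho0) => w wr; rewrite /E; case: asboolP => lw.
  by have [h1 _ h2 _] := small wr; rewrite (lat_discrete tp lw h2 h1).
 by rewrite DD0 //; apply/eqP => w0; apply: lw; rewrite w0; exact: lat0.
move: E0; rewrite ED D0E (tcD (cdiscD jd md) cd) (tcD jd md) (tcZ _ G'disc) (tcZ _ Gdisc) (tcZ _ idd) tc_id.
have rj : 0 < rho / rn j by rewrite divr_gt0.
rewrite (tc_scale j^-1 (Gq_disc tp' rj r4 r5)).
rewrite eqSS mulN1r mulNr => /eqP; rewrite subr_eq0 subr_eq => /eqP H.
exact: weight_solve j0 H.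
Qed.

End Modular.

Lemma Gq_modular (a b c d : int) (abcd : a * d - b * c = 1) (tau : uhp R) l :
 tc (Gq (val (mobius abcd tau))) l.+1 =
 jfactor c d tau ^+ l.+2 * tc (Gq (val tau)) l.+1 + (l == 0)%:R * (c%:~R * jfactor c d tau).
Proof.
have tp' := valP (mobius abcd tau); have j0 := jfactor_neq0 tau abcd.
have t'E : val (mobius abcd tau) = (a%:~R * val tau + b%:~R) / jfactor c d tau by [].
have jE : jfactor c d tau = c%:~R * val tau + d%:~R by [].
move: (jfactor c d tau) (val (mobius abcd tau)) (val tau) (valP tau) tp' j0 jE t'E => j t' t tp tp' j0 jE t'E.
have jp : 0 < rn j by rewrite rn_gt0.
have p0 : 0 < (2 * @pi R)^-1 by rewrite invr_gt0 mulr_gt0 // pi_gt0.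
(* A radius on which the expansions of [Gq] at t and, after division by j, at t' are valid and which
   contains no lattice point other than 0. *)
pose m1 := Num.min (Im t) (Num.min (2 * pi)^-1 1); pose m2 := Num.min (Im t') (2 * pi)^-1.
have m20 : 0 < m2 by rewrite lt_min tp' p0.
apply: (@Gq_modular_aux a b c d t t' j abcd tp tp' j0 jE t'E (Num.min m1 (m2 * rn j))).
- by rewrite !lt_min tp p0 ltr01 mulr_gt0.
- by rewrite !ge_min lexx.
- by rewrite !ge_min lexx ?orbT.
- by rewrite !ge_min lexx ?orbT.
- by rewrite ler_pdivrMr // ge_min; apply/orP; right; rewrite ler_pM2r // ge_min lexx.
- by rewrite ler_pdivrMr // ge_min; apply/orP; right; rewrite ler_pM2r // ge_min lexx orbT.
Qed.

End Weierstrass.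

(** * Lambert series: from Taylor coefficients to divisor sums *)

Section Lambert.
Variable R : realType.
Notation C := R[i].
Notation pii := (twopii R).
Notation ce := (tc (@cexp R)).

(** The pairs (n, d) with n d <= K are sorted by the product N = n d. *)
Lemma lambert_sum (f : nat -> nat -> C) (K : nat) : \sum_(1 <= n < K.+1) \sum_(1 <= d < (K %/ n).+1) f n d =
 \sum_(1 <= N < K.+1) \sum_(d <- divisors N) f (N %/ d)%N d.
Proof.
transitivity (\sum_(1 <= n < K.+1) \sum_(1 <= d < K.+1) \sum_(1 <= N < K.+1 | (n * d == N)%N) f n d).
 apply: eq_big_nat => n /andP[n0 nK].
 rewrite [RHS](@big_cat_nat _ _ _ (K %/ n).+1) ?ltnS ?leq_div //=.
 rewrite [X in _ = _ + X]big_nat_cond [X in _ = _ + X]big1 ?addr0 => [|d /andP[/andP[h1 h2] _]].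
  apply: eq_big_nat => d /andP[d0 dn]; rewrite ltnS leq_divRL // mulnC in dn.
  rewrite (big_rem (n * d)%N) /=; last by rewrite mem_index_iota ltnS dn muln_gt0 n0 d0.
  rewrite eqxx big_seq_cond big1 ?addr0 // => N /andP[]; rewrite mem_rem_uniq ?iota_uniq // inE eq_sym.
  by case: eqP.
 rewrite big_nat_cond big1 // => N /andP[/andP[_ NK] /eqP E]; exfalso.
 by move: h1; rewrite ltnNge leq_divRL // mulnC E -ltnS NK.
transitivity (\sum_(1 <= N < K.+1) \sum_(1 <= d < K.+1) \sum_(1 <= n < K.+1 | (n * d == N)%N) f n d).
 rewrite exchange_big /= [RHS]exchange_big /=; apply: eq_bigr => d _.
 under eq_bigr do rewrite big_mkcond /=; rewrite exchange_big /=.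
 by apply: eq_bigr => N _; rewrite -big_mkcond.
apply: eq_big_nat => N /andP[N0 NK].
have -> : \sum_(d <- divisors N) f (N %/ d)%N d = \sum_(1 <= d < K.+1 | (d %| N)%N) f (N %/ d)%N d.
 rewrite -[RHS]big_filter; apply: perm_big; apply: uniq_perm; rewrite ?divisors_uniq ?filter_uniq ?iota_uniq // => d.
 rewrite mem_filter mem_index_iota -dvdn_divisors //; case dN : (d %| N)%N => //=.
 by rewrite (dvdn_gt0 N0 dN) ltnS (leq_trans (dvdn_leq N0 dN)).
rewrite [RHS]big_mkcond; apply: eq_big_nat => d /andP[d0 dK]; case: ifP => dN.
 have [Nd0 NdK] : (0 < N %/ d)%N /\ (N %/ d < K.+1)%N.
  by rewrite divn_gt0 // dvdn_leq // (leq_ltn_trans (leq_div _ _) NK).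
 rewrite (big_rem (N %/ d)%N) /=; last by rewrite mem_index_iota Nd0 NdK.
 rewrite divnK // eqxx big_seq_cond big1 ?addr0 // => n /andP[]; rewrite mem_rem_uniq ?iota_uniq // inE.
 move=> /andP[nE _] /eqP E; move: nE; rewrite /= -E mulnK // => nE.
 by case/eqP: nE.
by rewrite big1 // => n /eqP E; move: dN; rewrite -E dvdn_mull.
Qed.

Lemma aq_geom (y : C) D : y != 1 -> aq y - \sum_(1 <= d < D.+1) y ^+ d = y ^+ D.+1 / (1 - y).
Proof.
move=> y1; have y2 : 1 - y != 0 by rewrite subr_eq0 eq_sym.
elim: D => [|D IH]; first by rewrite big_geq // subr0 expr1.
rewrite big_nat_recr //= opprD addrA IH; apply: (mulIf y2).
by rewrite mulrBl !divfK // [in RHS]exprS; ring.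
Qed.

(** The n-th geometric series is cut at d <= K / n, so that exactly the divisor sums up to K remain.
    Since n (K / n + 1) > K, each of the K cuts costs at most t^K / (1 - t). *)
Lemma lambert_err (q x : C) (t : R) K : 0 <= t < 1 -> (forall n, (0 < n)%N -> rn (q ^+ n * x) <= t ^+ n) ->
 rn (\sum_(1 <= n < K.+1) aq (q ^+ n * x) -
   \sum_(1 <= N < K.+1) \sum_(d <- divisors N) q ^+ N * x ^+ d) <= K%:R * (t ^+ K / (1 - t)).
Proof.
move=> /andP[t0 t1] H.
have -> : \sum_(1 <= N < K.+1) \sum_(d <- divisors N) q ^+ N * x ^+ d =
  \sum_(1 <= n < K.+1) \sum_(1 <= d < (K %/ n).+1) (q ^+ n * x) ^+ d.
 rewrite (lambert_sum (fun n d => (q ^+ n * x) ^+ d)); apply: eq_big_nat => N /andP[N0 _].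
 rewrite big_seq [RHS]big_seq; apply: eq_bigr => d; rewrite -dvdn_divisors // => dN.
 by rewrite exprMn -exprM divnK.
rewrite -sumrB; apply: le_trans (rn_sum _ _ _) _.
have -> : K%:R * (t ^+ K / (1 - t)) = \sum_(1 <= n < K.+1) t ^+ K / (1 - t).
 by rewrite sumr_const_nat subSS subn0 mulr_natl.
rewrite big_nat_cond [leRHS]big_nat_cond; apply: ler_sum => n /andP[/andP[n0 nK] _].
have yt := H n n0.
have yt1 : rn (q ^+ n * x) <= t.
 by apply: le_trans yt _; rewrite -[leRHS]expr1; apply: ler_wiXn2l => //; exact: ltW.
set y := q ^+ n * x in yt yt1 *.
have y1 : y != 1 by apply/eqP => y1; move: yt1; rewrite y1 rn1 leNgt t1.
rewrite aq_geom // rnM rnV rnX; apply: ler_pM; rewrite ?invr_ge0 ?exprn_ge0 ?rn_ge0 //.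
 apply: le_trans (_ : (t ^+ n) ^+ (K %/ n).+1 <= _).
  by apply: lerXn2r => //; rewrite nnegrE ?rn_ge0 ?exprn_ge0.
 rewrite -exprM; apply: ler_wiXn2l => //; first exact: ltW.
 by rewrite mulnC ltnW // ltn_ceil.
have h : 1 - t <= rn (1 - y) by have := rnBl 1 y; rewrite rn1; lra.
by rewrite lef_pV2 // posrE; [apply: lt_le_trans h|]; rewrite subr_gt0.
Qed.

Lemma cdisc_sum (I : Type) (r : seq I) (F : I -> C -> C) (rho : R) : 0 < rho ->
 (forall i, cdisc (F i) rho) -> cdisc (fun w => \sum_(i <- r) F i w) rho /\
 tc (fun w => \sum_(i <- r) F i w) = fun l => \sum_(i <- r) tc (F i) l.
Proof.
move=> r0 Fd; elim: r => [|i r [IH1 IH2]].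
 have -> : (fun w => \sum_(i <- [::]) F i w) = fun=> 0 by apply/funext => w; rewrite big_nil.
 split; first exact: cdisc_cst.
 by rewrite tc_cst; apply/funext => l; rewrite big_nil mul0r.
have -> : (fun w => \sum_(i <- i :: r) F i w) = fun w => F i w + \sum_(i <- r) F i w.
 by apply/funext => w; rewrite big_cons.
split; first exact: cdiscD.
by rewrite (tcD (Fd i) IH1) IH2; apply/funext => l; rewrite big_cons.
Qed.

Lemma rn_tri (a b c : C) (e : R) : rn (a - b) <= e / 2 -> rn (a - c) < e / 2 -> rn (b - c) <= e.
Proof.
move=> h1 h2; have -> : b - c = (a - c) - (a - b) by ring.
by have := rnB (a - c) (a - b); lra.
Qed.

Lemma nat_geom_tail (t A e : R) : 0 < t < 1 -> 0 <= A -> 0 < e ->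
 exists N, forall n, (N <= n)%N -> n%:R * (t ^+ n * A) <= e.
Proof.
move=> t01 A0 e0; have [M MH] := nat_pow_geom 2 t01.
have M0 : 0 <= M by apply: le_trans (MH 0%N); rewrite mulr_ge0 ?exprn_ge0 //; case/andP: t01 => /ltW.
exists (Num.bound (M * A / e)).+1 => n nN.
have n0 : 0 < (n%:R : R) by rewrite ltr0n; apply: leq_trans nN.
have h1 : M * A / e <= n%:R.
 apply: le_trans (ltW (archi_boundP _)) _; first by rewrite divr_ge0 ?mulr_ge0 // ltW.
 by rewrite ler_nat ltnW.
rewrite ler_pdivrMr // in h1.
have := ler_wpM2r A0 (MH n); rewrite expr2 => h2.
rewrite -(ler_pM2l n0); apply: le_trans (_ : M * A <= _) => //.
by apply: le_trans h2; rewrite le_eqVlt; apply/orP; left; apply/eqP; ring.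
Qed.

Section Tau.
Variable tau : C.
Hypothesis tau0 : 0 < Im tau.
Let q := ee tau.

(** The truncated Lambert series of [Sq q (ee w)]: finite sums of exponentials, whose Taylor
    coefficients are explicit. *)
Let P (K : nat) (w : C) : C :=
 \sum_(N <- index_iota 1 K.+1) \sum_(d <- divisors N) (q ^+ N * (ee w ^+ d - (ee w)^-1 ^+ d)).

Let term_disc N d (rho : R) : 0 < rho -> cdisc (fun w => q ^+ N * (ee w ^+ d - (ee w)^-1 ^+ d)) rho /\
 tc (fun w => q ^+ N * (ee w ^+ d - (ee w)^-1 ^+ d)) =
 fun l => q ^+ N * ((pii * d%:R) ^+ l * ce l - (- (pii * d%:R)) ^+ l * ce l).
Proof.
move=> r0; have cs (c : C) : cdisc (fun w => cexp (c * w)) rho.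
 split; first exact: r0.
 by move=> w _; dfs.
have -> : (fun w => q ^+ N * (ee w ^+ d - (ee w)^-1 ^+ d)) =
  fun w => q ^+ N * (cexp (pii * d%:R * w) + -1 * cexp (- (pii * d%:R) * w)).
 apply/funext => w; rewrite exprVn -eeMn -eeN mulN1r /ee.
 by congr (_ * (cexp _ - cexp _)); ring.
have mc := cdiscM (cdisc_cst (-1 : C) r0) (cs (- (pii * d%:R))).
split; first by apply: cdiscM (cdisc_cst _ r0) _; exact: cdiscD (cs _) mc.
have t1 := tc_scale (pii * d%:R) (cexp_disc (@ltr01 R)).
have t2 := tc_scale (- (pii * d%:R)) (cexp_disc (@ltr01 R)).
rewrite (tcZ (q ^+ N) (cdiscD (cs (pii * d%:R)) mc)) (tcD (cs (pii * d%:R)) mc).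
by rewrite (tcZ (-1) (cs (- (pii * d%:R)))) t1 t2; apply/funext => l; rewrite mulN1r.
Qed.

Lemma rn_exchange (a b a' b' S : C) (x y z : R) : rn (a - b - S) <= x -> rn (a - a') <= y -> rn (b - b') <= z ->
 rn (a' - b' - S) <= x + (y + z).
Proof.
move=> h1 h2 h3; have -> : a' - b' - S = (a - b - S) - ((a - a') - (b - b')) by ring.
by apply: le_trans (rnB _ _) _; apply: lerD => //; apply: le_trans (rnB _ _) _; exact: lerD.
Qed.

(** On |w| = Im tau / 2 the sums [P K] converge uniformly, so their Taylor coefficients converge.
    For odd l the two exponentials of each term contribute equally, and the powers d^l add up to
    sigma_l. *)
Lemma Sq_tc l : odd l -> tc (fun w => Sq q (ee w)) l = 2 * pii ^+ l * ce l * sigser l q.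
Proof.
move=> lo; pose y := Im tau; pose s := y / 2.
have s0 : 0 < s by rewrite divr_gt0.
have q1 := rn_q tau0; have q0 := ee_neq0 tau; rewrite -/q in q1 q0.
have Sd : cdisc (fun w => Sq q (ee w)) y by split => // w; exact: Sq_df_small.
have Pd K : cdisc (P K) y /\ tc (P K) = fun l => \sum_(N <- index_iota 1 K.+1) \sum_(d <- divisors N)
  q ^+ N * ((pii * d%:R) ^+ l * ce l - (- (pii * d%:R)) ^+ l * ce l).
 have H N := cdisc_sum (divisors N) tau0 (fun d => (term_disc N d tau0).1).
 have [H1 H2] := cdisc_sum (index_iota 1 K.+1) tau0 (fun N => (H N).1).
 split => //; rewrite H2; apply/funext => l'; apply: eq_bigr => N _; rewrite (H N).2.
 by apply: eq_bigr => d _; rewrite (term_disc N d tau0).2.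
have Ptc K : tc (P K) l = 2 * pii ^+ l * ce l * \sum_(N < K.+1) sigq R l N * q ^+ N.
 rewrite (Pd K).2 -(big_mkord xpredT (fun N => sigq R l N * q ^+ N)) big_ltn // mul0r add0r mulr_sumr.
 apply: eq_big_nat => N /andP[N0 _]; case: N N0 => // N _.
 rewrite /sigq /divisor_sigma natr_sum mulr_suml mulr_sumr; apply: eq_bigr => d _.
 rewrite natrX [(- _) ^+ l]exprNn -signr_odd lo expr1 (exprMn l pii d%:R).
 by move: (pii ^+ l) (ce l) (d%:R ^+ l) (q ^+ N.+1) => *; ring.
pose t := expR (- (pi * y)).
have t01 : 0 < t < 1 by rewrite expR_gt0 expR_lt1 oppr_lt0 mulr_gt0 // pi_gt0.
have t01' : 0 <= t < 1 by case/andP: t01 => /ltW -> ->.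
have pp := @pi_gt0 R.
have xt (x : C) n : (0 < n)%N -> `|Im x| <= s -> rn (q ^+ n * ee x) <= t ^+ n.
 move=> n0 xs; rewrite -eeMn -eeD rn_ee /t -expRM_natl ler_expR cImD cImM.
 have -> : Im (n%:R : C) = 0 by rewrite -(rmorph_nat (real_complex R)).
 have -> : Re (n%:R : C) = n%:R by rewrite -(rmorph_nat (real_complex R)).
 have n1 : 1 <= (n%:R : R) by rewrite ler1n.
 move: xs; rewrite ler_norml /s => /andP[xs _]; rewrite mul0r addr0.
 have h : n%:R * y <= 2 * (n%:R * y + Im x).
  by move: (n%:R : R) n1 (Im x) xs => k k1 X XH; have := ltW tau0; rewrite -/y => y0; nra.
 rewrite mulrN lerN2; have := ler_wpM2l (ltW pp) h; rewrite -/y.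
 by move: (n%:R : R) (Im x) => k X; lra.
pose M := expR (2 * pi * s).
have cM w : rn w = s -> rn (ee w) <= M /\ rn (ee w)^-1 <= M.
 move=> ws; have := Im_le_rn w; rewrite ws -eeN !rn_ee !ler_expR cImN -!mulrN !ler_pM2l ?mulr_gt0 //.
 by rewrite ler_norml opprK => /andP[h1 h2]; split=> //; rewrite lerNl.
have lim (e : R) : 0 < e -> exists N, forall K w, (N <= K)%N -> rn w = s -> rn (P K w - Sq q (ee w)) <= e.
 move=> e0; have e3 : 0 < e / 3 by rewrite divr_gt0.
 have A0 : 0 <= (1 - t)^-1 by rewrite invr_ge0 subr_ge0; case/andP: t01 => _ /ltW.
 have [N1 H1] := nat_geom_tail t01 A0 e3.
 have [n0 hn0] := n0_ex q1 M.
 have q01 : 0 <= rn q < 1 by rewrite rn_ge0 q1.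
 have [N2 H2] := geom_tail (4 * M / (1 - rn q)) q01 e3.
 exists (maxn N1 (maxn n0 N2)) => K w; rewrite !geq_max => /and3P[k1 k2 k3] ws.
 have [w1 w2] := cM w ws.
 have := Sq_tail q1 w1 w2 hn0 k2; rewrite mulrAC => h3; have {}h3 := le_trans h3 (ltW (H2 K k3)).
 have Iw : `|Im w| <= s by rewrite -ws; exact: Im_le_rn.
 have Iw' : `|Im (- w)| <= s by rewrite cImN normrN.
 have h2 := lambert_err K t01' (fun n n0 => xt w n n0 Iw).
 have h1 := lambert_err K t01' (fun n n0 => xt (- w) n n0 Iw').
 have h4 := H1 K k1.
 have -> : P K w = \sum_(1 <= N < K.+1) \sum_(d <- divisors N) q ^+ N * ee w ^+ d -
    \sum_(1 <= N < K.+1) \sum_(d <- divisors N) q ^+ N * ee (- w) ^+ d.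
  rewrite -sumrB; apply: eq_bigr => N _; rewrite -sumrB; apply: eq_bigr => d _.
  by rewrite mulrBr eeN.
 have E : \sum_(i < K) fq q i (ee w) =
   \sum_(1 <= n < K.+1) aq (q ^+ n * ee w) - \sum_(1 <= n < K.+1) aq (q ^+ n * ee (- w)).
  by rewrite -sumrB big_add1 big_mkord; apply: eq_bigr => i _; rewrite /fq eeN.
 rewrite E in h3; apply: le_trans (rn_exchange h3 h2 h1) _.
 by clear -h4; move: (K%:R * _) h4 => X; lra.
have ss : 0 < s < y by rewrite s0 ltr_pdivrMr // ltr_pMr // ltr1n.
have L := tc_limit l (fun K => (Pd K).1) Sd ss lim.
apply: rn_small_eq => e e0; have e2 : 0 < e / 2 by rewrite divr_gt0.
have [N1 H1] := L _ e2.
have [N2 H2] := psumZ (2 * pii ^+ l * ce l) (sigser_psum l q1) e2.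
have h1 := H1 (maxn N1 N2) (leq_maxl _ _); have := H2 (maxn N1 N2).+1 (leqW (leq_maxr _ _)).
under eq_bigr do rewrite -mulrA; rewrite -mulr_sumr -Ptc => h2.
exact: rn_tri h1 h2.
Qed.

Lemma Gq_tc l : odd l -> tc (Gq tau) l = pii ^+ l * (tc (@eta R) l.+1 - 2 * ce l * sigser l q).
Proof.
move=> lo; pose r := Num.min (Im tau) (2 * pi)^-1.
have pp := @pi_gt0 R; have p0 : 0 < (2 * @pi R)^-1 by rewrite invr_gt0 mulr_gt0.
have r0 : 0 < r by rewrite lt_min tau0 p0.
have r1 : r <= Im tau by rewrite ge_min lexx.
have r2 : r <= (2 * pi)^-1 by rewrite ge_min lexx orbT.
have Sd : cdisc (fun w => Sq q (ee w)) r by split=> [//|w wr]; apply: Sq_df_small => //; exact: lt_le_trans r1.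
have Bd : cdisc (fun w => Bh (pii * w)) r.
 have -> : (fun w => Bh (pii * w)) = fun w => Gq tau w + Sq q (ee w) by apply/funext => w; rewrite subrK.
 exact: cdiscD (Gq_disc tau0 r0 r1 r2) Sd.
have -> : Gq tau = fun w => Bh (pii * w) + -1 * Sq q (ee w) by apply/funext => w; rewrite mulN1r.
rewrite (tcD Bd (cdiscM (cdisc_cst (-1 : C) r0) Sd)) (tcZ _ Sd) (tc_scale _ (@Bh_disc R)) Bh_tc (Sq_tc lo).
by ring.
Qed.

End Tau.
End Lambert.

(** * Modular forms: reduction theory and vanishing theorems *)

Section ModularForms.
Variable R : realType.
Notation C := R[i].
Notation H := (uhp R).
Notation cdf g w := (dff (g : C^o -> C^o) (w : C^o)).
Implicit Types (f g : H -> C) (tau : H) (k : int).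

Lemma sin_le (x : R) : 0 < x -> sin x <= x.
Proof.
move=> x0.
have [|y _] := @MVT R sin cos 0 x x0 (fun y _ => is_derive_sin y).
 by apply: continuous_subspaceT => y; exact: continuous_sin.
by rewrite sin0 !subr0 => ->; rewrite ger_pMl // cos_le1.
Qed.

(** From sin (pi / 6) = 1 / 2 and sin x <= x. *)
Lemma pi_ge3 : 3 <= pi :> R.
Proof.
have key (x : R) : 0 < cos x -> sin (x + x) = cos x -> sin x = 1 / 2.
 rewrite sinD => c0 E; apply: (mulIf (lt0r_neq0 c0)).
 by move: E; rewrite [cos x * sin x]mulrC; move: (sin x * cos x) (cos x) => u v; lra.
have p0 := @pi_gt0 R; have x0 : 0 < (pi / 6 : R) by rewrite divr_gt0.
have s2 : sin (pi / 6) = 1 / 2 :> R.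
 apply: key; first by apply: cos_gt0_pihalf; lra.
 have -> : pi / 6 + pi / 6 = - (pi / 6) + pi / 2 :> R by field. by rewrite sinDpihalf cosN.
by have := sin_le x0; rewrite s2; lra.
Qed.

Lemma expR2pi : expR (- (2 * pi)) <= 1 / 4 :> R.
Proof.
have h : 4 <= expR (2 * pi) :> R. by apply: le_trans (expR_ge1Dx _); have := pi_ge3; lra.
by rewrite expRN div1r lef_pV2 ?posrE ?expR_gt0.
Qed.

Lemma rn_q_small tau : 1 <= Im (val tau) -> rn (ee (val tau)) <= 1 / 4.
Proof.
move=> t1; rewrite rn_ee; apply: le_trans expR2pi; rewrite ler_expR lerN2 ler_peMr //.
by rewrite mulr_ge0 // pi_ge0.
Qed.

Lemma rn_q_le (y : R) (t : C) : y <= Im t -> rn (ee t) <= expR (- (2 * pi * y)).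
Proof. by move=> h; rewrite rn_ee ler_expR lerN2 ler_wpM2l // mulr_ge0 // pi_ge0. Qed.

Definition hext f (t : C) : C := if insub t is Some tau then f tau else 0.

Lemma hextE f tau : hext f (val tau) = f tau.
Proof. by rewrite /hext valK. Qed.

Lemma uhpP (t : C) : 0 < Im t -> exists tau, val tau = t.
Proof. by move=> t0; exists (exist (fun t : C => is_true (0 < Im t)) t t0). Qed.

Lemma Im_ball tau (v : C) : rn (v - val tau) < Im (val tau) -> 0 < Im v.
Proof.
move=> h; have := le_lt_trans (Im_le_rn _) h; rewrite cImB ltr_norml => /andP[h1 _].
by move: h1; rewrite ltrBrDr addNr.
Qed.

Lemma hext_df f (G : C -> C) tau : (forall tau, f tau = G (val tau)) -> cdf G (val tau) ->
 cdf (hext f) (val tau).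
Proof.
move=> fG; apply: (@differentiable_local _ _ _ _ _ _ _ (valP tau)) => v /Im_ball/uhpP[t <-].
by rewrite hextE fG.
Qed.

Lemma hextM f g : hext (fun tau => f tau * g tau) = fun t => hext f t * hext g t.
Proof. by apply/funext => t; rewrite /hext; case: insub => [tau|] //; rewrite mulr0. Qed.
Lemma hextD f g : hext (fun tau => f tau + g tau) = fun t => hext f t + hext g t.
Proof. by apply/funext => t; rewrite /hext; case: insub => [tau|] //; rewrite addr0. Qed.

Definition hol f := forall tau, cdf (hext f) (val tau).
Definition mlaw k f := forall (a b c d : int) (abcd : a * d - b * c = 1) tau,
 f (mobius abcd tau) = jfactor c d tau ^ k * f tau.
(** Vanishing to order at least r at the cusp: r = 0 is boundedness there, r = 1 the condition on
    cusp forms. *)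
Definition cuspb (r : nat) f := exists Y B : R, forall tau, Y <= Im (val tau) ->
 rn (f tau) <= B * rn (ee (val tau)) ^+ r.
Definition mform k f := [/\ hol f, mlaw k f & cuspb 0 f].

Lemma holM f g : hol f -> hol g -> hol (fun tau => f tau * g tau).
Proof.
move=> hf hg tau; rewrite hextM.
exact: dfM (hf tau) (hg tau).
Qed.
Lemma holD f g : hol f -> hol g -> hol (fun tau => f tau + g tau).
Proof.
move=> hf hg tau; rewrite hextD.
exact: dfD (hf tau) (hg tau).
Qed.
Lemma hol_cst (c : C) : hol (fun=> c).
Proof. by move=> tau; apply: (hext_df (G := fun=> c)) => //; exact: dfcst. Qed.

Lemma cuspbW r f : cuspb r f -> exists Y B : R, [/\ 1 <= Y, 0 <= B & forall tau, Y <= Im (val tau) ->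
 rn (f tau) <= B * rn (ee (val tau)) ^+ r].
Proof.
move=> [Y [B H]]; exists (Num.max 1 Y), (Num.max 0 B); split; rewrite ?le_max ?lexx //.
move=> tau; rewrite ge_max => /andP[_ /H /le_trans]; apply.
by rewrite ler_wpM2r ?exprn_ge0 ?rn_ge0 // le_max lexx orbT.
Qed.

Lemma cuspbM r s f g : cuspb r f -> cuspb s g -> cuspb (r + s) (fun tau => f tau * g tau).
Proof.
move=> /cuspbW[Y [B [Y1 B0 h1]]] /cuspbW[Y' [B' [Y'1 B'0 h2]]].
exists (Num.max Y Y'), (B * B') => tau; rewrite ge_max => /andP[/h1 a1 /h2 a2].
by rewrite rnM exprD mulrACA; apply: ler_pM; rewrite ?rn_ge0.
Qed.

Lemma cuspbD r f g : cuspb r f -> cuspb r g -> cuspb r (fun tau => f tau + g tau).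
Proof.
move=> /cuspbW[Y [B [Y1 B0 h1]]] /cuspbW[Y' [B' [Y'1 B'0 h2]]].
exists (Num.max Y Y'), (B + B') => tau; rewrite ge_max => /andP[/h1 a1 /h2 a2].
by rewrite mulrDl; apply: le_trans (rnD _ _) _; exact: lerD.
Qed.

Lemma cuspb_le r s f : (r <= s)%N -> cuspb s f -> cuspb r f.
Proof.
move=> rs /cuspbW[Y [B [Y1 B0 h]]]; exists Y, B => tau yt; apply: le_trans (h tau yt) _.
rewrite ler_wpM2l //; apply: ler_wiXn2l => //; first exact: rn_ge0.
by apply: le_trans (rn_q_small (le_trans Y1 yt)) _; lra.
Qed.

Lemma cuspb_cst (c : C) : cuspb 0 (fun=> c).
Proof. by exists 0, (rn c) => tau _; rewrite expr0 mulr1. Qed.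

Lemma mformM k l f g : mform k f -> mform l g -> mform (k + l) (fun tau => f tau * g tau).
Proof.
move=> [hf mf cf] [hg mg cg]; split; [exact: holM| |exact: cuspbM cf cg].
by move=> a b c d abcd tau; rewrite mf mg mulrACA -expfzDr // (jfactor_neq0 tau abcd).
Qed.
Lemma mformD k f g : mform k f -> mform k g -> mform k (fun tau => f tau + g tau).
Proof.
move=> [hf mf cf] [hg mg cg]; split; [exact: holD| |exact: cuspbD].
by move=> a b c d abcd tau; rewrite mf mg mulrDr.
Qed.
Lemma mform_cst (c : C) : mform 0 (fun=> c).
Proof. by split; [exact: hol_cst| |exact: cuspb_cst] => a b e d abcd tau; rewrite expr0z mul1r. Qed.
Lemma mformZ k (c : C) f : mform k f -> mform k (fun tau => c * f tau).
Proof. by move=> mf; have := mformM (mform_cst c) mf; rewrite add0r. Qed.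
Lemma mform0 k : mform k (fun=> 0).
Proof. by split; [exact: hol_cst| |exact: cuspb_cst] => a b e d abcd tau; rewrite mulr0. Qed.
Lemma mformB k f g : mform k f -> mform k g -> mform k (fun tau => f tau - g tau).
Proof.
move=> mf mg; have := mformD mf (mformZ (-1) mg).
by congr (mform k _); apply/funext => tau; rewrite mulN1r.
Qed.
Lemma mformX k f n : mform k f -> mform (k * n%:Z) (fun tau => f tau ^+ n).
Proof.
move=> mf; elim: n => [|n IH].
 by rewrite mulr0; exact: mform_cst 1.
have := mformM mf IH; congr (mform _ _); first by rewrite intS mulrDr mulr1.
by apply/funext => tau; rewrite exprS.
Qed.
Lemma mform_sum (I : Type) (r : seq I) k (F : I -> H -> C) : (forall i, mform k (F i)) ->
 mform k (fun tau => \sum_(i <- r) F i tau).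
Proof.
move=> mF; elim: r => [|i r IH].
 by under eq_fun do rewrite big_nil; exact: mform0.
by under eq_fun do rewrite big_cons; exact: mformD.
Qed.

Lemma Tabcd (n : int) : 1 * 1 - n * 0 = 1 :> int. Proof. by rewrite mulr0 subr0 mulr1. Qed.
Lemma Sabcd : 0 * 0 - (-1) * 1 = 1 :> int. Proof. by []. Qed.
Lemma valT n tau : val (mobius (Tabcd n) tau) = val tau + n%:~R.
Proof. by rewrite /= /jfactor mul1r mul0r add0r divr1. Qed.
Lemma jT tau : jfactor 0 1 tau = 1.
Proof. by rewrite /jfactor mul0r add0r. Qed.
Lemma valS tau : val (mobius Sabcd tau) = - (val tau)^-1.
Proof. by rewrite /= /jfactor mul0r add0r mul1r addr0 intrN mulN1r. Qed.
Lemma jS tau : jfactor 1 0 tau = val tau.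
Proof. by rewrite /jfactor mul1r addr0. Qed.
Lemma val_neq0 tau : val tau != 0.
Proof. by apply/eqP => E; have := valP tau; rewrite E ltxx. Qed.

Lemma im_div (u v : C) : v != 0 -> Im (u / v) = (Im u * Re v - Re u * Im v) / rn v ^+ 2.
Proof.
move=> v0; have N0 : rn v ^+ 2 != 0 by rewrite expf_neq0 // rn_eq0.
have E : v^-1 = (Re v / rn v ^+ 2) +i* (- Im v / rn v ^+ 2).
 apply: (mulfI v0); rewrite divff //; apply/eqP; rewrite eq_complex cReM cImM /=.
 apply/andP; split; apply/eqP; last by ring.
 have key (x y N : R) : N = x ^+ 2 + y ^+ 2 -> N != 0 -> x * (x / N) - y * (- y / N) = 1.
  by move=> -> NN; field.
 by rewrite key // rn_sqr.
by rewrite cImM E /=; ring.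
Qed.

Lemma im_mobiusE (a b c d : int) (abcd : a * d - b * c = 1) tau :
 Im (val (mobius abcd tau)) = Im (val tau) / rn (jfactor c d tau) ^+ 2.
Proof.
have j0 := jfactor_neq0 tau abcd; rewrite [LHS](im_div _ j0); congr (_ / _).
rewrite /jfactor !cReD !cImD !cReM !cImM !Re_int !Im_int.
have E : a%:~R * d%:~R - b%:~R * c%:~R = 1 :> R by rewrite -!intrM -intrB abcd.
transitivity ((a%:~R * d%:~R - b%:~R * c%:~R) * Im (val tau)); last by rewrite E mul1r.
by move: (a%:~R : R) (b%:~R : R) (c%:~R : R) (d%:~R : R) => *; ring.
Qed.

(** After a translation |Re tau| <= 1 / 2, and S divides the height by |tau|^2. While the height is
    below 4 / 5, |tau|^2 is below 1 / 4 + 16 / 25 = 89 / 100 < 10 / 11, so each round gains a factor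
    11 / 10. Stopping at 4 / 5 rather than at the true bound makes this gain uniform. *)
Lemma reduction_ind (P : H -> Prop) : (forall tau, 4 / 5 <= Im (val tau) -> P tau) ->
 (forall tau n, P (mobius (Tabcd n) tau) -> P tau) ->
 (forall tau, P (mobius Sabcd tau) -> P tau) -> forall tau, P tau.
Proof.
move=> P0 PT PS.
have step m tau : 4 / 5 <= Im (val tau) * (11 / 10) ^+ m -> P tau.
 elim: m tau => [|m IH] tau; first by rewrite expr0 mulr1; exact: P0.
 have [/P0 //|lt45] := leP (4 / 5) (Im (val tau)).
 move=> h; pose n := - Num.floor (Re (val tau) + 1 / 2).
 apply: (PT tau n); apply: PS; apply: IH.
 have := floor_le_tmp (Re (val tau) + 1 / 2).
 have := floorD1_gt (Re (val tau) + 1 / 2).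
 rewrite intrD => f1 f2; rewrite im_mobiusE jS.
 have ReE : Re (val (mobius (Tabcd n) tau)) = Re (val tau) + n%:~R. by rewrite valT cReD Re_int.
 have ImE : Im (val (mobius (Tabcd n) tau)) = Im (val tau). by rewrite valT cImD Im_int addr0.
 have y0 := valP tau; rewrite ImE rn_sqr ReE ImE.
 have n1 : (Re (val tau) + n%:~R) ^+ 2 <= 1 / 4.
  rewrite /n intrN; move: (Num.floor _)%:~R f1 f2 => k f1 f2; nra.
 have N0 : 0 < (Re (val tau) + n%:~R) ^+ 2 + Im (val tau) ^+ 2. by rewrite ltr_wpDl ?sqr_ge0 // exprn_gt0.
 apply: le_trans h _; rewrite exprS mulrA ler_wpM2r ?exprn_ge0 //.
 rewrite ler_pdivlMr // -mulrA ler_piMr ?(ltW y0) //.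
 move: (_ ^+ 2) (Im _) y0 lt45 n1 {N0} => A y y0 lt45 n1; nra.
move=> tau; have q01 : 0 <= (10 / 11 : R) < 1 by lra.
have [N NH] := geom_tail (4 / 5) q01 (valP tau); apply: (step N).
have := ltW (NH N (leqnn N)); have -> : (10 / 11 : R) = (11 / 10)^-1 by field.
by rewrite exprVn ler_pdivrMr ?exprn_gt0.
Qed.

Lemma mlaw_T k f tau n : mlaw k f -> f (mobius (Tabcd n) tau) = f tau.
Proof. by move=> mf; rewrite mf jT exp1rz mul1r. Qed.

Lemma hext_per k f t : mlaw k f -> 0 < Im t -> hext f (t + 1) = hext f t.
Proof.
by move=> mf /uhpP[tau <-]; rewrite -[1]/(1%:~R) -valT !hextE (mlaw_T _ _ mf).
Qed.

Lemma phi_inv k f (a b c d : int) (abcd : a * d - b * c = 1) tau : mlaw k f ->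
 rn (f (mobius abcd tau)) ^+ 2 * Im (val (mobius abcd tau)) ^ k = rn (f tau) ^+ 2 * Im (val tau) ^ k.
Proof.
move=> mf; rewrite mf im_mobiusE rnM; have j0 := jfactor_neq0 tau abcd.
have jp : rn (jfactor c d tau) != 0 by rewrite rn_eq0.
have -> : rn (jfactor c d tau ^ k) = rn (jfactor c d tau) ^ k.
 by case: (k) => n; rewrite ?NegzE -?exprnP ?rnX // -!exprnN rnV rnX.
have y0 := lt0r_neq0 (valP tau); move: (rn (jfactor c d tau)) jp (rn (f tau)) (Im (val tau)) y0 => x x0 A y y0.
case: k {mf} => n.
 rewrite -!exprnP expr_div_n exprAC; have : x ^+ n != 0 by rewrite expf_neq0.
 by move: (x ^+ n) => X X0; field.
rewrite NegzE -!exprnN expr_div_n exprAC; have : x ^+ n.+1 != 0 by rewrite expf_neq0.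
have : y ^+ n.+1 != 0 by rewrite expf_neq0.
by move: (x ^+ n.+1) (y ^+ n.+1) => X Y Y0 X0; field; rewrite X0 Y0.
Qed.

(** phi = |f|^2 y^k is invariant, so by reduction a bound on y >= 4 / 5 holds everywhere, in
    particular on the line y = 3 / 4. The maximum principle for f^2 q^(-2 r) carries it from that
    line back to y >= 4 / 5 with the factor th gained. Iterating gives phi = 0. *)
Lemma mform_sup_zero k (r : nat) f (th : R) : 0 <= th < 1 -> mform k f -> cuspb r f ->
 (forall y, 4 / 5 <= y -> (4 * y / 3) ^ k * expR (- (4 * pi * (y - 3 / 4))) ^+ r <= th) ->
 forall tau, f tau = 0.
Proof.
move=> th01 [hf mf _] cf hth.
pose A := (3 / 4 : R) ^ k * expR (- (4 * pi * (3 / 4))) ^+ r.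
have A0 : 0 < A by rewrite mulr_gt0 ?exprz_gt0 ?exprn_gt0 ?expR_gt0.
pose g2 (t : C) : C := (hext f t) ^+ 2 * ee (- (2 * t)) ^+ r.
pose phi tau := rn (f tau) ^+ 2 * Im (val tau) ^ k.
have g2d t : 0 < Im t -> cdf g2 t.
 by move=> /uhpP[tau <-]; rewrite /g2; dfs; exact: hf.
have g2p t : 0 < Im t -> g2 (t + 1) = g2 t.
 move=> t0; rewrite /g2 (hext_per mf t0) mulrDr mulr1 opprD eeD.
 by rewrite [ee (- 2%:R)]ee_Nnat mulr1.
have rg2 tau : rn (g2 (val tau)) = rn (f tau) ^+ 2 * expR (4 * pi * Im (val tau)) ^+ r.
 rewrite /g2 hextE rnM !rnX rn_ee cImN cImM; congr (_ * expR _ ^+ _).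
 have -> : Im (2 : C) = 0 by rewrite -(rmorph_nat (real_complex R)).
 have -> : Re (2 : C) = 2 by rewrite -(rmorph_nat (real_complex R)). by ring.
have g2b : exists Y B : R, forall w, Y <= Im w -> rn (g2 w) <= B.
 have [Y [B [Y1 B0 HB]]] := cuspbW cf; exists Y, (B ^+ 2) => w Yw.
 have w0 : 0 < Im w by apply: lt_le_trans Yw; lra.
 have [tau tE] := uhpP w0; rewrite -tE rg2.
 have := HB tau; rewrite tE => /(_ Yw) hB.
 have h2 : rn (f tau) ^+ 2 <= (B * rn (ee w) ^+ r) ^+ 2.
  by apply: lerXn2r => //; rewrite nnegrE ?mulr_ge0 ?exprn_ge0 ?rn_ge0.
 apply: le_trans (ler_wpM2r _ h2) _; first by rewrite exprn_ge0 // expR_ge0.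
 have e1 : rn (ee w) ^+ 2 * expR (4 * pi * Im w) = 1.
  by rewrite rn_ee expr2 -!expRD (_ : _ + _ = 0) ?expR0 //; ring.
 have gen (b Q E : R) : Q ^+ 2 * E = 1 -> (b * Q ^+ r) ^+ 2 * E ^+ r = b ^+ 2.
  move=> h; have -> : (b * Q ^+ r) ^+ 2 * E ^+ r = b ^+ 2 * (Q ^+ 2 * E) ^+ r.
   by rewrite exprMn [in RHS]exprMn exprAC mulrA.
  by rewrite h expr1n mulr1.
 by rewrite gen.
have phiE tau : phi tau = rn (g2 (val tau)) * (A * ((4 * Im (val tau) / 3) ^ k *
  expR (- (4 * pi * (Im (val tau) - 3 / 4))) ^+ r)).
 rewrite rg2 /A /phi; have y0 := valP tau; move: (Im (val tau)) y0 => y y0.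
 have -> : y ^ k = (3 / 4) ^ k * (4 * y / 3) ^ k by rewrite -expfzMl; congr (_ ^ k); field.
 have e1 : expR (4 * pi * y) ^+ r * (expR (- (4 * pi * (3 / 4))) ^+ r *
    expR (- (4 * pi * (y - 3 / 4))) ^+ r) = 1.
  by rewrite -!exprMn -!expRD (_ : _ + _ = 0) ?expR0 ?expr1n //; field.
 move: (expR (4 * pi * y) ^+ r) (expR (- (4 * pi * (3 / 4))) ^+ r) (expR (- (4 * pi * (y - 3 / 4))) ^+ r) e1 => u v w e1.
 move: (rn _ ^+ 2) ((3 / 4) ^ k) ((4 * y / 3) ^ k) => a b c.
 by transitivity (a * (b * c) * (u * (v * w))); [rewrite e1 mulr1|ring].
have line M : (forall x, 0 <= x <= 1 -> rn (g2 (x +i* (3 / 4))) <= M) ->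
  forall tau, 4 / 5 <= Im (val tau) -> phi tau <= M * A * th.
 move=> HM tau ty.
 have h : rn (g2 (val tau)) <= M.
  apply: (@maxmod R g2 0 (3 / 4)) => //; lra.
 rewrite phiE -[leRHS]mulrA; apply: ler_pM; rewrite ?rn_ge0 //.
  by rewrite mulr_ge0 ?(ltW A0) // mulr_ge0 ?exprn_ge0 ?expR_ge0 // exprz_ge0 //; lra.
 by rewrite ler_pM2l //; exact: hth.
have half0 (x : R) : 0 < Im (x +i* (3 / 4) : C) by rewrite /=; lra.
have halve K : (forall tau, 4 / 5 <= Im (val tau) -> phi tau <= K) ->
  forall tau, 4 / 5 <= Im (val tau) -> phi tau <= K * th.
 move=> HK.
 have all : forall tau, phi tau <= K. by apply: reduction_ind => // [tau n|tau]; rewrite /phi phi_inv.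
 move=> tau ty; rewrite -[K](divfK (lt0r_neq0 A0)); apply: line ty => x _.
 have [t tE] := uhpP (half0 x); rewrite -tE ler_pdivlMr //; apply: le_trans (all t).
 rewrite phiE tE /= (_ : 4 * (3 / 4) / 3 = 1); last by field.
 by rewrite exp1rz subrr mulr0 oppr0 expR0 expr1n !mulr1.
have [M M0 MH] : exists2 M : R, 0 <= M & forall x, 0 <= x <= 1 -> rn (g2 (x +i* (3 / 4))) <= M.
 apply: (ccont_bounded ler01); apply: contat_h1 => x _; apply: contat_df; apply: g2d; exact: half0.
have iter n tau : 4 / 5 <= Im (val tau) -> phi tau <= M * A * th * th ^+ n.
 elim: n tau => [|n IH] tau ty; first by rewrite expr0 mulr1; exact: line MH tau ty.
 by rewrite exprSr mulrA; exact: halve IH tau ty.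
apply: reduction_ind => [tau ty|tau n|tau]; last 2 first.
- by rewrite (mlaw_T _ _ mf).
- by rewrite mf jS => /eqP; rewrite mulf_eq0 expfz_eq0 (negbTE (val_neq0 tau)) andbF /= => /eqP.
have y0 := valP tau; have yk : 0 < Im (val tau) ^ k by rewrite exprz_gt0.
have p0 : phi tau = 0.
 apply/le_anti; rewrite mulr_ge0 ?exprn_ge0 ?rn_ge0 ?(ltW yk) // andbT.
 apply/ler_addgt0Pr => e e0; rewrite add0r; have [N NH] := geom_tail (M * A * th) th01 e0.
 by apply: le_trans (iter N tau ty) (ltW (NH N (leqnn N))).
move/eqP: p0; rewrite mulf_eq0 (gt_eqF yk) orbF sqrf_eq0 rn_eq0 => /eqP //.
Qed.

Lemma mform_neg k f : k < 0 -> mform k f -> forall tau, f tau = 0.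
Proof.
move=> k0 mf; have [_ _ cf] := mf.
(* For y >= 4 / 5 one has 4 y / 3 >= 16 / 15, and the exponent k is negative. *)
apply: (@mform_sup_zero k 0 f (15 / 16)) => //; first by lra.
move=> y y45; rewrite expr0 mulr1; case: k k0 {mf} => // m _; rewrite NegzE -exprnN.
have h : 16 / 15 <= (4 * y / 3) ^+ m.+1.
 apply: le_trans (_ : (4 * y / 3) ^+ 1 <= _); first by rewrite expr1; lra.
 by apply: ler_weXn2l => //; lra.
have -> : 15 / 16 = (16 / 15 : R)^-1 by field.
by rewrite lef_pV2 ?posrE //; apply: lt_le_trans h; lra.
Qed.

Lemma mform_cusp8 k f : 0 <= k <= 8 -> mform k f -> cuspb 1 f -> forall tau, f tau = 0.
Proof.
move=> k08 mf cf; pose th := expR (- (1 / 20)) : R.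
apply: (@mform_sup_zero k 1 f th) => //; first by rewrite expR_ge0 expR_lt1; lra.
move=> y y45; case: k k08 {mf} => // m /andP[_ m8]; rewrite expr1 -exprnP.
have z1 : 1 <= 4 * y / 3 by lra.
have h1 : (4 * y / 3) ^+ m <= expR (4 * y / 3 - 1) ^+ 8.
 apply: le_trans (_ : (4 * y / 3) ^+ 8 <= _); first by apply: ler_weXn2l.
 apply: lerXn2r; rewrite ?nnegrE ?expR_ge0 //; first by lra.
 by have := @expR_ge1Dx R (4 * y / 3 - 1); rewrite addrC subrK.
apply: le_trans (ler_wpM2r (expR_ge0 _) h1) _.
rewrite -expRM_natl -expRD ler_expR; have := pi_ge3.
have y3 : 1 / 20 <= y - 3 / 4 by lra.
by move: (pi : R) => p p3; nra.
Qed.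

End ModularForms.

(** * Modularity of E4 and E6, the Serre derivative, and the zero-freeness of Delta *)

Section Eisenstein.
Variable R : realType.
Notation C := R[i].
Notation H := (uhp R).
Notation cdf g w := (dff (g : C^o -> C^o) (w : C^o)).
Notation pii := (twopii R).
Implicit Types (f g : H -> C) (tau : H) (k : int).

Lemma disc_lip (g : C -> C) : cdisc g 1 -> exists2 B : R, 0 <= B &
 forall w, rn w <= 1 / 4 -> rn (g w - g 0) <= B * rn w.
Proof.
move=> gd; have h2 : 0 < (1 / 2 : R) by lra.
have gc w : rn w = 1 / 2 -> contat g w by move=> ws; apply: contat_df; apply: gd.2; rewrite ws; lra.
have [M M0 MH] := circle_bound h2 gc.
exists (8 * M); first by rewrite mulr_ge0.
move=> w w4; have s01 : 0 < (1 / 2 : R) < 1 by lra.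
have := @tc_rem R g 1 (1 / 2) M 1 w gd s01 MH; rewrite big_ord1 expr0 mulr1 (tc_0 gd) expr1 => /(_ _)/le_trans; apply.
 by lra.
by rewrite le_eqVlt; apply/orP; left; apply/eqP; field.
Qed.

Lemma qf_hol f (g : C -> C) : cdisc g 1 -> (forall tau, f tau = g (ee (val tau))) -> hol f.
Proof.
move=> gd fE tau; apply: (hext_df (G := fun t => g (ee t))) => //.
by dfc g; apply: gd.2; exact: rn_q (valP tau).
Qed.

Lemma qf_cusp f (g : C -> C) : cdisc g 1 -> (forall tau, f tau = g (ee (val tau))) ->
 cuspb 1 (fun tau => f tau - g 0).
Proof.
move=> gd fE; have [B B0 BH] := disc_lip gd; exists 1, B => tau t1.
by rewrite fE expr1; apply: BH; exact: rn_q_small.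
Qed.

Lemma cuspb_value (a : C) f : cuspb 1 (fun tau => f tau - a) -> cuspb 0 f.
Proof.
move=> h; have := cuspbD (cuspb_le (leq0n 1) h) (cuspb_cst a).
by congr (cuspb 0 _); apply/funext => tau; rewrite subrK.
Qed.

Definition e4 (w : C) : C := 1 + 240 * sigser 3 w.
Definition e6 (w : C) : C := 1 + (- 504) * sigser 5 w.
Definition k2 (w : C) : C := pii ^+ 2 * (1 / 12 + (- 2) * sigser 1 w).
(* (2 pi i)^2 / 12 times the quasi-modular Eisenstein series of weight 2. *)
Definition kap tau : C := pii * tc (Gq (val tau)) 1.

Lemma affser_disc (a b : C) l : cdisc (fun w => a + b * sigser l w) 1.
Proof. exact: cdiscD (cdisc_cst a ltr01) (cdiscM (cdisc_cst b ltr01) (@sigser_disc R l)). Qed.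

Lemma e4_disc : cdisc e4 1. Proof. exact: affser_disc. Qed.
Lemma e6_disc : cdisc e6 1. Proof. exact: affser_disc. Qed.
Lemma k2_disc : cdisc k2 1.
Proof. exact: cdiscM (cdisc_cst _ ltr01) (affser_disc _ _ 1). Qed.

Lemma sigser_tc l : tc (@sigser R l) = sigq R l.
Proof. by apply: (@tc_psum _ _ _ 1) => // w w1; exact: sigser_psum. Qed.

Lemma sigser0 l : sigser l 0 = 0 :> C.
Proof. by rewrite -(tc_0 (@sigser_disc R l)) sigser_tc. Qed.

Lemma E4E tau : E4 tau = e4 (ee (val tau)). Proof. exact: eisensteinE. Qed.
Lemma E6E tau : E6 tau = e6 (ee (val tau)). Proof. exact: eisensteinE. Qed.
Lemma e4_0 : e4 0 = 1. Proof. by rewrite /e4 sigser0 mulr0 addr0. Qed.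
Lemma e6_0 : e6 0 = 1. Proof. by rewrite /e6 sigser0 mulr0 addr0. Qed.
Lemma k2_0 : k2 0 = pii ^+ 2 / 12. Proof. by rewrite /k2 sigser0 mulr0 addr0 mulrA mulr1. Qed.

Lemma kapE tau : kap tau = k2 (ee (val tau)).
Proof. by rewrite /kap (Gq_tc (valP tau)) // eta_2 ce1 /k2; ring. Qed.

Lemma E4_G tau : E4 tau = - 720 / pii ^+ 3 * tc (Gq (val tau)) 3.
Proof.
rewrite E4E (Gq_tc (valP tau)) // eta_4 ce3 /e4; have := twopii_neq0 R.
by move: (sigser 3 _) pii => s p p0; field.
Qed.

Lemma E6_G tau : E6 tau = 720 * 42 / pii ^+ 5 * tc (Gq (val tau)) 5.
Proof.
rewrite E6E (Gq_tc (valP tau)) // eta_6 ce5 /e6; have := twopii_neq0 R.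
by move: (sigser 5 _) pii => s p p0; field.
Qed.

Lemma law_aux (c j T x x' m : C) n : x' = c * (j ^+ n * T + false%:R * m) -> x = c * T -> x' = j ^+ n * x.
Proof. by move=> -> ->; rewrite mul0r addr0 mulrCA. Qed.

Lemma E4_mform : mform 4 (@E4 R).
Proof.
split; [exact: qf_hol e4_disc E4E| |exact: cuspb_value (qf_cusp e4_disc E4E)].
by move=> a b c d abcd tau; exact: law_aux (etrans (E4_G _) (congr1 _ (Gq_modular abcd tau 2))) (E4_G tau).
Qed.

Lemma E6_mform : mform 6 (@E6 R).
Proof.
split; [exact: qf_hol e6_disc E6E| |exact: cuspb_value (qf_cusp e6_disc E6E)].
by move=> a b c d abcd tau; exact: law_aux (etrans (E6_G _) (congr1 _ (Gq_modular abcd tau 4))) (E6_G tau).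
Qed.

Lemma kap_law (a b c d : int) (abcd : a * d - b * c = 1) tau :
 kap (mobius abcd tau) = jfactor c d tau ^+ 2 * kap tau + pii * (c%:~R * jfactor c d tau).
Proof.
have aux (p j T e : C) : p * (j ^+ 2 * T + 1%:R * (e * j)) = j ^+ 2 * (p * T) + p * (e * j) by ring.
exact: etrans (congr1 (fun x => pii * x) (Gq_modular abcd tau 0)) (aux _ _ _ _).
Qed.

Lemma kap_hol : hol kap. Proof. exact: qf_hol k2_disc kapE. Qed.
Lemma kap_cusp : cuspb 0 kap. Proof. exact: cuspb_value (qf_cusp k2_disc kapE). Qed.

Definition D1 f tau : C := tc (fun t => hext f (val tau + t)) 1.

Lemma hol_shift f tau : hol f -> cdisc (fun t => hext f (val tau + t)) (Im (val tau)).
Proof.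
move=> hf; split; first exact: (valP tau).
move=> t ts; dfc (hext f).
have : 0 < Im (val tau + t) by apply: (@Im_ball R tau); rewrite addrAC subrr add0r.
by move=> /uhpP[t' <-]; exact: hf.
Qed.

Lemma D1_M f g tau : hol f -> hol g ->
 D1 (fun tau => f tau * g tau) tau = D1 f tau * g tau + f tau * D1 g tau.
Proof.
move=> hf hg; rewrite /D1 hextM (tcM 1 (hol_shift tau hf) (hol_shift tau hg)).
rewrite big_ord_recl big_ord1 /= subn0 /bump /= addn0 subnn.
by rewrite (tc_0 (hol_shift tau hf)) (tc_0 (hol_shift tau hg)) !addr0 !hextE addrC.
Qed.

Lemma D1_B f g tau : hol f -> hol g -> D1 (fun tau => f tau - g tau) tau = D1 f tau - D1 g tau.
Proof.
move=> hf hg; have m1 := cdisc_cst (-1 : C) (valP tau).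
have -> : (fun tau => f tau - g tau) = fun tau => f tau + (-1) * g tau. by apply/funext => t; rewrite mulN1r.
rewrite /D1 hextD hextM.
have -> : (fun t => hext f (val tau + t) + hext (fun=> -1) (val tau + t) * hext g (val tau + t)) =
  fun t => hext f (val tau + t) + -1 * hext g (val tau + t).
 by apply/funext => t; rewrite /hext; case: insub => // ; rewrite !mulr0.
by rewrite (tcD (hol_shift tau hf) (cdiscM m1 (hol_shift tau hg))) (tcZ _ (hol_shift tau hg)) mulN1r.
Qed.

Lemma D1_hol f : hol f -> hol (D1 f).
Proof.
move=> hf tau; apply: (hext_df (G := fun t => tc (fun s => hext f (t + s)) 1)) => //.
apply: (deriv_holo (rho := Im (val tau))); first exact: (valP tau).
by move=> w /Im_ball/uhpP[t <-]; exact: hf.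
Qed.

(** Cauchy's estimate on the disc of radius 1 around tau; lowering the height by 1 costs the factor
    exp(2 pi). *)
Lemma D1_cusp (a : C) f : hol f -> cuspb 1 (fun tau => f tau - a) -> cuspb 1 (D1 f).
Proof.
move=> hf /cuspbW[Y [B [Y1 B0 HB]]]; exists (Y + 1), (2 * (B * expR (2 * pi))) => tau tY.
have c1 := cdisc_cst (- a) (valP tau); have hd := hol_shift tau hf.
have -> : D1 f tau = tc (fun t => hext f (val tau + t) + - a) 1. by rewrite (tcD hd c1) tc_cst mulr0 addr0.
have s01 : 0 < (1 : R) < Im (val tau) by rewrite ltr01; lra.
have := @tc_le _ _ _ 1 (B * expR (2 * pi) * rn (ee (val tau))) 1 (cdiscD hd c1) s01.
rewrite expr1n mulr1 => /(_ _)/le_trans; apply; last by rewrite expr1 !mulrA.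
move=> w w1; have Iw : Im (val tau) - 1 <= Im (val tau + w).
 by rewrite cImD; have := Im_le_rn w; rewrite w1 ler_norml; lra.
have [t tE] : exists t : H, val t = val tau + w by apply: uhpP; lra.
rewrite -tE hextE; apply: le_trans (HB t _) _; first by rewrite tE; lra.
rewrite expr1 -mulrA ler_wpM2l // tE; apply: le_trans (rn_q_le Iw) _.
by rewrite rn_ee -expRD ler_expR; lra.
Qed.

Lemma tc1_comp (F m : C -> C) (r r' : R) : cdisc F r -> cdisc m r' -> m 0 = 0 ->
 cdisc (fun t => F (m t)) r' -> tc (fun t => F (m t)) 1 = tc F 1 * tc m 1.
Proof.
move=> Fd md m0 Fm.
have [A hA] := (differentiable_deriv F 0).1 (Fd.2 0 ltac:(rewrite rn0; exact: Fd.1)).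
have [B hB] := (differentiable_deriv m 0).1 (md.2 0 ltac:(rewrite rn0; exact: md.1)).
rewrite (tc_deriv Fd hA) (tc_deriv md hB); apply: (tc_deriv Fm) => e e0.
have B1 : 0 < rn B + 1 by rewrite ltr_wpDl ?rn_ge0.
have A1 : 0 < rn A + 1 by rewrite ltr_wpDl ?rn_ge0.
have [d1 d10 H1] := hA _ (divr_gt0 (divr_gt0 e0 (ltr0n R 2)) B1).
pose e2 := Num.min 1 (e / 2 / (rn A + 1)); have e20 : 0 < e2 by rewrite lt_min ltr01 !divr_gt0.
have [d2 d20 H2] := hB _ e20.
exists (Num.min d2 (d1 / (rn B + 1))) => [|h]; first by rewrite lt_min d20 divr_gt0.
rewrite lt_min ltr_pdivlMr // => /andP[h2 h1]; have := H2 h h2; rewrite add0r m0 subr0 => mh.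
have h0 := rn_ge0 h.
have [mh1 mh2] : rn (m h - B * h) <= 1 * rn h /\ rn (m h - B * h) <= e / 2 / (rn A + 1) * rn h.
 by split; apply: le_trans mh _; rewrite ler_wpM2r // /e2 ge_min lexx ?orbT.
have mb : rn (m h) <= (rn B + 1) * rn h. by have := rnD (m h - B * h) (B * h); rewrite subrK rnM mulrDl; lra.
have := H1 (m h); rewrite add0r => /(_ _) h3.
have {}h3 : rn (F (m h) - F 0 - A * m h) <= e / 2 * rn h.
 apply: le_trans (h3 _) _; first by apply: le_lt_trans mb _; rewrite mulrC.
 apply: le_trans (ler_wpM2l (ltW (divr_gt0 (divr_gt0 e0 (ltr0n R 2)) B1)) mb) _.
 by rewrite mulrA divfK ?gt_eqF.
have -> : F (m h) - F 0 - A * B * h = (F (m h) - F 0 - A * m h) + A * (m h - B * h) by ring.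
apply: le_trans (rnD _ _) _; rewrite rnM.
have : rn A * rn (m h - B * h) <= (rn A + 1) * (e / 2 / (rn A + 1) * rn h).
 by apply: ler_pM; rewrite ?rn_ge0 // lerDl.
rewrite mulrA [(rn A + 1) * _]mulrC divfK ?gt_eqF // => h4; lra.
Qed.

Lemma tc_affX (u v : C) n : tc (fun t => (u + v * t) ^+ n) 1 = n%:R * v * u ^+ n.-1 /\
 tc (fun t => (u + v * t) ^+ n) 0 = u ^+ n.
Proof.
have ld : cdisc (fun t => u + v * t) 1.
 by apply: cdiscD (cdisc_cst u ltr01) _; apply: cdiscM (cdisc_cst v ltr01) _; split=> [//|w _]; exact: dfid.
have pd i : cdisc (fun t => (u + v * t) ^+ i) 1.
 by split=> [//|w w1]; dfs.
have l1 : tc (fun t => u + v * t) 1 = v.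
 have -> : (fun t => u + v * t) = fun t => (u%:P + v%:P * 'X : {poly C}).[t].
  by apply/funext => t; rewrite hornerD hornerM !hornerC hornerX.
 by rewrite tc_poly coefD coefC coefMX coefC /= add0r.
split; last by rewrite (tc_0 (pd n)) mulr0 addr0.
elim: n => [|n IH].
 by rewrite !mul0r; have -> : (fun t => (u + v * t) ^+ 0) = fun=> 1; [apply/funext => t; rewrite expr0|rewrite tc_cst mulr0].
have -> : (fun t => (u + v * t) ^+ n.+1) = fun t => (u + v * t) * (u + v * t) ^+ n.
 by apply/funext => t; rewrite exprS.
rewrite (tcM 1 ld (pd n)) big_ord_recl big_ord1 /= subn0 /bump /= addn0 subnn IH l1.
rewrite (tc_0 ld) (tc_0 (pd n)) mulr0 addr0 -natr1; case: n {IH} => [|n] /=.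
 by rewrite !expr0 /= !mul0r mulr0; ring.
by rewrite exprS; ring.
Qed.

Lemma D1_law (k : nat) f (a b c d : int) (abcd : a * d - b * c = 1) tau : mform k%:Z f -> (0 < k)%N ->
 D1 f (mobius abcd tau) = jfactor c d tau ^+ k.+2 * D1 f tau +
  k%:R * (c%:~R * jfactor c d tau ^+ k.+1 * f tau).
Proof.
move=> [hf mf _] k0; pose j := jfactor c d tau; have j0 : j != 0 := jfactor_neq0 tau abcd.
have jE : j = c%:~R * val tau + d%:~R by [].
have t'E : val (mobius abcd tau) = (a%:~R * val tau + b%:~R) / j by [].
have abcdC : a%:~R * d%:~R - b%:~R * c%:~R = 1 :> C by rewrite -!intrM -intrB abcd.
(* m t is the displacement of the image point: the image of tau + t minus that of tau. The law
   follows from the chain rule, with m'(0) = j^(-2). *)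
pose m (t : C) : C := t / (j * (j + c%:~R * t)).
pose r := Im (val tau); have r0 : 0 < r := valP tau.
have inH t : rn t < r -> exists t' : H, val t' = val tau + t.
 by move=> tr; apply: uhpP; apply: (@Im_ball R tau); rewrite addrAC subrr add0r.
have jt t' t : val t' = val tau + t -> jfactor c d t' = j + c%:~R * t.
 by move=> E; rewrite /jfactor E jE; ring.
have jt0 t : rn t < r -> j + c%:~R * t != 0.
 by move=> /inH[t' E]; rewrite -(jt t' t E) (jfactor_neq0 t' abcd).
have md : cdisc m r.
 by split=> [//|t tr]; rewrite /m; dfs; rewrite mulf_neq0 // jt0.
have ldd : cdisc (fun t => j * (j + c%:~R * t)) r.
 apply: cdiscM (cdisc_cst j r0) (cdiscD (cdisc_cst j r0) _).
 by apply: cdiscM (cdisc_cst _ r0) _; split=> [//|w _]; exact: dfid.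
have m0 : m 0 = 0 by rewrite /m mul0r.
have m1 : tc m 1 = (j ^+ 2)^-1.
 have : tc (fun t => m t * (j * (j + c%:~R * t))) 1 = 1.
  have idd : cdisc (fun t : C => t) r by split=> [//|w _]; exact: dfid.
  rewrite (tc_ext idd r0) ?tc_id // => t tr.
  by rewrite /m divfK // mulf_neq0 // jt0.
 rewrite (tcM 1 md ldd) big_ord_recl big_ord1 /= subn0 /bump /= addn0 subnn (tc_0 md) m0 mul0r add0r.
 rewrite (tc_0 ldd) mulr0 addr0 -expr2 => E; apply: (mulIf (expf_neq0 2 j0)).
 by rewrite mulVf ?expf_neq0.
have key t : rn t < r -> hext f (val (mobius abcd tau) + m t) = (j + c%:~R * t) ^+ k * hext f (val tau + t).
 move=> tr; have [t' E] := inH t tr; rewrite -E hextE.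
 have -> : val (mobius abcd tau) + m t = val (mobius abcd t').
  have -> : val (mobius abcd t') = (a%:~R * val t' + b%:~R) / jfactor c d t' by [].
  rewrite (jt t' t E) t'E /m E; have j1 := jt0 t tr.
  apply: (mulIf j1); rewrite divfK //; apply: (mulIf j0).
  have -> : ((a%:~R * val tau + b%:~R) / j + t / (j * (j + c%:~R * t))) * (j + c%:~R * t) * j =
    (a%:~R * val tau + b%:~R) * (j + c%:~R * t) + t * 1.
   by move: (j + c%:~R * t) j1 => J J0; field; rewrite j0 J0.
  transitivity ((a%:~R * val tau + b%:~R) * (j + c%:~R * t) + t * (a%:~R * d%:~R - b%:~R * c%:~R)).
   by rewrite abcdC.
  by rewrite jE; ring.
 by rewrite hextE mf (jt t' t E).
have hd := hol_shift tau hf; have hd' := hol_shift (mobius abcd tau) hf.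
have pd : cdisc (fun t => (j + c%:~R * t) ^+ k) r.
 by split=> [//|w w1]; dfs.
have cd := cdiscM pd hd.
have Fm : cdisc (fun t => hext f (val (mobius abcd tau) + m t)) r.
 split=> [//|w wr]; apply: (@differentiable_local _ C^o C^o
   (fun t : C^o => (j + c%:~R * t) ^+ k * hext f (val tau + t) : C^o) _ _ (r - rn w)).
 - by rewrite subr_gt0.
 - move=> v vw; rewrite key //; have := rnD (v - w) w; rewrite subrK.
  by move: (rn v) (rn (v - w)) (rn w) vw => x y z; lra.
 - exact: cd.2.
have := tc1_comp hd' md m0 Fm; rewrite -/(D1 f (mobius abcd tau)) m1.
rewrite (tc_ext cd r0); last by move=> t tr; rewrite key.
rewrite (tcM 1 pd hd) big_ord_recl big_ord1 /= subn0 /bump /= addn0 subnn.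
have [-> ->] := tc_affX j c%:~R k.
rewrite (tc_0 hd) addr0 hextE -/(D1 f tau) => E.
have -> : D1 f (mobius abcd tau) = (j ^+ k * D1 f tau + k%:R * c%:~R * j ^+ k.-1 * f tau) * j ^+ 2.
 by rewrite E divfK // expf_neq0.
case: k k0 {mf E key pd cd Fm} => // k _ /=.
by move: (c%:~R) (D1 f tau) (f tau) (k.+1%:R) => *; rewrite -/j !exprS; ring.
Qed.

(** The Serre derivative: the defect of [kap] under the modular group cancels that of the derivative
    [D1], so the weight rises by exactly 2. *)
Definition serre (k : nat) f tau : C := pii * D1 f tau - k%:R * (kap tau * f tau).

Lemma serre_mform (k : nat) (a : C) f : (0 < k)%N -> mform k%:Z f -> cuspb 1 (fun tau => f tau - a) ->
 mform (k%:Z + 2) (serre k f) /\ cuspb 1 (fun tau => serre k f tau + k%:R * (pii ^+ 2 / 12 * a)).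
Proof.
move=> k0 mf cf; have [hf lf _] := mf.
have cD := D1_cusp hf cf.
have c2 : cuspb 1 (fun tau => serre k f tau + k%:R * (pii ^+ 2 / 12 * a)).
 have h1 := cuspbM (cuspb_cst pii) cD.
 have h2 := cuspbM (qf_cusp k2_disc kapE) (cuspb_value cf).
 have h3 := cuspbM (cuspb_cst (pii ^+ 2 / 12)) cf.
 have h4 := cuspbM (cuspb_cst (- k%:R)) (cuspbD h2 h3).
 have := cuspbD h1 h4; congr (cuspb 1 _); apply/funext => tau.
 by rewrite /serre k2_0; move: (D1 f tau) (kap tau) (f tau) => *; ring.
split => //; split.
- have -> : serre k f = fun tau => pii * D1 f tau + (- k%:R) * (kap tau * f tau).
  by apply/funext => tau; rewrite mulNr.
 by apply: holD; apply: holM (hol_cst _) _; [exact: D1_hol|exact: holM kap_hol hf].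
- move=> b e c d abcd tau; rewrite /serre (D1_law abcd tau mf k0) kap_law lf.
 have j0 := jfactor_neq0 tau abcd; rewrite -PoszD -!exprnP addn2.
 move: (jfactor c d tau) (D1 f tau) (kap tau) (f tau) (c%:~R) => j D K F c'.
 by rewrite !exprS; ring.
- have := cuspbD (cuspb_le (leq0n 1) c2) (cuspb_cst (- (k%:R * (pii ^+ 2 / 12 * a)))).
 by congr (cuspb 0 _); apply/funext => tau; rewrite addrK.
Qed.

Lemma E4_cusp : cuspb 1 (fun tau => @E4 R tau - 1).
Proof. by have := qf_cusp e4_disc E4E; rewrite e4_0. Qed.
Lemma E6_cusp : cuspb 1 (fun tau => @E6 R tau - 1).
Proof. by have := qf_cusp e6_disc E6E; rewrite e6_0. Qed.

(** One of Ramanujan's identities, as is [serre_E6]: constant terms agree, and the difference is a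
    cusp form of weight at most 8, hence 0. *)
Lemma serre_E4 tau : serre 4 (@E4 R) tau = - (pii ^+ 2 / 3) * E6 tau.
Proof.
have [m c] := serre_mform (k := 4) isT E4_mform E4_cusp.
apply/eqP; rewrite -subr_eq0; apply/eqP.
apply: (@mform_cusp8 R 6 (fun tau => serre 4 (@E4 R) tau - - (pii ^+ 2 / 3) * E6 tau)) => //.
 exact: mformB m (mformZ _ E6_mform).
have := cuspbD c (cuspbM (cuspb_cst (pii ^+ 2 / 3)) E6_cusp); congr (cuspb 1 _); apply/funext => t.
by move: (serre _ _ _) (E6 t) => x y; field.
Qed.

Lemma E4_sqr_cusp : cuspb 1 (fun tau => @E4 R tau ^+ 2 - 1).
Proof.
have h := cuspbM (cuspb_value E4_cusp) E4_cusp; have := cuspbD h E4_cusp.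
by congr (cuspb 1 _); apply/funext => t; ring.
Qed.

Lemma serre_E6 tau : serre 6 (@E6 R) tau = - (pii ^+ 2 / 2) * E4 tau ^+ 2.
Proof.
have [m c] := serre_mform (k := 6) isT E6_mform E6_cusp.
apply/eqP; rewrite -subr_eq0; apply/eqP.
apply: (@mform_cusp8 R 8 (fun tau => serre 6 (@E6 R) tau - - (pii ^+ 2 / 2) * E4 tau ^+ 2)) => //.
 exact: mformB m (mformZ _ (mformX 2 E4_mform)).
have := cuspbD c (cuspbM (cuspb_cst (pii ^+ 2 / 2)) E4_sqr_cusp); congr (cuspb 1 _); apply/funext => t.
by move: (serre _ _ _) (E4 t ^+ 2) => x y; field.
Qed.

(** 1728 times the usual discriminant; [delta_ex] computes this leading coefficient. *)
Definition Delta tau : C := E4 tau ^+ 3 - E6 tau ^+ 2.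

Lemma Delta_mform : mform 12 Delta.
Proof. exact: mformB (mformX 3 E4_mform) (mformX 2 E6_mform). Qed.

Lemma D1_Delta tau : D1 Delta tau = 12 / pii * kap tau * Delta tau.
Proof.
have [h4' _ _] := E4_mform; have [h6 _ _] := E6_mform.
have h44 := holM h4' h4'.
have -> : Delta = fun tau => E4 tau * (E4 tau * E4 tau) - E6 tau * E6 tau.
 by apply/funext => t; rewrite /Delta; ring.
rewrite (D1_B tau (holM h4' h44) (holM h6 h6)) (D1_M tau h4' h44) (D1_M tau h4' h4') (D1_M tau h6 h6).
have p0 := twopii_neq0 R; have := serre_E4 tau; have := serre_E6 tau; rewrite /serre => e1 e2.
have -> : D1 (@E4 R) tau = (- (pii ^+ 2 / 3) * E6 tau + 4 * (kap tau * E4 tau)) / pii.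
 by rewrite -e2 subrK mulrC mulKf.
have -> : D1 (@E6 R) tau = (- (pii ^+ 2 / 2) * E4 tau ^+ 2 + 6 * (kap tau * E6 tau)) / pii.
 by rewrite -e1 subrK mulrC mulKf.
by move: (E4 tau) (E6 tau) (kap tau) pii p0 => x y K p p0; field.
Qed.

Lemma delta_ex : exists2 h : C -> C, cdisc h 1 & h 0 = 1728 /\
 forall tau, Delta tau = ee (val tau) * h (ee (val tau)).
Proof.
have d44 := cdiscM e4_disc e4_disc; have d3 := cdiscM e4_disc d44; have d2 := cdiscM e6_disc e6_disc.
have m1 := cdiscM (cdisc_cst (-1 : C) ltr01) d2; have dd := cdiscD d3 m1.
have t4 : tc e4 1 = 240.
 rewrite (tcD (cdisc_cst 1 ltr01) (cdiscM (cdisc_cst 240 ltr01) (@sigser_disc R 3))) (tcZ _ (@sigser_disc R 3)).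
 by rewrite tc_cst sigser_tc /sigq /divisor_sigma /= big_cons big_nil /= mulr0 add0r mulr1.
have t6 : tc e6 1 = - 504.
 rewrite (tcD (cdisc_cst 1 ltr01) (cdiscM (cdisc_cst (- 504) ltr01) (@sigser_disc R 5))) (tcZ _ (@sigser_disc R 5)).
 by rewrite tc_cst sigser_tc /sigq /divisor_sigma /= big_cons big_nil /= mulr0 add0r mulr1.
have M1 (g g' : C -> C) : cdisc g 1 -> cdisc g' 1 -> tc (fun w => g w * g' w) 1 = g 0 * tc g' 1 + tc g 1 * g' 0.
 move=> gd gd'; rewrite (tcM 1 gd gd') big_ord_recl big_ord1 /= subn0 /bump /= addn0 subnn.
 by rewrite (tc_0 gd) (tc_0 gd').
have [i|h hd [hE h0]] := order_split (n := 1) dd.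
 by rewrite ltnS leqn0 => /eqP ->; rewrite (tc_0 dd) e4_0 e6_0; ring.
exists h => //; split; last first.
 by move=> tau; rewrite /Delta E4E E6E; have := hE _ (rn_q (valP tau)); rewrite expr1 => <-; ring.
rewrite h0 (tcD d3 m1) (tcZ _ d2) (M1 _ _ e4_disc d44) (M1 _ _ e4_disc e4_disc) (M1 _ _ e6_disc e6_disc).
by rewrite t4 t6 e4_0 e6_0; ring.
Qed.

Lemma Delta_lower : exists Y : R, forall tau, Y <= Im (val tau) -> rn (ee (val tau)) <= rn (Delta tau).
Proof.
have [h hd [h0 hE]] := delta_ex; have [B B0 BH] := disc_lip hd.
have q01 : 0 <= (expR (- (2 * pi)) : R) < 1. by rewrite expR_ge0 expR_lt1 oppr_lt0 mulr_gt0 // pi_gt0.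
have [N NH] := geom_tail (B + 1) q01 (ltr01 (R := R)).
exists N.+1%:R => tau tN; have t1 : 1 <= Im (val tau) by apply: le_trans tN; rewrite ler1n.
have q4 := rn_q_small t1; rewrite hE rnM ler_peMr ?rn_ge0 //.
have qN : rn (ee (val tau)) <= expR (- (2 * pi)) ^+ N.+1.
 by apply: le_trans (rn_q_le tN) _; rewrite -expRM_natl ler_expR mulrN lerN2 mulrC.
have h1 : B * rn (ee (val tau)) <= 1.
 apply: ltW; apply: le_lt_trans (NH N.+1 (leqW (leqnn N))).
 by apply: ler_pM; rewrite ?rn_ge0 //; lra.
have := BH _ q4; have := rnBl (h 0) (h (ee (val tau))); rewrite [rn (h 0 - _)]rnC h0 rn_nat.
have h1728 : (2 : R) <= 1728%:R by rewrite ler_nat.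
by move: h1728 h1; lra.
Qed.

Lemma Delta_not0 tau : ~ (exists2 d : R, 0 < d & forall w, rn (w - val tau) < d -> hext Delta w = 0).
Proof.
move=> [d d0 Hd]; have [hD lD cD] := Delta_mform.
have [Y HY] := Delta_lower.
have z : forall w, 0 < Im w -> hext Delta w = 0.
 apply: (identity_H (tau0 := val tau) (d := d)) => //.
 - by move=> w /uhpP[t <-]; exact: hD.
 - by move=> w; exact: (hext_per lD).
 - have [Y' [B [Y1 B0 HB]]] := cuspbW cD; exists Y', B => w Yw.
  have [t tE] : exists t : H, val t = w by apply: uhpP; lra.
  by rewrite -tE hextE; have := HB t; rewrite tE expr0 mulr1; apply.
 - exact: (valP tau).
have [t tE] : exists t : H, val t = 0 +i* (Num.max Y 1). by apply: uhpP; rewrite /= lt_max ltr01 orbT.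
have := HY t; rewrite tE /= le_max lexx => /(_ isT); rewrite -(hextE Delta t) z; last exact: (valP t).
by rewrite rn0 leNgt rn_gt0 ee_neq0.
Qed.

(** By [D1_Delta] the logarithmic derivative of Delta is holomorphic; at a zero it would have a pole
    whose residue is the order of the zero. *)
Lemma Delta_neq0 tau : Delta tau != 0.
Proof.
apply/eqP => D0; have [hD _ _] := Delta_mform; have r0 := valP tau.
have [||n [h hd [h0 hE]]] := @finite_order R (hext Delta) (val tau) _ r0.
- by move=> w /Im_ball/uhpP[t <-]; exact: hD.
- by move=> H0; apply: (@Delta_not0 tau); exists (Im (val tau)).
have n0 : (0 < n)%N.
 case: n hE => // hE; have := hE 0; rewrite rn0 => /(_ r0); rewrite expr0 mul1r addr0 hextE D0.
 by move=> E; move: h0; rewrite -E eqxx.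
pose h' w := tc (fun t => h (w + t)) 1.
have hsh w : rn w < Im (val tau) -> cdisc (fun t => h (w + t)) (Im (val tau) - rn w).
 move=> wr; split; first by rewrite subr_gt0.
 by move=> t tr; dfc h; apply: hd.2; have := rnD w t; lra.
(* The differential equation for Delta = w^n h, divided by w^(n-1). At w = 0 it reads n h(0) = 0. *)
have key w : 0 < rn w < Im (val tau) -> n%:R * h w = w * (12 / pii * k2 (ee (val tau + w)) * h w - h' w).
 move=> /andP[w0 wr]; have wn : w != 0 by rewrite -rn_gt0.
 have [t tE] : exists t : H, val t = val tau + w.
  by apply: uhpP; apply: (@Im_ball R tau); rewrite addrAC subrr add0r.
 have := D1_Delta t; rewrite kapE tE /D1 -(hextE Delta t) tE hE //.
 pose s := Im (val tau) - rn w; have s0 : 0 < s by rewrite subr_gt0.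
 have pd : cdisc (fun t => (w + 1 * t) ^+ n) s.
  by split=> [//|v vs]; dfs.
 have -> : tc (fun t => hext Delta (val tau + w + t)) 1 = tc (fun t => (w + 1 * t) ^+ n * h (w + t)) 1.
  rewrite (tc_ext (cdiscM pd (hsh w wr)) s0) // => v vs.
  by rewrite mul1r -addrA hE //; have := rnD w v; rewrite /s in vs; lra.
 rewrite (tcM 1 pd (hsh w wr)) big_ord_recl big_ord1 /= subn0 /bump /= addn0 subnn.
 have [-> ->] := tc_affX w 1 n; rewrite (tc_0 (hsh w wr)) addr0 -/(h' w) mulr1 => E.
 have wnE : w ^+ n = w * w ^+ n.-1 by rewrite -exprS prednK.
 apply: (mulfI (expf_neq0 n.-1 wn)); move: E; rewrite wnE.
 move: (w ^+ n.-1) (h w) (h' w) (12 / pii * _) => W a b c E.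
 by transitivity (w * W * b + n%:R * W * a - w * W * b); [ring|rewrite E; ring].
have h'd : cdf h' 0 by apply: (deriv_holo (rho := Im (val tau))) => // w; rewrite subr0; exact: hd.2.
have hd0 : cdf h 0 by apply: hd.2; rewrite rn0.
have kd : cdf (fun w => k2 (ee (val tau + w))) 0.
 by dfc k2; apply: k2_disc.2; rewrite addr0; exact: rn_q.
have /eqP : n%:R * h 0 = 0 * (12 / pii * k2 (ee (val tau + 0)) * h 0 - h' 0).
 apply: (@cont_punct R (fun w => n%:R * h w) (fun w => w * (12 / pii * k2 (ee (val tau + w)) * h w - h' w)) 0 _ r0).
 - by apply: contatM; apply: contat_df => //; exact: dfcst.
 - apply: contatM; apply: contat_df; first exact: dfid.
  by dfs; [exact: kd|exact: hd0|exact: h'd].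
 - by move=> w; rewrite subr0; exact: key.
by rewrite mul0r mulf_eq0 (negbTE h0) orbF pnatr_eq0 -leqn0 leqNgt n0.
Qed.

Lemma E46_neq0 tau : E4 tau != 0 \/ E6 tau != 0.
Proof.
have [h4|] := eqVneq (E4 tau) 0; last by left.
right; apply/eqP => h6; have := Delta_neq0 tau.
by rewrite /Delta h4 h6 !expr0n /= subr0 eqxx.
Qed.

End Eisenstein.

(** * The ring of modular forms is generated by E4 and E6 *)

Section Structure.
Variable R : realType.
Notation C := R[i].
Notation H := (uhp R).
Notation cdf g w := (dff (g : C^o -> C^o) (w : C^o)).
Implicit Types (f g : H -> C) (tau : H) (k : int).

Lemma cuspb_hext k f : mform k f -> exists Y B : R, [/\ 1 <= Y, 0 <= B &
 forall w, Y <= Im w -> rn (hext f w) <= B].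
Proof.
move=> [_ _ /cuspbW[Y [B [Y1 B0 HB]]]]; exists Y, B; split => // w Yw.
have [t tE] : exists t : H, val t = w by apply: uhpP; lra.
by rewrite -tE hextE; have := HB t; rewrite tE expr0 mulr1; apply.
Qed.

Lemma mform_identity k f tau (d : R) : mform k f -> 0 < d ->
 (forall t : H, rn (val t - val tau) < d -> f t = 0) -> forall t, f t = 0.
Proof.
move=> mf d0 Hd t; have [hf lf _] := mf; rewrite -hextE.
apply: (identity_H (tau0 := val tau) (d := Num.min d (Im (val tau)))) => //.
- by move=> w /uhpP[u <-]; exact: hf.
- by move=> w; exact: (hext_per lf).
- by have [Y [B [_ _ HB]]] := cuspb_hext mf; exists Y, B.
- exact: (valP tau).
- by rewrite lt_min d0; exact: (valP tau).
- by move=> w; rewrite lt_min => /andP[w1 /Im_ball/uhpP[u uE]]; rewrite -uE hextE Hd // uE.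
- exact: (valP t).
Qed.

Lemma mform_expand k f : mform k f -> exists a : nat -> C, (forall tau, psum a (ee (val tau)) (f tau)) /\
 exists2 Y : R, 1 <= Y & forall n, exists2 K : R, 0 <= K & forall tau, Y <= Im (val tau) ->
  rn (\sum_(r < n) a r * ee (val tau) ^+ r - f tau) <= K * rn (ee (val tau)) ^+ n.
Proof.
move=> mf; have [hf lf _] := mf; have [Y [B [Y1 B0 HB]]] := cuspb_hext mf.
have hd w : 0 < Im w -> cdf (hext f) w by move=> /uhpP[u <-]; exact: hf.
have hb : exists Y B : R, forall w, Y <= Im w -> rn (hext f w) <= B by exists Y, B.
have [a [ab ap]] := half_plane_expand hd (fun w => hext_per lf) hb.
have ps tau : psum a (ee (val tau)) (f tau) by have := ap (val tau) (valP tau); rewrite hextE.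
exists a; split => //; exists (Y + 1); first by lra.
move=> n; pose s := expR (- (2 * pi * Y)) : R; have s0 : 0 < s by exact: expR_gt0.
have Y0 : 0 < Y by lra.
have aM r : rn (a r) * s ^+ r <= 2 * B by apply: ab => // x _; apply: HB.
exists (4 * B / s ^+ n); first by rewrite divr_ge0 ?mulr_ge0 ?exprn_ge0 ?(ltW s0).
move=> tau tY; have ts : rn (ee (val tau)) / s <= 1 / 4.
 rewrite rn_ee /s -expRN -expRD; apply: le_trans (@expR2pi R); rewrite ler_expR opprK.
 have := @pi_ge0 R; move: (pi : R) => p p0; nra.
have ts1 : rn (ee (val tau)) < s by move: ts; rewrite ler_pdivrMr //; lra.
apply: le_trans (psum_tail s0 aM ts1 (ps tau) n) _.
have t0 : 0 <= rn (ee (val tau)) / s by rewrite divr_ge0 ?rn_ge0 // ltW.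
have -> : 4 * B / s ^+ n * rn (ee (val tau)) ^+ n = 2 * B * (rn (ee (val tau)) / s) ^+ n * 2.
 by rewrite expr_div_n; move: (_ ^+ n) ((s ^+ n)^-1) => u v; ring.
rewrite ler_wpM2l ?mulr_ge0 ?exprn_ge0 //; move: (_ / s) ts t0 => t ts t0.
by rewrite -[2]invrK lef_pV2 ?posrE; lra.
Qed.

Lemma mform_value k f : mform k f -> exists a : C, cuspb 1 (fun tau => f tau - a).
Proof.
move=> /mform_expand[a [_ [Y Y1 HY]]]; exists (a 0%N); have [K K0 KH] := HY 1%N.
by exists Y, K => tau /KH; rewrite big_ord1 expr0 mulr1 rnC.
Qed.

(** The first nonzero q-coefficient dominates near the cusp. The lower bound limits the pole at the
    cusp of a quotient by f. *)
Lemma mform_order k f tau0 : mform k f -> f tau0 != 0 -> exists p : nat, exists2 c : R, 0 < c &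
 exists Y : R, forall tau, Y <= Im (val tau) -> c * rn (ee (val tau)) ^+ p <= rn (f tau).
Proof.
move=> mf f0; have [a [ps [Y Y1 HY]]] := mform_expand mf.
have ex : exists p, a p != 0.
 apply: contrapT => Hn; move/eqP: f0; apply; apply: (psum_unique (ps tau0)) => e e0; exists 0%N => n _.
 rewrite big1 ?subrr ?rn0 // => i _.
 by have [->|ai] := eqVneq (a i) 0; [rewrite mul0r|exfalso; apply: Hn; exists i].
have [p ap pm] := ex_minnP ex; have [K K0 KH] := HY p.+1.
have c0 : 0 < rn (a p) by rewrite rn_gt0.
exists p, (rn (a p) / 2); first by rewrite divr_gt0.
have q01 : 0 <= (expR (- (2 * pi)) : R) < 1. by rewrite expR_ge0 expR_lt1 oppr_lt0 mulr_gt0 // pi_gt0.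
have [N NH] := geom_tail K q01 (divr_gt0 c0 (ltr0n R 2)).
exists (Num.max Y N%:R) => tau; rewrite ge_max => /andP[tY tN].
have qN : rn (ee (val tau)) <= expR (- (2 * pi)) ^+ N.
 by apply: le_trans (rn_q_le tN) _; rewrite -expRM_natl ler_expR mulrN lerN2 mulrC.
have := KH tau tY; rewrite big_ord_recr /= big1 => [|i _]; last first.
 have [->|ai] := eqVneq (a i) 0; first by rewrite mul0r. by have := pm _ ai; rewrite leqNgt ltn_ord.
rewrite add0r exprS mulrA => h1; have := rnBl (a p * ee (val tau) ^+ p) (f tau); rewrite rnM rnX.
have h2 : K * rn (ee (val tau)) <= rn (a p) / 2.
 by apply: ltW; apply: le_lt_trans (NH N (leqnn N)); rewrite ler_wpM2l.
have h3 := ler_wpM2r (exprn_ge0 p (rn_ge0 (ee (val tau)))) h2.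
move: h1 h3; move: (_ ^+ p) (rn (f tau)) (rn (_ - _)) => x u v.
by move: (K * rn _ * x) => w; lra.
Qed.

Lemma mform_odd (m : nat) f : odd m -> mform m%:Z f -> forall tau, f tau = 0.
Proof.
move=> mo [_ lf _] tau; have abcd : (-1) * (-1) - 0 * 0 = 1 :> int by [].
have E : mobius abcd tau = tau.
 apply: val_inj; rewrite /= /jfactor mul0r add0r !addr0 intrN.
 by rewrite mulN1r invrN invr1 mulrN1 opprK.
have := lf _ _ _ _ abcd tau; rewrite E /jfactor mul0r add0r intrN -exprnP -signr_odd mo expr1 mulN1r => /eqP.
by rewrite -addr_eq0 -mulr2n mulrn_eq0 /= => /eqP.
Qed.

Lemma mform_div k f : mform k f -> cuspb 1 f -> mform (k - 12) (fun tau => f tau / Delta tau).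
Proof.
move=> [hf lf _] cf; have [hD lD _] := @Delta_mform R; split.
- move=> tau.
 have -> : hext (fun tau => f tau / Delta tau) = fun t => hext f t * (hext (@Delta R) t)^-1.
  by apply/funext => t; rewrite /hext; case: insub => // ; rewrite mul0r.
 by dfs; [exact: hf|exact: hD|rewrite hextE Delta_neq0].
- move=> a b c d abcd tau; have j0 := jfactor_neq0 tau abcd.
 have -> : jfactor c d tau ^ (k - 12) = jfactor c d tau ^ k * (jfactor c d tau ^+ 12)^-1 by rewrite expfzDr.
 rewrite lf lD (_ : jfactor c d tau ^ 12 = jfactor c d tau ^+ 12) // invfM; move: (jfactor c d tau ^ k) ((jfactor c d tau ^+ 12)^-1) (f tau) (Delta tau)^-1 => *; ring.
- have [Y HY] := @Delta_lower R; have [Y' [B [Y'1 B0 HB]]] := cuspbW cf.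
 exists (Num.max Y Y'), B => tau; rewrite ge_max => /andP[/HY h1 /HB h2].
 rewrite expr0 mulr1 rnM rnV ler_pdivrMr ?rn_gt0 ?Delta_neq0 //.
 by apply: le_trans h2 _; rewrite expr1 ler_wpM2l.
Qed.

Lemma E46_cusp (a b : nat) : cuspb 1 (fun tau => @E4 R tau ^+ a * E6 tau ^+ b - 1).
Proof.
have aux f (n : nat) : cuspb 1 (fun tau => f tau - 1) -> cuspb 1 (fun tau => f tau ^+ n - 1).
 move=> cf; elim: n => [|n IH].
  by exists 0, 0 => tau _; rewrite expr0 subrr rn0 mul0r.
 have := cuspbD (cuspbM (cuspb_value cf) IH) cf; congr (cuspb 1 _); apply/funext => t. by rewrite exprS; ring.
have h6 := aux _ b (@E6_cusp R); have h4 := aux _ a (@E4_cusp R).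
have := cuspbD (cuspbM (cuspb_value h4) h6) h4; congr (cuspb 1 _); apply/funext => t; ring.
Qed.

Lemma E46_mform (a b : nat) : mform (4 * a + 6 * b)%N%:Z (fun tau => @E4 R tau ^+ a * E6 tau ^+ b).
Proof.
by have := mformM (mformX a (@E4_mform R)) (mformX b (@E6_mform R)); rewrite PoszD !PoszM.
Qed.

Lemma mform_const f : mform 0 f -> exists a : C, forall tau, f tau = a.
Proof.
move=> mf; have [a ca] := mform_value mf; exists a => tau; apply/eqP; rewrite -subr_eq0; apply/eqP.
exact: (@mform_cusp8 R 0 (fun tau => f tau - a) _ (mformB mf (mform_cst a)) ca).
Qed.

Lemma mform_small_val (a b : nat) f : ((4 * a + 6 * b) <= 8)%N -> mform (4 * a + 6 * b)%N%:Z f ->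
 exists c : C, forall tau, f tau = c * (E4 tau ^+ a * E6 tau ^+ b).
Proof.
move=> le8 mf; have [c cc] := mform_value mf; exists c => tau; apply/eqP; rewrite -subr_eq0; apply/eqP.
apply: (@mform_cusp8 R (4 * a + 6 * b)%N%:Z (fun tau => f tau - c * (E4 tau ^+ a * E6 tau ^+ b))).
- by rewrite le0z_nat lez_nat.
- exact: mformB mf (mformZ c (E46_mform a b)).
- have := cuspbD cc (cuspbM (cuspb_cst (- c)) (E46_cusp a b)); congr (cuspb 1 _).
 by apply/funext => t; ring.
Qed.

(** f E4 and f E6 have weights 6 and 8, so they are multiples c E6 and c' E4^2. Hence c E6^2 = c'
    E4^3; at the cusp c = c', and then c Delta = 0. As E4 and E6 have no common zero, f vanishes. *)
Lemma mform_2 f : mform 2 f -> forall tau, f tau = 0.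
Proof.
move=> mf.
have [c cE] := @mform_small_val 0 1 _ isT (mformM mf (@E4_mform R)).
have [c' cE'] := @mform_small_val 2 0 _ isT (mformM mf (@E6_mform R)).
have cD tau : c * E6 tau ^+ 2 = c' * E4 tau ^+ 3.
 have e1 := cE tau; have e2 := cE' tau; rewrite expr0 expr1 mul1r in e1; rewrite expr0 mulr1 in e2.
 transitivity (f tau * E4 tau * E6 tau); first by rewrite e1; ring.
 transitivity (f tau * E6 tau * E4 tau); first by ring.
 by rewrite e2; ring.
have cc : c = c'.
 apply: rn_small_eq => e e0.
 have := cuspbD (cuspbM (cuspb_cst (- c)) (E46_cusp 0 2)) (cuspbM (cuspb_cst c') (E46_cusp 3 0)).
 move=> /cuspbW[Y [B [Y1 B0 HB]]].
 have q01 : 0 <= (expR (- (2 * pi)) : R) < 1. by rewrite expR_ge0 expR_lt1 oppr_lt0 mulr_gt0 // pi_gt0.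
 have [N NH] := geom_tail B q01 e0.
 have [t tE] : exists t : H, val t = 0 +i* (Num.max Y N%:R).
  by apply: uhpP; rewrite /= lt_max (lt_le_trans ltr01 Y1).
 have := HB t; rewrite tE /= le_max lexx => /(_ isT); rewrite -tE.
 have -> : - c * (E4 t ^+ 0 * E6 t ^+ 2 - 1) + c' * (E4 t ^+ 3 * E6 t ^+ 0 - 1) = c - c'.
  rewrite !expr0 mul1r mulr1; transitivity (c' * E4 t ^+ 3 - c * E6 t ^+ 2 + (c - c')); first by ring.
  by rewrite cD subrr add0r.
 move=> /le_trans; apply; apply: ltW; apply: le_lt_trans (NH N (leqnn N)).
 rewrite expr1 ler_wpM2l //; apply: le_trans (rn_q_le (_ : N%:R <= _)) _.
  by rewrite tE /= le_max lexx orbT.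
 by rewrite -expRM_natl ler_expR mulrN lerN2 mulrC.
move=> tau; have c0 : c = 0.
 have := Delta_neq0 tau; apply: contraNeq => c0; apply/eqP/(mulfI c0).
 by rewrite mulr0 /Delta mulrBr {1}cc -cD subrr.
have f4 : f tau * E4 tau = 0 by rewrite cE c0 mul0r.
have f6 : f tau * E6 tau = 0 by rewrite cE' -cc c0 mul0r.
have [h|h] := E46_neq0 tau; [move/eqP: f4|move/eqP: f6]. by rewrite mulf_eq0 (negbTE h) orbF => /eqP.
by rewrite mulf_eq0 (negbTE h) orbF => /eqP.
Qed.

Lemma weight46 (m : nat) : ~~ odd m -> (3 < m)%N -> exists a b : nat, m = (4 * a + 6 * b)%N.
Proof.
move=> me m3; have [m4|m4] := boolP (4 %| m)%N.
 by exists (m %/ 4)%N, 0%N; rewrite muln0 addn0 mulnC divnK.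
by exists ((m - 6) %/ 4)%N, 1%N; lia.
Qed.

(** Subtracting a multiple of a monomial in E4 and E6 of the same weight leaves a cusp form, which
    is a multiple of Delta = E4^3 - E6^2; both parts lie in the ideal (E4, E6). Only even weights
    above 2 give nonzero forms of nonzero weight. *)
Lemma mform_xy k f : k != 0 -> mform k f -> exists b c, [/\ mform (k - 4) b, mform (k - 6) c &
 forall tau, f tau = E4 tau * b tau + E6 tau * c tau].
Proof.
move=> k0 mf; suff [f0|] : (forall tau, f tau = 0) \/ exists m : nat, [/\ k = m%:Z, ~~ odd m & (3 < m)%N].
- by exists (fun=> 0), (fun=> 0); split=> [||tau]; rewrite ?f0 ?mulr0 ?addr0 //; exact: mform0.
- move=> [m [kE me m3]]; have [a [b mE]] := weight46 me m3.
 have [c0 cc] := mform_value mf.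
 pose f1 tau := f tau - c0 * (E4 tau ^+ a * E6 tau ^+ b).
 have m1 : mform k f1 by apply: mformB => //; rewrite kE mE; exact: mformZ (E46_mform a b).
 have c1 : cuspb 1 f1.
  have := cuspbD cc (cuspbM (cuspb_cst (- c0)) (E46_cusp a b)); congr (cuspb 1 _).
  by apply/funext => t; rewrite /f1; ring.
 have mg := mform_div m1 c1; pose g tau := f1 tau / Delta tau.
 have fE tau : f tau = c0 * (E4 tau ^+ a * E6 tau ^+ b) + (E4 tau ^+ 3 - E6 tau ^+ 2) * g tau.
  have gE : Delta tau * g tau = f1 tau by rewrite /g mulrC divfK ?Delta_neq0.
  have -> : (E4 tau ^+ 3 - E6 tau ^+ 2) * g tau = f1 tau by exact: gE. by rewrite /f1 addrC subrK.
 have w8 : 8 + (k - 12) = k - 4 by lia.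
 have w6 : 6 + (k - 12) = k - 6 by lia.
 have mb := mformM (mformX 2 (@E4_mform R)) mg; rewrite w8 in mb.
 have mc := mformZ (-1) (mformM (@E6_mform R) mg); rewrite w6 in mc.
 have [a0|a0] := posnP a.
  have [b0|b0] := posnP b; first by move: m3; rewrite mE a0 b0.
  exists (fun tau => E4 tau ^+ 2 * g tau), (fun tau => c0 * (E4 tau ^+ 0 * E6 tau ^+ b.-1) + -1 * (E6 tau * g tau)).
  split => // [|tau]; last by rewrite fE a0 -{1}(prednK b0) exprS; ring.
  apply: mformD => //; have -> : k - 6 = (4 * 0 + 6 * b.-1)%N%:Z by lia.
  exact: mformZ (E46_mform 0 b.-1).
 exists (fun tau => c0 * (E4 tau ^+ a.-1 * E6 tau ^+ b) + E4 tau ^+ 2 * g tau), (fun tau => -1 * (E6 tau * g tau)).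
 split => // [|tau]; last by rewrite fE -{1}(prednK a0) exprS; ring.
 apply: mformD => //; have -> : k - 4 = (4 * a.-1 + 6 * b)%N%:Z by lia.
 exact: mformZ (E46_mform a.-1 b).
case: k k0 mf => m; last by move=> _ mf; left; exact: mform_neg mf.
move=> m0 mf; have [mo|me] := boolP (odd m); first by left; exact: mform_odd mf.
have [m3|m3] := ltnP 3 m; first by right; exists m.
by left; have m2 : m = 2%N by [lia]; rewrite m2 in mf; exact: mform_2.
Qed.

(** Turns coefficients found as modular forms into scalars of [mring]; by [mform_xy] and induction
    on the weight. *)
Lemma mform_E46 k f : mform k f -> f \in @is_E4E6 R.
Proof.
have cstE (c : C) : (fun=> c) \in @is_E4E6 R.
 by apply/asboolP; exists (c%:P%:P); apply/funext => t; rewrite !hornerC.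
case: k => m; last first.
 move=> mf; have -> : f = fun=> 0 by apply/funext => t; exact: (mform_neg _ mf).
 exact: cstE.
have [n] := ubnP m; elim: n m f => // n IH m f mn mf.
have [m0|m0] := eqVneq m 0%N.
 rewrite m0 in mf; have [a fa] := mform_const mf.
 by have -> : f = fun=> a by apply/funext.
have IH' k' (g : H -> C) : k' < m%:Z -> mform k' g -> g \in @is_E4E6 R.
 case: k' => m' km mg; last first.
  have -> : g = fun=> 0 by apply/funext => t; exact: (mform_neg _ mg).
  exact: cstE.
 by apply: IH mg; lia.
have [|b [c [mb mc fE]]] := mform_xy _ mf; first by lia.
have lt4 : m%:Z - 4 < m%:Z by lia.
have lt6 : m%:Z - 6 < m%:Z by lia.
have /asboolP[p pE] := IH' _ _ lt4 mb; have /asboolP[r rE] := IH' _ _ lt6 mc.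
apply/asboolP; exists (('X)%:P * p + 'X * r); apply/funext => t.
by rewrite fE pE rE hornerD hornerM hornerC hornerM hornerX hornerD !hornerM hornerX hornerC.
Qed.

Lemma mform_not0_near k f tau0 : mform k f -> f tau0 != 0 -> forall tau (d : R), 0 < d ->
 exists2 t : H, rn (val t - val tau) < d & f t != 0.
Proof.
move=> mf f0 tau d d0; apply: contrapT => Hn; move/eqP: f0; apply.
apply: (mform_identity (d := d) (tau := tau) mf d0) => t td.
by apply/eqP; apply: contrapT => /negP h; apply: Hn; exists t.
Qed.

End Structure.

(** * Local bounds made uniform over segments and boxes *)

Section Compactness.
Variable R : realType.
Notation C := R[i].

Lemma rn_lt1 (a b : C) : rn (a - b) < 1 -> rn a <= rn b + 1.
Proof. by move=> h; have := rnBl a b; lra. Qed.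

Variable V : normedModType C.

Definition LB (P : V -> R -> Prop) (p : V) :=
 exists2 d : R, 0 < d & exists B : R, forall v, rn (v - p) < d -> P v B.

Lemma seg_LB (P : V -> R -> Prop) (p u : V) : (forall v B B', B <= B' -> P v B -> P v B') ->
 (forall x : R, 0 <= x <= 1 -> LB P (p + x%:C *: u)) ->
 LB (fun v B => forall x : R, 0 <= x <= 1 -> P (v + x%:C *: u) B) p.
Proof.
move=> Pm PL; have := @segment_compact R 0 1; rewrite compact_near_coveringP => cc.
have := cc (V * R)%type (filter_prod (nbhs p) (pinfty_nbhs R)) (fun vM x => P (vM.1 + x%:C *: u) vM.2) _.
case.
 move=> x; rewrite /= in_itv /= => x01; have [d d0 [B BH]] := PL x x01.
 pose d' := d / (2 * (rn u + 1)).
 have u1 : 0 < 2 * (rn u + 1) by rewrite mulr_gt0 // ltr_wpDl ?rn_ge0.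
 have d'0 : 0 < d' by rewrite divr_gt0.
 exists ([set x' | `|x' - x| < d'], [set vM : V * R | rn (vM.1 - p) < d / 2 /\ B <= vM.2]) => /=.
  split; first by apply/nbhs_ballP; exists d' => //= z; rewrite /ball /= distrC.
  exists ([set v | rn (v - p) < d / 2], [set M | B <= M]) => /=.
   split; first by apply/nbhs_rnP; exists (d / 2) => //; rewrite divr_gt0.
   by apply: nbhs_pinfty_ge; exact: num_real.
  by move=> [v M] /= [].
 move=> [x' [v M]] /= [h1 [h2 h3]]; apply: (Pm _ B) => //; apply: BH.
 have -> : v + x'%:C *: u - (p + x%:C *: u) = (v - p) + (x' - x)%:C *: u.
  by rewrite rmorphB scalerBl opprD addrACA.
 apply: le_lt_trans (rnD _ _) _; rewrite rnZ rn_real.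
 have : `|x' - x| * rn u <= d / 2.
  apply: le_trans (_ : d' * (rn u + 1) <= _).
   by apply: ler_pM; rewrite ?rn_ge0 ?normr_ge0 ?(ltW h1) // lerDl.
  by rewrite /d' invfM mulrA mulfVK // gt_eqF // ltr_wpDl ?rn_ge0.
 by lra.
move=> [A1 A2] /= [/nbhs_rnP[d d0 dA] [B [Br BA]]] AH.
exists d => //; exists (B + 1) => v vd x x01.
have := AH (v, B + 1) => /= /(_ _)/(_ _); apply; last by rewrite /= in_itv.
by split; [exact: dA|apply: BA; lra].
Qed.

(** One edge direction at a time: the bound over the remaining box is again a local bound, to which
    compactness of the next segment applies. *)
Lemma box_LB (P : V -> R -> Prop) (us : seq V) : (forall v B B', B <= B' -> P v B -> P v B') ->
 (forall p, LB P p) -> forall p, LB (fun v B => forall x : nat -> R, (forall i, 0 <= x i <= 1) ->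
   P (v + \sum_(i < size us) (x i)%:C *: nth 0 us i) B) p.
Proof.
elim: us => [|u us IH] Pm PL p.
 have [d d0 [B BH]] := PL p; exists d => //; exists B => v vd x _; rewrite big_ord0 addr0; exact: BH.
have := @seg_LB (fun v B => forall x : nat -> R, (forall i, 0 <= x i <= 1) ->
   P (v + \sum_(i < size us) (x i)%:C *: nth 0 us i) B) p u.
case.
- by move=> v B B' BB' h x x01; apply: (Pm _ B) => //; exact: h.
- by move=> x _; exact: IH.
move=> d d0 [B BH]; exists d => //; exists B => v vd x x01 /=.
rewrite big_ord_recl /= addrA; have := BH v vd (x 0%N) (x01 0%N) (fun i => x i.+1) (fun i => x01 i.+1).
by [].
Qed.

End Compactness.

(** * Behaviour of Jacobi forms at the cusp: Fourier expansions as growth bounds *)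

Section JacobiBasics.
Variable R : realType.
Notation C := R[i].
Notation H := (uhp R).
Notation cdf g w := (dff (g : C^o -> C^o) (w : C^o)).

Section OneForm.
Variable n : nat.
Implicit Types (f g : jfun R n) (tau : H) (z : 'cV[C]_n) (M : 'M[int]_n) (k : int).

Lemma jextE f tau z : jext f (val tau, z) = f (tau, z).
Proof. by rewrite /jext /= valK. Qed.

Lemma jextM (a : H -> C) f : jext (fun x => a x.1 * f x) = fun p => hext a p.1 * jext f p.
Proof. by apply/funext => p; rewrite /jext /hext; case: insub => //; rewrite mulr0. Qed.
Lemma jextD f g : jext (fun x => f x + g x) = fun p => jext f p + jext g p.
Proof. by apply/funext => p; rewrite /jext; case: insub => //; rewrite addr0. Qed.

Lemma df_hext (W : normedModType C) (a : H -> C) (p : C^o * W) : hol a -> 0 < Im (p.1 : C) ->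
 dff (fun p : C^o * W => hext a p.1 : C^o) p.
Proof.
move=> ha p0; dfc (hext a).
by have [t <-] := uhpP p0; exact: ha.
Qed.

Lemma holomorphicM (a : H -> C) f : hol a -> holomorphic f -> holomorphic (fun x => a x.1 * f x).
Proof.
move=> ha hf p p0; rewrite jextM.
by dfs; [exact: df_hext|exact: hf].
Qed.

Lemma holomorphicD f g : holomorphic f -> holomorphic g -> holomorphic (fun x => f x + g x).
Proof. by move=> hf hg p p0; rewrite jextD; dfs; [exact: hf|exact: hg]. Qed.

Lemma hol_line f tau (z u : 'cV[C]_n) (rho : R) : 0 < rho -> holomorphic f ->
 cdisc (fun t => f (tau, z + t *: u)) rho.
Proof.
move=> r0 hf; split=> [//|t _].
have -> : (fun t : C => f (tau, z + t *: u)) = fun t => jext f (val tau, z + t *: u).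
 by apply/funext => s; rewrite jextE.
dfc (jext f).
by apply: hf; exact: (valP tau).
Qed.

Lemma hol_tau f z : holomorphic f -> hol (fun tau => f (tau, z)).
Proof.
move=> hf tau; have E : hext (fun tau => f (tau, z)) = fun t => jext f (t, z).
 by apply/funext => t; rewrite /hext /jext /=; case: insub.
rewrite E; dfc (jext f).
by apply: hf; exact: (valP tau).
Qed.

(* The Fourier expansion starts no earlier than q^(- m). *)
Definition jb (m : nat) f := forall z, exists Y B : R, forall tau, Y <= Im (val tau) ->
 rn (ee (val tau) ^+ m * f (tau, z)) <= B.
Definition jper f := forall tau z, f (mobius (Tabcd 1) tau, z) = f (tau, z).

Lemma modular_per k M f : modular_law k M f -> jper f.
Proof.
move=> mf tau z; have := mf _ _ _ _ (Tabcd 1) tau z.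
by rewrite jT invr1 scale1r exp1rz mul1r !mulr0 !mul0r cexp0 mul1r.
Qed.

Lemma jper_hext f z t : jper f -> 0 < Im t ->
 hext (fun tau => f (tau, z)) (t + 1) = hext (fun tau => f (tau, z)) t.
Proof. by move=> pf /uhpP[tau <-]; rewrite -[1]/(1%:~R) -valT !hextE pf. Qed.

Definition qext (m : nat) f z (t : C) : C := ee t ^+ m * hext (fun tau => f (tau, z)) t.

Lemma qextE m f z tau : qext m f z (val tau) = ee (val tau) ^+ m * f (tau, z).
Proof. by rewrite /qext hextE. Qed.

Lemma qext_df m f z (t : C) : holomorphic f -> 0 < Im t -> cdf (qext m f z) t.
Proof.
move=> hf /uhpP[tau <-].
by rewrite /qext; dfs; exact: hol_tau.
Qed.

Lemma qext_per m f z (t : C) : jper f -> 0 < Im t -> qext m f z (t + 1) = qext m f z t.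
Proof. by move=> pf t0; rewrite /qext (jper_hext z pf t0) eeD ee1 mulr1. Qed.

Lemma qext_b m f z : jb m f -> exists Y B : R, forall w, Y <= Im w -> rn (qext m f z w) <= B.
Proof.
move=> bf; have [Y [B HB]] := bf z; exists (Num.max Y 1), B => w; rewrite ge_max => /andP[wY w1].
have [t tE] : exists t : H, val t = w by apply: uhpP; lra.
by rewrite -tE qextE; apply: HB; rewrite tE.
Qed.

Lemma jb_le m m' f : (m <= m')%N -> jb m f -> jb m' f.
Proof.
move=> mm bf z; have [Y [B HB]] := bf z; exists Y, B => tau tY.
rewrite -(subnK mm) exprD -mulrA rnM; apply: le_trans (HB tau tY).
rewrite ler_piMl ?rn_ge0 // rnX exprn_ile1 ?rn_ge0 //; exact: ltW (rn_q (valP tau)).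
Qed.

(** [jb] bounds each z separately, whereas Cauchy estimates need a bound uniform on a circle of z.
    On the line Im tau = 1 it comes from compactness in tau and t; above, the maximum principle for
    each fixed z keeps the same bound. *)
Lemma jb_unif m f (z u : 'cV[C]_n) : holomorphic f -> jper f -> jb m f ->
 exists B : R, forall tau t, 1 < Im (val tau) -> rn t = 1 ->
  rn (ee (val tau) ^+ m * f (tau, z + t *: u)) <= B.
Proof.
move=> hf pf bf.
pose G (w : C^o) (t : C) : C := qext m f (z + t *: u) w.
have GE (w : C^o) t : G w t = ee w ^+ m * jext f (w, z + t *: u).
 by rewrite /G /qext /hext /jext /=; case: insub.
pose P (w : C^o) (B : R) := forall t, rn t = 1 -> rn (G w t) <= B.
have Pm v B B' : B <= B' -> P v B -> P v B' by move=> BB h t /h /le_trans; apply.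
have PL (x : R) : LB P (('i : C^o) + x%:C *: (1 : C^o)).
 have w0 : 0 < Im (('i : C) + x%:C * 1) by rewrite cImD mulr1 /= addr0 ltr01.
 suff [d d0 [B BH]] : exists2 d : R, 0 < d & exists B : R, forall v t,
   rn (v - (('i : C^o) + x%:C *: (1 : C^o))) < d -> rn t = 1 -> rn (G v t) <= B.
  by exists d => //; exists B => v vd t t1; exact: BH.
 apply: (@tube_bound R C^o G _ 1 ltr01) => t t1.
 have : dff (fun p : C^o * C^o => ee p.1 ^+ m * jext f (p.1, z + p.2 *: u) : C^o) ((('i : C^o) + x%:C *: (1 : C^o), t) : C^o * C^o).
  by dfs; dfc (jext f); exact: hf.
 move=> /differentiable_continuous/continuous_rnP/(_ 1 ltr01)[d d0 dH].
 exists d => //; exists (rn (G (('i : C^o) + x%:C *: (1 : C^o)) t) + 1) => v t' h1 h2.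
 have := dH (v, t'); rewrite rn_pair /= gt_max h1 h2 => /(_ isT); rewrite -!GE => h.
 by have := rnBl (G v t') (G (('i : C^o) + x%:C *: (1 : C^o)) t); lra.
have [d d0 [B BH]] := @seg_LB R C^o P ('i : C^o) (1 : C^o) Pm (fun x _ => PL x).
exists B => tau t ty t1; rewrite -qextE.
apply: (@maxmod R (qext m f (z + t *: u)) 0 1 B) => [w|w|||x x01|].
- exact: qext_df.
- exact: qext_per.
- exact: qext_b.
- exact: ltr01.
- have := BH ('i : C^o) _ x x01 t t1; rewrite subrr rn0 => /(_ d0).
 by have -> : ('i : C^o) + x%:C *: (1 : C^o) = x +i* 1 by apply/eqP; rewrite eq_complex /= !mulr1 !mul0r !mulr0 ?addr0 ?add0r ?subr0 !eqxx.
- exact: ty.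
Qed.

Lemma psum_split (b : nat -> C) m (q l : C) : psum b q l -> psum (fun r => b (r + m)%N * q ^+ m) q (l - \sum_(r < m) b r * q ^+ r).
Proof.
move=> bl e e0; have [N NH] := bl e e0; exists N => N' NN'; have := NH (m + N')%N (leq_trans NN' (leq_addl _ _)).
rewrite big_split_ord /= opprB addrA [X in _ -> rn X < _]addrAC.
have -> : \sum_(r < N') b (r + m)%N * q ^+ m * q ^+ r = \sum_(i < N') b (m + i)%N * q ^+ (m + i).
 by apply: eq_bigr => i _; rewrite addnC exprD mulrA.
move: (\sum_(i < m) _) (\sum_(i < N') _) => x y.
by have -> : y - l + x = x + y - l by ring.
Qed.

(** Together with [bound_of_fourier] this replaces the expansion condition by a growth bound, which
    is stable under products, quotients and Taylor coefficients. *)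
Lemma fourier_of_bound m f : holomorphic f -> jper f -> jb m f ->
 exists2 c, fourier_expansion f c & forall j : int, j < - m%:Z -> c j = fun=> 0.
Proof.
move=> hf pf bf.
have /choice[a aP] z : exists a : nat -> C, forall tau, psum a (ee (val tau)) (ee (val tau) ^+ m * f (tau, z)).
 have [a [_ ap]] := half_plane_expand (fun w => @qext_df m f z w hf) (fun w => @qext_per m f z w pf) (qext_b z bf).
 by exists a => tau; have := ap (val tau) (valP tau); rewrite qextE.
pose c (j : int) z : C := if j + m%:Z is Posz r then a z r else 0.
exists c; last by move=> j jm; apply/funext => z; rewrite /c; case E : (j + m%:Z) => [r|//]; exfalso; lia.
move=> tau z; pose q := ee (val tau); have q0 : q != 0 := ee_neq0 _.
pose t := \sum_(r < m) c (Negz r) z * q ^ Negz r.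
exists (f (tau, z) - t), t; split; last by rewrite subrK.
- apply/cvg_rnP => e e0.
 have := psumZ (q ^- m) (psum_split m (aP z tau)) e0 => -[N NH].
 exists N => N' /NH; rewrite /series /= big_mkord.
 have -> : \sum_(r < N') q ^- m * (a z (r + m)%N * ee (val tau) ^+ m) * ee (val tau) ^+ r =
      \sum_(i < N') c i z * qpar tau ^ i.
  apply: eq_bigr => i _; rewrite /c -PoszD mulrCA [q ^- m * _]mulrC; congr (_ * _).
  by rewrite -/q divff ?mulr1 // expf_neq0.
 have -> // : q ^- m * (ee (val tau) ^+ m * f (tau, z) - \sum_(r < m) a z r * ee (val tau) ^+ r) = f (tau, z) - t.
 rewrite mulrBr mulKf ?expf_neq0 //; congr (_ - _); rewrite mulr_sumr /t (reindex_inj rev_ord_inj) /=.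
 apply: eq_bigr => i _; have iE : Negz i + m%:Z = (m - i.+1)%N%:Z by rewrite NegzE; have := ltn_ord i; lia.
 rewrite /c iE mulrCA; congr (_ * _); rewrite NegzE -exprnN -/q.
 apply: (mulfI (expf_neq0 i.+1 q0)); rewrite divff ?expf_neq0 // mulrCA -exprD subnKC ?mulVf ?expf_neq0 //.
- apply/cvg_rnP => e e0; exists m => N' mN'; rewrite /series /= big_mkord.
 rewrite -(big_mkord xpredT (fun r => c (Negz r) z * qpar tau ^ Negz r)) (big_cat_nat _ mN') //= big_mkord.
 have -> : \sum_(m <= i < N') c (Negz i) z * qpar tau ^ Negz i = 0.
  rewrite big_nat_cond big1 // => i /andP[/andP[mi _] _].
  rewrite /c; case E : (Negz i + m%:Z) => [r|]; last by rewrite mul0r.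
  by exfalso; lia.
 by rewrite addr0 -[X in X - t]/t subrr rn0.
Qed.

Lemma bound_of_fourier m f c : fourier_expansion f c -> (forall j : int, j < - m%:Z -> c j = fun=> 0) -> jb m f.
Proof.
move=> fc c0 z; pose b (r : nat) : C := c (r%:Z - m%:Z) z.
have bP tau : psum b (ee (val tau)) (ee (val tau) ^+ m * f (tau, z)).
 pose q := ee (val tau); have q0 : q != 0 := ee_neq0 _; have qm0 := expf_neq0 m q0.
 have [s [t [sP tP ->]]] := fc tau z.
 have tE : t = q ^- m * \sum_(r < m) b r * q ^+ r.
  apply: rn_small_eq => e e0; move/cvg_rnP : tP => /(_ e e0)[N NH].
  have := NH (maxn N m) (leq_maxl _ _); rewrite /series /= big_mkord.
  rewrite -(big_mkord xpredT (fun r => c (Negz r) z * qpar tau ^ Negz r)) (big_cat_nat _ (leq_maxr N m)) //= big_mkord.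
  have -> : \sum_(m <= i < maxn N m) c (Negz i) z * qpar tau ^ Negz i = 0.
   by rewrite big_nat_cond big1 // => i /andP[/andP[mi _] _]; rewrite c0 ?mul0r //; rewrite NegzE; lia.
  rewrite addr0 rnC => /ltW; congr (rn (_ - _) <= _).
  rewrite mulr_sumr [RHS](reindex_inj rev_ord_inj) /=; apply: eq_bigr => i _.
  have iE : (m - i.+1)%N%:Z - m%:Z = Negz i by rewrite NegzE; have := ltn_ord i; lia.
  rewrite /b iE [RHS]mulrCA; congr (_ * _); rewrite NegzE -exprnN -/q.
  apply: (mulfI (expf_neq0 i.+1 q0)); rewrite divff ?expf_neq0 // mulrCA -exprD subnKC ?mulVf ?expf_neq0 //.
 move=> e e0; have qp : 0 < rn (q ^+ m) by rewrite rn_gt0.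
 move/cvg_rnP : sP => /(_ _ (divr_gt0 e0 qp))[N NH]; exists (m + N)%N => N' mN'.
 have mN : (m <= N')%N by apply: leq_trans mN'; exact: leq_addr.
 have := NH (N' - m)%N; rewrite leq_subRL // => /(_ mN'); rewrite /series /= big_mkord ltr_pdivlMr // mulrC -rnM.
 suff -> : \sum_(r < N') b r * ee (val tau) ^+ r - ee (val tau) ^+ m * (s + t) =
   q ^+ m * (\sum_(i < N' - m) c i z * qpar tau ^ i - s) by [].
 have -> : \sum_(r < N') b r * ee (val tau) ^+ r =
   \sum_(r < m) b r * q ^+ r + \sum_(i < N' - m) b (m + i)%N * q ^+ (m + i).
  rewrite -(big_mkord xpredT (fun r => b r * ee (val tau) ^+ r)) (big_cat_nat _ mN) //= big_mkord.
  by congr (_ + _); rewrite -{1}[m]add0n big_addn big_mkord; apply: eq_bigr => i _; rewrite addnC.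
 rewrite -/q mulrDr tE mulVKf // mulrBr mulr_sumr.
 have -> : \sum_(i < N' - m) b (m + i)%N * q ^+ (m + i) = \sum_(i < N' - m) q ^+ m * (c i z * qpar tau ^ i).
  by apply: eq_bigr => i _; rewrite /b PoszD [_ - m%:Z]addrC addKr exprD mulrCA.
 by ring.
(* Convergence at tau = i bounds the coefficients; for Im tau >= 2 the series is then dominated by a
   geometric series of ratio 1 / 4. *)
have i0 : 0 < Im (0 +i* 1 : C) by exact: ltr01.
have [t0 tE] := uhpP i0; have [M MH] := psum_coef_bounded (bP t0).
pose s := rn (ee (val t0)); have s0 : 0 < s by rewrite rn_gt0 ee_neq0.
exists 2, (M * 2) => tau t2.
have ts : rn (ee (val tau)) / s <= 1 / 4.
 rewrite /s !rn_ee tE /= -expRN -expRD; apply: le_trans (@expR2pi R); rewrite ler_expR opprK.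
 by have := @pi_ge0 R; move: (pi : R) => p p0; nra.
have ts1 : rn (ee (val tau)) < s by move: ts; rewrite ler_pdivrMr //; lra.
have := psum_tail s0 MH ts1 (bP tau) 0; rewrite big_ord0 sub0r rnN expr0 mulr1 => /le_trans; apply.
have M0 : 0 <= M by apply: le_trans (MH 0%N); rewrite mulr_ge0 ?exprn_ge0 ?rn_ge0.
by rewrite ler_wpM2l //; move: (_ / s) ts => x xs; rewrite -[2]invrK lef_pV2 ?posrE; lra.
Qed.

Definition jform k M f := [/\ holomorphic f, modular_law k M f & elliptic_law M f].

Lemma weakP k M f : weak_jacobi k M f <-> jform k M f /\ jb 0 f.
Proof.
split=> [[hf mf ef [c fc c0]]|[[hf mf ef] bf]].
 by split => //; apply: (bound_of_fourier fc) => j; rewrite oppr0; exact: c0.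
have [c fc c0] := fourier_of_bound hf (modular_per mf) bf; split => //.
by exists c => // j j0; apply: c0; rewrite oppr0.
Qed.

Lemma whP k M f : weakly_holomorphic_jacobi k M f <-> jform k M f /\ exists m, jb m f.
Proof.
split=> [[hf mf ef [c fc /finite_seqP[s sE]]]|[[hf mf ef] [m bf]]].
 (* The sum of the absolute values of the exceptional exponents bounds each of them. *)
 split => //; exists (\sum_(j <- s) absz j)%N; apply: (bound_of_fourier fc) => j jm.
 apply: contrapT => cj; have : [set m : int | m < 0 /\ c m <> (fun=> 0)] j by split => //; lia.
 rewrite sE /= => js; have : (absz j <= \sum_(j <- s) absz j)%N by rewrite (big_rem j) //= leq_addr.
 by lia.
have [c fc c0] := fourier_of_bound hf (modular_per mf) bf; split => //; exists c => //.
apply: (@sub_finite_set _ _ [set` [seq Negz i | i <- iota 0 m]]); last exact: finite_seq.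
move=> j [j0 cj] /=; apply/mapP; exists (absz j).-1; last by lia.
rewrite mem_iota add0n /=; apply: contrapT => h; apply: cj; apply: c0; lia.
Qed.

End OneForm.
End JacobiBasics.

Section Vectors.
Variable R : realType.
Notation C := R[i].

Lemma rn_entry m n (z : 'M[C]_(m, n)) i j : rn (z i j) <= rn z.
Proof.
have h : (`|z i j|%:nng <= \big[Num.max/0%:nng]_ij `|z ij.1 ij.2|%:nng)%O.
 exact: (le_bigmax _ (fun ij : 'I_m * 'I_n => `|z ij.1 ij.2|%:nng) (i, j)).
by have : `|z i j| <= `|z| by []; rewrite !rnE lecR.
Qed.

Lemma rn_mx_le m n (z : 'M[C]_(m, n)) (B : R) : 0 <= B -> (forall i j, rn (z i j) <= B) -> rn z <= B.
Proof.
move=> B0 H; have [z0|z0] := eqVneq (mx_norm z) 0; first by rewrite /rn [`|z|]z0.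
by have [[i j] /= E] := mx_norm_neq0 z0; rewrite /rn [`|z|]E; exact: H.
Qed.

Lemma mulmx_bounded m n (A : 'M[C]_(m, n)) : exists2 K : R, 0 <= K & forall z : 'cV[C]_n, rn (A *m z) <= K * rn z.
Proof.
pose K := \sum_i \sum_j rn (A i j); have K0 : 0 <= K by rewrite sumr_ge0 // => i _; rewrite sumr_ge0 // => j _; exact: rn_ge0.
exists K => // z; apply: rn_mx_le; first by rewrite mulr_ge0 ?rn_ge0.
move=> i j; rewrite mxE; apply: le_trans (rn_sum _ _ _) _.
apply: le_trans (_ : (\sum_j rn (A i j)) * rn z <= _).
 by rewrite mulr_suml; apply: ler_sum => k _; rewrite rnM ler_wpM2l ?rn_ge0 // rn_entry.
rewrite ler_wpM2r ?rn_ge0 // /K (bigD1 i) //= lerDl sumr_ge0 // => k _; rewrite sumr_ge0 // => l _; exact: rn_ge0.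
Qed.

End Vectors.

(** * Taylor coefficients in z as operators on Jacobi forms *)

Section JointTaylor.
Variable R : realType.
Notation C := R[i].
Variables (V : normedModType C) (K : V * C^o -> C^o).

Lemma tube_joint (p : V) : (forall t : C^o, dff K (p, t)) ->
 exists2 d : R, 0 < d & exists B : R, forall v (t : C), rn (v - p) < d -> rn t = 1 -> rn (K (v, t)) <= B.
Proof.
move=> Kd; apply: (@tube_bound R V (fun v t => K (v, t)) p 1 ltr01) => t t1.
have /differentiable_continuous/continuous_rnP/(_ 1 ltr01)[d d0 dH] := Kd t.
exists d => //; exists (rn (K (p, t)) + 1) => u t' h1 h2.
have := dH (u, t'); rewrite rn_pair /= gt_max h1 h2 => /(_ isT).
by move=> h; exact: (rn_lt1 h).
Qed.

Lemma tc_joint (p : V) (r : R) j : 0 < r -> (forall (v : V) (t : C^o), rn (v - p) < r -> dff K (v, t)) ->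
 dff ((fun v => tc (fun t => K (v, t)) j) : V -> C^o) p.
Proof.
move=> r0 Kd; have pp : rn (p - p) < r by rewrite subrr rn0.
have [|d d0 [B BH]] := @tube_joint p; first by move=> t; exact: Kd.
pose rho := Num.min r d; have rho0 : 0 < rho by rewrite lt_min r0.
have rin (u : V) : rn (u - p) < rho -> rn (u - p) < r /\ rn (u - p) < d. by rewrite lt_min => /andP.
apply: (@tc_param R _ (fun v t => K (v, t)) p rho 1 B) => //.
- move=> u /rin[ur _]; split; first by rewrite mulr1.
 by move=> t _; dfc K; exact: Kd.
- by move=> u t /rin[ur _] _; dfc K; exact: Kd.
- by move=> u t /rin[_ ud]; exact: BH.
Qed.

End JointTaylor.

Section TaylorOperators.
Variable R : realType.
Notation C := R[i].
Notation H := (uhp R).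
Notation pii := (twopii R).
Variables (N n : nat).

(* The Gaussian factor cancels the exponential in the modular law, so that Taylor coefficients become
   Jacobi forms of the index induced by A, with weight raised by i. *)
Definition Tj (Q : C) (A : 'M[C]_(N, n)) (v : 'cV[C]_N) (i : nat) (f : jfun R N) : jfun R n := fun x =>
 tc (fun t => f (x.1, A *m x.2 + t *: v) * cexp (- (kap x.1 * Q * t ^+ 2))) i.

Lemma exp_regroup (J F x y x' y' : C) : x + y = x' + y' ->
 J * cexp x * F * cexp y = J * cexp x' * (F * cexp y').
Proof.
move=> h; have : cexp x * cexp y = cexp x' * cexp y' by rewrite -!cexpD h.
move: (cexp x) (cexp y) (cexp x') (cexp y') => X Y X' Y' e.
by transitivity (J * F * (X * Y)); [ring|rewrite e; ring].
Qed.

Section Fixed.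
Variables (Q : C) (A : 'M[C]_(N, n)) (v : 'cV[C]_N).
Implicit Types (f g : jfun R N) (tau : H) (z : 'cV[C]_n).

Lemma gauss_disc (c : C) (rho : R) : 0 < rho -> cdisc (fun t => cexp (- (c * t ^+ 2))) rho.
Proof.
move=> r0; split; first exact: r0.
by move=> t _; dfs.
Qed.

Lemma Tj_disc f tau z (rho : R) : 0 < rho -> holomorphic f ->
 cdisc (fun t => f (tau, A *m z + t *: v) * cexp (- (kap tau * Q * t ^+ 2))) rho.
Proof. by move=> r0 hf; exact: cdiscM (hol_line _ _ _ r0 hf) (gauss_disc _ r0). Qed.

Lemma TjD i f g : holomorphic f -> holomorphic g ->
 Tj Q A v i (fun x => f x + g x) = fun x => Tj Q A v i f x + Tj Q A v i g x.
Proof.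
move=> hf hg; apply/funext => -[tau z]; rewrite /Tj /=.
rewrite -[RHS](congr1 (fun F => F i) (tcD (Tj_disc tau z ltr01 hf) (Tj_disc tau z ltr01 hg))).
by congr (tc _ i); apply/funext => t; rewrite mulrDl.
Qed.

Lemma TjM i (a : H -> C) f : holomorphic f ->
 Tj Q A v i (fun x => a x.1 * f x) = fun x => a x.1 * Tj Q A v i f x.
Proof.
move=> hf; apply/funext => -[tau z]; rewrite /Tj /=.
rewrite -[RHS](congr1 (fun F => F i) (tcZ (a tau) (Tj_disc tau z ltr01 hf))).
by congr (tc _ i); apply/funext => t; rewrite mulrA.
Qed.

Lemma Tj_eq0 f tau z : holomorphic f -> (forall i, Tj Q A v i f (tau, z) = 0) ->
 forall t, f (tau, A *m z + t *: v) = 0.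
Proof.
move=> hf T0 t; have r0 : 0 < rn t + 1 by rewrite ltr_wpDl ?rn_ge0.
have := tc_eq0 (Tj_disc tau z r0 hf) T0; move=> /(_ t); rewrite ltrDl ltr01 => /(_ isT)/eqP.
by rewrite mulf_eq0 (negbTE (cexp_neq0 _)) orbF => /eqP.
Qed.

Let VV : normedModType C := (C^o * 'cV[C]_n)%type.

(** The function under [Tj], jointly in tau, z and t, so that [tc_joint] gives holomorphy of its
    coefficients in (tau, z). *)
Definition Tker f (q : VV * C^o) : C^o :=
 jext f (q.1.1, A *m q.1.2 + q.2 *: v) * cexp (- (hext (@kap R) q.1.1 * Q * q.2 ^+ 2)).

Lemma Tker_df f (q : VV * C^o) : holomorphic f -> 0 < Im (q.1.1 : C) -> dff (Tker f) q.
Proof.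
move=> hf q0; have [K K0 KH] := mulmx_bounded A.
have dA (p : 'cV[C]_n : normedModType C) : dff (mulmx A : 'cV[C]_n -> 'cV[C]_N) p by apply: (df_lin (K := K)) => // a x y; exact: linearP.
rewrite /Tker; dfs; first by dfc (jext f); [dfc (mulmx A : 'cV[C]_n -> 'cV[C]_N); exact: dA|exact: hf].
dfc (hext (@kap R)).
by have [t <-] := uhpP q0; exact: kap_hol.
Qed.

Lemma Tj_hol i f : holomorphic f -> holomorphic (Tj Q A v i f).
Proof.
move=> hf p p0.
pose F (p : VV) (t : C) : C := Tker f (p, t).
pose r := Im (p.1 : C).
have inb (u : VV) : rn (u - p) < r -> 0 < Im (u.1 : C).
 move=> up; have := le_lt_trans (Im_le_rn _) (le_lt_trans (rn_fst_le (u - p)) up).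
 by rewrite cImB ltr_norml => /andP[h _]; move: h; rewrite ltrBrDr addNr.
apply: (@differentiable_local _ _ _ ((fun u => tc (F u) i) : VV -> C^o) _ _ r) => //.
 move=> u /inb/uhpP[t tE]; rewrite /jext -tE valK /Tj /F /Tker /=; congr (tc _ i); apply/funext => s.
 by rewrite -tE jextE hextE.
have Fd (u : VV) (t : C^o) : rn (u - p) < r -> dff (Tker f) ((u, t) : VV * C^o).
 by move=> /inb u0; exact: Tker_df.
exact: (tc_joint i p0 Fd).
Qed.

Lemma Tj_jb i f : holomorphic f -> jper f -> jb 0 f -> jb 0 (Tj Q A v i f).
Proof.
move=> hf pf bf z; have [B HB] := jb_unif (A *m z) v hf pf bf.
have [Y [K [Y1 K0 HK]]] := cuspbW (@kap_cusp R).
exists (Y + 1), (2 * (`|B| * expR (K * rn Q))) => tau tY; rewrite expr0 mul1r.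
have t1 : 1 < Im (val tau) by lra.
have s01 : 0 < (1 : R) < 2 by rewrite ltr01 ltr1n.
have := @tc_le _ _ 2 1 (`|B| * expR (K * rn Q)) i (Tj_disc tau z (ltr0n R 2) hf) s01.
rewrite expr1n mulr1; apply => t tt; rewrite rnM; apply: ler_pM; rewrite ?rn_ge0 //.
 by have := HB tau t t1 tt; rewrite expr0 mul1r => /le_trans; apply; exact: ler_norm.
rewrite rn_cexp ler_expR; apply: le_trans (ler_norm _) _; apply: le_trans (Re_le_rn _) _.
rewrite rnN rnM (rnM (kap tau)) rnX tt expr1n mulr1 ler_wpM2r ?rn_ge0 //.
by have := HK tau; rewrite expr0 mulr1; apply; lra.
Qed.

End Fixed.

Section Law.
Variables (MN : 'M[int]_N) (M : 'M[int]_n) (Ai : 'M[int]_(N, n)) (v : 'cV[C]_N).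
Let A : 'M[C]_(N, n) := map_mx intr Ai.
Let MNc : 'M[C]_N := map_mx intr MN.
Hypothesis AMA : Ai^T *m MN *m Ai = M.
Hypothesis AMv : A^T *m MNc *m v = 0.
Hypothesis vMA : v^T *m MNc *m A = 0.

Lemma AMAc : A^T *m MNc *m A = map_mx intr M.
Proof. by rewrite -AMA !map_mxM map_trmx. Qed.

(** The vector v is orthogonal to the image of A, so the cross terms vanish. *)
Lemma quad_A z t : quad MN (A *m z + t *: v) = quad M z + t ^+ 2 * quad MN v.
Proof.
rewrite /quad -/MNc; have -> : (A *m z + t *: v)^T *m MNc *m (A *m z + t *: v) =
  z^T *m map_mx intr M *m z + t ^+ 2 *: (v^T *m MNc *m v).
 have -> : (A *m z + t *: v)^T = z^T *m A^T + t *: v^T by rewrite linearD linearZ /= trmx_mul.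
 rewrite !mulmxDl !mulmxDr -!scalemxAl -!scalemxAr -AMAc.
 have -> : z^T *m A^T *m MNc *m v = 0 by rewrite -!mulmxA [A^T *m _]mulmxA AMv mulmx0.
 have -> : v^T *m MNc *m (A *m z) = 0 by rewrite mulmxA vMA mul0mx.
 by rewrite !scaler0 addr0 add0r scalerA -expr2 !mulmxA.
by rewrite !mxE; ring.
Qed.

(** After rescaling t by j, the modular law of f leaves the extra exponent 2 pi i c j Q(v) t^2,
    which is exactly what the shift 2 pi i c j of [kap] cancels. The rescaling itself contributes
    j^i. *)
Lemma Tj_modular k i f : holomorphic f -> modular_law k MN f ->
 modular_law (k + i%:Z) M (Tj (quad MN v) A v i f).
Proof.
move=> hf mf a b c d abcd tau z; have j0 := jfactor_neq0 tau abcd.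
set j := jfactor c d tau in j0 *; rewrite /Tj /=.
pose phi t := f (tau, A *m z + t *: v) * cexp (- (kap tau * quad MN v * t ^+ 2)).
pose E0 := j ^ k * cexp (pii * c%:~R * quad M z / j).
transitivity (tc (fun t => E0 * phi (j * t)) i).
 congr (tc _ i); apply/funext => t.
 have -> : A *m (j^-1 *: z) + t *: v = j^-1 *: (A *m z + (j * t) *: v).
  by rewrite scalerDr scalerA mulKf // scalemxAr.
 rewrite mf quad_A kap_law -/j /E0 /phi; apply: exp_regroup.
 by move: (quad M z) (quad MN v) (kap tau) => x y K; field.
have pd : cdisc phi 1 by exact: Tj_disc.
have pj : cdisc (fun t => phi (j * t)) 1.
 split=> [//|t _]; dfc phi.
 have r0 : 0 < rn (j * t) + 1 by rewrite ltr_wpDl ?rn_ge0.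
 by apply: (Tj_disc (quad MN v) A v tau z r0 hf).2; rewrite ltrDl.
rewrite (tcZ E0 pj) (tc_scale j pd) /E0 expfzDr // -exprnP -/(phi).
by move: (tc phi i) (j ^ k) (j ^+ i) (cexp _) => *; ring.
Qed.

Lemma Tj_elliptic i f : holomorphic f -> elliptic_law MN f -> elliptic_law M (Tj (quad MN v) A v i f).
Proof.
move=> hf ef l m tau z l' m'; rewrite /Tj /=.
have mapA (u : 'cV[int]_n) : map_mx intr (Ai *m u) = A *m map_mx intr u :> 'cV[C]_N by rewrite map_mxM.
have q2 (u : 'cV[int]_n) : quad2 MN (Ai *m u) = quad2 M u. by rewrite /quad2 -AMA trmx_mul !mulmxA.
have ql : quad MN (A *m l') = quad M l'. by have := quad_A l' 0; rewrite scale0r addr0 expr0n /= mul0r addr0.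
pose E0 := (-1) ^ (quad2 M l + quad2 M m) *
 cexp (- (pii * val tau * quad M l') - pii * (l'^T *m map_mx intr M *m z) 0 0) : C.
rewrite -[RHS](congr1 (fun F => F i) (tcZ E0 (Tj_disc (quad MN v) A v tau z ltr01 hf))).
congr (tc _ i); apply/funext => t; rewrite mulrA; congr (_ * _).
have := ef (Ai *m l) (Ai *m m) tau (A *m z + t *: v); rewrite !mapA -/l' -/m' /=.
have -> : A *m z + t *: v + val tau *: (A *m l') + A *m m' = A *m (z + val tau *: l' + m') + t *: v.
 by rewrite !mulmxDr -scalemxAr -!addrA; congr (_ + _); rewrite [RHS]addrA [t *: v + _]addrC.
move=> ->; rewrite !q2 ql /E0; congr (_ * cexp (_ - pii * _) * _).
have -> : (A *m l')^T *m MNc *m (A *m z + t *: v) = l'^T *m map_mx intr M *m z; last by [].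
rewrite trmx_mul mulmxDr -scalemxAr -AMAc.
have -> : l'^T *m A^T *m MNc *m v = 0 by rewrite -!mulmxA [A^T *m _]mulmxA AMv mulmx0.
by rewrite scaler0 addr0 !mulmxA.
Qed.

Lemma Tj_weak k i f : jform k MN f -> jb 0 f ->
 jform (k + i%:Z) M (Tj (quad MN v) A v i f) /\ jb 0 (Tj (quad MN v) A v i f).
Proof.
move=> [hf mf ef] bf; split; last exact: Tj_jb (modular_per mf) bf.
by split; [exact: Tj_hol|exact: Tj_modular|exact: Tj_elliptic].
Qed.

End Law.
End TaylorOperators.

Section TaylorModular.
Variable R : realType.
Notation C := R[i].
Notation H := (uhp R).
Variables (N : nat) (MN : 'M[int]_N).

(** The case of no remaining variables: the corrected Taylor coefficients of z -> f(tau, z) along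
    the line through 0 and v, which are modular forms by [T0_mform]. *)
Definition T0 (v : 'cV[C]_N) (i : nat) (f : jfun R N) (tau : H) : C :=
 Tj (quad MN v) (0 : 'M[C]_(N, 0)) v i f (tau, 0).

Lemma jform0_mform k (M : 'M[int]_0) (g : jfun R 0) : jform k M g -> jb 0 g -> mform k (fun tau => g (tau, 0)).
Proof.
move=> [hg mg _] bg; split; first exact: hol_tau.
 move=> a b c d abcd tau; have := mg _ _ _ _ abcd tau 0; rewrite scaler0 => ->.
 by rewrite /quad mulmx0 mxE !mulr0 mul0r cexp0 mulr1.
by have [Y [B HB]] := bg 0; exists Y, B => tau /HB; rewrite !expr0 mul1r mulr1.
Qed.

Lemma T0_mform v k i f : jform k MN f -> jb 0 f -> mform (k + i%:Z) (T0 v i f).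
Proof.
move=> jf bf.
have [||| h1 h2] := @Tj_weak R N 0 MN 0 0 v _ _ _ k i f jf bf.
- by apply/matrixP => -[].
- by apply/matrixP => -[].
- by apply/matrixP => x [].
by rewrite map_mx0 in h1 h2; exact: jform0_mform h1 h2.
Qed.

Lemma T0_eq0 f tau : holomorphic f -> (forall v i, T0 v i f tau = 0) -> forall z, f (tau, z) = 0.
Proof.
move=> hf T00 z; have := Tj_eq0 hf (T00 z) 1.
by rewrite mulmx0 add0r scale1r.
Qed.

End TaylorModular.

(** * Finite dimensionality for a fixed tau *)

Section Theta.
Variable R : realType.
Notation C := R[i].
Notation H := (uhp R).
Notation pii := (twopii R).
Variables (n : nat) (M : 'M[int]_n).
Implicit Types (tau : H) (f : 'cV[C]_n -> C).

(* The functions z |-> f(tau, z) of the Jacobi forms of index M, for a fixed tau. *)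
Definition theta tau f := (forall z u (rho : R), 0 < rho -> cdisc (fun t => f (z + t *: u)) rho) /\
 (forall (p : 'cV[C]_n), exists2 d : R, 0 < d & exists B : R, forall v, rn (v - p) < d -> rn (f v) <= B) /\
 forall (l m : 'cV[int]_n) z, let l' := map_mx intr l in
  f (z + val tau *: l' + map_mx intr m) = (-1) ^ (quad2 M l + quad2 M m) * cexp (- (pii * val tau * quad M l') - pii * (l'^T *m map_mx intr M *m z) 0 0) * f z.

Lemma rn_sign (i : int) : rn ((-1) ^ i : C) = 1.
Proof. by case: i => j; rewrite ?NegzE -?exprnN -?exprnP ?rnV rnX rnN rn1 expr1n // invr1. Qed.

Lemma theta_sum (I : finType) tau (c : I -> C) (f : I -> 'cV[C]_n -> C) : (forall i, theta tau (f i)) ->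
 theta tau (fun z => \sum_i c i * f i z).
Proof.
move=> tf; split; [|split] => [z u rho r0|p|l m z l'].
- have [h _] := @cdisc_sum R I (index_enum I) (fun i t => c i * f i (z + t *: u)) rho r0
  (fun i => cdiscM (cdisc_cst (c i) r0) ((tf i).1 z u rho r0)).
 exact: h.
- have /choice[D DP] i : exists d : R, 0 < d /\ exists B : R, forall v, rn (v - p) < d -> rn (f i v) <= B.
  by have [d d0 [B HB]] := (tf i).2.1 p; exists d; split => //; exists B.
 have /choice[B BP] i : exists B : R, forall v, rn (v - p) < D i -> rn (f i v) <= B by have [_] := DP i.
 exists (\big[Num.min/1]_i D i).
  by elim/big_ind: _ => // [a b a0 b0|i _]; [rewrite lt_min a0|have [] := DP i].
 exists (\sum_i rn (c i) * B i) => v vd; apply: le_trans (rn_sum _ _ _) _; apply: ler_sum => i _.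
 rewrite rnM ler_wpM2l ?rn_ge0 // BP //; apply: lt_le_trans vd _.
 by rewrite (bigD1 i) //= ge_min lexx.
- rewrite mulr_sumr; apply: eq_bigr => i _; rewrite ((tf i).2.2 l m z) -/l'.
 by move: (f i z) (_ * cexp _) => *; ring.
Qed.

(** The constants below are uniform on this region. By [inK_ball] it contains a disc, which suffices
    for the identity theorem in tau. *)
Definition inK tau := `|Re (val tau)| <= 1 /\ 1 <= Im (val tau) <= 2.

Lemma inK_rn tau : inK tau -> rn (val tau) <= 3.
Proof.
move=> [h1 /andP[h2 h3]]; apply: le_trans (rn_le_ReIm _) _.
by rewrite [`|Im _|]ger0_norm; lra.
Qed.

Definition cellpt tau (x y : 'I_n -> R) : 'cV[C]_n := \col_i ((x i)%:C + (y i)%:C * val tau).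
Definition unitbox (x : 'I_n -> R) := forall i, 0 <= x i <= 1.

Lemma rn_cell tau x y : inK tau -> unitbox x -> unitbox y -> rn (cellpt tau x y) <= 4.
Proof.
move=> K ux uy; apply: rn_mx_le => // i j; rewrite mxE; apply: le_trans (rnD _ _) _; rewrite rnM !rn_real.
have /andP[x0 x1] := ux i; have /andP[y0 y1] := uy i; rewrite !ger0_norm //.
have := inK_rn K; have := rn_ge0 (val tau); move: (rn _) => r r0 r3; nra.
Qed.

Definition Msum : R := \sum_i \sum_j rn ((M i j)%:~R : C).

Lemma bilin_le (u w : 'cV[C]_n) (a b : R) : rn u <= a -> rn w <= b ->
 rn ((u^T *m map_mx intr M *m w) 0 0) <= a * b * Msum.
Proof.
move=> ua wb; have a0 : 0 <= a by exact: le_trans (rn_ge0 _) ua.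
have b0 : 0 <= b by exact: le_trans (rn_ge0 _) wb.
rewrite mxE; apply: le_trans (rn_sum _ _ _) _.
have -> : a * b * Msum = \sum_j \sum_i a * b * rn ((M i j)%:~R : C).
 by rewrite exchange_big /Msum mulr_sumr; apply: eq_bigr => i _; rewrite mulr_sumr.
apply: ler_sum => j _; rewrite mxE mulr_suml; apply: le_trans (rn_sum _ _ _) _.
apply: ler_sum => i _; rewrite !mxE !rnM.
have h1 := le_trans (rn_entry u i 0) ua; have h2 := le_trans (rn_entry w j 0) wb.
rewrite mulrAC; apply: ler_pM; rewrite ?mulr_ge0 ?rn_ge0 //.
by apply: ler_pM; rewrite ?rn_ge0.
Qed.

(** Bounds the automorphy factor that takes the fundamental cell to the ball of radius 16: there
    |tau| <= 3, cell points have norm at most 4, and the lattice vector l has norm at most 17. *)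
Definition C1 : R := expR (2 * pi * (3 * (17 * 17 * Msum) + 17 * 4 * Msum)).
Lemma C1_gt0 : 0 < C1. Proof. exact: expR_gt0. Qed.
Lemma cell_ring (x y a b t : C) : x + y * t = x - a + (y - b) * t + t * b + a.
Proof. ring. Qed.

Lemma half_le (x w : R) : 0 <= x -> x <= w -> 2^-1 * x <= w.
Proof. lra. Qed.

Lemma floor_bound (a y : R) : `|y| <= 16 -> y < a + 1%:~R -> a <= y -> `|a| <= 17.
Proof. by rewrite !ler_norml; lra. Qed.

Lemma reduce_cell tau z : exists x y : 'I_n -> R, exists l m : 'cV[int]_n,
 [/\ unitbox x, unitbox y, z = cellpt tau x y + val tau *: map_mx intr l + map_mx intr m &
  inK tau -> rn z <= 16 -> rn (map_mx intr l : 'cV[C]_n) <= 17].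
Proof.
have y0 := valP tau; set Y := Im (val tau) in y0.
pose yy i := Im (z i 0) / Y; pose xx i := Re (z i 0) - yy i * Re (val tau).
exists (fun i => xx i - (Num.floor (xx i))%:~R), (fun i => yy i - (Num.floor (yy i))%:~R).
exists (\col_i Num.floor (yy i)), (\col_i Num.floor (xx i)).
have fl (a : R) : 0 <= a - (Num.floor a)%:~R <= 1.
 by have := floor_le_tmp a; have := floorD1_gt a; rewrite intrD; lra.
split; [by move=> i; exact: fl|by move=> i; exact: fl| |].
 apply/colP => i; rewrite !mxE.
 rewrite (rmorphB (real_complex R) (xx i)) (rmorphB (real_complex R) (yy i)) !(rmorph_int (real_complex R)).
 transitivity ((xx i)%:C + (yy i)%:C * val tau).
  2: exact: cell_ring.
 apply/eqP; rewrite eq_complex cReD cImD cReM cImM /= !mul0r subr0 addr0 add0r.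
 by rewrite subrK eqxx /yy divfK ?eqxx // gt_eqF.
move=> [_ /andP[Y1 Y2]] z16; apply: rn_mx_le => // i j; rewrite !mxE rn_int.
have h : `|yy i| <= 16.
 rewrite /yy normrM normfV (gtr0_norm y0) ler_pdivrMr //.
 apply: le_trans (Im_le_rn _) _; apply: le_trans (rn_entry z i 0) _.
 by apply: le_trans z16 _; rewrite ler_peMr.
have := floor_le_tmp (yy i); have := floorD1_gt (yy i); rewrite intrD intr_norm.
by move=> f1 f2; exact: floor_bound h f1 f2.
Qed.

Lemma pii_bound (t q b : C) : rn (- (pii * t * q) - pii * b) <= 2 * pi * (rn t * rn q + rn b).
Proof.
apply: le_trans (rnB _ _) _; rewrite rnN (rnM (pii * t)) (rnM pii t) (rnM pii b) rn_twopii.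
by move: (2 * @pi R) => P; rewrite le_eqVlt; apply/orP; left; apply/eqP; ring.
Qed.

Lemma theta_ball tau f (K : R) : inK tau -> theta tau f ->
 (forall x y, unitbox x -> unitbox y -> rn (f (cellpt tau x y)) <= K) ->
 forall z, rn z <= 16 -> rn (f z) <= C1 * K.
Proof.
move=> kt [_ [_ ft]] fK z z16; have [x [y [l [m [ux uy zE lb]]]]] := reduce_cell tau z.
have {}lb := lb kt z16; have E := ft l m (cellpt tau x y).
rewrite zE E rnM rnM rn_sign mul1r; apply: ler_pM; rewrite ?rn_ge0 //; last exact: fK.
rewrite rn_cexp ler_expR; apply: le_trans (ler_norm _) _; apply: le_trans (Re_le_rn _) _.
apply: le_trans (pii_bound _ _ _) _; rewrite ler_wpM2l ?mulr_ge0 ?pi_ge0 //; apply: lerD; last first.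
 by apply: bilin_le => //; exact: rn_cell.
apply: ler_pM; rewrite ?rn_ge0 ?inK_rn // rnM rnV rn_nat.
by apply: half_le; [exact: rn_ge0|exact: (bilin_le lb lb)].
Qed.

Lemma theta_cell_bounded tau f : theta tau f ->
 exists2 K : R, 0 <= K & forall x y, unitbox x -> unitbox y -> rn (f (cellpt tau x y)) <= K.
Proof.
move=> [_ [fb _]].
have [E [szE nthE]] : exists E : seq 'I_n, size E = n /\ forall i0 i : 'I_n, nth i0 E i = i.
 by exists (enum 'I_n); split => [|i0 i]; rewrite ?size_enum_ord ?nth_ord_enum.
(* The cell is the box at the origin spanned by the basis vectors and their multiples by tau, which
   makes [box_LB] applicable. *)
pose us : seq 'cV[C]_n := [seq delta_mx i 0 | i <- E] ++ [seq val tau *: delta_mx i 0 | i <- E].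
pose P (v : 'cV[C]_n) (B : R) := rn (f v) <= B.
have Pm v B B' : B <= B' -> P v B -> P v B' by move=> BB h; exact: le_trans h BB.
have [d d0 [B BH]] := @box_LB R 'cV[C]_n P us Pm fb 0.
exists `|B| => // x y ux uy; apply: le_trans (ler_norm B).
pose g (k : nat) : R := if (k < n)%N then (if insub k is Some i then x i else 0) else
  if insub (k - n)%N is Some i then y i else 0.
have g01 k : 0 <= g k <= 1.
 by rewrite /g; case: ifP => _; case: insubP => [i _ _|_]; rewrite ?ux ?uy // lexx ler01.
have := BH 0 _ g g01; rewrite subrr rn0 => /(_ d0); rewrite /P add0r; congr (rn (f _) <= _).
have sz : size us = (n + n)%N.
 rewrite /us size_cat !size_map.
 by rewrite szE.
rewrite -(big_mkord xpredT (fun i => (g i)%:C *: us`_i)) sz big_mkord big_split_ord /=.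
apply/colP => i; rewrite !mxE !summxE.
congr (_ + _).
 rewrite (bigD1 i) //= big1 ?addr0 => [|j ji].
  rewrite /g ltn_ord valK nth_cat size_map szE ltn_ord (nth_map i) ?szE //.
  by rewrite nthE !mxE !eqxx mulr1.
 rewrite nth_cat size_map szE ltn_ord (nth_map i) ?szE // nthE !mxE.
 by rewrite eq_sym (negbTE ji) mulr0.
rewrite (bigD1 i) //= big1 ?addr0 => [|j ji].
 rewrite /g ltnNge leq_addr /= addKn valK nth_cat size_map szE ltnNge leq_addr /= addKn.
 by rewrite (nth_map i) ?szE // nthE !mxE !eqxx mulr1.
rewrite nth_cat size_map szE ltnNge leq_addr /= addKn (nth_map i) ?szE // nthE !mxE.
by rewrite eq_sym (negbTE ji) !mulr0.
Qed.

(** A bound K on the cell gives C1 K on the ball of radius 16. If the vanishing of f at suitable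
    places improves this to K / 2 on the cell, repetition forces f = 0. *)
Lemma theta_halve tau f : inK tau -> theta tau f ->
 (forall K, (forall z, rn z <= 16 -> rn (f z) <= C1 * K) -> 0 <= K -> forall x y, unitbox x -> unitbox y ->
   rn (f (cellpt tau x y)) <= K / 2) -> forall z, f z = 0.
Proof.
move=> kt tf half; have [K K0 KH] := theta_cell_bounded tf.
have iter m x y : unitbox x -> unitbox y -> rn (f (cellpt tau x y)) <= K * (1 / 2) ^+ m.
 elim: m x y => [|m IH] x y ux uy; first by rewrite expr0 mulr1 KH.
 have -> : K * (1 / 2) ^+ m.+1 = K * (1 / 2) ^+ m / 2 by rewrite exprSr; lra.
 by apply: (half (K * (1 / 2) ^+ m)) => //; [exact: (theta_ball kt tf IH)|rewrite mulr_ge0 // exprn_ge0].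
have cell0 x y : unitbox x -> unitbox y -> f (cellpt tau x y) = 0.
 move=> ux uy; apply: rn_small_eq => e e0; rewrite subr0.
 have h01 : 0 <= (1 / 2 : R) < 1 by lra.
 have [m mH] := geom_tail K h01 e0; apply: le_trans (iter m x y ux uy) (ltW (mH m (leqnn m))).
move=> z; have [x [y [l [m [ux uy -> _]]]]] := reduce_cell tau z.
by rewrite (tf.2.2 l m (cellpt tau x y)) cell0 ?mulr0.
Qed.

(** An order of vanishing at 0 that forces f = 0: 2^Bord >= Bord >= 8 C1 makes the Schwarz factor 4
    C1 / 2^Bord at most 1 / 2. *)
Definition Bord : nat := Num.bound (8 * C1).

Lemma quarter_le (c b X : R) : 8 * c < b -> b <= X -> 0 < X -> 4 * c / X <= 1 / 2.
Proof. by move=> h1 h2 h3; rewrite ler_pdivrMr //; lra. Qed.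

Lemma Bord_half : 4 * C1 * (1 / 2) ^+ Bord <= 1 / 2 :> R.
Proof.
have h : 8 * C1 < Bord%:R. by have := @archi_boundP R (8 * C1); apply; rewrite mulr_ge0 // ltW // C1_gt0.
have h2 : Bord%:R <= 2 ^+ Bord :> R by rewrite -natrX ler_nat ltnW // ltn_expl.
have h3 : 0 < 2 ^+ Bord :> R by rewrite exprn_gt0.
have -> : (1 / 2 : R) ^+ Bord = (2 ^+ Bord)^-1 by rewrite div1r exprVn.
exact: (quarter_le h h2 h3).
Qed.

Lemma theta_order tau f : inK tau -> theta tau f ->
 (forall u i, (i < Bord)%N -> tc (fun t => f (t *: u)) i = 0) -> forall z, f z = 0.
Proof.
move=> kt tf f0; apply: (theta_halve kt tf) => K fK K0 x y ux uy.
set z := cellpt tau x y; have z4 : rn z <= 4 by exact: rn_cell.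
have fd : cdisc (fun t => f (t *: z)) 4.
 have := tf.1 0 z 4 (ltr0n R 4); by under eq_fun do rewrite add0r.
have s24 : 0 < (2 : R) < 4 by rewrite ltr0n ltr_nat.
(* For z in the cell the circle |w| = 2 keeps w z in the ball of radius 8; the point w = 1 is at
   half its radius. *)
have bd (w : C) : rn w = 2 -> rn (f (w *: z)) <= C1 * K. by move=> w2; apply: fK; rewrite rnZ w2; lra.
have := @tc_rem R (fun t => f (t *: z)) 4 2 (C1 * K) Bord 1 fd s24 bd; rewrite rn1 divff // lexx => /(_ isT).
rewrite big1 => [|i _]; last by rewrite f0 ?mul0r ?ltn_ord.
rewrite subr0 scale1r => /le_trans; apply.
by have := ler_wpM2r K0 Bord_half; move: (_ ^+ Bord) => w; lra.
Qed.

(** Mesh of a grid in the square of half-width 4 of each coordinate. [theta_grid] needs C1 eps <= 1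
    / 2 and eps <= 1 / 4. *)
Definition eps : R := (4 * (C1 + 1))^-1.
Definition gridL : nat := (Num.bound (8 / eps)).+1.
Definition grid : Type := 'M['I_gridL * 'I_gridL]_(n, 1).
Definition gridpt (g : grid) : 'cV[C]_n := \col_i (((g i 0).1%:R * eps - 4) +i* ((g i 0).2%:R * eps - 4)).

Lemma eps_gt0 : 0 < eps. Proof. by rewrite invr_gt0 mulr_gt0 // ltr_wpDl // ltW // C1_gt0. Qed.

Lemma grid_coord (a : R) : `|a| <= 4 -> exists k : 'I_gridL, `|a - (k%:R * eps - 4)| <= eps.
Proof.
rewrite ler_norml => /andP[a1 a2]; have e0 := eps_gt0.
pose b := (a + 4) / eps; have b0 : 0 <= b by rewrite divr_ge0 ?(ltW e0) //; lra.
have bL : b < gridL%:R.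
 have a8 : a + 4 <= 8 by lra.
 apply: (@le_lt_trans _ _ (8 / eps)); first by apply: ler_wpM2r => //; rewrite invr_ge0 ltW.
 apply: lt_le_trans (archi_boundP _) _; first by rewrite divr_ge0 // ltW.
 by rewrite ler_nat leqnSn.
pose k := absz (Num.floor b).
have kE : (k%:R : R) = (Num.floor b)%:~R. by rewrite -[k%:R]/((k%:Z)%:~R) gez0_abs // floor_ge0.
have := floor_le_tmp b; have := floorD1_gt b; rewrite intrD -kE => f1 f2.
have kL : (k < gridL)%N by rewrite -(ltr_nat R); lra.
exists (Ordinal kL) => /=; have aE : a = b * eps - 4 by rewrite /b divfK ?gt_eqF // addrK.
rewrite aE; have -> : b * eps - 4 - (k%:R * eps - 4) = (b - k%:R) * eps by ring.
rewrite normrM (gtr0_norm e0) ler_piMl ?(ltW e0) // ler_norml; lra.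
Qed.

Lemma grid_near (z : 'cV[C]_n) : rn z <= 4 -> exists g : grid, rn (z - gridpt g) <= 2 * eps.
Proof.
move=> z4.
have H i : exists kk : 'I_gridL * 'I_gridL,
  `|Re (z i 0) - (kk.1%:R * eps - 4)| <= eps /\ `|Im (z i 0) - (kk.2%:R * eps - 4)| <= eps.
 have h := le_trans (rn_entry z i 0) z4.
 have [k1 h1] := grid_coord (le_trans (Re_le_rn _) h).
 by have [k2 h2] := grid_coord (le_trans (Im_le_rn _) h); exists (k1, k2).
have [kk kkP] := choice H; exists (\col_i kk i).
apply: rn_mx_le => [|i j]; first by rewrite mulr_ge0 // ltW // eps_gt0.
rewrite !mxE (ord1 j) (le_trans (rn_le_ReIm _)) //; have [h1 h2] := kkP i.
by rewrite cReB cImB /=; lra.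
Qed.

(** Each z of the cell lies within 2 eps of a zero g of f. The line from g to z, stretched by s = 4
    / eps, stays within 5 + 8 of the origin, where |f| <= C1 K; Schwarz's estimate of order 1 gives
    C1 K eps <= K / 2 at z. *)
Lemma theta_grid tau f : inK tau -> theta tau f -> (forall g, f (gridpt g) = 0) -> forall z, f z = 0.
Proof.
move=> kt tf f0; apply: (theta_halve kt tf) => K fK K0 x y ux uy.
set z := cellpt tau x y; have z4 : rn z <= 4 by exact: rn_cell.
have e0 := eps_gt0; have c0 := C1_gt0.
have [g gz] := grid_near z4; set u := z - gridpt g in gz.
have e1 : eps <= 1 / 4. by rewrite /eps div1r lef_pV2 ?posrE ?mulr_gt0 ?addr_gt0 // ler_peMr //; lra.
pose s := 4 / eps; have s0 : 0 < s by rewrite divr_gt0.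
have s16 : 16 <= s by rewrite /s ler_pdivlMr //; lra.
have fd := tf.1 (gridpt g) u (2 * s) (mulr_gt0 (ltr0n R 2) s0).
have s2 : 0 < s < 2 * s by rewrite s0 ltr_pMl // ltr1n.
have gp : rn (gridpt g) <= 5.
 have -> : gridpt g = z - u by rewrite /u opprB addrC subrK. by have := rnB z u; lra.
have bd (w : C) : rn w = s -> rn (f (gridpt g + w *: u)) <= C1 * K.
 move=> ws; apply: fK; apply: le_trans (rnD _ _) _; rewrite rnZ ws.
 have : s * rn u <= s * (2 * eps) by rewrite ler_pM2l.
 have -> : s * (2 * eps) = 8 by rewrite /s; have := lt0r_neq0 e0; move: eps => e ee; field. by lra.
have := @tc_rem R _ (2 * s) s (C1 * K) 1 1 fd s2 bd; rewrite rn1 big_ord1 expr0 mulr1 (tc_0 fd).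
rewrite scale0r addr0 f0 subr0 scale1r expr1 /u addrC subrK => /(_ _) h.
apply: le_trans (h _) _; first by lra.
have -> : 4 * (C1 * K) * (1 / s) = C1 * K * eps.
 by rewrite /s; have := lt0r_neq0 e0; move: eps => e ee; field.
have ce : C1 * eps <= 1 / 2. by rewrite /eps ler_pdivrMr ?mulr_gt0 ?addr_gt0 //; lra.
by rewrite mulrAC; have := ler_wpM2r K0 ce; lra.
Qed.

Lemma theta_jform k (F : jfun R n) tau : jform k M F -> theta tau (fun z => F (tau, z)).
Proof.
move=> [hF mF eF]; split; first by move=> z u rho r0; exact: hol_line.
split=> [p|l m z l'].
 have tp := valP tau.
 have /differentiable_continuous/continuous_rnP/(_ 1 ltr01)[d d0 dH] := hF (val tau, p) tp.
 exists d => //; exists (rn (F (tau, p)) + 1) => v vd; have := dH (val tau, v).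
 rewrite rn_pair /= subrr rn0 max_r ?rn_ge0 // !jextE => /(_ vd) h.
 by have := rnBl (F (tau, v)) (F (tau, p)); lra.
exact: eF.
Qed.

End Theta.

(** * Weak Jacobi forms: lower bound on weights and the regular sequence E4, E6 *)

Section WeakForms.
Variable R : realType.
Notation C := R[i].
Notation H := (uhp R).
Variables (n : nat) (M : 'M[int]_n).
Implicit Types (f g : jfun R n) (tau : H) (z : 'cV[C]_n) (k l w : int).

Definition wj (m : nat) k f := jform k M f /\ jb m f.

Lemma wjM m l k (a : H -> C) f : mform l a -> wj m k f -> wj m (l + k) (fun x => a x.1 * f x).
Proof.
move=> [ha la ca] [[hf mf ef] bf]; split; first split.
- exact: holomorphicM.
- move=> a' b c d abcd tau z /=; rewrite la mf expfzDr ?(jfactor_neq0 tau abcd) //.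
 by move: (jfactor c d tau ^ l) (jfactor c d tau ^ k) (cexp _) => *; ring.
- by move=> l' m' tau z /=; rewrite ef mulrCA.
- move=> z; have [Y [B [_ B0 HB]]] := cuspbW ca; have [Y' [B' HB']] := bf z.
 exists (Num.max Y Y'), (B * B') => tau; rewrite ge_max => /andP[/HB h1 /HB' h2].
 by rewrite mulrCA rnM; apply: ler_pM; rewrite ?rn_ge0 //; move: h1; rewrite expr0 mulr1.
Qed.

Lemma wjD m k f g : wj m k f -> wj m k g -> wj m k (fun x => f x + g x).
Proof.
move=> [[hf mf ef] bf] [[hg mg eg] bg]; split; first split.
- exact: holomorphicD.
- by move=> a b c d abcd tau z /=; rewrite mf mg mulrDr.
- by move=> l m' tau z /=; rewrite ef eg mulrDr.
- move=> z; have [Y [B HB]] := bf z; have [Y' [B' HB']] := bg z.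
 exists (Num.max Y Y'), (B + B') => tau; rewrite ge_max => /andP[/HB h1 /HB' h2].
 by rewrite mulrDr; apply: le_trans (rnD _ _) _; exact: lerD.
Qed.

Lemma wj_ext m k f g : (forall x, f x = g x) -> wj m k f -> wj m k g.
Proof. by move=> /funext ->. Qed.

Lemma wj0 m k : wj m k (fun=> 0).
Proof.
split; first split.
- move=> p p0; have -> : jext (fun=> 0 : C) = (fun=> 0) :> (C^o * 'cV[C]_n -> C^o).
  by apply/funext => q; rewrite /jext; case: insub.
 exact: dfcst.
- by move=> a b c d abcd tau z; rewrite mulr0.
- by move=> l m' tau z /=; rewrite mulr0.
- by move=> z; exists 0, 0 => tau _; rewrite mulr0 rn0.
Qed.

Lemma wjZ m k (c : C) f : wj m k f -> wj m k (fun x => c * f x).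
Proof. by move=> wf; rewrite -[k]add0r; exact: wjM (mform_cst c) wf. Qed.

Lemma wjB m k f g : wj m k f -> wj m k g -> wj m k (fun x => f x - g x).
Proof. by move=> wf wg; apply: wj_ext (wjD wf (wjZ (-1) wg)) => x; rewrite mulN1r. Qed.

Lemma wj_sum m r k (F : nat -> jfun R n) : (forall i, (i < r)%N -> wj m k (F i)) ->
 wj m k (fun x => \sum_(i < r) F i x).
Proof.
elim: r => [|r IH] wF.
 by apply: wj_ext (wj0 m k) => x; rewrite big_ord0.
apply: wj_ext (wjD (IH (fun i ir => wF i (ltnW ir))) (wF r (ltnSn r))) => x.
by rewrite big_ord_recr.
Qed.

Lemma wj_identity m k f tau0 (d : R) : wj m k f -> 0 < d ->
 (forall t z, rn (val t - val tau0) < d -> f (t, z) = 0) -> forall x, f x = 0.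
Proof.
move=> [[hf mf _] bf] d0 H0 [t z]; have pf := modular_per mf.
have : qext m f z (val t) = 0.
 apply: (identity_H (tau0 := val tau0) (d := Num.min d (Im (val tau0)))) (valP t).
 - by move=> w; exact: qext_df.
 - by move=> w; exact: qext_per.
 - exact: qext_b.
 - exact: (valP tau0).
 - by rewrite lt_min d0; exact: (valP tau0).
 - by move=> w; rewrite lt_min => /andP[w1 /Im_ball/uhpP[u uE]]; rewrite -uE qextE H0 ?mulr0 // uE.
by rewrite qextE => /eqP; rewrite mulf_eq0 (negbTE (expf_neq0 _ (ee_neq0 _))) => /eqP.
Qed.

Lemma inK_ball : exists tau0 : H, forall t : H, rn (val t - val tau0) < 1 / 2 -> inK t.
Proof.
have h : 0 < Im (0 +i* (3 / 2) : C) by rewrite /= divr_gt0.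
have [t0 t0E] := uhpP h; exists t0 => t; rewrite t0E => tb; rewrite /inK.
have := le_lt_trans (Re_le_rn _) tb; have := le_lt_trans (Im_le_rn _) tb.
rewrite cReB cImB /= subr0 !ltr_norml => /andP[a1 a2] /andP[a3 a4].
by rewrite ler_norml; split; lra.
Qed.

(** The corrected Taylor coefficients of order below [Bord] are modular forms of negative weight,
    hence 0. Multiplying the Gaussian factor back shows that f itself vanishes to that order, and
    [theta_order] applies on an open set of tau. *)
Lemma wj_lower k f : wj 0 k f -> k < - (Bord R M)%:Z -> forall x, f x = 0.
Proof.
move=> wf kB; have [[hf _ _] bf] := wf; have [t0 tK] := inK_ball.
have h2 : 0 < (1 / 2 : R) by lra.
apply: (wj_identity wf h2 (tau0 := t0)) => t z /tK tk.
apply: (theta_order tk (theta_jform t wf.1)) => u i iB.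
pose c := kap t * quad M u.
pose g s := f (t, s *: u) * cexp (- (c * s ^+ 2)).
have gE : g = fun s => f (t, (0 : 'M[C]_(n, 0)) *m 0 + s *: u) * cexp (- (kap t * quad M u * s ^+ 2)).
 by apply/funext => s; rewrite mulmx0 add0r.
have gT j : (j < Bord R M)%N -> tc g j = 0.
 move=> jB; have kj : k + j%:Z < 0 by lia.
 by have := mform_neg kj (T0_mform u j wf.1 bf) t; rewrite /T0 /Tj gE.
have gd : cdisc g 1 by rewrite gE; exact: Tj_disc.
have -> : (fun s => f (t, s *: u)) = fun s => g s * cexp (- (- c * s ^+ 2)).
 apply/funext => s; rewrite /g -mulrA -cexpD mulNr opprK addNr cexp0 mulr1 //.
rewrite (tcM i gd (gauss_disc (- c) ltr01)) big1 // => j _.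
by rewrite gT ?mul0r //; apply: leq_ltn_trans iB; rewrite -ltnS.
Qed.

(** This and the next two lemmas transfer holomorphy and the two transformation laws from a g to g
    at a point tau where a does not vanish. *)
Lemma div_df (a : H -> C) f g (tau : H) z : hol a -> holomorphic f -> (forall x, f x = a x.1 * g x) ->
 a tau != 0 -> dff (jext g) ((val tau, z) : (C^o * 'cV[C]_n)%type : normedModType C).
Proof.
move=> ha hf fE a0; have {}fE : f = fun x => a x.1 * g x by apply/funext.
pose p : ((C^o * 'cV[C]_n)%type : normedModType C) := (val tau, z).
have dp : dff (fun p : C^o * 'cV[C]_n => hext a p.1 : C^o) p by apply: df_hext => //; exact: (valP tau).
have a0' : hext a p.1 != 0 by rewrite hextE.
have e0 : 0 < rn (hext a p.1) by rewrite rn_gt0.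
have /continuous_rnP/(_ _ e0)[d d0 dH] := differentiable_continuous dp.
apply: (differentiable_local (f := fun v : C^o * 'cV[C]_n => jext f v * (hext a v.1)^-1 : C^o) d0).
 move=> v /dH vd; have v0 : hext a v.1 != 0.
  by apply/eqP => v0; move: vd; rewrite v0 sub0r rnN ltxx.
 by rewrite fE jextM mulrAC divff // mul1r.
by dfs; [apply: hf; exact: (valP tau)|exact: dp|exact: a0'].
Qed.

Lemma div_modular l k (a : H -> C) f g tau z (a' b c d : int) (abcd : a' * d - b * c = 1) :
 mlaw l a -> modular_law k M f -> (forall x, f x = a x.1 * g x) -> a tau != 0 ->
 g (mobius abcd tau, (jfactor c d tau)^-1 *: z) = jfactor c d tau ^ (k - l) *
   cexp (twopii R * c%:~R * quad M z / jfactor c d tau) * g (tau, z).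
Proof.
move=> la mf fE a0; have j0 := jfactor_neq0 tau abcd.
have := mf _ _ _ _ abcd tau z; rewrite !fE /= la.
have jl : jfactor c d tau ^ l != 0 by rewrite expfz_neq0.
rewrite {1}(_ : k = l + (k - l)); last by rewrite addrC subrK.
rewrite expfzDr // => E; apply: (mulfI (mulf_neq0 jl a0)); rewrite E.
by move: (cexp _) (_ ^ (k - l)) (_ ^ l) => *; ring.
Qed.

Lemma div_elliptic (a : H -> C) f g tau z (l m : 'cV[int]_n) :
 elliptic_law M f -> (forall x, f x = a x.1 * g x) -> a tau != 0 -> let l' : 'cV[C]_n := map_mx intr l in
  let m' : 'cV[C]_n := map_mx intr m in g (tau, z + val tau *: l' + m') = (-1) ^ (quad2 M l + quad2 M m) *
   cexp (- (twopii R * val tau * quad M l') - twopii R * (l'^T *m map_mx intr M *m z) 0 0) * g (tau, z).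
Proof.
move=> ef fE a0 l' m'; have := ef l m tau z; rewrite -/l' -/m'; cbv zeta; rewrite !fE [X in a X]/= => E.
by apply: (mulfI a0); rewrite E; move: (_ * cexp _) => *; ring.
Qed.

Lemma cusp_low (a : H -> C) : cuspb 1 (fun tau => a tau - 1) ->
 exists Y : R, forall tau, Y <= Im (val tau) -> 1 / 2 <= rn (a tau).
Proof.
move=> /cuspbW[Y [B [Y1 B0 HB]]].
exists (Num.max Y (2 * B)) => tau; rewrite ge_max => /andP[h1 h2].
have := HB tau h1; rewrite expr1 => h3.
have h4 : B * rn (ee (val tau)) <= 1 / 2.
 have := rn_q_le h2; have p3 := pi_ge3 R; have x0 : 0 < 1 + 2 * pi * (2 * B) by rewrite ltr_wpDr // !mulr_ge0 // pi_ge0.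
 have : expR (- (2 * pi * (2 * B))) <= (1 + 2 * pi * (2 * B))^-1.
  by rewrite expRN lef_pV2 ?posrE ?expR_gt0 // expR_ge1Dx.
 move=> a1 a2; apply: le_trans (ler_wpM2l B0 (le_trans a2 a1)) _.
 have : B * 1 <= B * pi by rewrite ler_wpM2l //; lra. by rewrite ler_pdivrMr //; move: (pi : R) => P; nra.
have := rnBl 1 (1 - a tau); rewrite rn1 opprB addrCA subrr addr0 rnC; lra.
Qed.

(** P / E6 and Q / E4 agree where both are defined, and E4 and E6 have no common zero, so one of the
    two describes the quotient near every point. At the cusp E4 tends to 1. *)
Lemma regular_pair w (P Q : jfun R n) : wj 0 (w - 4) P -> wj 0 (w - 6) Q ->
 (forall x, E4 x.1 * P x = E6 x.1 * Q x) ->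
 exists2 G, wj 0 (w - 6 - 4) G & forall x, P x = E6 x.1 * G x /\ Q x = E4 x.1 * G x.
Proof.
move=> [[hP mP eP] bP] [[hQ mQ eQ] bQ] PQ.
pose G : jfun R n := fun x => if E4 x.1 == 0 then P x / E6 x.1 else Q x / E4 x.1.
have GQ x : Q x = E4 x.1 * G x.
 rewrite /G; case: eqP => [x0|/eqP x0]; last by rewrite mulrC divfK.
 have [|y0] := E46_neq0 x.1; first by rewrite x0 eqxx.
 by move: (PQ x); rewrite x0 !mul0r => /esym/eqP; rewrite mulf_eq0 (negbTE y0) => /eqP.
have GP x : P x = E6 x.1 * G x.
 have [x0|y0] := E46_neq0 x.1. by apply: (mulfI x0); rewrite PQ GQ mulrCA.
 rewrite /G; case: eqP => [_|/eqP x0]; first by rewrite mulrC divfK.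
 by apply: (mulfI x0); rewrite PQ mulrCA; congr (_ * _); rewrite mulrC divfK.
have [hx lx _] := @E4_mform R; have [hy ly _] := @E6_mform R.
exists G => //; split; first split.
- move=> [p1 z] /= p0; have [tau <-] := uhpP p0.
 by have [x0|y0] := E46_neq0 tau; [exact: div_df hx hQ GQ x0|exact: div_df hy hP GP y0].
- move=> a b c d abcd tau z; have [x0|y0] := E46_neq0 tau; first exact: div_modular lx mQ GQ x0.
 by rewrite (div_modular _ _ ly mP GP y0); congr (_ ^ _ * _ * _); ring.
- move=> l m tau z; have [x0|y0] := E46_neq0 tau; first exact: div_elliptic eQ GQ x0.
 exact: div_elliptic eP GP y0.
- move=> z; have [Y HY] := cusp_low (@E4_cusp R); have [Y' [B HB]] := bQ z.
 exists (Num.max Y Y'), (2 * B) => tau; rewrite ge_max => /andP[/HY h1 /HB].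
 rewrite !expr0 !mul1r GQ rnM /=; have := rn_ge0 (G (tau, z)); move: (rn _) (rn _) h1 => b a h1 h2 h3.
 have : 1 / 2 * b <= a * b by rewrite ler_wpM2r.
 lra.
Qed.

End WeakForms.

(** * Freeness of the module of weak Jacobi forms *)

Section Families.
Variable R : realType.
Notation C := R[i].
Notation H := (uhp R).
Variables (n : nat) (M : 'M[int]_n).
Notation wj := (wj (R := R) M).

(** Families are functions on [nat] of which the first r values count, so that appending an element
    is a pointwise update. *)
Definition fam r (k : nat -> int) (f : nat -> jfun R n) := forall i, (i < r)%N -> wj 0 (k i) (f i).
Definition span r (c : nat -> H -> C) (f : nat -> jfun R n) : jfun R n :=
 fun x => \sum_(i < r) c i x.1 * f i x.
Definition coefs r (k : nat -> int) w (c : nat -> H -> C) := forall i, (i < r)%N -> mform (w - k i) (c i).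
Definition gindep r (k : nat -> int) (f : nat -> jfun R n) := forall w c, coefs r k w c -> (forall x, span r c f x = 0) ->
 forall i, (i < r)%N -> forall tau, c i tau = 0.
(* Linear independence modulo the submodule generated by E4 and E6. *)
Definition xyindep r (k : nat -> int) (f : nat -> jfun R n) := forall w (al : nat -> C) B E,
 (forall i, (i < r)%N -> al i <> 0 -> k i = w) -> wj 0 (w - 4) B -> wj 0 (w - 6) E ->
 (forall x, \sum_(i < r) al i * f i x = E4 x.1 * B x + E6 x.1 * E x) -> forall i, (i < r)%N -> al i = 0.

Lemma wj_span r k f w c : fam r k f -> coefs r k w c -> wj 0 w (span r c f).
Proof.
move=> ff cc; apply: (wj_sum (F := fun i x => c i x.1 * f i x)) => i ir; rewrite -(subrK (k i) w).
exact: wjM (cc i ir) (ff i ir).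
Qed.

Lemma spanD r (b d : nat -> H -> C) f (a : H -> C) x :
 span r (fun i tau => b i tau + a tau * d i tau) f x = span r b f x + a x.1 * span r d f x.
Proof.
rewrite /span mulr_sumr -big_split; apply: eq_bigr => i _ /=; rewrite mulrDl mulrA //.
Qed.

Lemma split_coef w (c : H -> C) : mform w c -> exists al b e, [/\ al <> 0 -> w = 0,
 mform (w - 4) b, mform (w - 6) e & forall tau, c tau = al + (E4 tau * b tau + E6 tau * e tau)].
Proof.
move=> mc; have [w0|w0] := eqVneq w 0; last first.
 by have [b [e [mb me cE]]] := mform_xy w0 mc; exists 0, b, e; split => // tau; rewrite add0r.
rewrite w0 in mc *; have [a aE] := mform_const mc; exists a, (fun=> 0), (fun=> 0).
by split => // [||tau]; [exact: mform0|exact: mform0|rewrite aE !mulr0 !addr0].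
Qed.

Lemma span_split r k f w c : coefs r k w c -> exists al b e,
 [/\ forall i, (i < r)%N -> al i <> 0 -> k i = w, coefs r k (w - 4) b, coefs r k (w - 6) e,
  forall i tau, (i < r)%N -> c i tau = al i + (E4 tau * b i tau + E6 tau * e i tau) &
  forall x, span r c f x = \sum_(i < r) al i * f i x + (E4 x.1 * span r b f x + E6 x.1 * span r e f x)].
Proof.
move=> cc.
have /choice[t tP] i : exists t : C * (H -> C) * (H -> C), (i < r)%N ->
 [/\ t.1.1 <> 0 -> k i = w, mform (w - 4 - k i) t.1.2, mform (w - 6 - k i) t.2 &
  forall tau, c i tau = t.1.1 + (E4 tau * t.1.2 tau + E6 tau * t.2 tau)].
 have [ir|ir] := ltnP i r; last by exists (0, fun=> 0, fun=> 0).
 have [al [b [e [h1 h2 h3 h4]]]] := split_coef (cc i ir); exists (al, b, e) => _ /=.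
 by split => //; [move=> /h1/eqP; rewrite subr_eq0 => /eqP|rewrite addrAC|rewrite addrAC].
exists (fun i => (t i).1.1), (fun i => (t i).1.2), (fun i => (t i).2); split.
- by move=> i ir; have [] := tP i ir.
- by move=> i ir; have [] := tP i ir.
- by move=> i ir; have [] := tP i ir.
- by move=> i tau ir; have [] := tP i ir.
move=> x; rewrite /span !mulr_sumr -!big_split; apply: eq_bigr => i _ /=.
have [_ _ _ ->] := tP i (ltn_ord i); ring.
Qed.

(** Split each coefficient into a constant and a part in (E4, E6). The constants vanish by
    [xyindep], which leaves E4 (G - span b) = E6 (span e), and [regular_pair] provides G'. *)
Lemma span_step r k f w c G : fam r k f -> xyindep r k f -> coefs r k w c -> wj 0 (w - 4) G ->
 (forall x, span r c f x = E4 x.1 * G x) -> exists b e, exists2 G', wj 0 (w - 6 - 4) G' &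
 [/\ coefs r k (w - 4) b, coefs r k (w - 6) e,
   forall i tau, (i < r)%N -> c i tau = E4 tau * b i tau + E6 tau * e i tau,
   forall x, span r e f x = E4 x.1 * G' x & forall x, G x = span r b f x + E6 x.1 * G' x].
Proof.
move=> ff xf cc wG cG; have [al [b [e [h1 cb ce h4 h5]]]] := span_split f cc.
have wb := wj_span ff cb; have we := wj_span ff ce.
have wGb := wjB wG wb.
have al0 : forall i, (i < r)%N -> al i = 0.
 apply: (xf w al _ _ h1 wGb (wjZ (-1) we)) => x.
 by have := h5 x; rewrite cG => h; ring: h.
have s0 x : \sum_(i < r) al i * f i x = 0 by rewrite big1 // => i _; rewrite al0 ?mul0r.
have [|G' wG' GP] := regular_pair wGb we. by move=> x; have := h5 x; rewrite s0 cG => h; ring: h.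
exists b, e, G' => //; split => // [i tau ir|x|x]; first by rewrite h4 // al0 // add0r.
 by have [_ ->] := GP x.
by have [<- _] := GP x; rewrite addrC subrK.
Qed.

(** Two statements proved together by induction on the weight: if E4 G lies in the span then so does
    G, and relations are trivial. The first at weight w - 6 expresses G' through coefficients d;
    then c = E4 (b + E6 d) + E6 (e - E4 d), where both brackets are relations of smaller weight. In
    low weights everything vanishes by [mform_neg] and [wj_lower]. *)
Lemma xy_claim r k f (L : nat) : fam r k f -> xyindep r k f -> (Bord R M <= L)%N ->
 (forall i, (i < r)%N -> - L%:Z <= k i) -> forall (m : nat) w, w < m%:Z - L%:Z ->
 (forall c G, coefs r k w c -> wj 0 (w - 4) G -> (forall x, span r c f x = E4 x.1 * G x) ->
   exists2 d, coefs r k (w - 4) d & forall x, G x = span r d f x) /\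
 (forall c, coefs r k w c -> (forall x, span r c f x = 0) -> forall i, (i < r)%N -> forall tau, c i tau = 0).
Proof.
move=> ff xf BL kL; elim=> [|m IH] w wm.
 have neg c i tau : coefs r k w c -> (i < r)%N -> c i tau = 0.
  by move=> cc ir; apply: mform_neg (cc i ir) tau; have := kL i ir; lia.
 split=> [c G cc wG cG|c cc _ i ir tau]; last exact: neg.
 have wB : w - 4 < - (Bord R M)%:Z by lia.
 exists (fun _ _ => 0) => [i _|x]; first exact: mform0.
 by rewrite (wj_lower wG wB) /span big1 // => i _; rewrite mul0r.
have [Cl6 Si6] := IH (w - 6) ltac:(lia); have [_ Si4] := IH (w - 4) ltac:(lia).
have w6 : w - 4 = 6 + (w - 6 - 4) by lia.
have w4 : w - 6 = 4 + (w - 6 - 4) by lia.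
split=> [c G cc wG cG|c cc c0 i ir tau].
 have [b [e [G' wG' [cb ce h4 h5 h6]]]] := span_step ff xf cc wG cG.
 have [d cd dE] := Cl6 e G' ce wG' h5.
 exists (fun i tau => b i tau + E6 tau * d i tau) => [i ir|x]; last by rewrite spanD -dE h6.
 by apply: mformD; [exact: cb|rewrite w6 -addrA; apply: mformM (@E6_mform R) (cd i ir)].
have [|b [e [G' wG' [cb ce h4 h5 h6]]]] := span_step ff xf cc (@wj0 R n M 0 (w - 4)).
 by move=> x; rewrite c0 mulr0.
have [d cd dE] := Cl6 e G' ce wG' h5.
have e0 : e i tau + - E4 tau * d i tau = 0.
 apply: (Si6 (fun i tau => e i tau + (- E4 tau) * d i tau)) => // [j jr|x]; last first.
  by rewrite (spanD _ _ _ _ (fun tau => - E4 tau)) -dE h5; ring.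
 apply: mformD; first exact: ce.
 rewrite w4 -addrA; apply: mformM (cd j jr).
 by have := mformZ (-1) (@E4_mform R); under eq_fun do rewrite mulN1r.
have b0 : b i tau + E6 tau * d i tau = 0.
 apply: (Si4 (fun i tau => b i tau + E6 tau * d i tau)) => // [j jr|x]; last by rewrite spanD -dE -h6.
 by apply: mformD; [exact: cb|rewrite w6 -addrA; apply: mformM (@E6_mform R) (cd j jr)].
have -> : c i tau = E4 tau * (b i tau + E6 tau * d i tau) + E6 tau * (e i tau + - E4 tau * d i tau).
 by rewrite h4 //; ring.
by rewrite e0 b0 !mulr0 addr0.
Qed.

Lemma weights_lower r (k : nat -> int) : exists2 L : nat, (Bord R M <= L)%N & forall i, (i < r)%N -> - L%:Z <= k i.
Proof.
elim: r => [|r [L LB kL]]; first by exists (Bord R M).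
exists (L + absz (k r))%N => [|i]; first by rewrite (leq_trans LB) // leq_addr.
by rewrite ltnS leq_eqVlt => /orP[/eqP ->|/kL]; lia.
Qed.

Lemma xy_gindep r k f : fam r k f -> xyindep r k f -> gindep r k f.
Proof.
move=> ff xf w c cc c0; have [L BL kL] := weights_lower r k.
have wL : w < (absz w + L).+1%:Z - L%:Z by lia.
by have [_ h] := xy_claim ff xf BL kL wL; exact: h.
Qed.

Lemma T0_span r v j (c : nat -> H -> C) (f : nat -> jfun R n) :
 (forall i, (i < r)%N -> hol (c i)) -> (forall i, (i < r)%N -> holomorphic (f i)) ->
 holomorphic (span r c f) /\
 forall tau, T0 M v j (span r c f) tau = \sum_(i < r) c i tau * T0 M v j (f i) tau.
Proof.
elim: r => [|r IH] hc hf.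
 have -> : span 0 c f = fun x => (fun=> 0) x.1 * (fun=> 0) x.
  by apply/funext => x; rewrite /span big_ord0 mul0r.
 have h0 : holomorphic ((fun=> 0) : jfun R n) by have [[]] := @wj0 R n M 0 0.
 split; first exact: (holomorphicM (hol_cst 0) h0).
 by move=> tau; rewrite /T0 (TjM _ _ _ _ (fun=> 0) h0) big_ord0 mul0r.
have [|h1 h2] := IH (fun i ir => hc i (ltnW ir)); first by move=> i ir; apply: hf; exact: ltnW.
have -> : span r.+1 c f = fun x => span r c f x + c r x.1 * f r x.
 by apply/funext => x; rewrite /span big_ord_recr.
have h3 := hf r (ltnSn r); have h4 := holomorphicM (hc r (ltnSn r)) h3.
split; first exact: holomorphicD.
by move=> tau; rewrite big_ord_recr /= -h2 /T0 (TjD _ _ _ _ h1 h4) (TjM _ _ _ _ _ h3).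
Qed.

Lemma mform_prod r (k : 'I_r -> int) (f : 'I_r -> H -> C) : (forall i, mform (k i) (f i)) ->
 mform (\sum_i k i) (fun tau => \prod_i f i tau).
Proof.
elim: r k f => [|r IH] k f mf.
 rewrite big_ord0; under eq_fun do rewrite big_ord0; exact: mform_cst.
have -> : (fun tau => \prod_i f i tau) = fun tau => f ord0 tau * \prod_(i < r) f (lift ord0 i) tau.
 by apply/funext => tau; rewrite big_ord_recl.
rewrite big_ord_recl.
by apply: mformM => //; exact: IH.
Qed.

Lemma mform_det r (a b : 'I_r -> int) (A : 'I_r -> 'I_r -> H -> C) :
 (forall l i, mform (a l + b i) (A l i)) ->
 mform (\sum_l a l + \sum_i b i) (fun tau => \det (\matrix_(l, i) A l i tau)).
Proof.
move=> mA; apply: mform_sum => s; apply: mformZ.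
rewrite [\sum_i b i](reindex_inj (@perm_inj _ s)) -big_split.
have -> : (fun tau => \prod_i (\matrix_(l, j) A l j tau) i (s i)) = fun tau => \prod_i A i (s i) tau.
 by apply/funext => tau; apply: eq_bigr => i _; rewrite mxE.
exact: (mform_prod (k := fun i => a i + b (s i)) (f := fun i => A i (s i)) (fun i => mA i (s i))).
Qed.

Lemma mform_cofactor r (a b : 'I_r -> int) (A : 'I_r -> 'I_r -> H -> C) l i :
 (forall l i, mform (a l + b i) (A l i)) ->
 mform (\sum_l a l + \sum_i b i - a l - b i) (fun tau => cofactor (\matrix_(l, i) A l i tau) l i).
Proof.
move=> mA; rewrite (bigD1_ord l) //= [\sum_i0 b i0](bigD1_ord i) //=.
set Sa := \sum_(x < r.-1) a _; set Sb := \sum_(x < r.-1) b _.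
have -> : a l + Sa + (b i + Sb) - a l - b i = Sa + Sb by ring.
apply: mformZ; have -> : (fun tau => \det (row' l (col' i (\matrix_(l, i) A l i tau)))) =
   fun tau => \det (\matrix_(x, y) A (lift l x) (lift i y) tau).
 by apply/funext => tau; congr (\det _); apply/matrixP => x y; rewrite !mxE.
exact: (mform_det (a := fun x => a (lift l x)) (b := fun y => b (lift i y)) (A := fun x y => A (lift l x) (lift i y))).
Qed.

Definition Dm r (v : nat -> 'cV[C]_n) (j : nat -> nat) (f : nat -> jfun R n) tau : C :=
 \det (\matrix_(l < r, i < r) T0 M (v l) (j l) (f i) tau).

Lemma Dm_mform r v (j : nat -> nat) (k : nat -> int) f : fam r k f -> mform (\sum_(l < r) (j l)%:Z + \sum_(i < r) k i) (Dm r v j f).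
Proof.
move=> ff; apply: (mform_det (a := fun l : 'I_r => (j l)%:Z) (b := fun i : 'I_r => k i)
 (A := fun l i tau => T0 M (v l) (j l) (f i) tau)) => l i.
by have [h1 h2] := ff i (ltn_ord i); rewrite addrC; exact: T0_mform.
Qed.

(** Induction on r. If all extensions of a nonzero r-minor by one row were singular, the cofactors
    along that row would give a combination of the f_i with all Taylor coefficients zero, hence a
    relation; its last coefficient is the nonzero minor. *)
Lemma gindep_det r k f : fam r k f -> gindep r k f -> exists v j tau, Dm r v j f tau != 0.
Proof.
elim: r => [|r IH] ff gf.
 have [t0 _] := @inK_ball R; exists (fun=> 0), (fun=> 0%N), t0. by rewrite /Dm det_mx00 oner_neq0.
have [|v [j [t0 D0]]] := IH (fun i ir => ff i (ltnW ir)).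
 move=> w c cc c0 i ir tau.
 pose c' i := if i == r then fun=> 0 else c i.
 have := gf w c' _ _ i (ltnW ir) tau; rewrite /c' (ltn_eqF ir); apply => [i' i'r|x].
  case: eqP => [_|/eqP nr]; first exact: mform0.
  by apply: cc; rewrite ltn_neqAle nr -ltnS.
 rewrite /span big_ord_recr /= eqxx mul0r addr0 -[RHS](c0 x); apply: eq_bigr => i' _.
 by rewrite (ltn_eqF (ltn_ord i')).
apply: contrapT => noD.
(* The new row carries the free direction u and order a; the cofactors along it do not depend on
   them, so one relation serves all u and a. *)
pose vv u l := if l == r then u else v l; pose jj a l := if l == r then a else j l.
have DD u a tau : Dm r.+1 (vv u) (jj a) f tau = 0.
 by apply/eqP/negP => h; apply: noD; exists (vv u), (jj a), tau; apply/negP.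
pose mat tau : 'M[C]_r.+1 := \matrix_(l, i) T0 M (vv 0 l) (jj 0%N l) (f i) tau.
pose c (i : nat) tau : C := cofactor (mat tau) ord_max (inord i).
have cE u a (i : 'I_r.+1) tau :
  cofactor (\matrix_(l, i) T0 M (vv u l) (jj a l) (f i) tau) ord_max i = c i tau.
 rewrite /c inord_val /cofactor; congr (_ * \det _); apply/matrixP => l i'.
 by rewrite !mxE /vv /jj lift_max (ltn_eqF (ltn_ord l)).
pose w : int := \sum_(l < r) (j l)%:Z + \sum_(i < r.+1) k i.
have cc : coefs r.+1 k w c.
 move=> i ir; rewrite /c; have -> : k i = k (inord i : 'I_r.+1) by rewrite inordK.
 have <- : \sum_(l < r.+1) (jj 0%N l)%:Z + \sum_(i < r.+1) k i - (jj 0%N (ord_max : 'I_r.+1))%:Z = w.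
  rewrite big_ord_recr /= addrAC addrK /w; congr (_ + _); apply: eq_bigr => l _.
  by rewrite /jj (ltn_eqF (ltn_ord l)).
 apply: (mform_cofactor (a := fun l : 'I_r.+1 => (jj 0%N l)%:Z) (b := fun i : 'I_r.+1 => k i)
  (A := fun (l i : 'I_r.+1) tau => T0 M (vv 0 l) (jj 0%N l) (f i) tau)) => l i'.
 by have [h1 h2] := ff i' (ltn_ord i'); rewrite addrC; exact: T0_mform.
have hc i : (i < r.+1)%N -> hol (c i) by move=> ir; have [] := cc i ir.
have hf i : (i < r.+1)%N -> holomorphic (f i) by move=> ir; have [[]] := ff i ir.
have c0 x : span r.+1 c f x = 0.
 case: x => tau z; have [hs _] := T0_span 0 0 hc hf.
 apply: (T0_eq0 (MN := M) hs) => u a; have [_ ->] := T0_span u a hc hf.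
 rewrite -[RHS](DD u a tau) /Dm (expand_det_row _ ord_max); apply: eq_bigr => i _.
 by rewrite cE !mxE /vv /jj eqxx mulrC.
have := gf w c cc c0 r (ltnSn r) t0; rewrite /c.
have -> : inord r = ord_max :> 'I_r.+1 by apply/val_inj; rewrite /= inordK.
rewrite /cofactor addnn -signr_odd odd_double expr0 mul1r => /eqP; apply/negP.
move: D0; congr (\det _ != 0); apply/matrixP => l i.
by rewrite !mxE /vv /jj !lift_max (ltn_eqF (ltn_ord l)).
Qed.

Lemma T0_zero u a (g : jfun R n) (t : H) : (forall z, g (t, z) = 0) -> T0 M u a g t = 0.
Proof.
move=> g0; rewrite /T0 /Tj; transitivity (tc (fun=> 0 : C) a); last by rewrite tc_cst mul0r.
by congr (tc _ a); apply/funext => s; rewrite g0 mul0r.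
Qed.

Definition grids : nat := #|{: 'M['I_(gridL R M) * 'I_(gridL R M)]_(n, 1)}|.

(** At a tau where the determinant is nonzero, more functions than grid points would satisfy a
    linear relation on the grid, hence everywhere by [theta_grid], and the matrix of Taylor
    coefficients would be singular. *)
Lemma rank_bound r k f : fam r k f -> gindep r k f -> (r <= grids)%N.
Proof.
move=> ff gf; have [v [j [t0 D0]]] := gindep_det ff gf.
have [t1 tK] := @inK_ball R; have h2 : 0 < (1 / 2 : R) by lra.
have [t tb Dt] := mform_not0_near (Dm_mform v j ff) D0 t1 h2; have {tK tb} kt := tK t tb.
rewrite leqNgt; apply/negP => rg.
pose A : 'M[C]_(r, grids) := \matrix_(i, g) f i (t, gridpt (enum_val g)).
have : kermx A != 0.
 rewrite -mxrank_eq0 mxrank_ker subn_eq0 -ltnNge.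
 exact: leq_ltn_trans (rank_leq_col A) rg.
move=> /rowV0Pn[lam /sub_kermxP lA lam0].
pose c (i : nat) (_ : H) : C := if insub i is Some i0 then lam 0 (i0 : 'I_r) else 0.
have cE (i : 'I_r) tau : c i tau = lam 0 i by rewrite /c valK.
have hc i : (i < r)%N -> hol (c i) by move=> ir; exact: hol_cst.
have hf i : (i < r)%N -> holomorphic (f i) by move=> ir; have [[]] := ff i ir.
have z0 z : span r c f (t, z) = 0.
 have th : theta M t (fun z => \sum_(i < r) lam 0 i * f i (t, z)).
  by apply: theta_sum => i; exact: theta_jform (ff i (ltn_ord i)).1.
 transitivity (\sum_(i < r) lam 0 i * f i (t, z)); first by apply: eq_bigr => i _; rewrite cE.
 apply: (theta_grid kt th) => g; have := congr1 (fun B : 'M[C]_(1, grids) => B 0 (enum_rank g)) lA.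
 rewrite !mxE => h; rewrite -[RHS]h; apply: eq_bigr => i _; rewrite !mxE enum_rankK //.
have lT : lam *m (\matrix_(l < r, i < r) T0 M (v l) (j l) (f i) t)^T = 0.
 apply/rowP => l; rewrite !mxE; have [_ /(_ t)] := T0_span (v l) (j l) hc hf.
 have -> : T0 M (v l) (j l) (span r c f) t = 0.
  exact: T0_zero.
 by move=> /esym h; rewrite -[RHS]h; apply: eq_bigr => i _; rewrite !mxE cE.
move: Dt; rewrite /Dm -det_tr -unitfE -[_ \is a _]/(_ \in unitmx) => u.
by move: lam0; rewrite -(mulmxK u lam) lT mul0mx eqxx.
Qed.

Definition generates r k f := forall w g, wj 0 w g -> exists2 c, coefs r k w c & forall x, g x = span r c f x.

(** A longest family independent modulo (E4, E6) exists by [rank_bound]. By maximality every weak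
    form is a constant combination of it modulo (E4, E6), and induction on the weight treats the two
    remaining factors. *)
Theorem weak_free : exists r k f, [/\ fam r k f, gindep r k f & generates r k f].
Proof.
pose P r := `[< exists k f, fam r k f /\ xyindep r k f >].
have P0 : exists r, P r. by exists 0%N; apply/asboolP; exists (fun=> 0), (fun=> 0); split.
have Pb r : P r -> (r <= grids)%N. by move=> /asboolP[k [f [ff xf]]]; exact: rank_bound ff (xy_gindep ff xf).
have [r /asboolP[k [f [ff xf]]] rmax] := ex_maxnP P0 Pb.
exists r, k, f; split => //; first exact: xy_gindep.
have [L BL kL] := weights_lower r k.
suff gen (m : nat) w g : w < m%:Z - L%:Z -> wj 0 w g ->
  exists2 c, coefs r k w c & forall x, g x = span r c f x.
 by move=> w g; apply: (gen (absz w + L).+1); lia.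
elim: m w g => [|m IH] w g wm wg.
 exists (fun _ _ => 0) => [i _|x]; first exact: mform0.
 have wB : w < - (Bord R M)%:Z by lia. by rewrite (wj_lower wg wB) /span big1 // => i _; rewrite mul0r.
have [al [B [E [al0 wB wE gE]]]] : exists (al : nat -> C) B E, [/\ forall i, (i < r)%N -> al i <> 0 -> k i = w,
  wj 0 (w - 4) B, wj 0 (w - 6) E & forall x, g x = \sum_(i < r) al i * f i x + (E4 x.1 * B x + E6 x.1 * E x)].
 (* Otherwise the family extended by g would still be independent: a relation with nonzero
    coefficient at g could be solved for g. *)
 apply: contrapT => no.
 pose k' i := if i == r then w else k i; pose f' i := if i == r then g else f i.
 have k'E (i : 'I_r) : k' i = k i by rewrite /k' (ltn_eqF (ltn_ord i)).
 have f'E (i : 'I_r) : f' i = f i by rewrite /f' (ltn_eqF (ltn_ord i)).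
 have : P r.+1; last by move=> /rmax; rewrite ltnn.
 apply/asboolP; exists k', f'; split=> [i|w' al B E al0 wB wE aE].
  rewrite ltnS leq_eqVlt /k' /f' => /orP[->//|ir]; rewrite (ltn_eqF ir); exact: ff.
 have h0 x : \sum_(i < r) al i * f i x + al r * g x = E4 x.1 * B x + E6 x.1 * E x.
  rewrite -aE big_ord_recr /= {2}/f' eqxx; congr (_ + _).
  by apply: eq_bigr => i _; rewrite f'E.
 have alr : al r = 0.
  apply/eqP; apply: contrapT => /negP alr; apply: no.
  have w'E : w = w' by have := al0 r (ltnSn r) (elimN eqP alr); rewrite /k' eqxx.
  rewrite -w'E in wB wE.
  exists (fun i => - (al r)^-1 * al i), (fun x => (al r)^-1 * B x), (fun x => (al r)^-1 * E x).
  split; [|exact: wjZ|exact: wjZ|].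
   move=> i ir ai; rewrite w'E -(al0 i (ltnW ir)); first by rewrite /k' (ltn_eqF ir).
   by move=> a0; apply: ai; rewrite a0 mulr0.
  move=> x; have -> : \sum_(i < r) - (al r)^-1 * al i * f i x = - (al r)^-1 * \sum_(i < r) al i * f i x.
   by rewrite mulr_sumr; apply: eq_bigr => i _; rewrite mulrA.
  have {1}-> : g x = (al r)^-1 * (al r * g x) by rewrite mulKf.
  have -> : al r * g x = E4 x.1 * B x + E6 x.1 * E x - \sum_(i < r) al i * f i x by rewrite -h0 addrC addKr.
  by move: (\sum_(i < r) _) (_^-1) => S a; ring.
 move=> i; rewrite ltnS leq_eqVlt => /orP[/eqP ->//|ir].
 apply: (xf w' al B E _ wB wE) => // [i' ir' ai|x].
  by have := al0 i' (ltnW ir') ai; rewrite /k' (ltn_eqF ir').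
 by rewrite -h0 alr mul0r addr0.
have [w1 w2] : w - 4 < m%:Z - L%:Z /\ w - 6 < m%:Z - L%:Z by lia.
have [b cb bE] := IH _ B w1 wB; have [e ce eE] := IH _ E w2 wE.
exists (fun i tau => (al i + E4 tau * b i tau) + E6 tau * e i tau) => [i ir|x].
 have w4 : w - k i = 4 + (w - 4 - k i) by lia.
 have w6 : w - k i = 6 + (w - 6 - k i) by lia.
 apply: mformD; last by rewrite w6; apply: mformM (@E6_mform R) (ce i ir).
 apply: mformD; last by rewrite w4; apply: mformM (@E4_mform R) (cb i ir).
 have [->|ai] := eqVneq (al i) 0; first exact: mform0.
 by rewrite (al0 i ir (elimN eqP ai)) subrr; exact: mform_cst.
rewrite spanD (spanD r (fun i _ => al i) b f (@E4 R)) gE bE eE addrA //.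
Qed.

End Families.

(** * Interchanging Taylor coefficients in two variables *)

Section Swap.
Variable R : realType.
Notation C := R[i].

Lemma nat_small (X e : R) : 0 <= X -> 0 < e -> exists N, forall n, (N <= n)%N -> X / n.+1%:R <= e.
Proof.
move=> X0 e0; exists (Num.bound (X / e)) => n nN.
rewrite ler_pdivrMr ?ltr0n // mulrC -ler_pdivrMr //; apply: ltW.
by apply: lt_le_trans (archi_boundP (divr_ge0 X0 (ltW e0))) _; rewrite ler_nat leqW.
Qed.

(** With x = 1 / (m + 1), this is (g(x) - sum of c_i x^i for i < j) / x^j, which tends to the j-th
    Taylor coefficient when c holds those of g. *)
Definition tquot (g : C -> C) (c : nat -> C) j (m : nat) : C :=
 m.+1%:R ^+ j * (g m.+1%:R^-1 + \sum_(i < j) - (m.+1%:R^-1) ^+ i * c i).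

Lemma big3 (a b : nat) : exists n, [/\ (a <= n)%N, (b <= n)%N & (1 <= n)%N].
Proof. by exists (a + b).+1; split; lia. Qed.

Lemma quot_field (a b x B : R) : a != 0 -> b != 0 -> x != 0 -> a * (4 * B * ((x * a)^-1 / b)) = 4 * B / b / x.
Proof. by move=> a0 b0 x0; field; rewrite a0 b0 x0. Qed.

Lemma tc_quot (g : C -> C) rho (s B : R) j m : cdisc g rho -> 0 < s < rho ->
 (forall w, rn w = s -> rn (g w) <= B) -> m.+1%:R^-1 <= s / 2 ->
 rn (tquot g (tc g) j m - tc g j) <= 4 * B / s ^+ j.+1 / m.+1%:R.
Proof.
move=> gd s0r gB ms; have /andP[s0 _] := s0r; set x : C := m.+1%:R^-1.
have m0 : m.+1%:R != 0 :> C by rewrite pnatr_eq0.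
have xr : rn x = m.+1%:R^-1 by rewrite rnV rn_nat.
have := @tc_rem R g rho s B j.+1 x gd s0r gB; rewrite xr => /(_ ms) h.
have -> : tquot g (tc g) j m - tc g j = m.+1%:R ^+ j * (g x - \sum_(r < j.+1) tc g r * x ^+ r).
 have -> : \sum_(r < j.+1) tc g r * x ^+ r = - (\sum_(i < j) - x ^+ i * tc g i) + tc g j * x ^+ j.
  by rewrite big_ord_recr -sumrN; congr (_ + _); apply: eq_bigr => i _; rewrite mulNr opprK mulrC.
 rewrite /tquot -/x; have : m.+1%:R ^+ j * x ^+ j = 1 by rewrite -exprMn divff // expr1n.
 move: (m.+1%:R ^+ j) (x ^+ j) (\sum_(i < j) _) (tc g j) => a b S t ab.
 by transitivity (a * (g x + S) - t * (a * b)); [rewrite ab mulr1|ring].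
rewrite rnM rnX rn_nat; apply: le_trans (ler_wpM2l _ h) _; first by rewrite exprn_ge0.
have n0 : m.+1%:R != 0 :> R by rewrite pnatr_eq0.
rewrite le_eqVlt; apply/orP; left; apply/eqP.
have sn : s != 0 by rewrite gt_eqF.
rewrite exprMn !exprVn exprS; have : m.+1%:R ^+ j != 0 :> R by rewrite expf_neq0.
have : s ^+ j.+1 != 0 by rewrite expf_neq0.
by move=> b0 a0; exact: quot_field.
Qed.

Variable K : C^o * C^o -> C^o.
Hypothesis Kd : forall p, dff K p.

Lemma swap_r (s : C) (rho : R) : 0 < rho -> cdisc (fun t => K (s, t)) rho.
Proof.
by move=> r0; split=> [//|t _]; dfc K.
Qed.

Lemma swap_l (t : C) (rho : R) : 0 < rho -> cdisc (fun s => K (s, t)) rho.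
Proof.
by move=> r0; split=> [//|s _]; dfc K.
Qed.

Lemma swap_tc_r j (rho : R) : 0 < rho -> cdisc (fun s => tc (fun t => K (s, t)) j) rho.
Proof. by move=> r0; split=> [//|s _]; apply: (tc_joint j ltr01). Qed.

Lemma swap_df (p : C^o * C^o) : dff (fun p : C^o * C^o => K (p.2, p.1)) p.
Proof.
by dfc K.
Qed.

End Swap.

Section Swap2.
Variable R : realType.
Notation C := R[i].
Variable K : C^o * C^o -> C^o.
Hypothesis Kd : forall p, dff K p.

(** Strong induction on j: the inner j-th coefficient is a uniform limit of quotients that involve
    only lower coefficients, and for these the outer coefficient is already known. *)
Lemma tc_swap a j : tc (fun s => tc (fun t => K (s, t)) j) a = tc (fun t => tc (fun s => K (s, t)) a) j.
Proof.
pose psi t := tc (fun s => K (s, t)) a; pose phi i s := tc (fun t => K (s, t)) i.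
have psid : cdisc psi 2 by exact: (swap_tc_r (swap_df Kd)).
have phid i : cdisc (phi i) 1 by exact: swap_tc_r.
rewrite -/psi -[LHS]/(tc (phi j) a).
elim/ltn_ind: j => j IH.
have [|d d0 [B BH]] := @tube_joint R C^o K 0; first by move=> t; exact: Kd.
pose del := Num.min d 1 / 2.
have [del0 deld del1] : [/\ 0 < del, del < d & del < 1].
 have m0 : 0 < Num.min d 1 by rewrite lt_min d0 ltr01.
 have := @ge_min _ R d d 1; have := @ge_min _ R 1 d 1; rewrite !lexx orbT /del => m1 m2.
 by move: (Num.min d 1) m0 m1 m2 => m m0 m1 m2; split; lra.
have s12 : 0 < (1 : R) < 2 by rewrite ltr01 ltr1n.
have [M M0 MH] : exists2 M : R, 0 <= M & forall w, rn w = 1 -> rn (psi w) <= M.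
 by apply: circle_bound => // w w1; apply: contat_df; apply: psid.2; rewrite w1 ltr1n.
have half n : (1 <= n)%N -> (n.+1%:R : R)^-1 <= 1 / 2.
 by move=> n1; rewrite div1r lef_pV2 ?posrE ?ltr0n // ler_nat.
have B0 : 0 <= B.
 apply: le_trans (rn_ge0 _) (BH 0 1 _ _); rewrite ?subrr ?rn0 ?rn1 //.
pose fn n s := tquot (fun t => K (s, t)) (phi^~ s) j n.
have fnd n : cdisc (fn n) 1 /\ tc (fn n) a = tquot psi (tc psi) j n.
 have h1 := swap_l Kd n.+1%:R^-1 (ltr01 : 0 < 1 :> R).
 have h2 (i : 'I_j) : cdisc (fun s => - (n.+1%:R^-1) ^+ i * phi i s) 1.
  exact: cdiscM (cdisc_cst _ ltr01) (phid i).
 have [h3 h4] := cdisc_sum (index_enum 'I_j) ltr01 h2.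
 split; first by apply: cdiscM (cdiscD h1 h3); exact: cdisc_cst.
 rewrite (tcZ _ (cdiscD h1 h3)) (tcD h1 h3) h4 /tquot; congr (_ * (_ + _)).
 by apply: eq_bigr => i _; rewrite (tcZ _ (phid i)) IH.
have lim := @tc_limit R fn (phi j) 1 del a (fun n => (fnd n).1) (phid j).
apply: rn_small_eq => e e0.
have e2 : 0 < e / 2 by rewrite divr_gt0.
have [|||N1 H1] := lim _ _ (e / 2) => //; first by rewrite del0.
 move=> e' e'0; have X0 : 0 <= 4 * B / 1 ^+ j.+1 by rewrite expr1n divr1 mulr_ge0.
 have [N HN] := nat_small X0 e'0.
 exists (maxn N 1) => n w; rewrite geq_max => /andP[nN n1] wd.
  apply: le_trans (HN n nN).
  apply: (tc_quot (g := fun t => K (w, t)) (rho := 2) (s := 1)) => //; last exact: half.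
   exact: swap_r.
  by move=> t t1; apply: BH => //; rewrite subr0 wd.
have X0 : 0 <= 4 * M / 1 ^+ j.+1 by rewrite expr1n divr1 mulr_ge0.
have [N2 H2] := nat_small X0 e2.
have [n [n1 n2 n3]] := big3 N1 N2.
have := H1 n n1; rewrite (fnd n).2 => h1.
have h2 := le_trans (tc_quot j psid s12 MH (half n n3)) (H2 n n2).
have -> : tc (phi j) a - tc psi j = (tquot psi (tc psi) j n - tc psi j) - (tquot psi (tc psi) j n - tc (phi j) a).
 by move: (tquot _ _ _ _) (tc _ _) (tc _ _) => *; ring.
apply: le_trans (rnB _ _) _; move: h1 h2; move: (rn _) (rn _) => x y; lra.
Qed.

End Swap2.

(** * Division of a weak Jacobi form by a modular form with zeros *)

Section Divide.
Variable R : realType.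
Notation C := R[i].
Notation H := (uhp R).
Variables (n : nat) (M : 'M[int]_n).
Let VV : normedModType C := (C^o * 'cV[C]_n)%type.
Implicit Types (tau t : H).

(** Let N be the order of D at tau0. The factor tau - tau0 is divided out N times. *)
Lemma local_divide d (D : H -> C) (G : jfun R n) tau0 tau1 : mform d D -> D tau1 != 0 -> holomorphic G ->
 (forall u a, exists2 b, hol b & forall tau, T0 M u a G tau = D tau * b tau) ->
 exists2 rho : R, 0 < rho & exists K : VV -> C^o, [/\ forall p : VV, rn (p.1 - val tau0) < rho -> dff K p,
    forall p : VV, rn (p.1 - val tau0) < rho -> jext G p = hext D p.1 * K p,
    forall w, 0 < rn (w - val tau0) < rho -> hext D w != 0 & rho <= Im (val tau0)].
Proof.
move=> mD D1 hG TG; have [hD _ _] := mD; have i0 := valP tau0.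
set t0 := val tau0; set r := Im t0 in i0 *.
have inb w : rn (w - t0) < r -> 0 < Im w by exact: Im_ball.
have [||N [e ed [e0 eE]]] := @finite_order R (hext D) t0 r i0.
- by move=> w /inb/uhpP[t <-]; exact: hD.
- have [t tb Dt] := mform_not0_near mD D1 tau0 i0.
 by move=> h; move: Dt; rewrite -hextE h ?eqxx.
have ec : contat e 0 by apply: contat_df; apply: ed.2; rewrite rn0.
have e00 : 0 < rn (e 0) by rewrite rn_gt0.
have [d1 d10 eH] := ec _ e00.
pose rho := Num.min r d1; have rho0 : 0 < rho by rewrite lt_min i0.
have en w : rn w < rho -> e w != 0.
 rewrite lt_min => /andP[_ wd]; apply/eqP => ew; have := eH w; rewrite subr0 ew sub0r rnN ltxx.
 by move=> /(_ wd).
have rr w : rn (w - t0) < rho -> rn (w - t0) < r by rewrite lt_min => /andP[].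
have DE w : rn (w - t0) < rho -> hext D w = (w - t0) ^+ N * e (w - t0).
 by move=> /rr /eE <-; rewrite addrC subrK.
(* If G = (tau - tau0)^s K with s < N, the corrected Taylor coefficients of K along z are (tau -
   tau0)^(N - s) times holomorphic functions near tau0. So they vanish at tau0, K vanishes on the
   slice, and [divide_linear] applies. *)
have step s : (s <= N)%N -> exists2 K : VV -> C^o, forall p : VV, rn (p.1 - t0) < rho -> dff K p &
  forall p : VV, rn (p.1 - t0) < rho -> jext G p = (p.1 - t0) ^+ s * K p.
 elim: s => [_|s IH sN].
  by exists (jext G) => [p /rr/inb|p _]; [exact: hG|rewrite expr0 mul1r].
 have [K Kd KE] := IH (ltnW sN).
 have [z|K' K'd K'E] := @divide_linear R 'cV[C]_n K t0 rho rho0 Kd; last first.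
  by exists K' => // p pr; rewrite KE // K'E exprSr mulrA.
 pose Q := quad M z.
 pose L (q : C^o * C^o) : C^o := K (q.1, q.2 *: z) * cexp (- (hext (@kap R) q.1 * Q * q.2 ^+ 2)).
 have Ld (v t : C^o) : rn (v - (t0 : C^o)) < rho -> dff L (v, t).
  move=> vr; rewrite /L; dfs; first by dfc K; exact: Kd.
  by apply: df_hext; [exact: kap_hol|exact/inb/rr].
 have Lc (v : C) (x : R) : rn (v - t0) < rho -> 0 < x -> cdisc (fun t : C => L (v, t)) x.
  move=> vr x0; split=> [//|t _].
  by dfc L; exact: Ld.
 have tt : rn (t0 - t0) < rho by rewrite subrr rn0.
 have phi0 a : tc (fun t : C => L (t0, t)) a = 0.
  have [b hb bE] := TG z a.
  have := @cont_punct R (fun v => tc (fun t : C => L (v, t)) a)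
    (fun v => (v - t0) ^+ (N - s) * (e (v - t0) * hext b v)) t0 rho rho0.
  rewrite subrr expr0n subn_eq0 leqNgt sN mul0r; apply.
  - by apply: contat_df; exact: (tc_joint a rho0 Ld).
  - apply: contat_df.
   by dfs; [dfc e; apply: ed.2; rewrite subrr rn0|exact: hb].
  move=> w /andP[w0 wr]; have [t tE] := uhpP (inb _ (rr _ wr)).
  have wn : w - t0 != 0 by rewrite -rn_gt0.
  apply: (mulfI (expf_neq0 s wn)); transitivity ((w - t0) ^+ N * e (w - t0) * hext b w).
   2: by rewrite -{1}(subnKC (ltnW sN)) exprD -!mulrA.
  rewrite -DE // -tE !hextE -bE /T0 /Tj /= tE.
  rewrite -[LHS](congr1 (fun F => F a) (tcZ _ (Lc w 1 wr ltr01))); congr (tc _ a); apply/funext => x.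
  rewrite /L /= mulmx0 add0r mulrA -(KE (w, x *: z)) // -tE jextE hextE //.
 have := tc_eq0 (Lc t0 2 tt (ltr0n R 2)) phi0; move=> /(_ 1); rewrite rn1 ltr1n => /(_ isT)/eqP.
 by rewrite /L /= mulf_eq0 (negbTE (cexp_neq0 _)) orbF scale1r => /eqP.
have [K Kd KE] := step N (leqnn N).
exists rho => //; exists (fun p => K p * (e (p.1 - t0))^-1); split.
- by move=> p pr; dfs; [exact: Kd|dfc e; apply: ed.2; exact: rr|exact: en].
- move=> p pr; rewrite KE // DE // -mulrA; congr (_ * _); by rewrite mulrCA divff ?en // mulr1.
- move=> w /andP[w0 wr]; rewrite DE // mulf_neq0 ?en // expf_neq0 //.
 by rewrite -rn_gt0.
- by rewrite ge_min lexx.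
Qed.

End Divide.

Section DivideWeak.
Variable R : realType.
Notation C := R[i].
Notation H := (uhp R).
Notation cdf g w := (dff (g : C^o -> C^o) (w : C^o)).
Variables (n : nat) (M : 'M[int]_n).
Notation wj := (wj (R := R) M).
Let VV : normedModType C := (C^o * 'cV[C]_n)%type.
Implicit Types (tau : H).

(** Zeros of D are isolated, so identities that hold off them extend by continuity. *)
Lemma generic_eq d (D : H -> C) tau1 (u v : H -> C) tau0 : mform d D -> D tau1 != 0 ->
 contat (hext u) (val tau0) -> contat (hext v) (val tau0) -> (forall t, D t != 0 -> u t = v t) -> u tau0 = v tau0.
Proof.
move=> mD D1 cu cv uv; have [hD _ _] := mD; have i0 := valP tau0.
have [||e e0 eH] := @isolated_zero R (hext D) (val tau0) _ i0.
- by move=> w /Im_ball/uhpP[t <-]; exact: hD.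
- have [t tb Dt] := mform_not0_near mD D1 tau0 i0.
 by move=> h; move: Dt; rewrite -hextE h ?eqxx.
have m0 : 0 < Num.min e (Im (val tau0)) by rewrite lt_min e0.
rewrite -[LHS]hextE -[RHS]hextE; apply: (cont_punct m0 cu cv) => w /andP[w0].
rewrite lt_min => /andP[w1 /Im_ball/uhpP[t tE]]; rewrite -tE !hextE uv // -hextE tE.
by apply: eH; rewrite w0.
Qed.

Lemma contat_hol (u : H -> C) tau : hol u -> contat (hext u) (val tau).
Proof. by move=> hu; apply: contat_df; exact: hu. Qed.

(** Continuity in tau of a form whose arguments both move with tau, as on the left-hand sides of the
    transformation laws. *)
Lemma hol_path (h : jfun R n) (phi : H -> H) (psi : H -> 'cV[C]_n) tau0 : holomorphic h ->
 contat (hext (fun t => val (phi t))) (val tau0) ->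
 (forall e : R, 0 < e -> exists2 d : R, 0 < d & forall t : H, rn (val t - val tau0) < d -> rn (psi t - psi tau0) < e) ->
 contat (hext (fun t => h (phi t, psi t))) (val tau0).
Proof.
move=> hh cphi cpsi e e0.
have /differentiable_continuous/continuous_rnP/(_ e e0)[d d0 dH] := hh (val (phi tau0), psi tau0) (valP (phi tau0)).
have [d1 d10 H1] := cphi d d0; have [d2 d20 H2] := cpsi d d0.
exists (Num.min (Im (val tau0)) (Num.min d1 d2)).
 by rewrite !lt_min d10 d20; have := valP tau0 => ->.
move=> v; rewrite !lt_min => /and3P[/Im_ball/uhpP[t tE] v1 v2].
have := H1 v v1; have := H2 t; rewrite -tE !hextE tE => /(_ v2) h2 h1.
have := dH (val (phi t), psi t); rewrite rn_pair /= gt_max h1 h2 !jextE; exact.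
Qed.

Lemma df_expz (V : normedModType C) (f : V -> C^o) p (k : int) : dff f p -> f p != 0 ->
 dff (fun v => f v ^ k : C^o) p.
Proof.
move=> df f0; case: k => m; first exact: dfX.
by rewrite /exprz; dfs => //; exact: expf_neq0.
Qed.

Lemma T0_hol u a (f : jfun R n) : holomorphic f -> hol (T0 M u a f).
Proof. by move=> hf; exact: (hol_tau 0 (Tj_hol _ _ _ _ hf)). Qed.

Lemma jfactor_df (c d : int) (w : C^o) : dff (fun w : C^o => c%:~R * w + d%:~R : C^o) w.
Proof. by dfs. Qed.

Lemma contat_mul (u v : H -> C) tau : contat (hext u) (val tau) -> contat (hext v) (val tau) ->
 contat (hext (fun t => u t * v t)) (val tau).
Proof. by move=> cu cv; rewrite hextM; exact: contatM. Qed.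

Lemma psum_half_le (b : nat -> C) (B : R) l : (forall r, rn (b r) <= B) -> psum b (1 / 2) l -> rn l <= 2 * B.
Proof.
move=> bB bl; have B0 : 0 <= B by exact: le_trans (rn_ge0 _) (bB 0%N).
have h12 : rn (1 / 2 : C) = 1 / 2 by rewrite rnM rnV rn1 rn_nat.
apply: (@limit_le R (fun m => \sum_(r < m) b r * (1 / 2) ^+ r)).
 by move=> e e0; have [N NH] := bl e e0; exists N => m /NH/ltW.
exists 0%N => m _; apply: le_trans (rn_sum _ _ _) _.
have t01 : 0 <= (1 / 2 : R) < 1 by lra.
have := geom_sum_le t01 (leq0n m); rewrite expr0 big_mkord => h.
apply: le_trans (_ : B * (\sum_(i < m) (1 / 2) ^+ i) <= _).
 by rewrite mulr_sumr; apply: ler_sum => i _; rewrite rnM rnX h12 ler_wpM2r ?exprn_ge0 ?(andP t01).1 //; lra.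
have h' : 1 / (1 - 1 / 2) = 2 :> R by field.
by apply: le_trans (ler_wpM2l B0 h) _; rewrite h' mulrC.
Qed.

Lemma gauss_le (k Q t : C) (B : R) : rn k <= B -> rn t <= 1 -> rn (cexp (- (k * Q * t ^+ 2))) <= expR (B * rn Q).
Proof.
move=> kB t1; rewrite rn_cexp ler_expR; apply: le_trans (ler_norm _) _; apply: le_trans (Re_le_rn _) _.
rewrite rnN (rnM (k * Q)) (rnM k) rnX -[leRHS]mulr1.
by apply: ler_pM; rewrite ?mulr_ge0 ?exprn_ge0 ?rn_ge0 ?exprn_ile1 ?rn_ge0 // ler_wpM2r ?rn_ge0.
Qed.

(** A priori h has a pole of order p at the cusp. On a fixed horizontal line Cauchy's estimate
    bounds its corrected Taylor coefficients uniformly in their order; being modular forms they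
    satisfy the same bound above that line. Summing the series bounds h. *)
Lemma bounded_of_taylor k p (h : jfun R n) : holomorphic h -> jper h -> jb p h ->
 (forall u a, mform (k + a%:Z) (T0 M u a h)) -> jb 0 h.
Proof.
(* With u = 2 z the value at z is reached at t = 1 / 2, inside the unit circle used for the
   estimate. *)
move=> hh ph bh mh z; pose u := 2 *: z; pose Q := quad M u.
have [B HB] := jb_unif 0 u hh ph bh.
have [Y0 [B0 [Y01 B00 HK]]] := cuspbW (@kap_cusp R).
have HKr tau : Y0 <= Im (val tau) -> rn (kap tau) <= B0 by move=> /HK; rewrite expr0 mulr1.
pose y1 := Num.max 2 Y0.
have y12 : 2 <= y1 by rewrite le_max lexx.
have y1Y : Y0 <= y1 by rewrite le_max lexx orbT.
pose Mx := B * expR (2 * pi * y1) ^+ p * expR (B0 * rn Q).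
have Tb tau a : Im (val tau) = y1 -> rn (T0 M u a h tau) <= 2 * Mx.
 move=> ty; have s12 : 0 < (1 : R) < 2 by rewrite ltr01 ltr1n.
 have := @tc_le R _ 2 1 Mx a (Tj_disc Q (0 : 'M[C]_(n, 0)) u tau 0 (ltr0n R 2) hh) s12.
 rewrite expr1n mulr1; apply.
 move=> t t1; rewrite rnM /Mx; apply: ler_pM; rewrite ?rn_ge0 //; last first.
  by apply: gauss_le; [apply: HKr; rewrite ty|rewrite t1].
 have := HB tau t _ t1; rewrite ty => /(_ _); rewrite rnM rnX rn_ee ty mulmx0.
 have y1gt : 1 < y1 by apply: lt_le_trans y12; rewrite ltr1n.
 move=> /(_ y1gt); rewrite expRN exprVn => h1.
 by rewrite -ler_pdivrMr ?exprn_gt0 ?expR_gt0 // mulrC.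
have Tall tau a : y1 < Im (val tau) -> rn (T0 M u a h tau) <= 2 * Mx.
 move=> ty; rewrite -hextE; have mf := mh u a; have [hf lf _] := mf.
 have y10 : 0 < y1 by apply: lt_le_trans y12; rewrite ltr0n.
 apply: (maxmod (Y0 := 0) (y1 := y1)) => //.
 - by move=> w /uhpP[t <-]; exact: hf.
 - by move=> w; exact: hext_per lf.
 - by have [Y [B' [_ _ h']]] := cuspb_hext mf; exists Y, B'.
 - move=> x _; have [|t tE] := @uhpP R (x +i* y1); first exact: y10.
  by rewrite -tE hextE; apply: Tb; rewrite tE.
exists (y1 + 1), (2 * (2 * Mx) * expR (B0 * rn Q)) => tau ty; rewrite expr0 mul1r.
have ty1 : y1 < Im (val tau) by apply: lt_le_trans ty; rewrite ltrDl.
pose F t := h (tau, (0 : 'M[C]_(n, 0)) *m 0 + t *: u) * cexp (- (kap tau * Q * t ^+ 2)).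
have h2 : rn (1 / 2 : C) = 1 / 2 by rewrite rnM rnV rn1 rn_nat.
have Fd : cdisc F 1 by exact: Tj_disc.
have h21 : rn (1 / 2 : C) < 1 by rewrite h2; lra.
have ps := (tcP Fd).2 _ h21.
have Fb := psum_half_le (fun a => Tall tau a ty1) ps.
have -> : h (tau, z) = F (1 / 2) * cexp (- (- kap tau * Q * (1 / 2) ^+ 2)).
 rewrite /F -mulrA -cexpD !mulNr opprK addNr cexp0 mulr1 mulmx0 add0r /u scalerA div1r mulVf ?scale1r //.
rewrite rnM; apply: ler_pM; rewrite ?rn_ge0 //; apply: gauss_le; last by rewrite h2; lra.
by rewrite rnN; apply: HKr; apply: le_trans y1Y (ltW ty1).
Qed.

Theorem divide_weak d w (D : H -> C) (G : jfun R n) tau1 : mform d D -> D tau1 != 0 -> wj 0 w G ->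
 (forall u a, exists2 b, mform (w - d + a%:Z) b & forall tau, T0 M u a G tau = D tau * b tau) ->
 exists2 h, wj 0 (w - d) h & forall x, G x = D x.1 * h x.
Proof.
move=> mD D1 [[hG mG eG] bG] TG; have [hD lD _] := mD.
have TG' u a : exists2 b, hol b & forall tau, T0 M u a G tau = D tau * b tau.
 by have [b [hb _ _] bE] := TG u a; exists b.
have /choice[Kr KP] tau0 : exists Kr : (VV -> C^o) * R, 0 < Kr.2 /\
  [/\ forall p : VV, rn (p.1 - val tau0) < Kr.2 -> dff Kr.1 p,
    forall p : VV, rn (p.1 - val tau0) < Kr.2 -> jext G p = hext D p.1 * Kr.1 p,
    forall w, 0 < rn (w - val tau0) < Kr.2 -> hext D w != 0 & Kr.2 <= Im (val tau0)].
 by have [rho r0 [K KH]] := local_divide tau0 mD D1 hG TG'; exists (K, rho).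
(* At tau the local quotient centred at tau itself is used. Near a point tau0 these values agree
   with the quotient centred at tau0, since off its centre D does not vanish and both equal G /
   D. *)
pose h : jfun R n := fun x => (Kr x.1).1 (val x.1, x.2).
have Gh x : G x = D x.1 * h x.
 case: x => tau z; have [r0 [_ KE _ _]] := KP tau.
 by have := KE (val tau, z); rewrite subrr rn0 jextE hextE; exact.
have hh : holomorphic h.
 move=> [p1 z] /= p0; have [tau0 <-] := uhpP p0; have [r0 [Kd KE Kn rI]] := KP tau0.
 apply: (differentiable_local (f := (Kr tau0).1) r0); last by apply: Kd; rewrite subrr rn0.
 move=> v vr; have v1 := le_lt_trans (rn_fst_le (v - (val tau0, z))) vr.
 have [t tE] := uhpP (Im_ball (lt_le_trans v1 rI)).
 rewrite /jext -tE valK /h /=; have [tt|tn] := eqVneq (val t) (val tau0).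
  have -> : t = tau0 by exact: val_inj. by congr (_ _); rewrite [LHS]surjective_pairing -tE tt.
 have Dt : D t != 0. by rewrite -hextE; apply: Kn; rewrite rn_gt0 subr_eq0 tn tE.
 apply: (mulfI Dt); have := KE v v1; rewrite [in LHS](surjective_pairing v) -tE jextE hextE => <-.
 by rewrite Gh.
have mh : modular_law (w - d) M h.
 move=> a b c d' abcd tau0 z.
 pose E t := jfactor c d' t ^ (w - d) * cexp (twopii R * c%:~R * quad M z / jfactor c d' t).
 have j0 := jfactor_neq0 tau0 abcd.
 have jd := jfactor_df c d' (val tau0 : C^o).
 have jVd : cdf (fun w : C => (c%:~R * w + d'%:~R)^-1) (val tau0).
  by dfs.
 apply: (generic_eq (u := fun t => h (mobius abcd t, (jfactor c d' t)^-1 *: z))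
  (v := fun t => E t * h (t, z)) mD D1).
 - apply: hol_path => //.
   apply: contat_df; apply: (hext_df (G := fun w => (a%:~R * w + b%:~R) / (c%:~R * w + d'%:~R))) => [//|].
   by dfs.
  move=> e e0; have z1 : 0 < rn z + 1 by rewrite ltr_wpDl ?rn_ge0.
  have [x x0 xH] := contat_df jVd (divr_gt0 e0 z1); exists x => // t /xH.
  rewrite -scalerBl rnZ /jfactor; rewrite ltr_pdivlMr //; apply: le_lt_trans.
  by rewrite ler_wpM2l ?rn_ge0 // lerDl.
 - apply: contat_mul; last by apply: contat_hol; exact: hol_tau.
  apply: contat_df; apply: (hext_df (G := fun x => (c%:~R * x + d'%:~R) ^ (w - d) *
    cexp (twopii R * c%:~R * quad M z / (c%:~R * x + d'%:~R)))) => [//|].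
  by dfs; [exact: (df_expz _ jd)|exact: j0].
 - by move=> t Dt; exact: div_modular lD mG Gh Dt.
have eh : elliptic_law M h.
 move=> l m tau0 z l' m'.
 pose E (t : H) := (-1) ^ (quad2 M l + quad2 M m) * cexp (- (twopii R * val t * quad M l')
      - twopii R * (l'^T *m map_mx intr M *m z) 0 0).
 apply: (generic_eq (u := fun t => h (t, z + val t *: l' + m')) (v := fun t => E t * h (t, z)) mD D1).
 - apply: hol_path => //.
   by apply: contat_df; apply: (hext_df (G := fun w => w)) => [//|]; exact: dfid.
  move=> e e0; have z1 : 0 < rn l' + 1 by rewrite ltr_wpDl ?rn_ge0.
  exists (e / (rn l' + 1)) => [|t]; first exact: divr_gt0.
  have -> : z + val t *: l' + m' - (z + val tau0 *: l' + m') = (val t - val tau0) *: l'.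
   by rewrite scalerBl opprD addrACA subrr addr0 opprD addrACA subrr add0r.
  rewrite rnZ ltr_pdivlMr //; apply: le_lt_trans.
  by rewrite ler_wpM2l ?rn_ge0 // lerDl.
 - apply: contat_mul; last by apply: contat_hol; exact: hol_tau.
  apply: contat_df; apply: (hext_df (G := fun x => (-1) ^ (quad2 M l + quad2 M m) *
    cexp (- (twopii R * x * quad M l') - twopii R * (l'^T *m map_mx intr M *m z) 0 0))) => [//|].
  by dfs.
 - by move=> t Dt; exact: div_elliptic eG Gh Dt.
exists h => //; split; first by split.
(* The order of D at the cusp bounds the a priori pole of G / D there. *)
have [p [c c0 [Y YH]]] := mform_order mD D1.
apply: (bounded_of_taylor (k := w - d) (p := p)) => //; first exact: modular_per mh.
 move=> z; have [Y' [B HB]] := bG z; exists (Num.max Y Y'), (B / c) => tau.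
 rewrite ge_max => /andP[/YH h1 /HB]; rewrite expr0 mul1r Gh rnM rnM rnX /= => h3.
 rewrite ler_pdivlMr //; apply: le_trans h3; rewrite mulrAC ler_wpM2r ?rn_ge0 // mulrC //.
move=> u a; have [b mb bE] := TG u a; have [hb _ _] := mb.
have -> : T0 M u a h = b; last exact: mb.
apply/funext => tau0; apply: (generic_eq (u := T0 M u a h) mD D1).
- by apply: contat_hol; exact: T0_hol.
- exact: contat_hol.
move=> t Dt; apply: (mulfI Dt); rewrite -bE.
have -> : G = fun x => D x.1 * h x by apply/funext.
by rewrite /T0 (TjM _ _ _ _ D hh).
Qed.

End DivideWeak.

(** * Products of Jacobi forms and forms of block-diagonal index *)

Lemma bilin_block (S : comPzRingType) (n1 n2 a b : nat) (A : 'M[S]_n1) (B : 'M[S]_n2)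
  (l : 'M[S]_(n1 + n2, a)) (z : 'M[S]_(n1 + n2, b)) : l^T *m block_mx A 0 0 B *m z =
 (usubmx l)^T *m A *m usubmx z + (dsubmx l)^T *m B *m dsubmx z.
Proof.
rewrite -{1}[l]vsubmxK -{1}[z]vsubmxK tr_col_mx mul_row_block mul_row_col.
by rewrite !mulmx0 addr0 add0r.
Qed.

Lemma quad0 (R : realType) n (M : 'M[int]_n) : quad M (0 : 'cV[R[i]]_n) = 0.
Proof. by rewrite /quad mulmx0 mxE mulr0. Qed.

Lemma dp_ring (S : comPzRingType) (s1 s2 e1 e2 x y : S) :
 s1 * e1 * x * (s2 * e2 * y) = s1 * s2 * (e1 * e2) * (x * y).
Proof. ring. Qed.

Section Products.
Variable R : realType.
Notation C := R[i].
Notation H := (uhp R).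
Variables (n1 n2 : nat) (M1 : 'M[int]_n1) (M2 : 'M[int]_n2).
Let MM : 'M[int]_(n1 + n2) := block_mx M1 0 0 M2.
Implicit Types (tau : H).

Lemma map_block : map_mx intr MM = block_mx (map_mx intr M1) 0 0 (map_mx intr M2) :> 'M[C]_(n1 + n2).
Proof. by rewrite map_block_mx !map_mx0. Qed.

Lemma quad_block (z : 'cV[C]_(n1 + n2)) : quad MM z = quad M1 (usubmx z) + quad M2 (dsubmx z).
Proof. by rewrite /quad map_block bilin_block mxE mulrDr. Qed.

Lemma quad2_block (l : 'cV[int]_(n1 + n2)) : quad2 MM l = quad2 M1 (usubmx l) + quad2 M2 (dsubmx l).
Proof. by rewrite /quad2 bilin_block mxE. Qed.

Lemma rn_usubmx (z : 'cV[C]_(n1 + n2)) : rn (usubmx z) <= rn z.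
Proof. by apply: rn_mx_le => [|i j]; rewrite ?rn_ge0 // mxE rn_entry. Qed.

Lemma rn_dsubmx (z : 'cV[C]_(n1 + n2)) : rn (dsubmx z) <= rn z.
Proof. by apply: rn_mx_le => [|i j]; rewrite ?rn_ge0 // mxE rn_entry. Qed.

Lemma holomorphic_pull N (L : 'cV[C]_(n1 + n2) -> 'cV[C]_N) (f : jfun R N) :
 linear L -> (forall z, rn (L z) <= rn z) -> holomorphic f ->
 forall p : (C^o * 'cV[C]_(n1 + n2))%type : normedModType C, 0 < Im (p.1 : C) ->
 dff (fun p : C^o * 'cV[C]_(n1 + n2) => jext f (p.1, L p.2)) p.
Proof.
move=> lL rL hf p p0.
dfc (jext f); last exact: hf.
by dfc L; apply: (df_lin (K := 1)) => // v; rewrite mul1r.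
Qed.

Lemma dp_holomorphic f g : holomorphic f -> holomorphic g -> holomorphic (dprd f g : jfun R (n1 + n2)).
Proof.
move=> hf hg p p0.
have -> : jext (dprd f g : jfun R (n1 + n2)) = fun p => jext f (p.1, usubmx p.2) * jext g (p.1, dsubmx p.2).
 by apply/funext => q; rewrite /jext /=; case: insub => [t|]; rewrite ?mul0r.
dfs.
 by apply: holomorphic_pull => //; [move=> a x y; rewrite linearP|exact: rn_usubmx].
by apply: holomorphic_pull => //; [move=> a x y; rewrite linearP|exact: rn_dsubmx].
Qed.

Lemma dp_wj m1 m2 k1 k2 (f : jfun R n1) (g : jfun R n2) : wj M1 m1 k1 f -> wj M2 m2 k2 g -> wj MM (m1 + m2) (k1 + k2) (dprd f g).
Proof.
move=> [[hf mf ef] bf] [[hg mg eg] bg]; split; first split.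
- exact: dp_holomorphic.
- move=> a b c d abcd tau z; rewrite /dprd /= !linearZ /= mf mg quad_block.
 rewrite expfzDr ?(jfactor_neq0 tau abcd) //.
 set X := twopii R * c%:~R; have -> : X * (quad M1 (usubmx z) + quad M2 (dsubmx z)) / jfactor c d tau =
   X * quad M1 (usubmx z) / jfactor c d tau + X * quad M2 (dsubmx z) / jfactor c d tau by rewrite mulrDr mulrDl.
 rewrite cexpD; move: (cexp _) (cexp _) (_ ^ k1) (_ ^ k2) => *; ring.
- move=> l m tau z l' m'; rewrite /dprd /=.
 have E1 : usubmx (z + sval tau *: l' + m') = usubmx z + sval tau *: map_mx intr (usubmx l) + map_mx intr (usubmx m).
  by rewrite !linearD linearZ /l' /m' /= !map_usubmx.
 have E2 : dsubmx (z + sval tau *: l' + m') = dsubmx z + sval tau *: map_mx intr (dsubmx l) + map_mx intr (dsubmx m).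
  by rewrite !linearD linearZ /l' /m' /= !map_dsubmx.
 have E3 : quad MM l' = quad M1 (map_mx intr (usubmx l)) + quad M2 (map_mx intr (dsubmx l)).
  by rewrite quad_block /l' map_usubmx map_dsubmx.
 have E4 : (l'^T *m map_mx intr MM *m z) 0 0 = ((map_mx intr (usubmx l))^T *m map_mx intr M1 *m usubmx z) 0 0 +
   ((map_mx intr (dsubmx l))^T *m map_mx intr M2 *m dsubmx z) 0 0.
  by rewrite map_block bilin_block /l' -map_usubmx -map_dsubmx mxE.
 rewrite E1 E2 E3 E4 ef eg !quad2_block.
 have -> : quad2 M1 (usubmx l) + quad2 M2 (dsubmx l) + (quad2 M1 (usubmx m) + quad2 M2 (dsubmx m)) =
  (quad2 M1 (usubmx l) + quad2 M1 (usubmx m)) + (quad2 M2 (dsubmx l) + quad2 M2 (dsubmx m)) by rewrite addrACA.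
 have n0 : -1 != 0 :> C by rewrite oppr_eq0 oner_eq0.
 rewrite (expfzDr (quad2 M1 (usubmx l) + quad2 M1 (usubmx m)) (quad2 M2 (dsubmx l) + quad2 M2 (dsubmx m)) n0).
 set A1 := quad M1 _; set A2 := quad M2 _; set B1 := (_ *m usubmx z) 0 0; set B2 := (_ *m dsubmx z) 0 0.
 set T := twopii R; have -> : - (T * val tau * (A1 + A2)) - T * (B1 + B2) =
  (- (T * val tau * A1) - T * B1) + (- (T * val tau * A2) - T * B2) by move: (val tau) => t; ring.
 rewrite (cexpD (- (T * val tau * A1) - T * B1)); exact: dp_ring.
- move=> z; have [Y [B HB]] := bf (usubmx z); have [Y' [B' HB']] := bg (dsubmx z).
 exists (Num.max Y Y'), (B * B') => tau; rewrite ge_max => /andP[/HB h1 /HB' h2].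
 rewrite exprD /dprd /= mulrACA rnM; apply: ler_pM; rewrite ?rn_ge0 //.
Qed.

Definition A1 : 'M[C]_(n1 + n2, n1) := map_mx intr (col_mx 1%:M 0 : 'M[int]_(n1 + n2, n1)).
Definition A2 : 'M[C]_(n1 + n2, n2) := map_mx intr (col_mx 0 1%:M : 'M[int]_(n1 + n2, n2)).

Lemma A1E : A1 = col_mx 1%:M 0.
Proof. by rewrite /A1 map_col_mx map_mx1 map_mx0. Qed.
Lemma A2E : A2 = col_mx 0 1%:M.
Proof. by rewrite /A2 map_col_mx map_mx1 map_mx0. Qed.

(** Taylor coefficients in the first block of variables, which leave weak forms of index M2; [T2]
    exchanges the roles. The blocks are orthogonal, as [Tj_weak] requires. *)
Definition T1 (v : 'cV[C]_n1) j (F : jfun R (n1 + n2)) : jfun R n2 := Tj (quad M1 v) A2 (col_mx v 0) j F.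
Definition T2 (u : 'cV[C]_n2) a (F : jfun R (n1 + n2)) : jfun R n1 := Tj (quad M2 u) A1 (col_mx 0 u) a F.

Lemma T1_wj v j k F : wj MM 0 k F -> wj M2 0 (k + j%:Z) (T1 v j F).
Proof.
move=> [jF bF]; have Q : quad M1 v = quad MM (col_mx v 0).
 by rewrite quad_block col_mxKu col_mxKd quad0 addr0.
rewrite /T1 Q; apply: Tj_weak => //.
- by rewrite /MM bilin_block !col_mxKu !col_mxKd !mulmx0 add0r trmx1 mul1mx mulmx1.
- by rewrite -/A2 A2E map_block bilin_block !col_mxKu !col_mxKd !mulmx0 trmx0 !mul0mx addr0.
- by rewrite -/A2 A2E map_block bilin_block !col_mxKu !col_mxKd !mulmx0 trmx0 !mul0mx addr0.
Qed.

Lemma T2_wj u a k F : wj MM 0 k F -> wj M1 0 (k + a%:Z) (T2 u a F).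
Proof.
move=> [jF bF]; have Q : quad M2 u = quad MM (col_mx 0 u).
 by rewrite quad_block col_mxKu col_mxKd quad0 add0r.
rewrite /T2 Q; apply: Tj_weak => //.
- by rewrite /MM bilin_block !col_mxKu !col_mxKd !mulmx0 addr0 trmx1 mul1mx mulmx1.
- by rewrite -/A1 A1E map_block bilin_block !col_mxKu !col_mxKd !mulmx0 trmx0 !mul0mx addr0.
- by rewrite -/A1 A1E map_block bilin_block !col_mxKu !col_mxKd !mulmx0 trmx0 !mul0mx addr0.
Qed.

Lemma A1v (z : 'cV[C]_n1) (u : 'cV[C]_n2) (t : C) : A1 *m z + t *: col_mx 0 u = col_mx z (t *: u).
Proof. by rewrite A1E mul_col_mx mul1mx mul0mx scale_col_mx scaler0 add_col_mx addr0 add0r. Qed.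
Lemma A2v (z : 'cV[C]_n2) (u : 'cV[C]_n1) (t : C) : A2 *m z + t *: col_mx u 0 = col_mx (t *: u) z.
Proof. by rewrite A2E mul_col_mx mul1mx mul0mx scale_col_mx scaler0 add_col_mx addr0 add0r. Qed.

Lemma T_swap v j u a F tau : holomorphic F -> T0 M2 u a (T1 v j F) tau = T0 M1 v j (T2 u a F) tau.
Proof.
move=> hF; pose e1 t := cexp (- (kap tau * quad M1 v * t ^+ 2)); pose e2 s := cexp (- (kap tau * quad M2 u * s ^+ 2)).
pose K (q : C^o * C^o) : C^o := F (tau, col_mx (q.2 *: v) (q.1 *: u)) * (e1 q.2 * e2 q.1).
have Kd p : dff K p.
 have -> : K = fun q => jext F (val tau, q.2 *: col_mx v 0 + q.1 *: col_mx 0 u) * (e1 q.2 * e2 q.1).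
  by apply/funext => q; rewrite jextE !scale_col_mx !scaler0 add_col_mx addr0 add0r.
 by rewrite /e1 /e2; dfs; dfc (jext F); apply: hF; exact: (valP tau).
transitivity (tc (fun s => tc (fun t => K (s, t)) j) a).
 rewrite /T0 /Tj /=; congr (tc _ a); apply/funext => s; rewrite /T1 /Tj /= mulrC -/(e2 s).
 rewrite -[LHS](congr1 (fun F => F j) (tcZ _ (Tj_disc _ _ _ tau _ ltr01 hF))).
 by congr (tc _ j); apply/funext => t; rewrite A2v mulmx0 add0r /K /= -/(e1 t); move: (e1 t) (e2 s) (F _) => *; ring.
rewrite (tc_swap Kd); rewrite /T0 /Tj /=; congr (tc _ j); apply/funext => t; rewrite /T2 /Tj /= [RHS]mulrC -/(e1 t).
rewrite -[RHS](congr1 (fun F => F a) (tcZ _ (Tj_disc _ _ _ tau _ ltr01 hF))).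
by congr (tc _ a); apply/funext => s; rewrite A1v mulmx0 add0r /K /= -/(e2 s); move: (e1 t) (e2 s) (F _) => *; ring.
Qed.

Lemma tc_inj (g h : C -> C) rho w : cdisc g rho -> cdisc h rho -> tc g = tc h -> rn w < rho -> g w = h w.
Proof.
move=> gd hd e wr; have := (tcP gd).2 w wr; rewrite e => h1; exact: psum_unique h1 ((tcP hd).2 w wr).
Qed.

(** Cramer's combinations G i of the forms [T1F l] have Taylor coefficients D b_i, where b_i are the
    coefficients of [T2 u a F] in the basis f; this uses that mixed Taylor coefficients commute. So
    [divide_weak] yields h i with G i = D h i. *)
Theorem product_generated r k f w F : fam M1 r k f -> gindep r k f -> generates M1 r k f -> wj MM 0 w F ->
 exists2 h : nat -> jfun R n2, forall i, (i < r)%N -> wj M2 0 (w - k i) (h i) &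
  forall x, F x = \sum_(i < r) dprd (f i) (h i) x.
Proof.
move=> ff gf genf wF; have [v [j [t1 D1]]] := gindep_det ff gf.
have [[hF _ _] _] := wF; pose W : int := \sum_(l < r) (j l)%:Z + \sum_(i < r) k i.
have mD : mform W (Dm M1 r v j f) := Dm_mform v j ff.
pose mat tau : 'M[C]_r := \matrix_(l, i) T0 M1 (v l) (j l) (f i) tau.
pose T1F (l : nat) := T1 (v l) (j l) F.
pose c (i : 'I_r) (l : nat) tau : C := if insub l is Some l0 then \adj (mat tau) i l0 else 0.
pose G i := span r (c i) T1F.
have mc (i : 'I_r) l : (l < r)%N -> mform (W - (j l)%:Z - k i) (c i l).
 move=> lr; rewrite /c insubT; under eq_fun do rewrite mxE.
 apply: (mform_cofactor (a := fun l : 'I_r => (j l)%:Z) (b := fun i : 'I_r => k i)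
   (A := fun (l i : 'I_r) tau => T0 M1 (v l) (j l) (f i) tau) (Sub l lr) i) => l' i'.
 by have [h1 h2] := ff i' (ltn_ord i'); rewrite addrC; exact: T0_mform.
have wT l : wj M2 0 (w + (j l)%:Z) (T1F l) by exact: T1_wj.
have wG (i : 'I_r) : wj M2 0 (W + w - k i) (G i).
 apply: (wj_sum (F := fun l x => c i l x.1 * T1F l x)) => l lr.
 have -> : W + w - k i = (W - (j l)%:Z - k i) + (w + (j l)%:Z) by ring.
 exact: wjM (mc i l lr) (wT l).
have hT l : (l < r)%N -> holomorphic (T1F l) by move=> _; have [[]] := wT l.
have hc (i : 'I_r) l : (l < r)%N -> hol (c i l) by move=> lr; have [] := mc i l lr.
have hf i : (i < r)%N -> holomorphic (f i) by move=> ir; have [[]] := ff i ir.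
have TG u a (b : nat -> H -> C) : coefs r k (w + a%:Z) b -> (forall x, T2 u a F x = span r b f x) ->
  forall (i : 'I_r) tau, T0 M2 u a (G i) tau = Dm M1 r v j f tau * b i tau.
 move=> cb bE i tau; have [_ ->] := T0_span M2 u a (hc i) hT.
 have hb i' : (i' < r)%N -> hol (b i') by move=> ir; have [] := cb i' ir.
 have E (l : 'I_r) : T0 M2 u a (T1F l) tau = (mat tau *m \col_i b i tau) l 0.
  rewrite T_swap // (_ : T2 u a F = span r b f); last exact/funext.
  have [_ ->] := T0_span M1 (v l) (j l) hb hf; rewrite mxE; apply: eq_bigr => i' _. by rewrite !mxE mulrC.
 transitivity ((\adj (mat tau) *m (mat tau *m \col_i b i tau)) i 0).
  by rewrite [RHS]mxE; apply: eq_bigr => l _; rewrite E /c valK.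
 by rewrite mulmxA mul_adj_mx mul_scalar_mx !mxE.
have gT2 u a : exists2 b, coefs r k (w + a%:Z) b & forall x, T2 u a F x = span r b f x.
 exact: genf (T2_wj u a wF).
have /choice[h hP] i : exists h : jfun R n2, forall ir : (i < r)%N,
  wj M2 0 (w - k i) h /\ forall x, G (Sub i ir) x = Dm M1 r v j f x.1 * h x.
 have [ir|nir] := pselect (i < r)%N; last by exists (fun=> 0) => ir; case: (nir ir).
 have [|h wh hE] := divide_weak mD D1 (wG (Sub i ir)).
  move=> u a; have [b cb bE] := gT2 u a; exists (b i); last exact: TG cb bE (Sub i ir).
  by have -> : W + w - k i - W + a%:Z = w + a%:Z - k i by [ring|]; exact: cb.
 exists h => ir'; rewrite (bool_irrelevance ir' ir); split => //.
 by have -> : w - k i = W + w - k i - W by ring.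
exists h => [i ir|[tau z]]; first by have [] := hP i ir.
have Gh (i : 'I_r) x : G i x = Dm M1 r v j f x.1 * h i x.
 by have [_ <-] := hP i (ltn_ord i); congr (G _ x); apply: val_inj.
have hh (i : nat) : (i < r)%N -> holomorphic (h i) by move=> ir; have [[[]]] := hP i ir.
(* F and the sum of products are compared on the line t -> (z1, t u), at t = 1 inside a disc of
   radius 2, by showing that all Taylor coefficients agree. *)
pose u := dsubmx z; pose z1 := usubmx z; have zE : z = col_mx z1 (1 *: u) by rewrite scale1r vsubmxK.
pose e2 (s : C) := cexp (- (kap tau * quad M2 u * s ^+ 2)).
have hd (i : 'I_r) : cdisc (fun s => f i (tau, z1) * (h i (tau, (0 : 'M[C]_(n2, 0)) *m 0 + s *: u) * e2 s)) 2.
 by apply: cdiscM; [exact: cdisc_cst|exact: Tj_disc _ _ _ _ _ _ (hh i (ltn_ord i))].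
have [sd sT] := cdisc_sum (index_enum 'I_r) (ltr0n R 2) hd.
have Fd := Tj_disc (quad M2 u) A1 (col_mx 0 u) tau z1 (ltr0n R 2) hF.
have := @tc_inj _ _ 2 1 Fd sd _; rewrite rn1 ltr1n A1v => /(_ _ isT) eq1.
have {}eq1 := eq1 _.
suff tcE : tc (fun t => F (tau, A1 *m z1 + t *: col_mx 0 u) * cexp (- (kap tau * quad M2 u * t ^+ 2))) =
  tc (fun w => \sum_(i < r) f i (tau, z1) * (h i (tau, (0 : 'M[C]_(n2, 0)) *m 0 + w *: u) * e2 w)).
 have := eq1 tcE; under eq_bigr do rewrite mulrA; rewrite -mulr_suml -/(e2 1).
 move=> /(mulIf (cexp_neq0 _)); rewrite zE => ->; apply: eq_bigr => i _.
 by rewrite /dprd /= col_mxKu col_mxKd mulmx0 add0r.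
rewrite sT; apply/funext => a; have [b cb bE] := gT2 u a.
rewrite -[LHS]/(T2 u a F (tau, z1)) bE /span; apply: eq_bigr => i _.
rewrite (tcZ _ (Tj_disc _ _ _ _ _ (ltr0n R 2) (hh i (ltn_ord i)))) mulrC; congr (_ * _).
have := cb i (ltn_ord i); rewrite -[RHS]/(T0 M2 u a (h i) tau) => -[hb _ _].
apply: (generic_eq (u := b i) (v := T0 M2 u a (h i)) mD D1).
- exact: contat_hol.
- by apply: contat_hol; apply: T0_hol; exact: hh.
move=> t Dt; apply: (mulfI Dt); rewrite /= -(TG u a b cb bE).
have -> : G i = fun x => Dm M1 r v j f x.1 * h i x by apply/funext => x; exact: Gh.
by rewrite /T0 (TjM _ _ _ _ _ (hh i (ltn_ord i))).
Qed.

(** For tau with nonzero determinant, Taylor coefficients in the first block turn the relation into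
    an invertible linear system for the values y_i(tau, z). The zeros of the determinant are covered
    by continuity. *)
Theorem product_free r k f (y : nat -> jfun R n2) : fam M1 r k f -> gindep r k f ->
 (forall i, (i < r)%N -> holomorphic (y i)) ->
 (forall x, \sum_(i < r) dprd (f i) (y i) x = 0) -> forall i, (i < r)%N -> forall x, y i x = 0.
Proof.
move=> ff gf hy y0 i ir [tau0 z]; have [v [j [t1 D1]]] := gindep_det ff gf.
have mD := Dm_mform v j ff.
have hf i' : (i' < r)%N -> holomorphic (f i') by move=> ir'; have [[]] := ff i' ir'.
apply: (generic_eq (u := fun tau => y i (tau, z)) (v := fun=> 0) mD D1).
- by apply: contat_hol; apply: hol_tau; exact: hy.
- by apply: contat_hol; exact: hol_cst.
move=> t Dt; pose c (i : nat) (_ : H) := y i (t, z).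
have hc i' : (i' < r)%N -> hol (c i') by move=> _; exact: hol_cst.
have s0 z1 : span r c f (t, z1) = 0.
 have := y0 (t, col_mx z1 z); rewrite /dprd /= => h; rewrite -[RHS]h; apply: eq_bigr => i' _.
 by rewrite /c col_mxKu col_mxKd mulrC.
pose mat : 'M[C]_r := \matrix_(l, i) T0 M1 (v l) (j l) (f i) t.
have mu : mat \in unitmx by rewrite unitmxE unitfE.
have m0 : mat *m \col_i y i (t, z) = 0.
 apply/colP => l; rewrite !mxE; have [_ /(_ t)] := T0_span M1 (v l) (j l) hc hf.
 rewrite (T0_zero _ _ _ s0) => /esym h; rewrite -[RHS]h; apply: eq_bigr => i' _.
 by rewrite !mxE mulrC.
have := mulKmx mu (\col_i y i (t, z)); rewrite m0 mulmx0 => /colP/(_ (Ordinal ir)).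
by rewrite !mxE.
Qed.

End Products.

(** * The graded modules and the tensor product isomorphism *)

Section Graded.
Variable R : realType.
Notation C := R[i].
Notation H := (uhp R).

Lemma jsumE n (I : Type) (s : seq I) (F : I -> jfun R n) x : (\sum_(i <- s) F i) x = \sum_(i <- s) F i x.
Proof. by elim: s => [|i s IH]; rewrite ?big_nil ?big_cons // -IH. Qed.

Variables (n : nat) (J : int -> set (jfun R n)).
Hypothesis J0 : forall k, J k 0.
Hypothesis JD : forall k f g, J k f -> J k g -> J k (f + g).
Hypothesis JM : forall l k (a : H -> C) f, mform l a -> J k f -> J (l + k) (fun x => a x.1 * f x).

Lemma gs_hom k f : J k f -> f \in graded_sum J.
Proof.
move=> Jf; apply/asboolP; exists [:: k], (fun l => if l == k then f else 0).
by split=> [//|l|]; [case: eqP => [->|_]|rewrite big_seq1 eqxx].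
Qed.

Lemma gs_ind (P : jfun R n -> Prop) : P 0 -> (forall f g, P f -> P g -> P (f + g)) ->
 (forall k f, J k f -> P f) -> forall f, f \in graded_sum J -> P f.
Proof.
move=> P0 PD PJ _ /asboolP[s [F [_ JF ->]]]; elim: s => [|k s IH]; first by rewrite big_nil.
by rewrite big_cons; apply: PD IH; exact: PJ (JF k).
Qed.

Lemma gsD f g : f \in graded_sum J -> g \in graded_sum J -> f + g \in graded_sum J.
Proof.
move=> /asboolP[s1 [F1 [u1 J1 ->]]] /asboolP[s2 [F2 [u2 J2 ->]]]; apply/asboolP.
have S s s' (F : int -> jfun R n) : uniq s -> uniq s' -> {subset s <= s'} ->
  \sum_(k <- s) F k = \sum_(k <- s') if k \in s then F k else 0.
 move=> us us' ss; rewrite -big_mkcond -[RHS]big_filter; apply: perm_big; apply: uniq_perm => //.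
  exact: filter_uniq.
 by move=> k; rewrite mem_filter; case: (boolP (k \in s)) => // /ss ->.
exists (undup (s1 ++ s2)), (fun k => (if k \in s1 then F1 k else 0) + (if k \in s2 then F2 k else 0)).
split; [exact: undup_uniq|by move=> k; apply: JD; case: ifP|].
rewrite big_split (S s1 (undup (s1 ++ s2)) F1) ?undup_uniq // => [|k]; last by rewrite mem_undup mem_cat => ->.
by rewrite (S s2 (undup (s1 ++ s2)) F2) ?undup_uniq // => k; rewrite mem_undup mem_cat orbC => ->.
Qed.

Lemma gs0 : 0 \in graded_sum J. Proof. exact: gs_hom (J0 0). Qed.

Lemma gs_closed : GRing.submod_closed (graded_sum J).
Proof.
split; first exact: gs0.
move=> a f g fJ gJ; apply: gsD => //; move: f fJ.
apply: (gs_ind (P := fun f => a *: f \in graded_sum J)) => [|f1 g1 h1 h2|k f1 Jf]; [by rewrite scaler0 gs0|by rewrite scalerDr gsD|].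
case: a => a aP; have /asboolP[p aE] := aP.
(* A scalar is a polynomial in E4 and E6; its monomials are modular forms and shift the weight. *)
have -> : Mring aP *: f1 = \sum_(i < size p) \sum_(j < size p`_i)
  ((fun x => (p`_i`_j * (E4 x.1 ^+ j * E6 x.1 ^+ i)) * f1 x) : jfun R n).
 apply/funext => x; rewrite jsumE -[LHS]/(a x.1 * f1 x) aE (horner_coef p) horner_sum mulr_suml.
 apply: eq_bigr => i _; rewrite jsumE -polyC_exp hornerM hornerC horner_coef !mulr_suml.
 by apply: eq_bigr => j _; rewrite -!mulrA.
elim/big_ind: _ => [||i _]; [exact: gs0|by move=> u v; exact: gsD|].
elim/big_ind: _ => [||j _]; [exact: gs0|by move=> u v; exact: gsD|].
exact: gs_hom (JM (mformZ p`_i`_j (E46_mform R j i)) Jf).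
Qed.

End Graded.

Section Iso.
Variable R : realType.
Variables (n1 n2 : nat) (J1 : {pred jfun R n1}) (J2 : {pred jfun R n2}) (J : {pred jfun R (n1 + n2)}).
Variables (h1 : GRing.submod_closed J1) (h2 : GRing.submod_closed J2) (h : GRing.submod_closed J).
Variables (r : nat) (f : 'I_r -> jfun R n1).
Hypothesis fJ : forall i, f i \in J1.
Hypothesis dpJ : forall u v, u \in J1 -> v \in J2 -> dprd u v \in J.
(** Weakly holomorphic u are combinations of the f_i only after multiplication by a power d of
    Delta; writing v = d v' lets d be moved across the tensor sign. For weak forms d = 1. *)
Hypothesis gen : forall u v, u \in J1 -> v \in J2 -> exists (d : mring R) v' (a : 'I_r -> mring R),
 [/\ v' \in J2, v = d *: v' & d *: u = \sum_i a i *: f i].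
Hypothesis free : forall y : 'I_r -> jfun R n2, (forall i, y i \in J2) ->
 \sum_i dprd (f i) (y i) = 0 -> forall i, y i = 0.
Hypothesis onto : forall F, F \in J -> exists2 y : 'I_r -> jfun R n2, forall i, y i \in J2 &
 F = \sum_i dprd (f i) (y i).

Let U := submodule h1.
Let V := submodule h2.
Let ff i : U := Submodule h1 (fJ i).
Let b (u : U) (v : V) : submodule h := Submodule h (dpJ (submodule_valP u) (submodule_valP v)).

Lemma tens_gen (x : tensor U V) : exists y : 'I_r -> V, x = \sum_i tens (ff i) (y i).
Proof.
have tD u (v v' : V) : tens u (v + v') = tens u v + tens u v' :> tensor U V.
 by have := tens_linearr u 1 v v'; rewrite !scale1r.
have t0 u : tens u (0 : V) = 0 :> tensor U V.
 by have := tens_linearr u (-1) (0 : V) 0; rewrite scaler0 addr0 scaleN1r addNr.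
have t0l v : tens (0 : U) v = 0 :> tensor U V.
 by have := tens_linearl v (-1) (0 : U) 0; rewrite scaler0 addr0 scaleN1r addNr.
have tDl (u u' : U) v : tens (u + u') v = tens u v + tens u' v :> tensor U V.
 by have := tens_linearl v 1 u u'; rewrite !scale1r.
have tZ a (u : U) v : tens (a *: u) v = tens u (a *: v) :> tensor U V.
 exact/tensP/tens_scale.
rewrite -[x]reprK tensor_seqE; elim: (repr x) => [|[u v] s [y IH]].
 by exists (fun=> 0); rewrite big_nil big1.
rewrite big_cons IH /=.
have [d [v' [a [v'J vE uE]]]] := gen (submodule_valP u) (submodule_valP v).
pose w : V := Submodule h2 v'J.
exists (fun i => a i *: w + y i).
have -> : tens u v = \sum_i tens (ff i) (a i *: w) :> tensor U V.
 have -> : v = d *: w by apply: val_inj; rewrite /= vE.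
 rewrite -tZ; have -> : d *: u = \sum_i a i *: ff i.
  by apply: val_inj; rewrite /= uE; elim/big_rec2: _ => //= i z1 z2 _ ->.
 by elim/big_rec2: _ => [|i z1 z2 _ <-]; rewrite ?t0l // tDl tZ.
by rewrite -big_split; apply: eq_bigr => i _; rewrite tD.
Qed.

Lemma dp_iso : direct_product_iso J1 J2 J.
Proof.
have bl v : linear (b^~ v).
 by move=> a u u'; apply: val_inj; apply/funext => x; rewrite -[LHS]/((a x.1 * val u (x.1, usubmx x.2) + val u' (x.1, usubmx x.2)) * val v (x.1, dsubmx x.2)) mulrDl -mulrA.
have br u : linear (b u).
 by move=> a v v'; apply: val_inj; apply/funext => x; rewrite -[LHS]/(val u (x.1, usubmx x.2) * (a x.1 * val v (x.1, dsubmx x.2) + val v' (x.1, dsubmx x.2))) mulrDr mulrCA.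
have [phi phiE _] := tensor_universal bl br.
exists h1, h2, h, phi; split; last by move=> u v; rewrite phiE.
have phiS (y : 'I_r -> V) : val (phi (\sum_i tens (ff i) (y i))) = \sum_i dprd (f i) (val (y i)).
 rewrite linear_sum; elim/big_rec2: _ => //= i z1 z2 _ <-.
 by rewrite phiE.
have inj : injective phi.
 move=> x x' e; apply/eqP; rewrite -subr_eq0; have [y yE] := tens_gen (x - x').
 have := phiS y; rewrite -yE linearB e subrr => /esym/free-/(_ (fun i => submodule_valP (y i))) y0.
 rewrite yE big1 // => i _; have -> : y i = 0 by apply: val_inj; rewrite /= y0.
 by have := tens_linearr (ff i) (-1) (0 : V) 0; rewrite scaler0 addr0 scaleN1r addNr => ->.
have sur F : exists x, phi x = F.
 have [y yJ yE] := onto (submodule_valP F).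
 exists (\sum_i tens (ff i) (Submodule h2 (yJ i))); apply: val_inj; rewrite phiS /=.
 by rewrite -yE.
have [g gP] := choice sur; exists g => // x; apply: inj; exact: gP.
Qed.

End Iso.

(** * Passage between weak and weakly holomorphic forms by powers of Delta *)

Section DeltaShift.
Variable R : realType.
Notation C := R[i].
Notation H := (uhp R).

Lemma Delta_cusp : cuspb 1 (@Delta R).
Proof.
have h1 := E46_cusp R 3 0; have h2 := cuspbM (cuspb_cst (-1 : C)) (E46_cusp R 0 2).
have := cuspbD h1 h2; congr (cuspb 1); apply/funext => tau; rewrite /Delta !expr0.
by move: (E4 tau) (E6 tau) => *; ring.
Qed.

Lemma DeltaX_cusp m : cuspb m (fun tau => @Delta R tau ^+ m).
Proof.
elim: m => [|m IH]; first by under eq_fun do rewrite expr0; exact: cuspb_cst.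
by have := cuspbM Delta_cusp IH; under eq_fun do rewrite -exprS.
Qed.

Variables (n : nat) (M : 'M[int]_n).
Implicit Types f : jfun R n.

Lemma Delta_up m k f : wj M m k f -> wj M 0 (12 * m%:Z + k) (fun x => Delta x.1 ^+ m * f x).
Proof.
move=> wf; have [jf _] := wjM (mformX m (@Delta_mform R)) wf; split => // z.
have [Y [B [_ B0 HB]]] := cuspbW (DeltaX_cusp m); have [_ bf] := wf; have [Y' [B' HB']] := bf z.
exists (Num.max Y Y'), (B * B') => tau; rewrite ge_max => /andP[/HB h1 /HB' h2].
rewrite expr0 mul1r rnM; apply: le_trans (ler_wpM2r (rn_ge0 _) h1) _; rewrite -mulrA ler_wpM2l //.
by rewrite -rnX -rnM.
Qed.

Lemma Delta_down p m k f : wj M p k f -> wj M (p + m) (k - 12 * m%:Z) (fun x => f x / Delta x.1 ^+ m).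
Proof.
move=> [[hf mf ef] bf]; have [hD lD _] := mformX m (@Delta_mform R).
have D0 (tau : H) : Delta tau ^+ m != 0 := expf_neq0 m (Delta_neq0 tau).
pose g : jfun R n := fun x => f x / Delta x.1 ^+ m.
have fE x : f x = Delta x.1 ^+ m * g x by rewrite mulrC divfK.
rewrite -/g; split; first split.
- by move=> [p1 z] /= p0; have [tau <-] := uhpP p0; exact: (div_df z hD hf fE (D0 tau)).
- by move=> a b c d abcd tau z; exact: (div_modular z abcd lD mf fE (D0 tau)).
- by move=> l l' tau z; exact: (div_elliptic (a := fun t => Delta t ^+ m) _ _ _ ef fE (D0 tau)).
- move=> z; have [Y HY] := @Delta_lower R; have [Y' [B HB]] := bf z.
 exists (Num.max Y Y'), B => tau; rewrite ge_max => /andP[/HY h1 /HB h2]; apply: le_trans h2.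
 rewrite exprD -mulrA fE /=; move: (g (tau, z)) (ee (val tau)) (Delta tau) h1 => y q D h1.
 rewrite (rnM (q ^+ p)) [leRHS](rnM (q ^+ p)) ler_wpM2l ?rn_ge0 // [leLHS]rnM [leRHS]rnM.
 by rewrite ler_wpM2r ?rn_ge0 // !rnX lerXn2r ?nnegrE ?rn_ge0.
Qed.

End DeltaShift.

Section Spaces.
Variable R : realType.
Notation C := R[i].
Notation H := (uhp R).
Variables (n : nat) (M : 'M[int]_n).
Implicit Types f : jfun R n.

Lemma weak_wj k f : weak_jacobi k M f <-> wj M 0 k f. Proof. exact: weakP. Qed.

Lemma wh_wj k f : weakly_holomorphic_jacobi k M f <-> exists m, wj M m k f.
Proof. by split=> [/whP[jf [m bf]]|[m [jf bf]]]; [exists m|apply/whP; split => //; exists m]. Qed.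

Lemma wj_mono m m' k f : (m <= m')%N -> wj M m k f -> wj M m' k f.
Proof. by move=> mm [jf bf]; split => //; exact: jb_le mm bf. Qed.

Lemma weak0 k : weak_jacobi k M (0 : jfun R n).
Proof. by apply/weak_wj; exact: wj0. Qed.
Lemma weakD k f g : weak_jacobi k M f -> weak_jacobi k M g -> weak_jacobi k M (f + g).
Proof. by move=> /weak_wj wf /weak_wj wg; apply/weak_wj; exact: wjD. Qed.
Lemma weakM l k (a : H -> C) f : mform l a -> weak_jacobi k M f ->
 weak_jacobi (l + k) M ((fun x => a x.1 * f x) : jfun R n).
Proof. by move=> ma /weak_wj wf; apply/weak_wj; exact: wjM. Qed.

Lemma wh0 k : weakly_holomorphic_jacobi k M (0 : jfun R n).
Proof. by apply/wh_wj; exists 0%N; exact: wj0. Qed.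
Lemma whD k f g : weakly_holomorphic_jacobi k M f -> weakly_holomorphic_jacobi k M g ->
 weakly_holomorphic_jacobi k M (f + g).
Proof.
move=> /wh_wj[m wf] /wh_wj[m' wg]; apply/wh_wj; exists (m + m')%N.
by apply: wjD; [apply: wj_mono wf; rewrite leq_addr|apply: wj_mono wg; rewrite leq_addl].
Qed.
Lemma whM l k (a : H -> C) f : mform l a -> weakly_holomorphic_jacobi k M f ->
 weakly_holomorphic_jacobi (l + k) M ((fun x => a x.1 * f x) : jfun R n).
Proof. by move=> ma /wh_wj[m wf]; apply/wh_wj; exists m; exact: wjM. Qed.

Lemma Jw_closed : GRing.submod_closed (Jw R M).
Proof. exact: gs_closed weak0 weakD weakM. Qed.
Lemma Jwh_closed : GRing.submod_closed (Jwh R M).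
Proof. exact: gs_closed wh0 whD whM. Qed.

Lemma JwD f g : f \in Jw R M -> g \in Jw R M -> f + g \in Jw R M.
Proof. exact: gsD weak0 weakD _ _. Qed.
Lemma JwhD f g : f \in Jwh R M -> g \in Jwh R M -> f + g \in Jwh R M.
Proof. exact: gsD wh0 whD _ _. Qed.

Lemma wj_Jw k f : wj M 0 k f -> f \in Jw R M.
Proof. by move=> /weak_wj; exact: (gs_hom weak0). Qed.
Lemma wj_Jwh m k f : wj M m k f -> f \in Jwh R M.
Proof. by move=> wf; apply: (gs_hom wh0 (k := k)); apply/wh_wj; exists m. Qed.

Lemma Jw_Jwh f : f \in Jw R M -> f \in Jwh R M.
Proof.
move: f; apply: (gs_ind (P := fun f => f \in Jwh R M)) => [|g g' h1 h2|k g /weak_wj]; [exact: Jwh_closed.1|exact: JwhD|exact: wj_Jwh].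
Qed.

Lemma Jwh_hol f : f \in Jwh R M -> holomorphic f.
Proof.
move: f; apply: (gs_ind (P := @holomorphic R n)) => [|g g' h1 h2|k g /wh_wj[m [[]]]//]; last exact: holomorphicD.
by have [[]] := @wj0 R n M 0 0.
Qed.

(** Powers of Delta as scalars; they act invertibly on weakly holomorphic forms by [Jwh_down] and
    [Dl_down]. *)
Definition Dl m : mring R := Mring (mform_E46 (mformX m (@Delta_mform R))).

Lemma Jwh_up f : f \in Jwh R M -> exists m, Dl m *: f \in Jw R M.
Proof.
have [J0 JL] := Jw_closed; have JZ a g : g \in Jw R M -> a *: g \in Jw R M.
 by move=> gJ; rewrite -[a *: g]addr0; exact: JL.
move: f; apply: (gs_ind (P := fun f => exists m, Dl m *: f \in Jw R M)) => [|g g' [m1 h1] [m2 h2]|k g /wh_wj[m wg]].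
- by exists 0%N; rewrite scaler0.
- exists (m1 + m2)%N; have -> : Dl (m1 + m2) *: (g + g') = Dl m2 *: (Dl m1 *: g) + Dl m1 *: (Dl m2 *: g').
  apply/funext => x; rewrite -[LHS]/(Delta x.1 ^+ (m1 + m2) * (g x + g' x)).
  rewrite -[RHS]/(Delta x.1 ^+ m2 * (Delta x.1 ^+ m1 * g x) + Delta x.1 ^+ m1 * (Delta x.1 ^+ m2 * g' x)) exprD.
  by move: (_ ^+ m1) (_ ^+ m2) (g x) (g' x) => *; ring.
 by apply: JL; [exact: h1|exact: JZ].
- by exists m; exact: wj_Jw (Delta_up wg).
Qed.

Lemma Jwh_down m f : f \in Jwh R M -> ((fun x => f x / Delta x.1 ^+ m) : jfun R n) \in Jwh R M.
Proof.
move: f; apply: (gs_ind (P := fun f => ((fun x => f x / Delta x.1 ^+ m) : jfun R n) \in Jwh R M)) => [|g g' h1 h2|k g /wh_wj[p wg]].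
- have -> : ((fun x => (0 : jfun R n) x / Delta x.1 ^+ m) : jfun R n) = 0 by apply/funext => x; exact: mul0r.
 exact: Jwh_closed.1.
- have -> : ((fun x => (g + g') x / Delta x.1 ^+ m) : jfun R n) =
   (fun x => g x / Delta x.1 ^+ m) + (fun x => g' x / Delta x.1 ^+ m) by apply/funext => x; exact: mulrDl.
 exact: JwhD.
- exact: wj_Jwh (Delta_down m wg).
Qed.

Lemma Dl_down m f : f = Dl m *: ((fun x => f x / Delta x.1 ^+ m) : jfun R n).
Proof.
apply/funext => x; rewrite -[RHS]/(Delta x.1 ^+ m * (f x / Delta x.1 ^+ m)) mulrC divfK; last exact: expf_neq0 (Delta_neq0 _).
by [].
Qed.

Lemma Jw_gen r k (f : nat -> jfun R n) g : generates M r k f -> g \in Jw R M ->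
 exists a : 'I_r -> mring R, g = \sum_i a i *: f i.
Proof.
move=> gf; move: g; apply: (gs_ind (P := fun g => exists a : 'I_r -> mring R, g = \sum_i a i *: f i)) => [|g1 g2 [a1 ->] [a2 ->]|w g1 /weak_wj wg].
- by exists (fun=> 0); rewrite big1 // => i _; rewrite scale0r.
- by exists (fun i => a1 i + a2 i); rewrite -big_split; apply: eq_bigr => i _; rewrite scalerDl.
have [c cc cE] := gf w g1 wg.
exists (fun i : 'I_r => Mring (mform_E46 (cc i (ltn_ord i)))); apply/funext => x; rewrite jsumE cE.
by apply: eq_bigr => i _.
Qed.

End Spaces.

Section Isomorphisms.
Variable R : realType.
Variables (n1 n2 : nat) (M1 : 'M[int]_n1) (M2 : 'M[int]_n2).
Let MM : 'M[int]_(n1 + n2) := block_mx M1 0 0 M2.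

Lemma dpD (u u' : jfun R n1) (v : jfun R n2) : dprd (u + u') v = dprd u v + dprd u' v.
Proof. by apply/funext => x; rewrite /dprd [LHS]mulrDl. Qed.
Lemma dpDr (u : jfun R n1) (v v' : jfun R n2) : dprd u (v + v') = dprd u v + dprd u v'.
Proof. by apply/funext => x; rewrite /dprd [LHS]mulrDr. Qed.
Lemma dp0 (v : jfun R n2) : dprd (0 : jfun R n1) v = 0.
Proof. by apply/funext => x; rewrite /dprd mul0r. Qed.
Lemma dp0r (v : jfun R n1) : dprd v (0 : jfun R n2) = 0.
Proof. by apply/funext => x; rewrite /dprd mulr0. Qed.

Lemma dp_Jw (u : jfun R n1) (v : jfun R n2) : u \in Jw R M1 -> v \in Jw R M2 -> dprd u v \in Jw R MM.
Proof.
have [J0 _] := Jw_closed R MM; have JD := @JwD R _ MM.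
move=> uJ vJ; move: u uJ; apply: (gs_ind (P := fun u => dprd u v \in Jw R MM)) => [|f g h1 h2|k f /weak_wj wf]; [by rewrite dp0|by rewrite dpD JD|].
move: v vJ; apply: (gs_ind (P := fun v => dprd f v \in Jw R MM)) => [|f' g h1 h2|k' g /weak_wj wg]; [by rewrite dp0r|by rewrite dpDr JD|].
exact: wj_Jw (dp_wj wf wg).
Qed.

Lemma dp_Jwh (u : jfun R n1) (v : jfun R n2) : u \in Jwh R M1 -> v \in Jwh R M2 -> dprd u v \in Jwh R MM.
Proof.
have [J0 _] := Jwh_closed R MM; have JD := @JwhD R _ MM.
move=> uJ vJ; move: u uJ; apply: (gs_ind (P := fun u => dprd u v \in Jwh R MM)) => [|f g h1 h2|k f /wh_wj[m wf]]; [by rewrite dp0|by rewrite dpD JD|].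
move: v vJ; apply: (gs_ind (P := fun v => dprd f v \in Jwh R MM)) => [|f' g h1 h2|k' g /wh_wj[m' wg]]; [by rewrite dp0r|by rewrite dpDr JD|].
exact: wj_Jwh (dp_wj wf wg).
Qed.

Lemma Jw_onto r k (f : nat -> jfun R n1) F : fam M1 r k f -> gindep r k f -> generates M1 r k f -> F \in Jw R MM ->
 exists2 y : 'I_r -> jfun R n2, forall i, y i \in Jw R M2 & F = \sum_(i < r) dprd (f i) (y i).
Proof.
move=> ff gf genf; move: F; apply: (gs_ind (P := fun F => exists2 y : 'I_r -> jfun R n2, forall i, y i \in Jw R M2 & F = \sum_(i < r) dprd (f i) (y i))) => [|F1 F2 [y1 h1 ->] [y2 h2 ->]|w F1 /weak_wj wF].
- exists (fun=> 0) => [i|]; first by have [] := Jw_closed R M2.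
 by rewrite big1 // => i _; exact: dp0r.
- exists (fun i => y1 i + y2 i) => [i|]; first exact: JwD.
 by rewrite -big_split; apply: eq_bigr => i _; rewrite dpDr.
have [y yw yE] := product_generated ff gf genf wF.
exists (fun i => y i) => [i|]; first exact: wj_Jw (yw i (ltn_ord i)).
by apply/funext => x; rewrite yE jsumE.
Qed.

Lemma Jwh_free r k (f : nat -> jfun R n1) (y : 'I_r -> jfun R n2) : fam M1 r k f -> gindep r k f ->
 (forall i, y i \in Jwh R M2) -> \sum_(i < r) dprd (f i) (y i) = 0 -> forall i, y i = 0.
Proof.
move=> ff gf yJ y0 i; pose y' (j : nat) := if insub j is Some j0 then y j0 else 0.
have y'E (j : 'I_r) : y' j = y j by rewrite /y' valK.
rewrite -y'E; apply/funext => x; apply: (product_free (f := f) ff gf) (ltn_ord i) x.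
- by move=> j jr; rewrite (y'E (Ordinal jr)); exact: Jwh_hol (yJ _).
- move=> x; transitivity ((\sum_(i < r) dprd (f i) (y i)) x); last by rewrite y0.
 by rewrite jsumE; apply: eq_bigr => j _; rewrite y'E.
Qed.

Theorem weak_iso : direct_product_iso (Jw R M1) (Jw R M2) (Jw R MM).
Proof.
have [r [k [f [ff gf genf]]]] := weak_free R M1.
apply: (@dp_iso R n1 n2 _ _ _ (Jw_closed R M1) (Jw_closed R M2) (Jw_closed R MM) r (fun i => f i)).
- by move=> i; exact: wj_Jw (ff i (ltn_ord i)).
- exact: dp_Jw.
- move=> u v uJ vJ; have [a uE] := Jw_gen genf uJ.
 by exists 1, v, a; split; rewrite ?scale1r.
- by move=> y yJ; apply: (Jwh_free ff gf) => i; exact: Jw_Jwh.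
- by move=> F; exact: (Jw_onto ff gf genf).
Qed.

Theorem wh_iso : direct_product_iso (Jwh R M1) (Jwh R M2) (Jwh R MM).
Proof.
have [r [k [f [ff gf genf]]]] := weak_free R M1.
apply: (@dp_iso R n1 n2 _ _ _ (Jwh_closed R M1) (Jwh_closed R M2) (Jwh_closed R MM) r (fun i => f i)).
- by move=> i; exact: wj_Jwh (ff i (ltn_ord i)).
- exact: dp_Jwh.
- move=> u v uJ vJ; have [m umJ] := Jwh_up uJ; have [a uE] := Jw_gen genf umJ.
 exists (Dl R m), (fun x => v x / Delta x.1 ^+ m), a; split => //; first exact: Jwh_down.
 exact: Dl_down.
- by move=> y yJ; exact: (Jwh_free ff gf).
- move=> F FJ; have [m FmJ] := Jwh_up FJ; have [y yJ yE] := Jw_onto ff gf genf FmJ.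
 exists (fun i x => y i x / Delta x.1 ^+ m) => [i|]; first by apply: Jwh_down; exact: Jw_Jwh.
 apply/funext => x; have := congr1 (fun G : jfun R (n1 + n2) => G x / Delta x.1 ^+ m) yE.
 rewrite -[X in X = _]/(Delta x.1 ^+ m * F x / Delta x.1 ^+ m) mulrC mulKf ?expf_neq0 ?Delta_neq0 // => ->.
 by rewrite !jsumE mulr_suml; apply: eq_bigr => i _; rewrite /dprd mulrA.
Qed.

End Isomorphisms.

(** * Hilbert series *)

Section Numerators.

(** P vanishes far below, so only finitely many (a, b) contribute, and a square of side N contains
    them all. *)
Lemma sum_grid (P : int -> int) (L : int) (N : nat) (k : int) : (forall v, v < L -> P v = 0) -> k - N%:Z < L ->
 \sum_(ab \in [set: nat * nat]) P (k - (4 * ab.1 + 6 * ab.2)%N%:Z) =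
 \sum_(ab : 'I_N * 'I_N) P (k - (4 * ab.1 + 6 * ab.2)%N%:Z).
Proof.
move=> PL kN; pose g (ab : 'I_N * 'I_N) : nat * nat := (val ab.1, val ab.2).
rewrite (fsbigE [seq g ab | ab <- index_enum _]).
- by rewrite big_map; apply: eq_bigl => ab; exact: in_setT.
- rewrite map_inj_uniq ?index_enum_uniq // => -[a b] [a' b'] [].
 by move=> /val_inj -> /val_inj ->.
- by [].
move=> [a b] _ /negP ab; apply: PL => /=.
have [aN|aN] := ltnP a N; last by lia.
have [bN|bN] := ltnP b N; last by lia.
case: ab; apply/mapP; exists (Ordinal aN, Ordinal bN) => //; exact: mem_index_enum.
Qed.

Lemma finite_lower (P : int -> int) : finite_set [set k | P k != 0] -> exists L : nat, forall v, v < - L%:Z -> P v = 0.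
Proof.
move=> /finite_seqP[s sE]; exists (\sum_(k <- s) absz k)%N => v vL; apply/eqP; apply: contraT => Pv.
have vs : v \in s by have := congr1 (fun A : set int => A v) sE; rewrite /= => <-.
by move: vL; rewrite (big_rem v) //=; lia.
Qed.

Variable R : realType.
Notation C := R[i].
Notation H := (uhp R).

Section OneIndex.
Variables (n : nat) (M : 'M[int]_n).

Lemma has_dim_le (V : set (jfun R n)) d d' : has_dim V d -> has_dim V d' -> (d <= d')%N.
Proof.
move=> [b [Vb bP]] [b' [Vb' bP']].
have /choice[A AP] i : exists c : 'rV[C]_d', forall x, b i x = \sum_j c 0 j * b' j x.
 by have [c [cP _]] := bP' _ (Vb i); exists c.
have /choice[B BP] j : exists c : 'rV[C]_d, forall x, b' j x = \sum_i c 0 i * b i x.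
 by have [c [cP _]] := bP _ (Vb' j); exists c.
pose AA : 'M[C]_(d, d') := \matrix_(i, j) A i 0 j; pose BB : 'M[C]_(d', d) := \matrix_(j, i) B j 0 i.
have AB : 1%:M *m AA *m BB = 1%:M.
 rewrite mul1mx; apply/row_matrixP => i; have [c [_ cu]] := bP _ (Vb i).
 have <- : c = row i (AA *m BB); last have <- // : c = row i 1%:M.
  apply: cu => x; rewrite AP; transitivity (\sum_j \sum_l (A i 0 j * B j 0 l) * b l x).
   by apply: eq_bigr => j _; rewrite BP mulr_sumr; apply: eq_bigr => l _; rewrite mulrA.
  rewrite exchange_big; apply: eq_bigr => l _; rewrite !mxE mulr_suml; apply: eq_bigr => j _.
  by rewrite !mxE.
 apply: cu => x; rewrite (bigD1 i) //= big1 ?addr0 => [|l li]; first by rewrite !mxE eqxx mul1r.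
 by rewrite !mxE eq_sym (negbTE li) mul0r.
exact: leq_trans (mulmx1_min_rank AB) (rank_leq_col AA).
Qed.

(** The dimension formula is triangular: its term (a, b) = (0, 0) is P k, and all others involve P
    at smaller arguments. As both numerators vanish far below, induction determines them. *)
Lemma numerator_unique (P P' : int -> int) : weak_numerator R M P -> weak_numerator R M P' -> P = P'.
Proof.
move=> [fP dP] [fP' dP']; have [L1 PL1] := finite_lower fP; have [L2 PL2] := finite_lower fP'.
pose L : int := - (L1 + L2)%N%:Z.
have PL v : v < L -> P v = 0 by move=> vL; apply: PL1; rewrite /L in vL; lia.
have PL' v : v < L -> P' v = 0 by move=> vL; apply: PL2; rewrite /L in vL; lia.
suff h (m : nat) k : k < L + m%:Z -> P k = P' k.
 by apply/funext => k; apply: (h (absz (k - L)).+1); lia.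
elim: m k => [|m IH] k km; first by rewrite PL ?PL' //; lia.
have [d hd dE] := dP k; have [d' hd' dE'] := dP' k.
have dd : d = d' by apply/eqP; rewrite eqn_leq !(has_dim_le hd hd', has_dim_le hd' hd).
have kN : k - (absz (k - L)).+1%:Z < L by lia.
move: dE dE'; rewrite dd (sum_grid PL kN) (sum_grid PL' kN) => -> .
rewrite (bigD1 (ord0, ord0)) //= [RHS](bigD1 (ord0, ord0)) //= !muln0 subr0.
rewrite (eq_bigr (fun ab : 'I_(absz (k - L)).+1 * 'I_(absz (k - L)).+1 => P' (k - (4 * ab.1 + 6 * ab.2)%N%:Z))).
 by move=> /addIr.
move=> [[a ai] [b bi]] /= ab; apply: IH.
have : (0 < a + b)%N by rewrite lt0n; apply: contraNN ab => /eqP h; apply/eqP; congr (_, _); apply: val_inj => /=; lia.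
lia.
Qed.

Lemma has_dim_fin (T : finType) (A : {pred T}) (V : set (jfun R n)) (b : T -> jfun R n) :
 (forall t, t \in A -> V (b t)) ->
 (forall f, V f -> exists c : T -> C, forall x, f x = \sum_(t in A) c t * b t x) ->
 (forall c : T -> C, (forall x, \sum_(t in A) c t * b t x = 0) -> forall t, t \in A -> c t = 0) ->
 has_dim V #|A|.
Proof.
move=> Vb gen ind; exists (fun i => b (enum_val i)); split=> [i|f Vf]; first exact: Vb (enum_valP i).
have [c cE] := gen f Vf; exists (\row_i c (enum_val i)); split=> [x|c' c'E].
 by rewrite cE big_enum_val; apply: eq_bigr => i _; rewrite mxE.
pose e t : C := if [pick i | enum_val i == t :> T] is Some i then c t - c' 0 (i : 'I_#|A|) else 0.
have eE i : e (enum_val i) = c (enum_val i) - c' 0 i.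
 by rewrite /e; case: pickP => [j /eqP/enum_val_inj ->//|/(_ i)]; rewrite eqxx.
apply/rowP => i; rewrite mxE; apply/eqP; rewrite -subr_eq0 -eE; apply/eqP.
apply: (ind e _ _ (enum_valP i)) => x; rewrite big_enum_val /=.
under eq_bigr => j _ do rewrite eE mulrBl.
by rewrite sumrB -c'E cE; apply/eqP; rewrite subr_eq0; apply/eqP; exact/esym/big_enum_val.
Qed.

End OneIndex.

Lemma mform_mono w m : mform w m -> exists2 s : seq (C * (nat * nat)),
 forall t, t \in s -> (4 * t.2.1 + 6 * t.2.2)%N%:Z = w &
 forall tau, m tau = \sum_(t <- s) t.1 * (E4 tau ^+ t.2.1 * E6 tau ^+ t.2.2).
Proof.
suff h (q : nat) : forall (w : int) m, w < q%:Z -> mform w m -> exists2 s : seq (C * (nat * nat)),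
  forall t, t \in s -> (4 * t.2.1 + 6 * t.2.2)%N%:Z = w &
  forall tau, m tau = \sum_(t <- s) t.1 * (E4 tau ^+ t.2.1 * E6 tau ^+ t.2.2).
 by apply: (h (absz w).+1); lia.
elim: q => [|q IH] {}w {}m wq mm.
 by exists [::] => [//|tau]; rewrite big_nil (mform_neg wq mm).
have [w0|w0] := eqVneq w 0.
 rewrite w0 in mm *; have [a aE] := mform_const mm; exists [:: (a, (0, 0)%N)] => [t|tau].
  by rewrite inE => /eqP ->.
 by rewrite big_seq1 !expr0 !mulr1.
have [b [c [mb mc mE]]] := mform_xy w0 mm.
have [w4 w6] : w - 4 < q%:Z /\ w - 6 < q%:Z by lia.
have [s1 h1 E1] := IH _ _ w4 mb; have [s2 h2 E2] := IH _ _ w6 mc.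
exists ([seq (t.1, (t.2.1.+1, t.2.2)) | t <- s1] ++ [seq (t.1, (t.2.1, t.2.2.+1)) | t <- s2]) => [t|tau].
 by rewrite mem_cat => /orP[] /mapP[[z [a b']] us ->]; [have := h1 _ us|have := h2 _ us]; rewrite /=; lia.
rewrite mE E1 E2 big_cat !big_map !mulr_sumr; congr (_ + _); apply: eq_bigr => t _ /=; rewrite exprS.
 by move: (E4 tau ^+ _) (E6 tau ^+ _) => *; ring.
by move: (E4 tau ^+ _) (E6 tau ^+ _) => *; ring.
Qed.

Lemma hol_sum (I : Type) (s : seq I) (P : pred I) (F : I -> H -> C) : (forall i, hol (F i)) ->
 hol (fun tau => \sum_(i <- s | P i) F i tau).
Proof.
move=> hF; elim: s => [|i s IH].
 by have -> : (fun tau => \sum_(i <- [::] | P i) F i tau) = fun=> 0; [apply/funext => tau; rewrite big_nil|exact: hol_cst].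
have -> : (fun tau => \sum_(i <- i :: s | P i) F i tau) =
  fun tau => (if P i then 1 else 0) * F i tau + \sum_(i <- s | P i) F i tau.
 by apply/funext => tau; rewrite big_cons; case: ifP => _; rewrite ?mul1r ?mul0r ?add0r.
by apply: holD => //; apply: holM => //; exact: hol_cst.
Qed.

Lemma eqN0 (x : C) : x = -1 * x -> x = 0.
Proof.
move=> h; have /eqP : x + x = 0 by rewrite {1}h mulN1r addNr.
by rewrite -mulr2n mulrn_eq0 => /eqP.
Qed.

(** The point i is fixed by S, and weight 6 gives E6(i) = i^6 E6(i) = - E6(i). *)
Lemma E6_i : exists2 t0 : H, E6 t0 = 0 & E4 t0 != 0.
Proof.
have [|t tE] := @uhpP R (0 +i* 1); first exact: ltr01.
have ii : (0 +i* 1) ^+ 2 = -1 :> C by apply/eqP; rewrite eq_complex /=; apply/andP; split; apply/eqP; ring.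
have iN : - ((0 +i* 1)^-1) = 0 +i* 1 :> C.
 have i0 : (0 +i* 1) != 0 :> C by rewrite eq_complex /= oner_eq0 andbF.
 by apply: (mulIf i0); rewrite mulNr mulVf // -ii expr2.
have St : mobius (Sabcd) t = t by apply: val_inj; rewrite valS tE iN.
have [_ l6 _] := @E6_mform R; have := l6 _ _ _ _ Sabcd t; rewrite St jS tE.
have -> : (0 +i* 1 : C) ^ 6 = -1 by rewrite -exprnP (exprM _ 2 3) ii; ring.
move=> /eqN0 e6.
by have [e4|] := E46_neq0 t; [exists t; [exact: e6|exact: e4]|rewrite e6 eqxx].
Qed.

Lemma E6_nz : exists t1 : H, E6 t1 != 0.
Proof.
have [Y HY] := cusp_low (@E6_cusp R); have y0 : 0 < Num.max Y 1 by rewrite lt_max ltr01 orbT.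
have [|t tE] := @uhpP R (0 +i* Num.max Y 1); first exact: y0.
exists t; rewrite -rn_gt0; apply: lt_le_trans (HY t _); first by lra.
by rewrite tE /= le_max lexx.
Qed.

Lemma pow_split (x : C) m q : (m < q)%N -> x ^+ q = x ^+ m.+1 * x ^+ (q - m).-1.
Proof. by move=> mq; rewrite -exprD; congr (_ ^+ _); lia. Qed.

(** Induction on the exponent m of E6: divide the relation by E6^m and evaluate at a zero of E6,
    where E4 is nonzero. In a fixed weight only one monomial has a given exponent of E6, so a single
    coefficient survives. *)
Lemma mono_indep (w : int) N (c : 'I_N * 'I_N -> C) :
 (forall tau, \sum_(ab : 'I_N * 'I_N | (4 * ab.1 + 6 * ab.2)%N%:Z == w) c ab * (E4 tau ^+ ab.1 * E6 tau ^+ ab.2) = 0) ->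
 forall ab : 'I_N * 'I_N, (4 * ab.1 + 6 * ab.2)%N%:Z == w -> c ab = 0.
Proof.
move=> c0 ab abw; have [m mE] : exists m : nat, m = ab.2 by exists (val ab.2).
elim/ltn_ind: m ab abw mE => m IH ab abw mE.
have [t0 e6 e4] := E6_i; have [t1 e6'] := E6_nz.
pose rest tau : C := \sum_(p : 'I_N * 'I_N | ((4 * p.1 + 6 * p.2)%N%:Z == w) && (m < p.2)%N) c p * (E4 tau ^+ p.1 * E6 tau ^+ (p.2 - m).-1).
pose u tau := c ab * E4 tau ^+ ab.1 + E6 tau * rest tau.
have hE a b : hol (fun tau => @E4 R tau ^+ a * E6 tau ^+ b) by have [] := E46_mform R a b.
have h4 a : hol (fun tau => @E4 R tau ^+ a) by have := hE a 0%N; under eq_fun do rewrite expr0 mulr1.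
have hu : hol u.
 apply: holD; first by apply: holM; [exact: hol_cst|exact: h4].
 apply: holM; first by have [] := @E6_mform R.
 by apply: (@hol_sum _ (index_enum _) _ (fun (p : 'I_N * 'I_N) tau => c p * (E4 tau ^+ p.1 * E6 tau ^+ (p.2 - m).-1))) => p; apply: holM; [exact: hol_cst|exact: hE].
have u0 tau : E6 tau ^+ m * u tau = 0.
 rewrite -[RHS](c0 tau) (bigD1 ab) //= /u mulrDr -mE; congr (_ + _).
  by move: (E4 tau ^+ _) (E6 tau ^+ m) (c ab) => *; ring.
 rewrite (bigID (fun p : 'I_N * 'I_N => (m < p.2)%N)) /= [X in _ + X]big1 ?addr0 => [|p].
  rewrite mulrA -exprSr /rest mulr_sumr; apply: eq_big => [p|p /andP[_ mp]].
   by case: (ltnP m p.2) => mp; rewrite ?andbF // !andbT; case: eqP => //= _; apply/esym/eqP => pab; move: mp; rewrite pab mE ltnn.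
  rewrite [in RHS](pow_split _ mp).
  by move: (_ ^+ _) (_ ^+ _) (_ ^+ _) => *; ring.
 move=> /andP[/andP[pw pab]]; rewrite -leqNgt leq_eqVlt => /orP[/eqP pm|pm]; last by rewrite (IH _ pm) ?mul0r.
 case/eqP: pab; case: p ab {u hu} pw pm abw mE => a b [a' b'] /= pw pm abw mE.
 by congr (_, _); apply: val_inj => /=; move/eqP: pw; move/eqP: abw; lia.
have ut0 : u t0 = 0.
 apply: (@generic_eq R 6 (@E6 R) t1 u (fun=> 0) t0 (@E6_mform R) e6' (contat_hol _ hu) (contat_hol _ (hol_cst 0))) => t et.
 by have /eqP := u0 t; rewrite mulf_eq0 (negbTE (expf_neq0 _ et)) => /eqP.
have uE : u t0 = c ab * E4 t0 ^+ ab.1 + E6 t0 * rest t0 by [].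
move: uE; rewrite ut0 e6 mul0r addr0 => /esym/eqP.
by rewrite mulf_eq0 (negbTE (expf_neq0 _ e4)) orbF => /eqP.
Qed.

(** A homogeneous basis indexed by a finite type, since the basis of products is indexed by
    pairs. *)
Definition fbasis n (M : 'M[int]_n) (I : finType) (k : I -> int) (f : I -> jfun R n) :=
 [/\ forall i, wj M 0 (k i) (f i),
   forall w g, wj M 0 w g -> exists2 c : I -> H -> C, forall i, mform (w - k i) (c i) &
    forall x, g x = \sum_i c i x.1 * f i x & forall w (c : I -> H -> C), (forall i, mform (w - k i) (c i)) ->
    (forall x, \sum_i c i x.1 * f i x = 0) -> forall i tau, c i tau = 0].

(** The coefficients of the sum of t^(k i), the numerator for free generators of weights k i. *)
Definition wcount (I : finType) (k : I -> int) (v : int) : int := \sum_i (k i == v)%:Z.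

Lemma wcount_finite (I : finType) (k : I -> int) : finite_set [set v | wcount k v != 0].
Proof.
apply: (@sub_finite_set _ _ [set` [seq k i | i <- index_enum I]]); last exact: finite_seq.
move=> v /=; apply: contraR => vk; apply/eqP; rewrite /wcount big1 // => i _.
by case: eqP => // kv; case/negP: vk; apply/mapP; exists i; rewrite // mem_index_enum.
Qed.

Lemma fbasis_numerator n (M : 'M[int]_n) (I : finType) (k : I -> int) f : fbasis M k f -> weak_numerator R M (wcount k).
Proof.
move=> [wf gen ind]; split; first exact: wcount_finite.
move=> w; have [L kL] := finite_lower (wcount_finite k).
(* The weights k i are at least - L, so exponents with 4 a + 6 b = w - k i stay below N. *)
pose N := (absz w + L).+1.
have wN : w - N%:Z < - L%:Z by rewrite /N; lia.
have kiL i : - L%:Z <= k i.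
 rewrite leNgt; apply/negP => /kL/eqP; rewrite /wcount psumr_eq0 => [|j _]; last by case: eqP.
 by move=> /allP/(_ i (mem_index_enum i)); rewrite eqxx.
pose wt (p : I * ('I_N * 'I_N)) : int := (4 * p.2.1 + 6 * p.2.2)%N%:Z.
pose A : {pred I * ('I_N * 'I_N)} := [pred p | wt p == w - k p.1].
pose b (p : I * ('I_N * 'I_N)) : jfun R n := fun x => (E4 x.1 ^+ p.2.1 * E6 x.1 ^+ p.2.2) * f p.1 x.
have split_sum (c : I * ('I_N * 'I_N) -> C) x : \sum_(p in A) c p * b p x =
  \sum_i (\sum_(ab : 'I_N * 'I_N | (4 * ab.1 + 6 * ab.2)%N%:Z == w - k i) c (i, ab) * (E4 x.1 ^+ ab.1 * E6 x.1 ^+ ab.2)) * f i x.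
 under [RHS]eq_bigr => i _ do rewrite mulr_suml.
 rewrite pair_big_dep; apply: eq_big => [[i ab]|[i ab] _] //=; rewrite /b /= mulrA //.
exists #|A|.
 apply: (@has_dim_fin n _ A _ b).
 - move=> p /eqP pA; apply/weak_wj; have := wjM (E46_mform R p.2.1 p.2.2) (wf p.1).
  by rewrite -[(4 * _ + _)%N%:Z]/(wt p) pA subrK.
 - move=> g /weak_wj wg; have [c mc cE] := gen w g wg.
  have /choice[s sP] i : exists s : seq (C * (nat * nat)), (forall t, t \in s -> (4 * t.2.1 + 6 * t.2.2)%N%:Z = w - k i) /\
   forall tau, c i tau = \sum_(t <- s) t.1 * (E4 tau ^+ t.2.1 * E6 tau ^+ t.2.2).
   by have [s h1 h2] := mform_mono (mc i); exists s.
  exists (fun p => \sum_(t <- s p.1 | t.2 == (val p.2.1, val p.2.2)) t.1) => x.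
  rewrite split_sum cE; apply: eq_bigr => i _; congr (_ * _); have [s1 ->] := sP i.
  under [RHS]eq_bigr => ab _ do rewrite mulr_suml.
  rewrite [RHS]/= (exchange_big_dep xpredT) //= big_seq [RHS]big_seq; apply: eq_bigr => t ts.
  have tw := s1 t ts; have kN := kiL i.
  have [aN bN] : (t.2.1 < N)%N /\ (t.2.2 < N)%N by rewrite /N; split; lia.
  rewrite (big_pred1 (Ordinal aN, Ordinal bN)) //= => -[[a ai] [a' ai']] /=.
  have -> : (t.2 == (a, a')) = (((Ordinal ai, Ordinal ai') : 'I_N * 'I_N) == (Ordinal aN, Ordinal bN)).
   by apply/eqP/eqP => [e|[-> ->]]; [congr (_, _); apply: val_inj; rewrite /= e|case: (t.2)].
  by case: (eqVneq ((Ordinal ai, Ordinal ai') : 'I_N * 'I_N) (Ordinal aN, Ordinal bN)) => [[-> ->]|_]; rewrite ?andbF // tw eqxx.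
 - move=> c c0 [i ab] pA.
  pose ci i tau := \sum_(ab : 'I_N * 'I_N | (4 * ab.1 + 6 * ab.2)%N%:Z == w - k i) c (i, ab) * (E4 tau ^+ ab.1 * E6 tau ^+ ab.2).
  apply: (mono_indep (w := w - k i) (c := fun ab => c (i, ab))) => // tau.
  apply: (ind w ci _ _ i tau) => [j|x]; last by rewrite -split_sum.
  have -> : ci j = fun tau => \sum_(ab : 'I_N * 'I_N) (if (4 * ab.1 + 6 * ab.2)%N%:Z == w - k j then c (j, ab) else 0) * (E4 tau ^+ ab.1 * E6 tau ^+ ab.2).
   apply/funext => t; rewrite /ci big_mkcond; apply: eq_bigr => ab' _.
   by case: ifP; rewrite ?mul0r.
  apply: mform_sum => ab'; case: eqP => [<-|_]; first by apply: mformZ; exact: E46_mform.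
  by under eq_fun do rewrite mul0r; exact: mform0.
rewrite (sum_grid kL wN) -natz -sum1_card natr_sum big_mkcond /= /wcount.
transitivity (\sum_i \sum_(ab : 'I_N * 'I_N) (k i == w - (4 * ab.1 + 6 * ab.2)%N%:Z)%:Z).
 rewrite pair_bigA; apply: eq_bigr => -[i ab] _ /=; rewrite inE /wt /=.
 by have -> : ((4 * ab.1 + 6 * ab.2)%N%:Z == w - k i) = (k i == w - (4 * ab.1 + 6 * ab.2)%N%:Z);
  [apply/eqP/eqP; lia|case: eqP].
by rewrite exchange_big.
Qed.

Section Product.
Variables (n1 n2 : nat) (M1 : 'M[int]_n1) (M2 : 'M[int]_n2).
Let MM : 'M[int]_(n1 + n2) := block_mx M1 0 0 M2.

Lemma fam_fbasis r k f : fam M1 r k f -> gindep r k f -> generates M1 r k f ->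
 fbasis M1 (fun i : 'I_r => k i) (fun i : 'I_r => f i).
Proof.
move=> ff gf genf; split=> [i|w g wg|w c mc c0 i tau]; first exact: ff.
 by have [c cc cE] := genf w g wg; exists (fun i : 'I_r => c i) => // i; exact: cc.
pose c' (j : nat) := if insub j is Some j0 then c j0 else fun=> 0.
have c'E (j : 'I_r) : c' j = c j by rewrite /c' valK.
rewrite -c'E; apply: (gf w c') => // [j jr|x]; first by rewrite (c'E (Ordinal jr)); exact: mc.
by rewrite -[RHS](c0 x); apply: eq_bigr => j _; rewrite c'E.
Qed.

End Product.

Section ProductBasis.
Variables (n1 n2 : nat) (M1 : 'M[int]_n1) (M2 : 'M[int]_n2).
Let MM : 'M[int]_(n1 + n2) := block_mx M1 0 0 M2.

(** Generation expands each h_i of [product_generated] in the second basis. Independence removes the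
    first family by [product_free] and then uses independence of the second. *)
Lemma product_fbasis r1 k1 f1 r2 k2 f2 : fam M1 r1 k1 f1 -> gindep r1 k1 f1 -> generates M1 r1 k1 f1 ->
 fam M2 r2 k2 f2 -> gindep r2 k2 f2 -> generates M2 r2 k2 f2 ->
 fbasis MM (fun p : 'I_r1 * 'I_r2 => k1 p.1 + k2 p.2) (fun p => dprd (f1 p.1) (f2 p.2)).
Proof.
move=> ff gf genf fg gg geng.
have pairE (c : 'I_r1 * 'I_r2 -> H -> C) x : \sum_p c p x.1 * dprd (f1 p.1) (f2 p.2) x =
  \sum_(i < r1) dprd (f1 i) (fun y => \sum_(j < r2) c (i, j) y.1 * f2 j y) x.
 transitivity (\sum_(i < r1) \sum_(j < r2) c (i, j) x.1 * dprd (f1 i) (f2 j) x).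
  by rewrite pair_bigA; apply: eq_bigr => -[i j] _.
 apply: eq_bigr => i _; rewrite /dprd mulr_sumr; apply: eq_bigr => j _ /=.
 by rewrite mulrCA.
split=> [[i j]|w F wF|w c mc c0 [i j] tau].
- exact: dp_wj (ff i (ltn_ord i)) (fg j (ltn_ord j)).
- have [h wh hE] := product_generated ff gf genf wF.
 have /choice[c cP] (i : 'I_r1) : exists c, coefs r2 k2 (w - k1 i) c /\ forall x, h i x = span r2 c f2 x.
  by have [c c1 c2] := geng _ _ (wh i (ltn_ord i)); exists c.
 exists (fun p : 'I_r1 * 'I_r2 => c p.1 p.2) => [[i j]|x].
  by have [c1 _] := cP i; rewrite opprD addrA; exact: c1.
 rewrite hE (pairE (fun p => c p.1 p.2)); apply: eq_bigr => i _; rewrite /dprd; congr (_ * _).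
 by have [_ ->] := cP i.
pose y (i0 : nat) : jfun R n2 := fun x => if insub i0 is Some i then \sum_(j < r2) c (i, j) x.1 * f2 j x else 0.
have yE (i0 : 'I_r1) : y i0 = fun x => \sum_(j < r2) c (i0, j) x.1 * f2 j x by apply/funext => x; rewrite /y valK.
have [_ _ ind2] := fam_fbasis fg gg geng.
have mcc (i0 : 'I_r1) (j0 : 'I_r2) : mform (w - k1 i0 - k2 j0) (c (i0, j0)) by have := mc (i0, j0); rewrite opprD addrA.
apply: (ind2 (w - k1 i) (fun j0 => c (i, j0)) (mcc i)) => x.
have := product_free ff gf (y := y) _ _ (ltn_ord i) x; rewrite yE; apply => [i0 ir|x'].
 rewrite (yE (Ordinal ir)).
 pose cc (j0 : nat) := if insub j0 is Some j then c (Ordinal ir, j) else fun=> 0.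
 have ccE (j0 : 'I_r2) : cc j0 = c (Ordinal ir, j0) by rewrite /cc valK.
 have [||hs _] := @T0_span R n2 M2 r2 0 0 cc f2.
 - by move=> j0 jr; rewrite (ccE (Ordinal jr)); have [] := mcc (Ordinal ir) (Ordinal jr).
 - by move=> j0 jr; have [[]] := fg j0 jr.
 by move: hs; congr holomorphic; apply/funext => x0; apply: eq_bigr => j0 _; rewrite ccE.
by rewrite -[RHS](c0 x') pairE; apply: eq_bigr => i0 _; rewrite yE.
Qed.

End ProductBasis.

Lemma wcount_mul (I1 I2 : finType) (k1 : I1 -> int) (k2 : I2 -> int) :
 wcount (fun p : I1 * I2 => k1 p.1 + k2 p.2) = laurent_mul (wcount k1) (wcount k2).
Proof.
apply/funext => v; rewrite /laurent_mul.
rewrite (fsbigE (undup [seq k1 i | i <- index_enum I1])) ?undup_uniq //; last first.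
 move=> l _; rewrite mem_undup => lk; rewrite {1}/wcount big1 ?mul0r // => i _.
 by case: eqP => // kl; case/negP: lk; apply/mapP; exists i; rewrite ?mem_index_enum.
rewrite (eq_bigl xpredT) => [|l]; last by rewrite in_setT.
under eq_bigr => l _ do rewrite {1}/wcount mulr_suml.
transitivity (\sum_i \sum_j (k1 i + k2 j == v)%:Z); first by rewrite pair_bigA.
rewrite [RHS]/= [RHS]exchange_big /=; apply: eq_bigr => i _.
rewrite (bigD1_seq (k1 i)) ?undup_uniq ?mem_undup ?map_f ?mem_index_enum //= eqxx mul1r /wcount.
rewrite [X in _ = _ + X]big1 ?addr0 => [|l li]; last by rewrite eq_sym (negbTE li) mul0r.
by apply: eq_bigr => j _; congr (nat_of_bool _)%:Z; apply/eqP/eqP; lia.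
Qed.

End Numerators.

Theorem theorem2p4 (R : realType) (n1 n2 : nat)
    (M1 : 'M[int]_n1) (M2 : 'M[int]_n2)
    (M1_sym : M1^T = M1) (M2_sym : M2^T = M2)
    (M1_psd : psd R M1) (M2_psd : psd R M2) :
  [/\ direct_product_iso (Jwh R M1) (Jwh R M2) (Jwh R (block_mx M1 0 0 M2)),
      direct_product_iso (Jw R M1) (Jw R M2) (Jw R (block_mx M1 0 0 M2))
    & forall P1 P2 : int -> int,
        weak_numerator R M1 P1 -> weak_numerator R M2 P2 ->
        forall P : int -> int,
          weak_numerator R (block_mx M1 0 0 M2) P <-> P = laurent_mul P1 P2].
Proof.
split; [exact: wh_iso|exact: weak_iso|move=> P1 P2 h1 h2 P].
have [r1 [k1 [f1 [a1 b1 c1]]]] := weak_free R M1.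
have [r2 [k2 [f2 [a2 b2 c2]]]] := weak_free R M2.
(* The numerators are forced to count the weights of the bases, so the claim becomes an identity of
   counts. *)
have -> := numerator_unique h1 (fbasis_numerator (fam_fbasis a1 b1 c1)).
have -> := numerator_unique h2 (fbasis_numerator (fam_fbasis a2 b2 c2)).
have hP := fbasis_numerator (product_fbasis a1 b1 c1 a2 b2 c2).
rewrite -wcount_mul; split=> [hP'|->]; [exact: numerator_unique hP' hP|exact: hP].
Qed.
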